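(* Let $\mathbb{G}$ be a coamenable locally compact quantum group with left Haar weight $\phi$ and right Haar weight $\psi$. Suppose that $X$ is a nondegenerate TRO in $\mathrm{C}_0(\mathbb{G})$. If the linking algebra $\mathsf{A}_X\subseteq M_2(\mathrm{C}_0(\mathbb{G}))$ is a right invariant, $\psi^{(2)}$-expected subalgebra, then there exists a contractive idempotent functional $\omega\in \mathrm{M}(\mathbb{G})$ such that $X=L_\omega(\mathrm{C}_0(\mathbb{G}))$. Moreover, $\mathsf{A}_X\subseteq M_2(\mathrm{C}_0(\mathbb{G}))$ is also a $\phi^{(2)}$-expected subalgebra.
   Context: Locally compact quantum groups are in the $C^*$-algebraic sense of Kustermans and Vaes: $\mathbb{G}$ is given by a $C^*$-algebra $\mathrm{C}_0(\mathbb{G})$ with a coassociative nondegenerate $^*$-homomorphism $\Delta:\mathrm{C}_0(\mathbb{G})\to M(\mathrm{C}_0(\mathbb{G})\otimes \mathrm{C}_0(\mathbb{G}))$ (comultiplication) satisfying the cancellation laws $\overline{\mathrm{span}}\,\Delta(\mathrm{C}_0(\mathbb{G}))(\mathrm{C}_0(\mathbb{G})\otimes 1)=\mathrm{C}_0(\mathbb{G})\otimes \mathrm{C}_0(\mathbb{G})=\overline{\mathrm{span}}\,\Delta(\mathrm{C}_0(\mathbb{G}))(1\otimes \mathrm{C}_0(\mathbb{G}))$, and admitting faithful KMS weights $\phi$ (left Haar weight: $\phi((\omega\otimes\mathrm{id})\Delta(a))=\omega(1)\phi(a)$) and $\psi$ (right Haar weight: $\psi((\mathrm{id}\otimes\omega)\Delta(a))=\omega(1)\psi(a)$),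 for positive functionals $\omega$ and positive $a$ of finite weight. $\mathbb{G}$ is coamenable if $\mathrm{C}_0(\mathbb{G})$ admits a bounded counit. $\mathrm{M}(\mathbb{G})=\mathrm{C}_0(\mathbb{G})^*$ with product $\omega\star\mu=(\omega\otimes\mu)\circ\Delta$. An idempotent functional is a nonzero $\omega\in \mathrm{M}(\mathbb{G})$ with $\omega\star\omega=\omega$; it is contractive if $\|\omega\|\le1$. For $\omega\in \mathrm{M}(\mathbb{G})$: $L_\omega(a)=(\omega\otimes\mathrm{id})(\Delta(a))$ and $R_\omega(a)=(\mathrm{id}\otimes\omega)(\Delta(a))$ are maps $\mathrm{C}_0(\mathbb{G})\to \mathrm{C}_0(\mathbb{G})$. A TRO in a $C^*$-algebra $A$ is a closed subspace $X\subseteq A$ with $xy^*z\in X$ for all $x,y,z\in X$. Write $X^*=\{x^*:x\in X\}$ and $\langle XY\rangle=\overline{\mathrm{span}}\{xy:x\in X,y\in Y\}$ (similarly for more factors). $X$ is nondegenerate in $A$ if $\langle XA^*A\rangle=A$ and $\langle AA^*X\rangle=A$. The linking algebra of $X$ is the $C^*$-algebra $\mathsf{A}_X=\begin{bmatrix}\langle XX^*\rangle & X\\ X^* & \langle X^*X\rangle\end{bmatrix}\subseteq M_2(A)$. The weight $\psi^{(2)}$ on $M_2(\mathrm{C}_0(\mathbb{G}))_+$ is $\psi^{(2)}\bigl(\begin{bmatrix} a_1 & a_2 \\ a_3 & a_4 \end{bmatrix}\bigr)=\psi(a_1)+\psi(a_4)$; $\phi^{(2)}$ is defined analogously from $\phi$.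 A subset $F\subseteq M_2(\mathrm{C}_0(\mathbb{G}))$ is right invariant if for every $\nu\in \mathrm{C}_0(\mathbb{G})^*$ the entrywise application $R_\nu^{(2)}$ of $R_\nu$ maps $F$ into $F$. If $\eta$ is a weight on a $C^*$-algebra $A$, a $C^*$-subalgebra $B\subseteq A$ is $\eta$-expected if there is a conditional expectation $P$ from $A$ onto $B$ with $\eta(P(a))=\eta(a)$ for all $a\in A_+$ with $\eta(a)<\infty$. *)

(* Defs.v *)
From HB Require Import structures.
From mathcomp Require Import all_boot all_order all_algebra.
From mathcomp Require Import all_classical all_reals all_analysis.
From mathcomp Require Import complex.

Set Implicit Arguments.
Unset Strict Implicit.
Unset Printing Implicit Defensive.

Import Order.TTheory GRing.Theory Num.Theory.
Import numFieldNormedType.Exports.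
Local Open Scope classical_set_scope.
Local Open Scope ring_scope.
Local Open Scope complex_scope.

Reserved Notation "a ∙ b" (at level 40, left associativity).
Reserved Notation "a ^†" (at level 1, format "a ^†").

(* Complex C*-algebras, not assumed unital; the scalars are [R[i]] for a
   [realType] [R].  The norm is [R[i]]-valued, as for every normed module over
   [R[i]] in the library, and its values are nonnegative reals. *)

HB.mixin Record CompleteNormedModule_isCStarAlgebra (R : realType) A
    of CompleteNormedModule R[i] A := {
  cmul : A -> A -> A ;
  cstar : A -> A ;
  cmulA : forall a b c, cmul a (cmul b c) = cmul (cmul a b) c ;
  cmulPl : forall (k : R[i]) a b c,
    cmul (k *: a + b) c = k *: cmul a c + cmul b c ;
  cmulPr : forall (k : R[i]) a b c,
    cmul c (k *: a + b) = k *: cmul c a + cmul c b ;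
  cstarK : forall a, cstar (cstar a) = a ;
  cstarP : forall (k : R[i]) a b,
    cstar (k *: a + b) = Num.conj k *: cstar a + cstar b ;
  cstarM : forall a b, cstar (cmul a b) = cmul (cstar b) (cstar a) ;
  cnormM : forall a b, `|cmul a b| <= `|a| * `|b| ;
  cnorm_star : forall a, `|cmul (cstar a) a| = `|a| ^+ 2
}.

#[short(type="cstarType")]
HB.structure Definition CStarAlgebra (R : realType) :=
  { A of CompleteNormedModule R[i] A
       & CompleteNormedModule_isCStarAlgebra R A }.

Notation "a ∙ b" := (cmul a b) : ring_scope.
Notation "a ^†" := (cstar a) : ring_scope.

Definition pos_cone (R : realType) (A : cstarType R) : set A :=
  [set a | exists b, a = b^† ∙ b].

Definition star_hom (R : realType) (A B : cstarType R) (f : A -> B) : Prop :=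
  [/\ linear f, {morph f : a b / a ∙ b} & {morph f : a / a^†}].

Section Subspaces.
Variables (R : realType) (A : cstarType R).
Implicit Types S X Y : set A.

Definition lin_span S : set A :=
  [set x | exists n (k : 'I_n -> R[i]) (s : 'I_n -> A),
     (forall i, S (s i)) /\ x = \sum_i k i *: s i].

Definition cspan S : set A := closure (lin_span S).

Definition lin_subspace S : Prop :=
  S 0 /\ forall (k : R[i]) x y, S x -> S y -> S (k *: x + y).

Definition set_mul X Y : set A := [set x ∙ y | x in X & y in Y].
Definition set_star X : set A := [set x^† | x in X].

Definition tro X : Prop :=
  [/\ closed X, lin_subspace X
    & forall x y z, X x -> X y -> X z -> X (x ∙ y^† ∙ z)].

Definition tro_nondegenerate X : Prop :=
  cspan (set_mul (set_mul X (set_star setT)) setT) = setT /\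
  cspan (set_mul (set_mul setT (set_star setT)) X) = setT.

End Subspaces.

Section Dual.
Variables (R : realType) (A : cstarType R).

Definition dual : set (A -> R[i]) :=
  [set f | linear (f : A -> R[i]^o) /\ continuous (f : A -> R[i]^o)].

Definition pos_dual : set (A -> R[i]) :=
  [set f | dual f /\ forall a, 0 <= f (a^† ∙ a)].

Definition contractive_functional (f : A -> R[i]) : Prop :=
  forall a, `|f a| <= `|a|.

End Dual.

(* [M(A)] is realized by double centralizers; linearity and boundedness of
   both components are automatic in a C*-algebra. *)

Record multiplier (R : realType) (A : cstarType R) := Multiplier {
  mL : A -> A ;
  mR : A -> A ;
  mLR : forall a b, a ∙ mL b = mR a ∙ b
}.

Section Multipliers.
Variables (R : realType) (A : cstarType R).
Implicit Types m n : multiplier A.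

Lemma mone_subproof (a b : A) : a ∙ b = a ∙ b. Proof. by []. Qed.
Definition mone : multiplier A := @Multiplier R A id id mone_subproof.

Lemma mmul_subproof m n (a b : A) :
  a ∙ mL m (mL n b) = mR n (mR m a) ∙ b.
Proof. by rewrite !mLR. Qed.
Definition mmul m n : multiplier A := Multiplier (mmul_subproof m n).

Lemma mstar_subproof m (a b : A) :
  a ∙ (mR m b^†)^† = (mL m a^†)^† ∙ b.
Proof. by rewrite -[a in LHS]cstarK -cstarM -mLR cstarM cstarK. Qed.
Definition mstar m : multiplier A := Multiplier (mstar_subproof m).

Lemma mof_subproof (c a b : A) : a ∙ (c ∙ b) = (a ∙ c) ∙ b.
Proof. exact: cmulA. Qed.
(* the canonical embedding of A in M(A) *)
Definition mof (c : A) : multiplier A := Multiplier (mof_subproof c).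

HB.instance Definition _ := gen_eqMixin (multiplier A).
HB.instance Definition _ := gen_choiceMixin (multiplier A).
HB.instance Definition _ := isPointed.Build (multiplier A) mone.

(* [get] and [xget] below pick objects that exist and are unique for standard
   C*-algebraic reasons (density, nondegeneracy, Cohen factorization).

   The strictly continuous extension of a functional f to M(A): by Cohen
   factorization f = g (_ ∙ b) with g bounded, and the value at m is g (m b),
   whatever the factorization. *)
Definition dual_ext (f : A -> R[i]) m : R[i] :=
  xget 0 [set z : R[i] | exists g b,
    [/\ dual g, forall a, f a = g (a ∙ b) & z = g (mL m b)]].

End Multipliers.

Section NondegenerateMorphisms.
Variables (R : realType) (A B : cstarType R).

Definition nondeg_hom (F : A -> multiplier B) : Prop :=
  [/\ forall (k : R[i]) a b c,
        mL (F (k *: a + b)) c = k *: mL (F a) c + mL (F b) c,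
      forall a b, F (a ∙ b) = mmul (F a) (F b),
      forall a, F a^† = mstar (F a)
    & cspan [set mL (F a) b | a in setT & b in setT] = setT].

(* the unique extension M(A) -> M(B) of a nondegenerate morphism *)
Definition mult_ext (F : A -> multiplier B) (m : multiplier A) :
    multiplier B :=
  get [set p | forall a, mmul p (F a) = F (mL m a) /\
                         mmul (F a) p = F (mR m a)].

End NondegenerateMorphisms.

Section FormalTensors.
Variables (R : realType) (A B : cstarType R).

(* [:: (a1, b1); ...; (an, bn)] stands for a1 ⊗ b1 + ... + an ⊗ bn in the
   algebraic tensor product *)
Definition formal_star (x : seq (A * B)) : seq (A * B) :=
  [seq (p.1^†, p.2^†) | p <- x].

Definition formal_mul (x y : seq (A * B)) : seq (A * B) :=
  [seq (p.1 ∙ q.1, p.2 ∙ q.2) | p <- x, q <- y].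

Definition formal_eval (f : A -> R[i]) (g : B -> R[i]) (x : seq (A * B)) :
    R[i] :=
  \sum_(p <- x) f p.1 * g p.2.

(* ‖x‖ <= c for the spatial norm of the algebraic tensor product, i.e. the
   operator norm of x in the tensor product of the universal representations
   of A and B: the vectors y (ξ_f ⊗ ξ_g) exhaust the algebraic tensor products
   of the GNS spaces of f and g, and have norm (f ⊗ g)(y^* y)^(1/2). *)
Definition spatial_norm_le (x : seq (A * B)) (c : R) : Prop :=
  forall f g, pos_dual f -> pos_dual g -> forall y : seq (A * B),
    let xy := formal_mul x y in
    formal_eval f g (formal_mul (formal_star xy) xy) <=
    (c ^+ 2)%:C * formal_eval f g (formal_mul (formal_star y) y).

End FormalTensors.

(* T is the completion of the algebraic tensor product of A and B for the
   spatial norm *)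
Record min_tensor (R : realType) (A B T : cstarType R) := MinTensor {
  tens :> A -> B -> T ;
  tensPl : forall (k : R[i]) a a' b,
    tens (k *: a + a') b = k *: tens a b + tens a' b ;
  tensPr : forall (k : R[i]) a b b',
    tens a (k *: b + b') = k *: tens a b + tens a b' ;
  tensM : forall a a' b b', tens (a ∙ a') (b ∙ b') = tens a b ∙ tens a' b' ;
  tens_star : forall a b, tens a^† b^† = (tens a b)^† ;
  tens_dense : cspan [set tens a b | a in setT & b in setT] = setT ;
  tens_norm : forall (x : seq (A * B)) (c : R), 0 <= c ->
    `|\sum_(p <- x) tens p.1 p.2| <= c%:C <-> spatial_norm_le x c
}.

Section TensorMaps.
Variables (R : realType) (A B T : cstarType R) (t : min_tensor A B T).

(* m ⊗ n in M(A ⊗ B) for m in M(A) and n in M(B) *)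
Definition mtens (m : multiplier A) (n : multiplier B) : multiplier T :=
  get [set p | forall a b, mL p (t a b) = t (mL m a) (mL n b) /\
                           mR p (t a b) = t (mR m a) (mR n b)].

Definition dual_tens (f : A -> R[i]) (g : B -> R[i]) : T -> R[i] :=
  get [set h : T -> R[i]^o | dual h /\ forall a b, h (t a b) = f a * g b].

(* the slice map f ⊗ id : A ⊗ B -> B *)
Definition slice_l (f : A -> R[i]) : T -> B :=
  get [set S : T -> B |
    [/\ linear S, continuous S & forall a b, S (t a b) = f a *: b]].

(* the slice map id ⊗ g : A ⊗ B -> A *)
Definition slice_r (g : B -> R[i]) : T -> A :=
  get [set S : T -> A |
    [/\ linear S, continuous S & forall a b, S (t a b) = g b *: a]].

(* Strictly continuous extensions M(A ⊗ B) -> M(B) and M(A ⊗ B) -> M(A) of the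
   slice maps: if f = f' (_ ∙ b) then
   (f ⊗ id)(m) c = (f' ⊗ id)(m (b ⊗ c)). *)
Definition mslice_l (f : A -> R[i]) (m : multiplier T) : multiplier B :=
  get [set p | exists f' b,
    [/\ dual f', forall a, f a = f' (a ∙ b)
      & forall c, mL p c = slice_l f' (mL m (t b c))]].

Definition mslice_r (g : B -> R[i]) (m : multiplier T) : multiplier A :=
  get [set p | exists g' b,
    [/\ dual g', forall a, g a = g' (a ∙ b)
      & forall c, mL p c = slice_r g' (mL m (t c b))]].

End TensorMaps.

(* F ⊗ F' : A ⊗ A' -> M(B ⊗ B') for nondegenerate F : A -> M(B) and
   F' : A' -> M(B') *)
Definition hom_tens (R : realType) (A A' AA' B B' BB' : cstarType R)
    (s : min_tensor A A' AA') (t : min_tensor B B' BB')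
    (F : A -> multiplier B) (F' : A' -> multiplier B') :
    AA' -> multiplier BB' :=
  get [set H : AA' -> multiplier BB' |
    nondeg_hom H /\ forall a a', H (s a a') = mtens t (F a) (F' a')].

Section Weights.
Variables (R : realType) (A : cstarType R).
Local Open Scope ereal_scope.

(* Only the values of [eta] on the positive cone are meaningful. *)
Definition weight (eta : A -> \bar R) : Prop :=
  [/\ forall a, pos_cone a -> 0 <= eta a,
      forall a b, pos_cone a -> pos_cone b ->
        eta (a + b)%R = eta a + eta b
    & forall (r : R) a, (0 <= r)%R -> pos_cone a ->
        eta (r%:C *: a)%R = r%:E * eta a].

Definition proper_weight (eta : A -> \bar R) : Prop :=
  [/\ weight eta,
      exists2 a, pos_cone a & eta a != 0,
      @pos_cone R A `<=` closure [set a | pos_cone a /\ eta a < +oo]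
    & forall r : R, closed [set a | pos_cone a /\ eta a <= r%:E]].

Definition faithful_weight (eta : A -> \bar R) : Prop :=
  forall a, pos_cone a -> eta a = 0 -> a = 0%R.

Definition one_param_group (sigma : R -> A -> A) : Prop :=
  [/\ forall t, star_hom (sigma t),
      forall a, sigma 0%R a = a,
      forall s t a, sigma (s + t)%R a = sigma s (sigma t a)
    & forall a, continuous (fun t => sigma t a)].

(* b = sigma_{i/2}(a), in particular a is in the domain of sigma_{i/2} *)
Definition sigma_half_i (sigma : R -> A -> A) (a b : A) : Prop :=
  exists f : R[i]^o -> A,
    [/\ {within [set z : R[i]^o | (0 <= complex.Im z <= 2^-1)%R],
           continuous f},
        forall z : R[i]^o, (0 < complex.Im z < 2^-1)%R -> derivable f z 1%R,
        forall t : R, f t%:C = sigma t a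
      & f (0 +i* 2^-1)%R = b].

Definition kms_weight (eta : A -> \bar R) : Prop :=
  proper_weight eta /\
  exists sigma : R -> A -> A,
    [/\ one_param_group sigma,
        forall t a, pos_cone a -> eta (sigma t a) = eta a
      & forall a b, sigma_half_i sigma a b ->
          eta (a^† ∙ a)%R = eta (b ∙ b^†)%R].

End Weights.

(* A C*-algebra with a coassociative comultiplication satisfying the
   cancellation laws.  The associativity of ⊗ is built in by using a single
   algebra [C0_3] for both (C0 ⊗ C0) ⊗ C0 and C0 ⊗ (C0 ⊗ C0). *)
Record cstar_bialgebra (R : realType) := CStarBialgebra {
  C0 : cstarType R ;
  C0_2 : cstarType R ;
  C0_3 : cstarType R ;
  tens2 : min_tensor C0 C0 C0_2 ;
  tens21 : min_tensor C0_2 C0 C0_3 ;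
  tens12 : min_tensor C0 C0_2 C0_3 ;
  tens_assoc : forall a b c, tens21 (tens2 a b) c = tens12 a (tens2 b c) ;
  Delta : C0 -> multiplier C0_2 ;
  Delta_hom : nondeg_hom Delta ;
  Delta_coassoc : forall a,
    mult_ext (hom_tens tens2 tens21 Delta (@mof R C0)) (Delta a) =
    mult_ext (hom_tens tens2 tens12 (@mof R C0) Delta) (Delta a) ;
  Delta_cancel_l_sub : forall a b, exists z,
    mof z = mmul (Delta a) (mtens tens2 (mof b) (mone C0)) ;
  Delta_cancel_l : cspan [set z | exists a b,
    mof z = mmul (Delta a) (mtens tens2 (mof b) (mone C0))] = setT ;
  Delta_cancel_r_sub : forall a b, exists z,
    mof z = mmul (Delta a) (mtens tens2 (mone C0) (mof b)) ;
  Delta_cancel_r : cspan [set z | exists a b,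
    mof z = mmul (Delta a) (mtens tens2 (mone C0) (mof b))] = setT
}.

Section Convolution.
Variables (R : realType) (G : cstar_bialgebra R).

(* By the cancellation laws, the slices of Delta a are in the image of C0. *)
Definition L_map (omega : C0 G -> R[i]) (a : C0 G) : C0 G :=
  get [set b : C0 G | mof b = mslice_l (tens2 G) omega (Delta a)].

Definition R_map (omega : C0 G -> R[i]) (a : C0 G) : C0 G :=
  get [set b : C0 G | mof b = mslice_r (tens2 G) omega (Delta a)].

Definition conv (omega mu : C0 G -> R[i]) : C0 G -> R[i] :=
  fun a => dual_ext (dual_tens (tens2 G) omega mu) (Delta a).

Definition idempotent_functional (omega : C0 G -> R[i]) : Prop :=
  [/\ dual omega, omega <> (fun=> 0) & conv omega omega = omega].

(* A bounded counit is a bounded functional epsilon with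
   (epsilon ⊗ id) Delta = id = (id ⊗ epsilon) Delta; it is the unit of the
   Banach algebra C0(G)^* and automatically a *-character. *)
Definition coamenable : Prop :=
  exists2 epsilon : C0 G -> R[i], dual epsilon &
    forall a, L_map epsilon a = a /\ R_map epsilon a = a.

Local Open Scope ereal_scope.

(* omega(1) is the value at 1 of the strict extension of omega *)
Definition left_haar_weight (phi : C0 G -> \bar R) : Prop :=
  [/\ kms_weight phi, faithful_weight phi
    & forall omega a, pos_dual omega -> pos_cone a -> phi a < +oo ->
        phi (L_map omega a) =
        (complex.Re (dual_ext omega (mone (C0 G))))%:E * phi a].

Definition right_haar_weight (psi : C0 G -> \bar R) : Prop :=
  [/\ kms_weight psi, faithful_weight psi
    & forall omega a, pos_dual omega -> pos_cone a -> psi a < +oo ->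
        psi (R_map omega a) =
        (complex.Re (dual_ext omega (mone (C0 G))))%:E * psi a].

End Convolution.

Record lcqg (R : realType) := LCQG {
  lcqg_bialgebra :> cstar_bialgebra R ;
  haar_l : C0 lcqg_bialgebra -> \bar R ;
  haar_r : C0 lcqg_bialgebra -> \bar R ;
  haar_lP : left_haar_weight haar_l ;
  haar_rP : right_haar_weight haar_r
}.

(* The ring structure of ['M_n] in the library needs unital entries, so the
   *-algebra operations of M_n(A) are written out. *)

Section Matrices.
Variables (R : realType) (A : cstarType R) (n : nat).
Implicit Types x y : 'M[A]_n.

Definition mat_mul x y : 'M[A]_n :=
  \matrix_(i, j) \sum_(k < n) x i k ∙ y k j.
Definition mat_star x : 'M[A]_n := \matrix_(i, j) (x j i)^†.
Definition mat_scale (k : R[i]) x : 'M[A]_n := map_mx (fun a => k *: a) x.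

Definition mat_pos_cone : set 'M[A]_n :=
  [set x | exists y, x = mat_mul (mat_star y) y].

(* the C*-norm of M_n(A), acting on the Hilbert A-module A^n *)
Definition mat_norm x : R :=
  sup [set complex.Re `|\sum_i \sum_j (b i)^† ∙ x i j ∙ c j|
      | b in [set b : 'I_n -> A | `|\sum_i (b i)^† ∙ b i| <= 1]
      & c in [set c : 'I_n -> A | `|\sum_i (c i)^† ∙ c i| <= 1]].

(* P is a conditional expectation from M_n(A) onto B; by Tomiyama's theorem
   every contractive linear projection onto a C*-subalgebra B is also positive
   and B-bimodular. *)
Record cond_expectation (B : set 'M[A]_n) (P : 'M[A]_n -> 'M[A]_n) : Prop :=
  CondExpectation {
    ce_add : forall x y, P (x + y) = P x + P y ;
    ce_scale : forall k x, P (mat_scale k x) = mat_scale k (P x) ;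
    ce_range : forall x, B (P x) ;
    ce_id : forall x, B x -> P x = x ;
    ce_contractive : forall x, mat_norm (P x) <= mat_norm x ;
    ce_pos : forall x, mat_pos_cone x -> mat_pos_cone (P x) ;
    ce_bimod : forall b x c, B b -> B c ->
      P (mat_mul (mat_mul b x) c) = mat_mul (mat_mul b (P x)) c
  }.

Definition expected (eta : 'M[A]_n -> \bar R) (B : set 'M[A]_n) : Prop :=
  exists2 P, cond_expectation B P &
    forall x, mat_pos_cone x -> (eta x < +oo)%E -> eta (P x) = eta x.

End Matrices.

Definition weight2 (R : realType) (A : cstarType R) (eta : A -> \bar R)
    (x : 'M[A]_2) : \bar R :=
  (eta (x ord0 ord0) + eta (x ord_max ord_max))%E.

Definition linking_algebra (R : realType) (A : cstarType R) (X : set A) :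
    set 'M[A]_2 :=
  [set x | [/\ cspan (set_mul X (set_star X)) (x ord0 ord0),
               X (x ord0 ord_max),
               set_star X (x ord_max ord0)
             & cspan (set_mul (set_star X) X) (x ord_max ord_max)]].

Definition right_invariant (R : realType) (G : cstar_bialgebra R)
    (F : set 'M[C0 G]_2) : Prop :=
  forall nu : C0 G -> R[i], dual nu ->
    forall x, F x -> F (map_mx (R_map nu) x).

(* Main.v *)
(* For [a], [b] in the GNS domain of the right Haar weight psi, let e_b(a) be the element
   of C0(G) with nu(e_b(a)) = <a, R_nu' b>_psi for all functionals nu, where nu' is the
   adjoint of nu.  It is a norm limit of slices of Delta(b^* )(a (x) 1) by positive
   functionals below psi.  The heart of the proof is that e_b(a) = 0 implies e_a(b) = 0.
   If sum p_i (x) w_i approaches Delta(a)(1 (x) c), then by coassociativity and left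
   invariance the sums of e_b(p_i) e_y(R_i x), with R_i the slice map by f(d^* . w_i) and
   y = h^* k, k in the domain of psi, h in that of phi, tend weakly to 0 in the GNS space
   of phi; they also converge in norm, hence to 0.  The counit is a *-character sending
   them to a net with limit f(d^* e_x(y)^* e_a(b)^* c), so e_a(b) e_x(y) = 0 for all x, y,
   which forces e_a(b) = 0.

   The expectation P acts entrywise through maps P_ij.  For a in the domain of psi, the
   element a - P_ij a is orthogonal to the corner X_ij, so by right invariance
   e_b(a - P_ij a) = 0 for b in X_ij.  By symmetry the slices R_nu (a - P_ij a) are
   orthogonal to X_ij as well, that is, P_ij commutes with every R_nu.  Hence
   P_ij = L_omega with omega = eps o P_ij, which is a contractive idempotent; the diagonal
   functionals are states, so left invariance of phi gives the phi-expectation. *)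
From HB Require Import structures.
Require Import Defs.
From mathcomp Require Import all_boot all_order all_algebra.
From mathcomp Require Import all_classical all_reals all_analysis.
From mathcomp Require Import complex ring lra.

Set Implicit Arguments.
Unset Strict Implicit.
Unset Printing Implicit Defensive.

Import Order.TTheory GRing.Theory Num.Theory.
Import numFieldNormedType.Exports.
Local Open Scope classical_set_scope.
Local Open Scope ring_scope.
Local Open Scope complex_scope.

(** Formally [e_a(b)] is the antipode of [e_b(a)^†], so the implication from e_b(a) = 0 to e_a(b) =
    0 says that the antipode is well defined. It is proved directly, because the antipode is
    unbounded and would have to be constructed first. The two Haar weights enter together: taking y
    = h^† k with h in the domain of phi and k in that of psi makes e_y(x) a vector of the GNS space
    of phi, where left invariance applies and faithfulness identifies the limit. The norm
    convergence rests on row estimates that do not depend on the number of summands, which is why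
    approximating sums are rewritten with orthonormal first legs. GNS spaces are never completed.
    All estimates use semi-inner products on the domains, and eta ⊗ f is replaced by eta composed
    with a slice map. Objects selected by [get] can only be computed once a witness has been built,
    hence the long construction of slices, legs and extensions. Since there is no unit, statements
    about the unitization are phrased through left multiplication, or through a square root of the
    gap M - h. *)

Section StarAlgebra.
Variables (R : realType) (A : cstarType R).
Implicit Types (a b c x y z : A) (k : R[i]).

Lemma cmulDl a b c : (a + b) ∙ c = a ∙ c + b ∙ c.
Proof. by rewrite -[a in LHS]scale1r cmulPl scale1r. Qed.
Lemma cmulDr a b c : c ∙ (a + b) = c ∙ a + c ∙ b.
Proof. by rewrite -[a in LHS]scale1r cmulPr scale1r. Qed.
Lemma cmul0l a : 0 ∙ a = 0.
Proof. by apply: (@addrI _ (0 ∙ a)); rewrite -cmulDl !addr0. Qed.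
Lemma cmul0r a : a ∙ 0 = 0.
Proof. by apply: (@addrI _ (a ∙ 0)); rewrite -cmulDr !addr0. Qed.
Lemma cmulZl k a b : (k *: a) ∙ b = k *: (a ∙ b).
Proof. by rewrite -[k *: a]addr0 cmulPl cmul0l addr0. Qed.
Lemma cmulZr k a b : a ∙ (k *: b) = k *: (a ∙ b).
Proof. by rewrite -[k *: b]addr0 cmulPr cmul0r addr0. Qed.
Lemma cmulNl a b : (- a) ∙ b = - (a ∙ b).
Proof. by rewrite -scaleN1r cmulZl scaleN1r. Qed.
Lemma cmulNr a b : a ∙ (- b) = - (a ∙ b).
Proof. by rewrite -scaleN1r cmulZr scaleN1r. Qed.
Lemma cmulBl a b c : (a - b) ∙ c = a ∙ c - b ∙ c.
Proof. by rewrite cmulDl cmulNl. Qed.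
Lemma cmulBr a b c : c ∙ (a - b) = c ∙ a - c ∙ b.
Proof. by rewrite cmulDr cmulNr. Qed.
Lemma cstarD a b : (a + b)^† = a^† + b^†.
Proof. by rewrite -[a in LHS]scale1r cstarP rmorph1 scale1r. Qed.
Lemma cstar0 : (0 : A)^† = 0.
Proof. by apply: (@addrI _ (0 : A)^†); rewrite -cstarD !addr0. Qed.
Lemma cstarZ k a : (k *: a)^† = Num.conj k *: a^†.
Proof. by rewrite -[k *: a]addr0 cstarP cstar0 addr0. Qed.
Lemma cstarN a : (- a)^† = - a^†.
Proof. by rewrite -scaleN1r cstarZ rmorphN1 scaleN1r. Qed.
Lemma cstarB a b : (a - b)^† = a^† - b^†.
Proof. by rewrite cstarD cstarN. Qed.
Lemma conjC_real (t : R) : Num.conj t%:C = t%:C.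
Proof. by apply/CrealP; apply/complex_realP; exists t. Qed.
Lemma cstarZr (t : R) a : (t%:C *: a)^† = t%:C *: a^†.
Proof. by rewrite cstarZ conjC_real. Qed.
Lemma cmul_suml (I : Type) (r : seq I) (P : pred I) (F : I -> A) b :
  (\sum_(i <- r | P i) F i) ∙ b = \sum_(i <- r | P i) F i ∙ b.
Proof. by apply: (big_morph (fun x => x ∙ b)) => [x y|]; rewrite ?cmulDl ?cmul0l. Qed.
Lemma cmul_sumr (I : Type) (r : seq I) (P : pred I) (F : I -> A) b :
  b ∙ (\sum_(i <- r | P i) F i) = \sum_(i <- r | P i) b ∙ F i.
Proof. by apply: (big_morph (fun x => b ∙ x)) => [x y|]; rewrite ?cmulDr ?cmul0r. Qed.
Lemma cstar_sum (I : Type) (r : seq I) (P : pred I) (F : I -> A) :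
  (\sum_(i <- r | P i) F i)^† = \sum_(i <- r | P i) (F i)^†.
Proof. by apply: (big_morph (fun x : A => x^†)) => [x y|]; rewrite ?cstarD ?cstar0. Qed.

End StarAlgebra.

(* A reflexive decision procedure for identities in a (noncommutative, possibly
   nonunital) algebra; words are compared syntactically and the equality of the
   coefficients is left to [ring]. *)
Section NonCommutativeRing.
Variables (R : realType) (A : cstarType R).

Inductive nc_expr : Type :=
| NcVar of nat
| NcZero
| NcAdd of nc_expr & nc_expr
| NcOpp of nc_expr
| NcMul of nc_expr & nc_expr
| NcScale of R[i] & nc_expr.

Fixpoint nc_den (env : seq A) (e : nc_expr) : A :=
  match e with
  | NcVar n => nth 0 env n
  | NcZero => 0
  | NcAdd e1 e2 => nc_den env e1 + nc_den env e2
  | NcOpp e1 => - nc_den env e1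
  | NcMul e1 e2 => nc_den env e1 ∙ nc_den env e2
  | NcScale k e1 => k *: nc_den env e1
  end.

(** A word is a first letter and a tail: without a unit the empty word has no value. *)
Fixpoint nc_word (env : seq A) (n : nat) (w : seq nat) : A :=
  match w with
  | [::] => nth 0 env n
  | m :: w' => nth 0 env n ∙ nc_word env m w'
  end.

Definition nc_mon (env : seq A) (m : R[i] * (nat * seq nat)) : A :=
  m.1 *: nc_word env m.2.1 m.2.2.

Definition nc_poly := seq (R[i] * (nat * seq nat)).

Definition nc_sem (env : seq A) (p : nc_poly) : A :=
  foldr (fun m s => nc_mon env m + s) 0 p.

Definition nc_mul1 (m n : R[i] * (nat * seq nat)) : R[i] * (nat * seq nat) :=
  (m.1 * n.1, (m.2.1, m.2.2 ++ n.2.1 :: n.2.2)).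

Fixpoint nc_mulm (m : R[i] * (nat * seq nat)) (q : nc_poly) : nc_poly :=
  match q with [::] => [::] | n :: q' => nc_mul1 m n :: nc_mulm m q' end.

Fixpoint nc_mulp (p q : nc_poly) : nc_poly :=
  match p with [::] => [::] | m :: p' => nc_mulm m q ++ nc_mulp p' q end.

Fixpoint nc_scale (k : R[i]) (p : nc_poly) : nc_poly :=
  match p with [::] => [::] | m :: p' => (k * m.1, m.2) :: nc_scale k p' end.

Fixpoint nc_norm (e : nc_expr) : nc_poly :=
  match e with
  | NcVar n => [:: (1, (n, [::]))]
  | NcZero => [::]
  | NcAdd e1 e2 => nc_norm e1 ++ nc_norm e2
  | NcOpp e1 => nc_scale (-1) (nc_norm e1)
  | NcMul e1 e2 => nc_mulp (nc_norm e1) (nc_norm e2)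
  | NcScale k e1 => nc_scale k (nc_norm e1)
  end.

(** [Nat.eqb] and [if] keep this test computable by the short delta list of [nc_ring_with]. *)
Fixpoint nc_eqw (v w : seq nat) : bool :=
  match v, w with
  | [::], [::] => true
  | x :: v', y :: w' => if Nat.eqb x y then nc_eqw v' w' else false
  | _, _ => false
  end.

Fixpoint nc_ins (m : R[i] * (nat * seq nat)) (p : nc_poly) : nc_poly :=
  match p with
  | [::] => [:: m]
  | n :: p' => if nc_eqw (m.2.1 :: m.2.2) (n.2.1 :: n.2.2)
               then (m.1 + n.1, n.2) :: p' else n :: nc_ins m p'
  end.

Fixpoint nc_collect (p : nc_poly) : nc_poly :=
  match p with [::] => [::] | m :: p' => nc_ins m (nc_collect p') end.

Fixpoint nc_null (p : nc_poly) : Prop :=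
  match p with [::] => True | m :: p' => m.1 = 0 /\ nc_null p' end.

Lemma nc_word_cat env n v m w :
  nc_word env n (v ++ m :: w) = nc_word env n v ∙ nc_word env m w.
Proof.
elim: v n => [|l v IH] n //=.
by rewrite IH cmulA.
Qed.

Lemma nc_sem_cat env p q : nc_sem env (p ++ q) = nc_sem env p + nc_sem env q.
Proof. by elim: p => [|m p IH] /=; rewrite ?add0r // IH addrA. Qed.

Lemma nc_sem_scale env k p : nc_sem env (nc_scale k p) = k *: nc_sem env p.
Proof.
elim: p => [|m p IH] /=; first by rewrite scaler0.
by rewrite IH scalerDr /nc_mon scalerA.
Qed.

Lemma nc_sem_mulm env m q : nc_sem env (nc_mulm m q) = nc_mon env m ∙ nc_sem env q.
Proof.
elim: q => [|n q IH] /=; first by rewrite cmul0r.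
rewrite IH cmulDr; congr (_ + _).
by rewrite /nc_mon /= nc_word_cat cmulZl cmulZr scalerA.
Qed.

Lemma nc_normP env e : nc_sem env (nc_norm e) = nc_den env e.
Proof.
elim: e => //= [n|e1 <- e2 <-|e <-|e1 <- e2 <-|k e <-].
- by rewrite /nc_mon /= scale1r addr0.
- exact: nc_sem_cat.
- by rewrite nc_sem_scale scaleN1r.
- elim: (nc_norm e1) => [|m p IH] /=; first by rewrite cmul0l.
  by rewrite nc_sem_cat nc_sem_mulm IH cmulDl.
- exact: nc_sem_scale.
Qed.

Lemma nc_eqwP v w : nc_eqw v w -> v = w.
Proof.
elim: v w => [|x v IH] [|y w] //=.
by case: (PeanoNat.Nat.eqb_spec x y) => // -> /IH ->.
Qed.

Lemma nc_sem_ins env m p : nc_sem env (nc_ins m p) = nc_mon env m + nc_sem env p.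
Proof.
elim: p => //= n p IH; case: ifP => [|_] /=; last by rewrite IH addrCA.
case: (PeanoNat.Nat.eqb_spec m.2.1 n.2.1) => // e1 /nc_eqwP e2.
by rewrite /nc_mon /= e1 e2 scalerDl addrA.
Qed.

Lemma nc_sem_collect env p : nc_sem env (nc_collect p) = nc_sem env p.
Proof. by elim: p => //= m p IH; rewrite nc_sem_ins IH. Qed.

Lemma nc_nullP env p : nc_null p -> nc_sem env p = 0.
Proof. by elim: p => //= m p IH [e /IH ->]; rewrite /nc_mon e scale0r addr0. Qed.

Lemma nc_eq env e1 e2 :
  nc_null (nc_collect (nc_norm (NcAdd e1 (NcOpp e2)))) ->
  nc_den env e1 = nc_den env e2.
Proof.
move/(nc_nullP env); rewrite nc_sem_collect nc_normP /= => h.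
by apply/eqP; rewrite -subr_eq0; apply/eqP.
Qed.

End NonCommutativeRing.

Ltac nc_vars t l :=
  lazymatch t with
  | @cmul _ _ ?a ?b => let l1 := nc_vars a l in nc_vars b l1
  | @GRing.add _ ?a ?b => let l1 := nc_vars a l in nc_vars b l1
  | @GRing.opp _ ?a => nc_vars a l
  | @GRing.scale _ _ ?k ?a => nc_vars a l
  | @GRing.zero _ => l
  | _ => lazymatch l with
         | context [cons t _] => l
         | _ => constr:(cons t l)
         end
  end.

Ltac nc_index t l :=
  lazymatch l with
  | cons t _ => constr:(O)
  | cons _ ?l' => let n := nc_index t l' in constr:(S n)
  end.

Ltac nc_reify R t l :=
  lazymatch t with
  | @cmul _ _ ?a ?b =>
    let a' := nc_reify R a l in let b' := nc_reify R b l in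
    constr:(@NcMul R a' b')
  | @GRing.add _ ?a ?b =>
    let a' := nc_reify R a l in let b' := nc_reify R b l in
    constr:(@NcAdd R a' b')
  | @GRing.opp _ ?a => let a' := nc_reify R a l in constr:(@NcOpp R a')
  | @GRing.scale _ _ ?k ?a =>
    let a' := nc_reify R a l in constr:(@NcScale R k a')
  | @GRing.zero _ => constr:(@NcZero R)
  | _ => let n := nc_index t l in constr:(@NcVar R n)
  end.

Ltac nc_ring_with R A :=
  lazymatch goal with
  | |- ?x = ?y =>
    let l1 := nc_vars x (@nil (CStarAlgebra.sort A)) in
    let l := nc_vars y l1 in
    let e1 := nc_reify R x l in
    let e2 := nc_reify R y l in
    apply: (@nc_eq R A l e1 e2);
    lazy beta iota zeta delta [nc_null nc_collect nc_norm nc_ins nc_eqw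
      nc_mulp nc_mulm nc_mul1 nc_scale Nat.eqb fst snd cat];
    repeat split; try (first [ring | by field])
  end.

(** When the type of the goal does not display its algebra, a product in the goal reveals it; goals
    without a product call [nc_ring_with] directly. *)
Ltac nc_ring :=
  lazymatch goal with
  | |- @eq _ ?x _ =>
    lazymatch type of x with
    | CStarAlgebra.sort ?A => lazymatch type of A with
                              | CStarAlgebra.type ?R => nc_ring_with R A end
    | ?T => match goal with
      | |- context [@cmul ?R ?A _ _] => nc_ring_with R A
      end
    end
  end.

(** * Norms and positive elements *)

Section RealNorm.
Variables (R : realType) (V : normedModType R[i]).
Implicit Types (x y z : V).

Definition nm x : R := complex.Re `|x|.

Lemma nmE x : `|x| = (nm x)%:C.
Proof. by rewrite /nm RRe_real ?normr_real. Qed.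
Lemma nm_ge0 x : 0 <= nm x.
Proof. by rewrite -lecR -nmE normr_ge0. Qed.
Lemma nm0 : nm (0 : V) = 0.
Proof. by rewrite /nm normr0. Qed.
Lemma nm_eq0 x : nm x = 0 -> x = 0.
Proof. by move=> h; apply/eqP; rewrite -normr_eq0 nmE h. Qed.
Lemma nmD x y : nm (x + y) <= nm x + nm y.
Proof. by rewrite -lecR rmorphD /= -!nmE ler_normD. Qed.
Lemma nmN x : nm (- x) = nm x.
Proof. by rewrite /nm normrN. Qed.
Lemma nmB x y : nm (x - y) <= nm x + nm y.
Proof. by rewrite -[nm y]nmN nmD. Qed.
Lemma nmC x y : nm (x - y) = nm (y - x).
Proof. by rewrite -nmN opprB. Qed.
Lemma nmZ (k : R[i]) x : nm (k *: x) = complex.Re `|k| * nm x.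
Proof.
apply: complexI; rewrite rmorphM /= -!nmE normrZ.
by congr (_ * _); rewrite RRe_real ?normr_real.
Qed.
Lemma nmZr (t : R) x : nm (t%:C *: x) = `|t| * nm x.
Proof. by rewrite nmZ normc_def /= expr0n /= addr0 sqrtr_sqr. Qed.
Lemma nmZp (t : R) x : 0 <= t -> nm (t%:C *: x) = t * nm x.
Proof. by move=> t0; rewrite nmZr ger0_norm. Qed.
Lemma nm_gt0 x : (0 < nm x) = (x != 0).
Proof.
rewrite lt_neqAle nm_ge0 andbT eq_sym; congr (~~ _); apply/eqP/eqP => [/nm_eq0|->] //.
by rewrite nm0.
Qed.
Lemma nm_tri x y z : nm (x - z) <= nm (x - y) + nm (y - z).
Proof. by have := nmD (x - y) (y - z); rewrite addrA subrK. Qed.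
Lemma nm_sum (I : Type) (r : seq I) (P : pred I) (F : I -> V) :
  nm (\sum_(i <- r | P i) F i) <= \sum_(i <- r | P i) nm (F i).
Proof.
elim/big_rec2: _ => [|i y1 y2 _ h]; first by rewrite nm0.
by apply: le_trans (nmD _ _) _; rewrite lerD2l.
Qed.

(** Sequential convergence with a real tolerance. By [closure_scvg] sequences reach every point of a
    closure, so density arguments can be run along sequences. *)
Definition scvg (u : nat -> V) (l : V) :=
  forall e : R, 0 < e -> exists N, forall n, (N <= n)%N -> nm (u n - l) < e.

Lemma scvg_cst x : scvg (fun=> x) x.
Proof. by move=> e e0; exists 0%N => n _; rewrite subrr nm0. Qed.

Lemma scvg_shift u l k : scvg u l -> scvg (fun n => u (n + k)%N) l.
Proof.
move=> h e /h[N HN]; exists N => n Nn; apply: HN.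
exact: leq_trans Nn (leq_addr _ _).
Qed.

Lemma scvg_uniq u l m : scvg u l -> scvg u m -> l = m.
Proof.
move=> h1 h2; apply/eqP; rewrite -subr_eq0; apply/eqP/nm_eq0/eqP.
rewrite eq_le nm_ge0 andbT leNgt; apply/negP => e0.
have e2 : 0 < nm (l - m) / 2 by lra.
have [N1 H1] := h1 _ e2; have [N2 H2] := h2 _ e2.
have := H1 (maxn N1 N2) (leq_maxl _ _); have := H2 (maxn N1 N2) (leq_maxr _ _).
have := nm_tri l (u (maxn N1 N2)) m; rewrite [nm (l - u _)]nmC; lra.
Qed.

Lemma scvgD u v l m : scvg u l -> scvg v m -> scvg (fun n => u n + v n) (l + m).
Proof.
move=> h1 h2 e e0; have e2 : 0 < e / 2 by lra.
have [N1 H1] := h1 _ e2; have [N2 H2] := h2 _ e2.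
exists (maxn N1 N2) => n; rewrite geq_max => /andP[/H1 a1 /H2 a2].
have := nmD (u n - l) (v n - m); rewrite addrACA -opprD; lra.
Qed.

Lemma scvgZ k u l : scvg u l -> scvg (fun n => k *: u n) (k *: l).
Proof.
move=> h e e0; have p0 : 0 <= complex.Re `|k|.
  by rewrite -ler0c RRe_real ?normr_real.
have e2 : 0 < e / (complex.Re `|k| + 1) by rewrite divr_gt0 // ltr_wpDl.
have [N H] := h _ e2; exists N => n /H a; rewrite -scalerBr nmZ.
apply: (@le_lt_trans _ _ ((complex.Re `|k| + 1) * nm (u n - l))).
  by rewrite ler_wpM2r ?nm_ge0 // lerDl.
by rewrite mulrC -ltr_pdivlMr // ltr_wpDl.
Qed.

Lemma scvg_le u l M : scvg u l -> (forall n, nm (u n) <= M) -> nm l <= M.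
Proof.
move=> h H; rewrite leNgt; apply/negP => lt.
have e0 : 0 < nm l - M by lra.
have [N HN] := h _ e0; have := HN N (leqnn _); have := H N.
have := nm_tri l (u N) 0; rewrite !subr0 [nm (l - u N)]nmC; lra.
Qed.

Lemma scvg_squeeze u l (v : nat -> R) :
  (forall n, nm (u n - l) <= v n) ->
  (forall e, 0 < e -> exists N, forall n, (N <= n)%N -> v n < e) -> scvg u l.
Proof.
by move=> h H e /H[N HN]; exists N => n /HN; apply: le_lt_trans.
Qed.

End RealNorm.

Lemma inv_small (R : realType) (e : R) : 0 < e ->
  exists N, forall n, (N <= n)%N -> n.+1%:R^-1 < e.
Proof.
move=> e0; exists (Num.Def.truncn e^-1) => n Nn.
rewrite invf_plt ?posrE //; apply: lt_le_trans (truncnS_gt _) _.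
by rewrite ler_nat ltnS.
Qed.

Lemma geom_small (R : realType) (q C e : R) : 0 <= q < 1 -> 0 <= C -> 0 < e ->
  exists N, forall n, (N <= n)%N -> C * q ^+ n < e.
Proof.
move=> /andP[q0 q1] C0 e0.
have hq : `|q| < 1 by rewrite ger0_norm.
have := @cvg_geometric R C q hq; move/cvgrPdist_lt => /(_ e e0) [N _ HN].
exists N => n /HN /=; rewrite sub0r normrN ger0_norm // mulr_ge0 // exprn_ge0 //.
Qed.

Section Topology.
Variables (R : realType) (V : normedModType R[i]).

Lemma posC_real (e : R[i]) : 0 < e -> e = (complex.Re e)%:C /\ 0 < complex.Re e.
Proof.
move=> e0; have er : e \is Num.real by apply: gtr0_real.
by split; [rewrite RRe_real | rewrite -ltcR RRe_real].
Qed.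

Lemma closureP (S : set V) x :
  closure S x <-> forall e : R, 0 < e -> exists2 y, S y & nm (x - y) < e.
Proof.
split=> [h e e0|h B /nbhs_ballP[e /= e0 sB]].
  have := h (ball x e%:C); case.
    by apply: nbhsx_ballx; rewrite ltcR.
  move=> y [Sy]; rewrite -ball_normE /ball_ /= nmE ltcR => h2.
  by exists y.
have [eE e0'] := posC_real e0; have [y Sy hy] := h _ e0'.
by exists y; split => //; apply: sB; rewrite -ball_normE /ball_ /= nmE eE ltcR.
Qed.

Lemma closed_scvg (S : set V) u l : closed S -> (forall n, S (u n)) -> scvg u l -> S l.
Proof.
move=> cS Su ul; apply: cS; apply/closureP => e /ul[N HN].
by exists (u N) => //; rewrite nmC; apply: HN.
Qed.

Lemma closure_scvg (S : set V) x : closure S x ->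
  exists u, (forall n, S (u n)) /\ scvg u x.
Proof.
move=> /closureP h.
have /choice[u Hu] : forall n : nat, exists y, S y /\ nm (x - y) < n.+1%:R^-1.
  move=> n; have [|y Sy hy] := h n.+1%:R^-1; first by rewrite invr_gt0 ltr0n.
  by exists y.
exists u; split=> [n|]; first by have [] := Hu n.
apply: (@scvg_squeeze _ _ _ _ (fun n => n.+1%:R^-1)) => [n|e e0].
  by rewrite nmC; apply/ltW; have [] := Hu n.
exact: inv_small.
Qed.

End Topology.

Section Complete.
Variables (R : realType) (V : completeNormedModType R[i]).

Lemma scvg_cauchy (u : nat -> V) :
  (forall e : R, 0 < e -> exists N, forall m n, (N <= m)%N -> (N <= n)%N ->
     nm (u m - u n) < e) -> exists l, scvg u l.
Proof.
move=> h.
have cu : cauchy (u @ \oo).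
  apply/cauchy_ballP => e e0; have [eE e0'] := posC_real e0.
  have [N HN] := h _ e0'; exists (u @` [set n | (N <= n)%N], u @` [set n | (N <= n)%N]) => /=.
    by split; exists N => //= n Nn; exists n.
  move=> [x y] /= [[m Nm <-] [n Nn <-]]; rewrite /= -ball_normE /ball_ /= nmE eE ltcR.
  exact: HN.
have /cvg_ex[l ul] : cvg (u @ \oo) by apply: cauchy_cvg.
exists l => e e0.
have eC : 0 < e%:C by rewrite ltcR.
have /cvgrPdist_lt/(_ _ eC)[N _ HN] := ul.
exists N => n /HN /=; rewrite nmE ltcR.
by rewrite nmC.
Qed.

Lemma scvg_geom (u : nat -> V) (C q : R) : 0 <= q < 1 -> 0 <= C ->
  (forall n, nm (u n.+1 - u n) <= C * q ^+ n) -> exists l, scvg u l.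
Proof.
move=> q01 C0 h; have /andP[q0 q1] := q01; apply: scvg_cauchy => e e0.
have tail : forall N k, nm (u (N + k)%N - u N) <= C * q ^+ N / (1 - q).
  move=> N k.
  have : nm (u (N + k)%N - u N) <= C * q ^+ N * (1 - q ^+ k) / (1 - q).
    elim: k => [|k IH]; first by rewrite addn0 subrr nm0 expr0 subrr mulr0 mul0r.
    apply: le_trans (nm_tri _ (u (N + k)%N) _) _.
    apply: le_trans (lerD (_ : _ <= C * q ^+ (N + k)) IH) _; first by rewrite addnS.
    rewrite exprD exprS; have : 1 - q != 0 by rewrite subr_eq0 eq_sym lt_eqF.
    move=> nz; rewrite le_eqVlt; apply/orP; left; apply/eqP; by field.
  move=> /le_trans; apply; rewrite ler_wpM2r ?invr_ge0 ?subr_ge0 ?(ltW q1) //.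
  by rewrite ler_piMr ?mulr_ge0 ?exprn_ge0 // lerBlDr lerDl exprn_ge0.
have e2 : 0 < e / 2 * (1 - q) by apply: mulr_gt0; lra.
have [N HN] := geom_small q01 C0 e2; exists N => m n Nm Nn.
have := tail N (m - N)%N; have := tail N (n - N)%N; rewrite !subnKC //.
have : C * q ^+ N / (1 - q) < e / 2 by rewrite ltr_pdivrMr; [exact: HN | lra].
have := nm_tri (u m) (u N) (u n); rewrite [nm (u N - u n)]nmC; lra.
Qed.

End Complete.

Section CStarNorm.
Variables (R : realType) (A : cstarType R).
Implicit Types (a b c h s x y z : A) (t : R).

Lemma nmM a b : nm (a ∙ b) <= nm a * nm b.
Proof. by rewrite -lecR rmorphM /= -!nmE cnormM. Qed.
Lemma nm_cstar2 a : nm (a^† ∙ a) = nm a ^+ 2.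
Proof. by apply: complexI; rewrite rmorphXn /= -!nmE cnorm_star. Qed.
Lemma nm_star a : nm a^† = nm a.
Proof.
have h b : nm b <= nm b^†.
  have := nmM b^† b; rewrite nm_cstar2 expr2.
  have [->|nz] := eqVneq b 0; first by rewrite cstar0 nm0.
  by rewrite ler_pM2r // nm_gt0.
by apply/eqP; rewrite eq_le h andbT -{2}[a]cstarK h.
Qed.
Lemma nm_cstar2r a : nm (a ∙ a^†) = nm a ^+ 2.
Proof. by rewrite -{1}[a]cstarK nm_cstar2 nm_star. Qed.
Lemma cstar_mul_eq0 a : a^† ∙ a = 0 -> a = 0.
Proof.
move=> e; apply: nm_eq0; apply/eqP; rewrite -sqrf_eq0.
by rewrite -nm_cstar2 e nm0.
Qed.

(** The choice [z := x^†] gives nm x ^ 2 <= M * nm x. The norm of an element is thus that of its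
    left multiplication, which lets bounds in the unitization be expressed through
    [t%:C *: z - a ∙ z]. *)
Lemma nm_le_mul x M : 0 <= M -> (forall z, nm (x ∙ z) <= M * nm z) -> nm x <= M.
Proof.
move=> M0 h; have := h x^†; rewrite nm_cstar2r nm_star expr2.
have [->|nz] := eqVneq x 0; first by rewrite nm0.
by rewrite ler_pM2r // nm_gt0.
Qed.

Lemma scvg_star (u : nat -> A) l : scvg u l -> scvg (fun n => (u n)^†) l^†.
Proof.
by move=> h e /h[N HN]; exists N => n /HN; rewrite -cstarB nm_star.
Qed.

Lemma scvgMr (u : nat -> A) l a : scvg u l -> scvg (fun n => a ∙ u n) (a ∙ l).
Proof.
move=> h e e0; have e2 : 0 < e / (nm a + 1) by rewrite divr_gt0 // ltr_wpDl ?nm_ge0.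
have [N H] := h _ e2; exists N => n /H b; rewrite -cmulBr.
apply: le_lt_trans (nmM _ _) _.
apply: (@le_lt_trans _ _ ((nm a + 1) * nm (u n - l))).
  by rewrite ler_wpM2r ?nm_ge0 // lerDl.
by rewrite mulrC -ltr_pdivlMr // ltr_wpDl ?nm_ge0.
Qed.

Lemma scvgMl (u : nat -> A) l a : scvg u l -> scvg (fun n => u n ∙ a) (l ∙ a).
Proof.
move=> /scvg_star/(scvgMr a^†)/scvg_star; rewrite cstarM !cstarK => h e /h[N HN].
by exists N => n /HN; rewrite cstarM !cstarK.
Qed.

Lemma scvg_bounded (u : nat -> A) l : scvg u l -> exists2 N, True &
  forall n, (N <= n)%N -> nm (u n) <= nm l + 1.
Proof.
move=> /(_ 1 ltr01)[N HN]; exists N => // n /HN.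
have := nm_tri (u n) l 0; rewrite !subr0; lra.
Qed.

Lemma scvgM (u v : nat -> A) l m :
  scvg u l -> scvg v m -> scvg (fun n => u n ∙ v n) (l ∙ m).
Proof.
move=> h1 h2.
suff h0 : scvg (fun n => u n ∙ (v n - m)) 0.
  have := scvgD h0 (scvgMl m h1); rewrite add0r => h e /h[N HN].
  by exists N => n /HN; rewrite cmulBr subrK.
have [N1 _ H1] := scvg_bounded h1 => e e0.
have p : 0 < nm l + 1 by rewrite ltr_wpDl ?nm_ge0.
have e2 : 0 < e / (nm l + 1) by rewrite divr_gt0.
have [N2 H2] := h2 _ e2; exists (maxn N1 N2) => n.
rewrite geq_max subr0 => /andP[/H1 a1 /H2 a2].
apply: le_lt_trans (nmM _ _) _.
apply: (@le_lt_trans _ _ ((nm l + 1) * nm (v n - m))).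
  by rewrite ler_wpM2r ?nm_ge0.
by rewrite mulrC -ltr_pdivlMr.
Qed.

Lemma scvg_comm (u : nat -> A) l x : scvg u l -> (forall n, u n ∙ x = x ∙ u n) ->
  l ∙ x = x ∙ l.
Proof.
move=> h e; apply: (@scvg_uniq _ _ (fun n => u n ∙ x)); first exact: scvgMl.
by move=> d /(scvgMr x h)[N HN]; exists N => n /HN; rewrite e.
Qed.

Lemma scvg_sa (u : nat -> A) l : scvg u l -> (forall n, (u n)^† = u n) -> l^† = l.
Proof.
move=> h e; apply: (@scvg_uniq _ _ (fun n => (u n)^†)); first exact: scvg_star.
by move=> d /h[N HN]; exists N => n /HN; rewrite e.
Qed.

(* [1 - s] is the square root of [1 - h] in the unitization, obtained as the
   fixed point of the contraction [s |-> (h + s^2) / 2]. *)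
Lemma sqrt1m h : h^† = h -> nm h < 1 -> exists s,
  [/\ s^† = s, s + s - s ∙ s = h & forall x, h ∙ x = x ∙ h -> s ∙ x = x ∙ s].
Proof.
move=> hs h1; pose F s := (2^-1)%:C *: (h + s ∙ s).
pose u n := iter n F 0.
have bnd n : nm (u n) <= nm h.
  elim: n => [|n IH] /=; first by rewrite nm0 nm_ge0.
  rewrite /F nmZp ?invr_ge0 //.
  have := nmD h (u n ∙ u n); have := nmM (u n) (u n).
  have : nm (u n) * nm (u n) <= nm h * 1.
    by apply: ler_pM; rewrite ?nm_ge0 // (le_trans IH) // ltW.
  lra.
have step n : nm (u n.+1 - u n) <= 1 * nm h ^+ n.
  elim: n => [|n IH].
    rewrite expr0 mulr1 subr0 (le_trans (bnd _)) // ltW //.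
  rewrite {1}/u !iterS -/(u n) -/(u n.+1) -/(F (u n)).
  (* This factorization of a difference of squares holds without commutation and makes [nm h] the
     contraction factor. *)
  have -> : F (u n.+1) - F (u n) = (2^-1)%:C *: (u n.+1 ∙ (u n.+1 - u n) + (u n.+1 - u n) ∙ u n).
    by rewrite /F; nc_ring.
  rewrite nmZp ?invr_ge0 //.
  have := nmD (u n.+1 ∙ (u n.+1 - u n)) ((u n.+1 - u n) ∙ u n).
  have := nmM (u n.+1) (u n.+1 - u n); have := nmM (u n.+1 - u n) (u n).
  have := ler_pM (nm_ge0 _) (nm_ge0 _) (bnd n.+1) IH.
  have := ler_pM (nm_ge0 _) (nm_ge0 _) IH (bnd n).
  rewrite !mul1r [_ ^+ n * _]mulrC -exprS; lra.
have [||s us] := scvg_geom _ _ step; [by rewrite nm_ge0|by []|].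
have usa n : (u n)^† = u n.
  by elim: n => [|n IH] /=; rewrite ?cstar0 // /F cstarZr cstarD cstarM IH hs.
exists s; split; first exact: scvg_sa us usa.
- have : s = F s.
    apply: (@scvg_uniq _ _ (fun n => u (n + 1)%N)); first exact: scvg_shift us.
    have := scvgZ (2^-1)%:C (scvgD (scvg_cst h) (scvgM us us)).
    by move=> H e /H[N HN]; exists N => n /HN; rewrite addn1.
  move/(congr1 (fun x => 2%:C *: x)); rewrite /F scalerA -rmorphM /= divff //.
  rewrite rmorph1 scale1r -[2]/(1 + 1) rmorphD rmorph1 scalerDl scale1r => ->.
  by rewrite addrK.
- move=> x hx; apply: scvg_comm us _ => n; elim: n => [|n IH].
    by rewrite cmul0l cmul0r.
  rewrite /= /F cmulZl cmulZr cmulDl cmulDr hx; congr (_ *: (_ + _)).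
  by rewrite -cmulA IH cmulA IH cmulA.
Qed.

End CStarNorm.

(** * The positive cone, square roots, and positivity of [b^† ∙ b] *)

Section Cone.
Variables (R : realType) (A : cstarType R).
Implicit Types (a b c d h s x y z : A) (t : R).

(* The norm description of the positive cone: [0 <= a] iff [a] is self-adjoint
   and [t - a] has norm at most [t] in the unitization for some [t > 0]. *)
Definition cpos a := a^† = a /\
  exists2 t : R, 0 < t & forall z, nm (t%:C *: z - a ∙ z) <= t * nm z.

Lemma cposD a b : cpos a -> cpos b -> cpos (a + b).
Proof.
move=> [sa [t t0 ht]] [sb [t' t'0 ht']]; split; first by rewrite cstarD sa sb.
exists (t + t'); first exact: addr_gt0.
move=> z; have -> : (t + t')%:C *: z - (a + b) ∙ z =
   (t%:C *: z - a ∙ z) + (t'%:C *: z - b ∙ z) by rewrite rmorphD /=; nc_ring.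
by apply: le_trans (nmD _ _) _; rewrite mulrDl lerD.
Qed.

Lemma cposZ r a : 0 < r -> cpos a -> cpos (r%:C *: a).
Proof.
move=> r0 [sa [t t0 ht]]; split; first by rewrite cstarZr sa.
exists (r * t); first exact: mulr_gt0.
move=> z; have -> : (r * t)%:C *: z - (r%:C *: a) ∙ z = r%:C *: (t%:C *: z - a ∙ z).
  by rewrite rmorphM /=; nc_ring.
by rewrite nmZp ?(ltW r0) // -mulrA ler_wpM2l // (ltW r0).
Qed.

(* The iterates are kept in the form [sigma n - u n] with a scalar [sigma n]
   tending to 1 and [u n] in the (possibly nonunital) algebra. *)
Lemma sqrt_cpos1 a : a^† = a -> (forall z, nm (z - a ∙ z) <= nm z) -> exists b,
  [/\ b^† = b, b ∙ b = a, forall z, nm (z - b ∙ z) <= nm z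
    & forall x, a ∙ x = x ∙ a -> b ∙ x = x ∙ b].
Proof.
move=> sa ha.
(* This is the iteration s |-> (h + s^2) / 2 at h = 1 - a, written for s = p.1 - p.2. Now h may have
   norm exactly 1, so there is no contraction; the scalar sequence for h = 1 serves as a majorant
   instead. *)
pose F (p : R * A) : R * A :=
  (2^-1 * (1 + p.1 ^+ 2), (2^-1)%:C *: a + p.1%:C *: p.2 - (2^-1)%:C *: (p.2 ∙ p.2)).
have hC : (2^-1)%:C = 2^-1 :> R[i] by rewrite fmorphV rmorph_nat.
have [sg [u [sg0 u0 sgS uS]]] : exists (sg : nat -> R) (u : nat -> A),
    [/\ sg 0%N = 0, u 0%N = 0, forall n, sg n.+1 = 2^-1 * (1 + sg n ^+ 2)
      & forall n, u n.+1 = (2^-1)%:C *: a + (sg n)%:C *: u n - (2^-1)%:C *: (u n ∙ u n)].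
  by exists (fun n => (iter n F (0, 0)).1), (fun n => (iter n F (0, 0)).2).
have sg01 n : 0 <= sg n <= 1.
  elim: n => [|n /andP[h0 h1]]; first by rewrite sg0; lra.
  rewrite sgS; nra.
have sgmono n : sg n <= sg n.+1.
  by rewrite sgS -subr_ge0; have := sqr_ge0 (1 - sg n); lra.
have sgmonok n k : sg n <= sg (n + k)%N.
  elim: k => [|k IH]; first by rewrite addn0.
  by rewrite addnS (le_trans IH).
(* The gap g = 1 - sg n satisfies g' = g - g^2 / 2, which gives the decay 2 / (n + 2). *)
have sgrate n : (1 - sg n) * (n.+2)%:R <= 2.
  elim: n => [|n IH]; first by rewrite sg0; lra.
  have N2 : 2 <= n.+2%:R :> R by rewrite ler_nat.
  rewrite sgS -[n.+3%:R]natr1; move: IH (sg01 n) N2.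
  move: (n.+2%:R) (sg n) => N w h /andP[w0 w1] N2.
  pose g := 1 - w; have gE : w = 1 - g by rewrite /g; lra.
  have h' : g * N <= 2 by [].
  have g0 : 0 <= g by rewrite /g; lra.
  have g1 : g <= 1 by rewrite /g; lra.
  have -> : (1 - 2^-1 * (1 + w ^+ 2)) * (N + 1) = (g - g ^+ 2 / 2) * (N + 1).
    by rewrite gE; field.
  have [gl|gg] := leP (g * (N + 1)) 2; first by nra.
  have : 0 <= (2 - g * N) * g by apply: mulr_ge0; lra.
  by nra.
have usa n : (u n)^† = u n.
  elim: n => [|n IH]; first by rewrite u0 cstar0.
  by rewrite uS cstarB cstarD !cstarZr cstarM IH sa.
have bnd n z : nm ((sg n)%:C *: z - u n ∙ z) <= sg n * nm z.
  elim: n z => [|n IH] z.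
    by rewrite sg0 u0 scale0r cmul0l subr0 nm0 mul0r.
  have -> : (sg n.+1)%:C *: z - u n.+1 ∙ z = (2^-1)%:C *: ((z - a ∙ z) +
     ((sg n)%:C *: ((sg n)%:C *: z - u n ∙ z) - u n ∙ ((sg n)%:C *: z - u n ∙ z))).
    by rewrite sgS uS rmorphM rmorphD /= rmorph1 rmorphXn /= hC; nc_ring.
  rewrite nmZp ?invr_ge0 // sgS -mulrA ler_pM2l ?invr_gt0 //.
  apply: le_trans (nmD _ _) _; rewrite mulrDl mul1r lerD // (le_trans (IH _)) //.
  by rewrite expr2 -mulrA ler_wpM2l //; case/andP: (sg01 n).
(* All coefficients of the iteration are nonnegative, so the increments of sg n - u n are dominated
   by those of [sg], whose sum is at most 1. *)
have inc n z : nm ((sg n.+1 - sg n)%:C *: z - (u n.+1 - u n) ∙ z) <=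
    (sg n.+1 - sg n) * nm z.
  elim: n z => [|n IH] z.
    by rewrite sg0 u0 !subr0 bnd.
  set D := fun z => (sg n.+1 - sg n)%:C *: z - (u n.+1 - u n) ∙ z in IH.
  have -> : (sg n.+2 - sg n.+1)%:C *: z - (u n.+2 - u n.+1) ∙ z = (2^-1)%:C *:
     (((sg n.+1)%:C *: (D z) - u n.+1 ∙ (D z)) + D ((sg n)%:C *: z - u n ∙ z)).
    have -> : sg n.+2 - sg n.+1 = 2^-1 * (sg n.+1 ^+ 2 - sg n ^+ 2).
      by have := sgS n.+1; have := sgS n; lra.
    have -> : u n.+2 - u n.+1 = (sg n.+1)%:C *: u n.+1 - (2^-1)%:C *: (u n.+1 ∙ u n.+1)
        - ((sg n)%:C *: u n - (2^-1)%:C *: (u n ∙ u n)).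
      by rewrite (uS n.+1) [X in _ - X = _](uS n); nc_ring.
    rewrite /D.
    by rewrite !rmorphB !rmorphM !rmorphB /= !rmorphXn /= hC; nc_ring.
  rewrite nmZp ?invr_ge0 //.
  have -> : sg n.+2 - sg n.+1 = 2^-1 * ((sg n.+1 - sg n) * (sg n.+1 + sg n)).
    by rewrite (sgS n.+1) [in X in _ - X = _](sgS n); field.
  rewrite -mulrA ler_pM2l ?invr_gt0 //; apply: le_trans (nmD _ _) _.
  have -> : (sg n.+1 - sg n) * (sg n.+1 + sg n) * nm z =
     sg n.+1 * ((sg n.+1 - sg n) * nm z) + (sg n.+1 - sg n) * (sg n * nm z) by ring.
  apply: lerD.
    apply: (le_trans (bnd _ _)); apply: ler_wpM2l; last exact: IH.
    by case/andP: (sg01 n.+1).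
  apply: (le_trans (IH _)); apply: ler_wpM2l; last exact: bnd.
  by rewrite subr_ge0.
have cau n k z : nm ((u (n + k)%N - u n) ∙ z) <= 2 * (sg (n + k)%N - sg n) * nm z.
  have : nm ((sg (n + k)%N - sg n)%:C *: z - (u (n + k)%N - u n) ∙ z) <=
    (sg (n + k)%N - sg n) * nm z.
    elim: k => [|k IH]; first by rewrite addn0 !subrr cmul0l scale0r subrr nm0 mul0r.
    rewrite addnS; have := inc (n + k)%N z.
    have := nmD ((sg (n + k).+1 - sg (n + k)%N)%:C *: z - (u (n + k).+1 - u (n + k)%N) ∙ z)
      ((sg (n + k)%N - sg n)%:C *: z - (u (n + k)%N - u n) ∙ z).
    have -> : (sg (n + k).+1 - sg (n + k)%N)%:C *: z - (u (n + k).+1 - u (n + k)%N) ∙ z +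
      ((sg (n + k)%N - sg n)%:C *: z - (u (n + k)%N - u n) ∙ z) =
      (sg (n + k).+1 - sg n)%:C *: z - (u (n + k).+1 - u n) ∙ z.
      by rewrite !rmorphB /=; nc_ring.
    move: IH; lra.
  have := nm_tri ((u (n + k)%N - u n) ∙ z) ((sg (n + k)%N - sg n)%:C *: z) 0.
  rewrite !subr0 [nm (_ - _ *: z)]nmC nmZp ?subr_ge0 //; lra.
have [b ub] : exists b, scvg u b.
  apply: scvg_cauchy => e e0; have e8 : 0 < e / 8 by lra.
  have [N HN] := inv_small e8.
  have key n : (N <= n)%N -> nm (u n - u N) < e / 2.
    move=> Nn; have cN : nm (u n - u N) <= 2 * (sg n - sg N).
      apply: nm_le_mul => [|z]; first by rewrite mulr_ge0 // subr_ge0 -(subnKC Nn).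
      by rewrite -(subnKC Nn) cau.
    have r1 : 1 - sg N <= 2 * N.+1%:R^-1.
      rewrite ler_pdivlMr ?ltr0n //; apply: le_trans (sgrate N).
      by apply: ler_wpM2l; rewrite ?ler_nat // subr_ge0; case/andP: (sg01 N).
    move: (HN N (leqnn _)) r1; move: (N.+1%:R^-1) => w hw r1; case/andP: (sg01 n) => _ q1.
    lra.
  exists N => m n /key hm /key hn; have := nm_tri (u m) (u N) (u n).
  by rewrite [nm (u N - u n)]nmC; lra.
have sgl : forall e : R, 0 < e -> exists N, forall n, (N <= n)%N -> 1 - sg n < e.
  move=> e e0; have e2 : 0 < e / 2 by lra.
  have [N HN] := inv_small e2; exists N => n /HN.
  have : 1 - sg n <= 2 * n.+1%:R^-1.
    rewrite ler_pdivlMr ?ltr0n //; apply: le_trans (sgrate n).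
    by apply: ler_wpM2l; rewrite ?ler_nat // subr_ge0; case/andP: (sg01 n).
  move: (n.+1%:R^-1) => w; lra.
have sgu x (w : nat -> A) : scvg w x -> scvg (fun n => (sg n)%:C *: w n) x.
  move=> wx e e0; have e2 : 0 < e / 2 by lra.
  have [N1 H1] := wx _ e2.
  have e3 : 0 < e / 2 / (nm x + 1) by rewrite divr_gt0 // ltr_wpDl ?nm_ge0.
  have [N2 H2] := sgl _ e3; exists (maxn N1 N2) => n; rewrite geq_max => /andP[/H1 a1 /H2 a2].
  have -> : (sg n)%:C *: w n - x = (sg n)%:C *: (w n - x) - (1 - sg n)%:C *: x.
    by rewrite rmorphB rmorph1 /=; nc_ring_with R A.
  have /andP[p0 p1] := sg01 n.
  apply: le_lt_trans (nmB _ _) _; rewrite !nmZp ?subr_ge0 //.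
  have : sg n * nm (w n - x) <= 1 * nm (w n - x) by rewrite ler_wpM2r ?nm_ge0.
  have : (1 - sg n) * nm x <= (1 - sg n) * (nm x + 1) by rewrite ler_wpM2l ?subr_ge0 // lerDl.
  have : (1 - sg n) * (nm x + 1) < e / 2 by rewrite -ltr_pdivlMr // ltr_wpDl ?nm_ge0.
  lra.
exists b; split; first exact: scvg_sa ub usa.
- have h1 := scvg_shift 1 ub.
  have h2 : scvg (fun n => u (n + 1)%N) ((2^-1)%:C *: a + b - (2^-1)%:C *: (b ∙ b)).
    have := scvgD (scvgD (scvg_cst ((2^-1)%:C *: a)) (sgu _ _ ub)) (scvgZ (- (2^-1)%:C) (scvgM ub ub)).
    rewrite scaleNr => H e /H[N HN]; exists N => n /HN; rewrite addn1 uS.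
    by rewrite scaleNr.
  have e := scvg_uniq h1 h2.
  have : (2^-1)%:C *: (b ∙ b - a) = 0.
    have -> : (2^-1)%:C *: (b ∙ b - a) = b - ((2^-1)%:C *: a + b - (2^-1)%:C *: (b ∙ b)) by nc_ring.
    by rewrite -e subrr.
  move/eqP; rewrite scaler_eq0 subr_eq0 => /orP[|/eqP//].
  by rewrite hC invr_eq0 pnatr_eq0.
- move=> z; apply: (@scvg_le _ _ (fun n => (sg n)%:C *: z - u n ∙ z)).
    have := scvgD (sgu _ _ (scvg_cst z)) (scvgZ (-1) (scvgMl z ub)).
    by rewrite scaleN1r => H e /H[N HN]; exists N => n /HN; rewrite scaleN1r.
  move=> n; apply: le_trans (bnd _ _) _.
  by rewrite ler_piMl ?nm_ge0 //; case/andP: (sg01 n).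
- move=> x hx; apply: scvg_comm ub _ => n; elim: n => [|n IH].
    by rewrite u0 cmul0l cmul0r.
  rewrite uS; have -> : ((2^-1)%:C *: a + (sg n)%:C *: u n - (2^-1)%:C *: (u n ∙ u n)) ∙ x =
    (2^-1)%:C *: (a ∙ x) + (sg n)%:C *: (u n ∙ x) - (2^-1)%:C *: (u n ∙ (u n ∙ x)) by nc_ring.
  by rewrite hx IH [u n ∙ (x ∙ u n)]cmulA IH; nc_ring.
Qed.

Lemma le_eps (r1 r2 C : R) : (forall e, 0 < e -> r1 <= r2 + C * e) -> r1 <= r2.
Proof.
move=> h; rewrite leNgt; apply/negP => lt.
pose e := (r1 - r2) / (2 * (`|C| + 1)).
have C0 : 0 < `|C| + 1 by rewrite ltr_wpDl.
have e0 : 0 < e by rewrite divr_gt0 ?subr_gt0 // mulr_gt0.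
have h1 : C * e <= `|C| * e by rewrite ler_wpM2r ?(ltW e0) ?ler_norm.
have h2 : (`|C| + 1) * e = (r1 - r2) / 2 by rewrite /e; field; rewrite gt_eqF.
have := h _ e0; have : (`|C| + 1) * e = `|C| * e + e by ring.
lra.
Qed.

Lemma sqrt_cpos a : cpos a -> exists b,
  [/\ b^† = b, b ∙ b = a, cpos b & forall x, a ∙ x = x ∙ a -> b ∙ x = x ∙ b].
Proof.
move=> [sa [t t0 ht]].
have tC : t%:C != 0 :> R[i] by rewrite -(rmorph0 (real_complex R)) (inj_eq (@complexI _)) gt_eqF.
have [||b [sb bb hb cb]] := @sqrt_cpos1 (t^-1%:C *: a).
- by rewrite cstarZr sa.
- move=> z; have -> : z - (t^-1%:C *: a) ∙ z = t^-1%:C *: (t%:C *: z - a ∙ z).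
    by rewrite fmorphV; nc_ring.
  by rewrite nmZp ?invr_ge0 ?(ltW t0) // mulrC ler_pdivrMr // mulrC.
have st : (Num.sqrt t)%:C * (Num.sqrt t)%:C = t%:C.
  by rewrite -rmorphM /= -expr2 sqr_sqrtr // ltW.
have st0 : 0 < Num.sqrt t by rewrite sqrtr_gt0.
exists ((Num.sqrt t)%:C *: b); split.
- by rewrite cstarZr sb.
- rewrite cmulZl cmulZr scalerA st bb scalerA fmorphV divff // scale1r //.
- by apply: cposZ => //; split=> //; exists 1 => // z; rewrite scale1r mul1r.
- move=> x hx; rewrite cmulZl cmulZr cb // cmulZl cmulZr hx //.
Qed.

(** Think of c as cos θ. With 1 - s the square root of 1 - c^2, the elements c ± i(1 - s) are the
    unitaries of angle ±θ in the unitization. Then 1 - s is half a difference of unitaries up to a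
    phase, and 1 - 2c^2 = -cos 2θ is minus the average of their squares, whence both bounds. *)
Lemma sa_cos c : c^† = c -> nm c < 1 ->
  (forall z, nm (z - c ∙ (c ∙ z)) <= nm z) /\
  (forall z, nm (z - 2%:C *: (c ∙ (c ∙ z))) <= nm z).
Proof.
move=> sc c1.
have [||s [ss hs cs]] := @sqrt1m R A (c ∙ c); first by rewrite cstarM sc.
  apply: le_lt_trans (nmM _ _) _; have := nm_ge0 c; nra.
have {}cs : s ∙ c = c ∙ s by apply: cs; rewrite cmulA.
have ii : 'i%R * 'i%R = -1 :> R[i] by rewrite -expr2 sqrCi.
have ci : Num.conj 'i%R = - 'i%R :> R[i] by rewrite conjCi.
have unit e : e * e = -1 -> Num.conj e = - e ->
    forall z, nm (c ∙ z + e *: (z - s ∙ z)) = nm z.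
  move=> ee ce z; apply/eqP.
  rewrite -(@eqrXn2 _ 2) ?nm_ge0 // -!nm_cstar2.
  have -> : (c ∙ z + e *: (z - s ∙ z))^† ∙ (c ∙ z + e *: (z - s ∙ z)) =
     z^† ∙ (c ∙ c) ∙ z + e *: (z^† ∙ ((s ∙ c) - (c ∙ s)) ∙ z)
     - (e * e) *: (z^† ∙ z - z^† ∙ (s + s - s ∙ s) ∙ z).
    by rewrite !(cstarD, cstarZ, cstarM, cstarN) sc ss ce; nc_ring.
  by rewrite cs subrr cmul0r cmul0l scaler0 addr0 ee hs scaleN1r opprK addrC subrK.
have u1 := unit 'i%R ii ci.
have u2 : forall z, nm (c ∙ z + (- 'i%R) *: (z - s ∙ z)) = nm z.
  by apply: unit; [rewrite mulrNN | rewrite rmorphN /= ci].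
have s1 z : nm (z - s ∙ z) <= nm z.
  have -> : z - s ∙ z = (- 'i%R / 2) *: ((c ∙ z + 'i%R *: (z - s ∙ z)) - (c ∙ z + (- 'i%R) *: (z - s ∙ z))).
    have -> : (- 'i%R / 2) *: ((c ∙ z + 'i%R *: (z - s ∙ z)) - (c ∙ z + (- 'i%R) *: (z - s ∙ z)))
      = (- ('i%R * 'i%R)) *: (z - s ∙ z) by nc_ring.
    by rewrite ii opprK scale1r.
  rewrite nmZ; have -> : complex.Re `|- 'i%R / 2 : R[i]| = 2^-1.
    rewrite normrM normrN normCi mul1r normfV ger0_norm // -[X in complex.Re X]/(2^-1 : R[i]).
    by rewrite -(rmorph_nat (real_complex R)) -fmorphV.
  have := nmB (c ∙ z + 'i%R *: (z - s ∙ z)) (c ∙ z + (- 'i%R) *: (z - s ∙ z)).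
  rewrite u1 u2; lra.
split=> z.
  have -> : z - c ∙ (c ∙ z) = (z - s ∙ z) - s ∙ (z - s ∙ z).
    by rewrite cmulA -hs; nc_ring.
  exact: le_trans (s1 _) (s1 _).
pose v z := c ∙ z + 'i%R *: (z - s ∙ z).
pose w z := c ∙ z + (- 'i%R) *: (z - s ∙ z).
have {}u1 z' : nm (v z') = nm z' by exact: u1.
have {}u2 z' : nm (w z') = nm z' by exact: u2.
have -> : z - 2%:C *: (c ∙ (c ∙ z)) = (- (2^-1)%:C) *: (v (v z) + w (w z)).
  have -> : (- (2^-1)%:C) *: (v (v z) + w (w z)) = - (c ∙ c) ∙ z
     - ('i%R * 'i%R) *: (z - (s + s - s ∙ s) ∙ z).
    rewrite /v /w fmorphV rmorph_nat; nc_ring.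
  by rewrite ii hs -[2]/(1+1) rmorphD rmorph1; nc_ring.
rewrite scaleNr nmN nmZp ?invr_ge0 //.
have := nmD (v (v z)) (w (w z)); rewrite !u1 !u2; lra.
Qed.

(** For r > nm a write a = r c^2 with nm c < 1 and apply [sa_cos]; the boundary case r = t follows
    by letting r decrease to t. *)
Lemma cpos_bound a t : cpos a -> nm a <= t ->
  (forall z, nm (t%:C *: z - a ∙ z) <= t * nm z) /\
  (forall z, nm (t%:C *: z - 2%:C *: (a ∙ z)) <= t * nm z).
Proof.
move=> pa at'; have [b [sb bb _ _]] := sqrt_cpos pa.
have t0 : 0 <= t := le_trans (nm_ge0 a) at'.
have strict r : nm a < r -> (forall z, nm (r%:C *: z - a ∙ z) <= r * nm z) /\
    (forall z, nm (r%:C *: z - 2%:C *: (a ∙ z)) <= r * nm z).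
  move=> ar; have r0 : 0 < r := le_lt_trans (nm_ge0 a) ar.
  have rC : r%:C != 0 :> R[i] by rewrite -(rmorph0 (real_complex R)) (inj_eq (@complexI _)) gt_eqF.
  pose q := (Num.sqrt r)^-1; have q2 : q * q = r^-1.
    by rewrite /q -invfM -expr2 sqr_sqrtr // ltW.
  pose c := q%:C *: b.
  have cc : r%:C *: (c ∙ c) = a.
    by rewrite /c cmulZl cmulZr !scalerA -mulrA -rmorphM /= q2 fmorphV divff // scale1r.
  have sc : c^† = c by rewrite /c cstarZr sb.
  have c1 : nm c < 1.
    rewrite -(@ltr_pXn2r _ 2) ?nnegrE ?nm_ge0 ?ler01 // expr1n -nm_cstar2 sc.
    have : nm a < r * 1 by rewrite mulr1.
    by rewrite -cc nmZp ?(ltW r0) // ltr_pM2l.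
  have [h1 h2] := sa_cos sc c1.
  split=> z.
    have -> : r%:C *: z - a ∙ z = r%:C *: (z - c ∙ (c ∙ z)) by rewrite -cc; nc_ring.
    by rewrite nmZp ?(ltW r0) // ler_pM2l.
  have -> : r%:C *: z - 2%:C *: (a ∙ z) = r%:C *: (z - 2%:C *: (c ∙ (c ∙ z))).
    by rewrite -cc; nc_ring.
  by rewrite nmZp ?(ltW r0) // ler_pM2l.
have te e : 0 < e -> nm a < t + e by move=> e0; apply: le_lt_trans at' _; rewrite ltrDl.
split=> z; apply: (@le_eps _ _ (2 * nm z)) => e e0.
  have [h _] := strict _ (te _ e0); have := h z; have := nmB ((t + e)%:C *: z - a ∙ z) (e%:C *: z).
  have -> : (t + e)%:C *: z - a ∙ z - e%:C *: z = t%:C *: z - a ∙ z.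
    by rewrite rmorphD /=; nc_ring.
  rewrite (nmZp _ (ltW e0)); nra.
have [_ h] := strict _ (te _ e0); have := h z.
have := nmB ((t + e)%:C *: z - 2%:C *: (a ∙ z)) (e%:C *: z).
have -> : (t + e)%:C *: z - 2%:C *: (a ∙ z) - e%:C *: z = t%:C *: z - 2%:C *: (a ∙ z).
  by rewrite rmorphD /=; nc_ring.
rewrite (nmZp _ (ltW e0)); nra.
Qed.

(** Monotonicity of the norm without spectra: the bounds on t - e and G - 2x from [cpos_bound]
    combine into nm x <= G (2t + D) / (G + 2t). As G is nm x itself, this forces G <= D. *)
Lemma cpos_le x e : cpos x -> cpos e -> nm x <= nm (x + e).
Proof.
move=> px pe; set D := nm (x + e); set G := nm x; set t := nm e.
have [he _] := cpos_bound pe (lexx t); have [_ hx] := cpos_bound px (lexx G).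
have G0 : 0 <= G := nm_ge0 _; have t0 : 0 <= t := nm_ge0 _; have D0 : 0 <= D := nm_ge0 _.
have [->//|Gnz] := eqVneq G 0.
have {Gnz}G0 : 0 < G by rewrite lt_neqAle eq_sym Gnz.
suff : G <= G * (2 * t + D) / (G + 2 * t).
  rewrite ler_pdivlMr; last by lra.
  rewrite ler_pM2l //; lra.
apply: nm_le_mul => [|z].
  by apply: divr_ge0; [apply: mulr_ge0|]; lra.
rewrite mulrAC ler_pdivlMr; last by lra.
have -> : nm (x ∙ z) * (G + 2 * t) = nm ((2^-1)%:C *: ((G + 2 * t)%:C *: (2%:C *: (x ∙ z)))).
  rewrite nmZp ?invr_ge0 // nmZp; last by lra.
  by rewrite nmZp //; field.
(* In this combination [e] and the bare multiples of [z] cancel. *)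
have -> : (G + 2 * t)%:C *: (2%:C *: (x ∙ z)) =
  G%:C *: (2%:C *: ((t%:C *: z - e ∙ z) + (x + e) ∙ z)) - (2 * t)%:C *: (G%:C *: z - 2%:C *: (x ∙ z)).
  by rewrite rmorphD rmorphM /=; nc_ring.
rewrite nmZp ?invr_ge0 //.
have := nmB (G%:C *: (2%:C *: ((t%:C *: z - e ∙ z) + (x + e) ∙ z))) ((2 * t)%:C *: (G%:C *: z - 2%:C *: (x ∙ z))).
rewrite (nmZp _ (ltW G0)) (nmZp _ (ler0n _ 2)) nmZp; last by lra.
have := nmD (t%:C *: z - e ∙ z) ((x + e) ∙ z); have := he z; have := hx z.
have := nmM (x + e) z; rewrite -/D.
move: (nm (_ - e ∙ _)) (nm ((_ + _) ∙ _)) (nm (_ + (_ + _) ∙ _)) (nm (_ - _ *: (x ∙ _))) (nm (_ - (2 * _)%:C *: _)) (nm z) (nm_ge0 z).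
move=> n1 n2 n3 n4 n5 Z Z0 a1 a2 a3 a4 a5.
have : G * n3 <= G * (t * Z + D * Z) by rewrite ler_pM2l //; lra.
have : t * n4 <= t * (G * Z) by rewrite ler_wpM2l.
nra.
Qed.

Lemma cpos_anti a : cpos a -> cpos (- a) -> a = 0.
Proof.
move=> pa na; apply: nm_eq0; apply/eqP; rewrite eq_le nm_ge0 andbT.
by have := cpos_le pa na; rewrite subrr nm0.
Qed.

Lemma cpos_sq c : c^† = c -> cpos (c ∙ c).
Proof.
move=> sc; split; first by rewrite cstarM sc.
pose r := nm c + 1; have r0 : 0 < r by rewrite ltr_wpDl ?nm_ge0.
have rC : r%:C != 0 :> R[i] by rewrite -(rmorph0 (real_complex R)) (inj_eq (@complexI _)) gt_eqF.
have [||h _] := @sa_cos (r^-1%:C *: c); first by rewrite cstarZr sc.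
  rewrite nmZp ?invr_ge0 ?(ltW r0) // mulrC ltr_pdivrMr // mul1r /r ltrDl //.
exists (r ^+ 2); first exact: exprn_gt0.
move=> z; have -> : (r ^+ 2)%:C *: z - c ∙ c ∙ z =
    (r ^+ 2)%:C *: (z - (r^-1%:C *: c) ∙ ((r^-1%:C *: c) ∙ z)).
  rewrite rmorphXn fmorphV /=; nc_ring.
by rewrite nmZp ?exprn_ge0 ?(ltW r0) // ler_pM2l // exprn_gt0.
Qed.

Lemma cposD0 a b : cpos a -> cpos b -> a + b = 0 -> a = 0.
Proof.
move=> pa pb /eqP; rewrite addrC addr_eq0 => /eqP e; apply: cpos_anti => //.
by rewrite -e.
Qed.

Lemma sa_sq0 d : d^† = d -> d ∙ d = 0 -> d = 0.
Proof. by move=> sd dd; apply: cstar_mul_eq0; rewrite sd. Qed.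

(** With d = x - y the positive elements d x d and d y d add up to d (x^2 - y^2) = 0, so both
    vanish, and so does their difference d^3. *)
Lemma sqrt_uniq x y : cpos x -> cpos y -> x ∙ y = y ∙ x -> x ∙ x = y ∙ y -> x = y.
Proof.
move=> px py xy xx; have [sx _] := px; have [sy _] := py.
pose d := x - y; have sd : d^† = d by rewrite cstarB sx sy.
have cd w : cpos w -> w ∙ d = d ∙ w -> cpos (d ∙ w ∙ d).
  move=> pw wd; have [v [sv vv _ cv]] := sqrt_cpos pw.
  have vd := cv _ wd.
  have -> : d ∙ w ∙ d = (v ∙ d) ∙ (v ∙ d) by rewrite {1}vd -vv !cmulA.
  by apply: cpos_sq; rewrite cstarM sv sd vd.
have hx : x ∙ d = d ∙ x by rewrite /d cmulBl cmulBr xy.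
have hy : y ∙ d = d ∙ y by rewrite /d cmulBl cmulBr xy.
have s0 : d ∙ x ∙ d + d ∙ y ∙ d = 0.
  have -> : d ∙ x ∙ d + d ∙ y ∙ d = d ∙ (x ∙ x - y ∙ y + (y ∙ x - x ∙ y)).
    rewrite /d; nc_ring.
  by rewrite xx xy !subrr addr0 cmul0r.
have d1 := cposD0 (cd _ px hx) (cd _ py hy) s0.
have d2 : d ∙ y ∙ d = 0 by move: s0; rewrite d1 add0r.
have d3 : d ∙ d ∙ d = 0.
  by rewrite -(subrr (0 : A)) -{1}d1 -d2 /d; nc_ring.
have : d = 0.
  apply: sa_sq0 => //; apply: sa_sq0; first by rewrite cstarM sd.
  by rewrite cmulA d3 cmul0l.
by move/eqP; rewrite subr_eq0 => /eqP.
Qed.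

(** With m = |a| the halves of m + a and m - a have product 0. Their positivity is the difficulty:
    it is obtained by showing that m + a and m - a equal their own absolute values r and q. *)
Lemma cpos_decomp a : a^† = a -> exists p n,
  [/\ cpos p, cpos n, a = p - n, p ∙ n = 0 & n ∙ p = 0].
Proof.
move=> sa; have [m [sm mm pm cm]] := sqrt_cpos (cpos_sq sa).
have ma : m ∙ a = a ∙ m by apply: cm; rewrite cmulA.
pose p := m + a; pose n := m - a.
have sp : p^† = p by rewrite cstarD sm sa.
have sn : n^† = n by rewrite cstarB sm sa.
have pn : p ∙ n = 0.
  have -> : p ∙ n = m ∙ m - a ∙ a - (m ∙ a - a ∙ m) by rewrite /p /n; nc_ring.
  by rewrite mm ma !subrr.
have np : n ∙ p = 0.
  have -> : n ∙ p = m ∙ m - a ∙ a + (m ∙ a - a ∙ m) by rewrite /p /n; nc_ring.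
  by rewrite mm ma !subrr addr0.
have [r [sr rr pr cr]] := sqrt_cpos (cpos_sq sp).
have [q [sq qq pq cq]] := sqrt_cpos (cpos_sq sn).
have kill (u v w : A) : u^† = u -> v^† = v -> u ∙ u = w ∙ w -> w ∙ v = 0 -> u ∙ v = 0.
  move=> su sv uw wv; apply: cstar_mul_eq0.
  by rewrite cstarM su sv -cmulA [u ∙ (u ∙ v)]cmulA uw -[w ∙ w ∙ v]cmulA wv !cmul0r.
have rn : r ∙ n = 0 := kill _ _ _ sr sn rr pn.
have qp : q ∙ p = 0 := kill _ _ _ sq sp qq np.
have pq0 : p ∙ q = 0 by rewrite -[LHS]cstarK cstarM sq sp qp cstar0.
have rq : r ∙ q = 0 := kill _ _ _ sr sq rr pq0.
have qr : q ∙ r = 0 by rewrite -[LHS]cstarK cstarM sq sr rq cstar0.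
have mr : m ∙ r = r ∙ m.
  apply/esym/cr; have -> : p ∙ p ∙ m = m ∙ (p ∙ p) + (a ∙ m - m ∙ a) ∙ m + a ∙ (a ∙ m - m ∙ a) + (a ∙ m - m ∙ a) ∙ a + m ∙ (a ∙ m - m ∙ a).
    by rewrite /p; nc_ring.
  by rewrite ma subrr !(cmul0l, cmul0r) !addr0.
have mq : m ∙ q = q ∙ m.
  apply/esym/cq; have -> : n ∙ n ∙ m = m ∙ (n ∙ n) - (a ∙ m - m ∙ a) ∙ m + a ∙ (a ∙ m - m ∙ a) + (a ∙ m - m ∙ a) ∙ a - m ∙ (a ∙ m - m ∙ a).
    by rewrite /n; nc_ring.
  by rewrite ma subrr !(cmul0l, cmul0r) !(addr0, subr0).
(* Since p q, q p, r q and q r vanish, (r + q)^2 = p^2 + n^2 = (2m)^2, and commuting positive roots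
   coincide. *)
have e : r + q = m + m.
  apply: sqrt_uniq; [exact: cposD|exact: cposD| |].
    by rewrite !cmulDl !cmulDr mr mq; nc_ring.
  have -> : (r + q) ∙ (r + q) = r ∙ r + q ∙ q + r ∙ q + q ∙ r by nc_ring.
  rewrite rq qr !addr0 rr qq.
  have -> : p ∙ p + n ∙ n = m ∙ m + m ∙ m + a ∙ a + a ∙ a by rewrite /p /n; nc_ring.
  by rewrite -mm; nc_ring.
have rp : r ∙ p = p ∙ p.
  have : (r + q) ∙ p = (p + n) ∙ p by rewrite e /p /n; congr (_ ∙ _); nc_ring_with R A.
  by rewrite (cmulDl r q p) (cmulDl p n p) qp np !addr0.
have pr' : p ∙ r = p ∙ p by rewrite -[LHS]cstarK cstarM sr sp rp cstarM sp.
have erp : r = p.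
  apply/eqP; rewrite -subr_eq0; apply/eqP/sa_sq0; first by rewrite cstarB sr sp.
  have -> : (r - p) ∙ (r - p) = r ∙ r - r ∙ p - p ∙ r + p ∙ p by nc_ring.
  by rewrite rr rp pr' subrr sub0r addrC subrr.
have eqn : q = n.
  apply: (@addrI _ r); rewrite e erp /p /n; nc_ring_with R A.
have h0 : (0 : R) < 2^-1 by rewrite invr_gt0.
exists ((2^-1)%:C *: p), ((2^-1)%:C *: n); split.
- by apply: cposZ => //; rewrite -erp.
- by apply: cposZ => //; rewrite -eqn.
- by rewrite /p /n fmorphV rmorph_nat; nc_ring_with R A.
- by rewrite cmulZl cmulZr pn !scaler0.
- by rewrite cmulZl cmulZr np !scaler0.
Qed.

Lemma cpos_re_im c : cpos (c^† ∙ c + c ∙ c^†).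
Proof.
pose x := c + c^†; pose y := 'i%R *: (c - c^†).
have sx : x^† = x by rewrite cstarD cstarK addrC.
have sy : y^† = y by rewrite cstarZ conjCi cstarB cstarK scaleNr -scalerN opprB.
have h0 : (0 : R) < 2^-1 by rewrite invr_gt0.
have -> : c^† ∙ c + c ∙ c^† = (2^-1)%:C *: (x ∙ x + y ∙ y).
  rewrite /x /y fmorphV rmorph_nat.
  have -> : ('i%R *: (c - c^†)) ∙ ('i%R *: (c - c^†)) = ('i%R * 'i%R) *: ((c - c^†) ∙ (c - c^†)) by nc_ring.
  by rewrite -expr2 sqrCi; nc_ring.
by apply: cposZ => //; apply: cposD; apply: cpos_sq.
Qed.

(** Kaplansky's argument: for n the negative part of b^† b and c = b n, both -c^† c = n^3 and c c^†
    are positive. Instead of comparing spectra of c^† c and c c^†, take d = r c^† with r^2 = -c^† c: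
    then d^† d and d d^† are minus squares, while their sum is positive by [cpos_re_im], so all of
    them vanish. *)
Theorem cpos_star_mul b : cpos (b^† ∙ b).
Proof.
have sa : (b^† ∙ b)^† = b^† ∙ b by rewrite cstarM cstarK.
have [p [n [pp pn e pn0 np0]]] := cpos_decomp sa.
have [sp _] := pp; have [sn _] := pn.
pose c := b ∙ n.
have cc : - (c^† ∙ c) = n ∙ n ∙ n.
  rewrite /c cstarM sn -cmulA [b^† ∙ _]cmulA e cmulBl pn0 sub0r cmulNr opprK cmulA //.
have pcc : cpos (- (c^† ∙ c)).
  rewrite cc; have [v [sv vv _ cv]] := sqrt_cpos pn.
  have vn := cv n erefl.
  have -> : n ∙ n ∙ n = (v ∙ n) ∙ (v ∙ n).
    by rewrite -[RHS]cmulA [n ∙ (v ∙ n)]cmulA -vn !cmulA vv.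
  by apply: cpos_sq; rewrite cstarM sv sn vn.
have pcc' : cpos (c ∙ c^†).
  have -> : c ∙ c^† = (c^† ∙ c + c ∙ c^†) + (- (c^† ∙ c)) by nc_ring.
  exact: cposD (cpos_re_im _) pcc.
have [r [sr rr _ _]] := sqrt_cpos pcc.
pose d := r ∙ c^†.
have d1 : d^† ∙ d = - ((c ∙ c^†) ∙ (c ∙ c^†)).
  rewrite /d cstarM cstarK sr.
  have -> : c ∙ r ∙ (r ∙ c^†) = c ∙ (r ∙ r) ∙ c^† by nc_ring.
  by rewrite rr; nc_ring.
have d2 : d ∙ d^† = - ((c^† ∙ c) ∙ (c^† ∙ c)).
  rewrite /d cstarM cstarK sr.
  have -> : r ∙ c^† ∙ (c ∙ r) = - (r ∙ (- (c^† ∙ c)) ∙ r) by nc_ring.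
  rewrite -rr; have -> : r ∙ (r ∙ r) ∙ r = (r ∙ r) ∙ (r ∙ r) by nc_ring.
  by rewrite rr; nc_ring.
have q1 : cpos ((c ∙ c^†) ∙ (c ∙ c^†)) by apply: cpos_sq; rewrite cstarM cstarK.
have q2 : cpos ((c^† ∙ c) ∙ (c^† ∙ c)) by apply: cpos_sq; rewrite cstarM cstarK.
have z0 : (c ∙ c^†) ∙ (c ∙ c^†) + (c^† ∙ c) ∙ (c^† ∙ c) = 0.
  apply: cpos_anti; first exact: cposD.
  by rewrite opprD -d1 -d2; apply: cpos_re_im.
have : (c^† ∙ c) ∙ (c^† ∙ c) = 0 by apply: cposD0 q2 q1 _; rewrite addrC.
move/(sa_sq0 (_ : (c^† ∙ c)^† = _)) => c0.
have : n ∙ n ∙ n = 0 by rewrite -cc c0 ?oppr0 // cstarM cstarK.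
move=> n3; have n0 : n = 0.
  apply: sa_sq0 => //; apply: sa_sq0; first by rewrite cstarM sn.
  by rewrite cmulA n3 cmul0l.
by rewrite e n0 subr0.
Qed.

Lemma pos_cposE a : pos_cone a <-> cpos a.
Proof.
split; first by case=> b ->; apply: cpos_star_mul.
by move=> /sqrt_cpos[b [sb bb _ _]]; exists b; rewrite sb bb.
Qed.

End Cone.

(** * Order estimates and approximate units *)

Section Positive.
Variables (R : realType) (A : cstarType R).
Implicit Types (a b c d e h s x y z : A) (t M : R).
Local Notation pos := (@pos_cone R A).

Lemma pos_sa a : pos a -> a^† = a.
Proof. by case=> b ->; rewrite cstarM cstarK. Qed.
Lemma pos_star_mul b : pos (b^† ∙ b).
Proof. by exists b. Qed.
Lemma pos_mul_star b : pos (b ∙ b^†).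
Proof. by exists b^†; rewrite cstarK. Qed.
Lemma pos0 : pos 0.
Proof. by exists 0; rewrite cmul0r. Qed.
Lemma posD a b : pos a -> pos b -> pos (a + b).
Proof. by move=> /pos_cposE pa /pos_cposE pb; apply/pos_cposE/cposD. Qed.
Lemma posZ t a : 0 <= t -> pos a -> pos (t%:C *: a).
Proof.
move=> t0 [b ->]; exists ((Num.sqrt t)%:C *: b).
by rewrite cstarZr cmulZl cmulZr scalerA -rmorphM /= -expr2 sqr_sqrtr.
Qed.
Lemma pos_sum (I : Type) (r : seq I) (P : pred I) (F : I -> A) :
  (forall i, P i -> pos (F i)) -> pos (\sum_(i <- r | P i) F i).
Proof. by move=> h; elim/big_ind: _ => //; [exact: pos0 | exact: posD]. Qed.
Lemma pos_conj a z : pos a -> pos (z^† ∙ a ∙ z).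
Proof. by case=> b ->; exists (b ∙ z); rewrite cstarM !cmulA. Qed.
Lemma pos_sqrt a : pos a -> exists b, [/\ b^† = b, pos b, b ∙ b = a
  & forall x, a ∙ x = x ∙ a -> b ∙ x = x ∙ b].
Proof.
by move=> /pos_cposE/sqrt_cpos[b [sb bb pb cb]]; exists b; split=> //; apply/pos_cposE.
Qed.
Lemma pos_le_nm x y : pos x -> pos (y - x) -> nm x <= nm y.
Proof. by move=> /pos_cposE px /pos_cposE pyx; have := cpos_le px pyx; rewrite addrC subrK. Qed.

Lemma pos_scvg (u : nat -> A) l : (forall n, pos (u n)) -> scvg u l -> pos l.
Proof.
move=> pu ul; apply/pos_cposE; split; first by apply: scvg_sa ul _ => n; apply: pos_sa.
have [N _ HN] := scvg_bounded ul.
exists (nm l + 1) => [|z]; first by rewrite ltr_wpDl ?nm_ge0.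
apply: (@scvg_le _ _ (fun n => (nm l + 1)%:C *: z - u (n + N)%N ∙ z)).
  have := scvgD (scvg_cst ((nm l + 1)%:C *: z)) (scvgZ (-1) (scvgMl z (scvg_shift N ul))).
  by rewrite scaleN1r => h r /h[K HK]; exists K => n /HK; rewrite scaleN1r.
move=> n; have /pos_cposE pn := pu (n + N)%N.
by have [h _] := cpos_bound pn (HN _ (leq_addl _ _)); apply: h.
Qed.

Lemma pos_lim a : (forall r, 0 < r -> exists2 b, pos b & nm (a - b) < r) -> pos a.
Proof.
move=> h; have /choice[u Hu] : forall n : nat, exists b, pos b /\ nm (b - a) < n.+1%:R^-1.
  move=> n; have [|b pb hb] := h n.+1%:R^-1; first by rewrite invr_gt0 ltr0n.
  by exists b; rewrite nmC.
apply: (@pos_scvg u) => [n|]; first by case: (Hu n).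
apply: (@scvg_squeeze _ _ _ _ (fun n => n.+1%:R^-1)) => [n|r]; last exact: inv_small.
by apply/ltW; case: (Hu n).
Qed.

(** In the unitization this reads M - h = M (1 - s)^2. Keeping [s] explicit makes the identity
    transportable to every action of the algebra. *)
Lemma sqrt_gap h M : h^† = h -> nm h < M -> exists s,
  [/\ s^† = s, M%:C *: (s + s - s ∙ s) = h & forall x, h ∙ x = x ∙ h -> s ∙ x = x ∙ s].
Proof.
move=> sh hM; have M0 : 0 < M := le_lt_trans (nm_ge0 h) hM.
have MC : M%:C != 0 :> R[i] by rewrite -(rmorph0 (real_complex R)) (inj_eq (@complexI _)) gt_eqF.
have [||s [ss hs cs]] := @sqrt1m R A (M^-1%:C *: h).
- by rewrite cstarZr sh.
- by rewrite nmZp ?invr_ge0 ?(ltW M0) // mulrC ltr_pdivrMr // mul1r.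
exists s; split=> // [|x hx].
  by rewrite hs scalerA fmorphV divff // scale1r.
by apply: cs; rewrite cmulZl cmulZr hx.
Qed.

Lemma pos_gap h M z : h^† = h -> nm h <= M -> pos (M%:C *: (z^† ∙ z) - z^† ∙ h ∙ z).
Proof.
move=> sh hM; apply: pos_lim => r r0.
pose w := z^† ∙ z; pose q := r / (2 * (nm w + 1)).
have w0 := nm_ge0 w.
have q0 : 0 < q by rewrite divr_gt0 // mulr_gt0 // ltr_wpDl.
have [|s [ss hs _]] := @sqrt_gap h (M + q) sh; first by rewrite ltr_pwDr.
exists ((M + q)%:C *: w - z^† ∙ h ∙ z).
  have -> : (M + q)%:C *: w - z^† ∙ h ∙ z = (M + q)%:C *: ((z - s ∙ z)^† ∙ (z - s ∙ z)).
    by rewrite -hs cstarB cstarM ss /w; nc_ring.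
  apply: posZ; last exact: pos_star_mul.
  by rewrite addr_ge0 ?(ltW q0) // (le_trans _ hM) ?nm_ge0.
have -> : M%:C *: (z^† ∙ z) - z^† ∙ h ∙ z - ((M + q)%:C *: w - z^† ∙ h ∙ z) = - (q%:C *: w).
  by rewrite rmorphD /= /w; nc_ring.
rewrite nmN nmZp ?(ltW q0) //.
have : q * (nm w + 1) = r / 2 by rewrite /q; field; rewrite gt_eqF // ltr_wpDl.
nra.
Qed.

Lemma pos_gap_mul b z : pos ((nm b ^+ 2)%:C *: (z^† ∙ z) - (b ∙ z)^† ∙ (b ∙ z)).
Proof.
have -> : (b ∙ z)^† ∙ (b ∙ z) = z^† ∙ (b^† ∙ b) ∙ z by rewrite cstarM !cmulA.
by apply: pos_gap; rewrite ?cstarM ?cstarK ?nm_cstar2.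
Qed.

Lemma nm_contr h z : pos h -> nm h <= 1 -> nm (z - h ∙ z) <= nm z.
Proof.
move=> /pos_cposE ph h1; have [H _] := cpos_bound ph h1.
by have := H z; rewrite scale1r mul1r.
Qed.

Lemma pos_sub_sq h z : pos h -> nm h <= 1 -> pos (z^† ∙ h ∙ z - z^† ∙ (h ∙ h) ∙ z).
Proof.
move=> ph h1; have [k [sk pk kk _]] := pos_sqrt ph.
have -> : z^† ∙ h ∙ z - z^† ∙ (h ∙ h) ∙ z =
   (1%:C)%C *: ((k ∙ z)^† ∙ (k ∙ z)) - (k ∙ z)^† ∙ h ∙ (k ∙ z).
  by rewrite cstarM sk -kk rmorph1; nc_ring.
by apply: pos_gap => //; apply: pos_sa.
Qed.

(** The converse of [pos_gap_mul]: an operator inequality y^† y <= t, tested on all z, bounds the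
    norm of y. *)
Lemma nm_le_gap y t : 0 <= t -> (forall z, pos (t%:C *: (z^† ∙ z) - z^† ∙ (y^† ∙ y) ∙ z)) ->
  nm y ^+ 2 <= t.
Proof.
move=> t0 H; have : nm y <= Num.sqrt t.
  apply: nm_le_mul => [|z]; first exact: sqrtr_ge0.
  rewrite -(@ler_pXn2r _ 2) ?nnegrE ?nm_ge0 ?mulr_ge0 ?sqrtr_ge0 ?nm_ge0 //.
  rewrite exprMn sqr_sqrtr // -!nm_cstar2 -(nmZp _ t0).
  apply: pos_le_nm; first exact: pos_star_mul.
  by rewrite cstarM -[X in _ - X]cmulA [y^† ∙ (y ∙ z)]cmulA cmulA.
rewrite -(@ler_pXn2r _ 2) ?nnegrE ?nm_ge0 ?sqrtr_ge0 //.
by rewrite sqr_sqrtr.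
Qed.

(* With [h] a multiple of [sum b b^*], the elements [1 - (1 - h)^(2m)] form an
   approximate unit for the given finite family. *)
Lemma approx_unit (bs : seq A) (r : R) : 0 < r -> exists e,
  [/\ pos e, nm e <= 1, forall b, b \in bs -> nm (b - e ∙ b) < r
    & forall S : set A, lin_subspace S -> (forall x y, S x -> S y -> S (x ∙ y)) ->
        S (\sum_(b <- bs) b ∙ b^†) -> S e].
Proof.
move=> r0; pose B := \sum_(b <- bs) b ∙ b^†.
have pB : pos B by apply: pos_sum => b _; apply: pos_mul_star.
pose t := nm B + 1; have t0 : 0 < t by rewrite ltr_wpDl ?nm_ge0.
have tC : t%:C != 0 :> R[i] by rewrite -(rmorph0 (real_complex R)) (inj_eq (@complexI _)) gt_eqF.
pose h := t^-1%:C *: B.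
have ph : pos h by apply: posZ; rewrite ?invr_ge0 ?(ltW t0).
have sh := pos_sa ph.
have h1 : nm h <= 1.
  by rewrite nmZp ?invr_ge0 ?(ltW t0) // mulrC ler_pdivrMr // mul1r lerDl.
have [k [sk pk kk ck]] := pos_sqrt ph.
have kh : k ∙ h = h ∙ k by apply: ck.
pose F a := a + h - h ∙ a; pose a n := iter n F 0.
have aS n : a n.+1 = a n + h - h ∙ a n by [].
have ac x : h ∙ x = x ∙ h -> forall n, a n ∙ x = x ∙ a n.
  move=> hx; elim=> [|n IH]; first by rewrite cmul0l cmul0r.
  have -> : a n.+1 ∙ x = a n ∙ x + h ∙ x - h ∙ (a n ∙ x) by rewrite aS; nc_ring.
  by rewrite aS IH hx [h ∙ (x ∙ _)]cmulA hx; nc_ring.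
have ah := ac h erefl; have ak := ac k (esym kh).
have sa n : (a n)^† = a n.
  elim: n => [|n IH]; first exact: cstar0.
  by rewrite aS cstarB cstarD cstarM IH sh ah.
have a1 n z : nm (z - a n ∙ z) <= nm z.
  elim: n z => [|n IH] z; first by rewrite cmul0l subr0.
  have -> : z - a n.+1 ∙ z = (z - a n ∙ z) - h ∙ (z - a n ∙ z) by rewrite aS; nc_ring.
  exact: le_trans (nm_contr _ ph h1) (IH _).
have a0 : a 0%N = 0 by [].
have aP (S : set A) : lin_subspace S -> (forall x y, S x -> S y -> S (x ∙ y)) ->
    S B -> forall n, S (a n).
  move=> [S0 SP] SM SB; have Sh : S h by rewrite -[h]addr0; apply: (SP).
  elim=> [|n IH] //; rewrite aS -scaleN1r addrC; apply: (SP); first exact: SM.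
  by rewrite -[a n]scale1r; apply: (SP).
clearbody a.
(* In the unitization a n = 1 - (1 - h)^n, so y n = (1 - h)^n k, v n = (1 - h)^n h and q n = (1 -
   h)^(2n) h. *)
pose y n := k - a n ∙ k; pose v n := h - a n ∙ h; pose q n := y n ∙ y n.
have sy n : (y n)^† = y n by rewrite /y cstarB cstarM sa sk ak.
have sv n : (v n)^† = v n by rewrite /v cstarB cstarM sa sh ah.
have yk n : k ∙ y n = v n by rewrite /y /v cmulBr cmulA -ak -[a n ∙ k ∙ k]cmulA kk.
have ky n : y n ∙ k = v n by rewrite /y /v cmulBl -cmulA kk.
have yh n : h ∙ y n = y n ∙ h.
  by rewrite /y cmulBr cmulBl -[a n ∙ k ∙ h]cmulA kh [a n ∙ (h ∙ k)]cmulA ah -cmulA.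
have yk' n : y n ∙ k = k ∙ y n by rewrite ky yk.
have vv n : v n ∙ v n = h ∙ q n.
  by rewrite -yk /q -kk -!cmulA [y n ∙ (k ∙ _)]cmulA yk' -!cmulA.
have hv n : v n ∙ h = h ∙ v n by rewrite /v cmulBl cmulBr cmulA -ah -cmulA.
have qv n : q n = v n - a n ∙ v n.
  by rewrite /q {1}/y cmulBl -cmulA yk.
have yS n : y n.+1 = y n - h ∙ y n by rewrite /y aS; nc_ring.
have qS n : q n.+1 = q n - h ∙ q n - h ∙ q n + h ∙ (h ∙ q n).
  rewrite /q yS; have -> : (y n - h ∙ y n) ∙ (y n - h ∙ y n) =
    y n ∙ y n - h ∙ (y n ∙ y n) - (y n ∙ h) ∙ y n + h ∙ ((y n ∙ h) ∙ y n) by nc_ring.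
  by rewrite -yh; nc_ring.
have dec n : pos (v n ∙ v n - v n.+1 ∙ v n.+1).
  have -> : v n ∙ v n - v n.+1 ∙ v n.+1 = (v n)^† ∙ h ∙ v n + ((v n)^† ∙ h ∙ v n - (v n)^† ∙ (h ∙ h) ∙ v n).
    rewrite sv hv -[h ∙ v n ∙ v n]cmulA; have -> : v n ∙ (h ∙ h) ∙ v n = h ∙ (h ∙ (v n ∙ v n)).
      by rewrite cmulA hv -[h ∙ v n ∙ h]cmulA hv -!cmulA.
    by rewrite !vv qS; nc_ring.
  by apply: posD; [apply: pos_conj | apply: pos_sub_sq].
pose S n := \sum_(j < n) v j ∙ v j.
have Sv n : pos (S n - n%:R%:C *: (v n ∙ v n)).
  elim: n => [|n IH]; first by rewrite /S big_ord0 scale0r subr0; apply: pos0.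
  have -> : S n.+1 - n.+1%:R%:C *: (v n.+1 ∙ v n.+1) =
    (S n - n%:R%:C *: (v n ∙ v n)) + n.+1%:R%:C *: (v n ∙ v n - v n.+1 ∙ v n.+1).
    have nS : n.+1%:R%:C = n%:R%:C + 1 :> R[i] by rewrite -natr1 rmorphD rmorph1.
    by rewrite /S big_ord_recr /= nS; move: (n%:R%:C) (\sum_(j < n) _) => N s; nc_ring.
  by apply: posD => //; apply: posZ.
(* The differences q n - q (n + 1) = 2 (v n)^2 - h (v n)^2 dominate (v n)^2, so the squares
   telescope below h. As they decrease, n * nm (v n) ^ 2 <= 1. *)
have Sh n : pos (h - S n - q n).
  elim: n => [|n IH].
    rewrite /S big_ord0 /q /y a0 cmul0l !subr0 kk subrr; exact: pos0.
  have -> : h - S n.+1 - q n.+1 = (h - S n - q n) + (1%:C *: ((v n)^† ∙ v n) - (v n)^† ∙ h ∙ v n).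
    rewrite /S big_ord_recr /= sv hv -cmulA vv qS rmorph1; move: (\sum_(j < n) _) => s; nc_ring.
  by apply: posD => //; apply: pos_gap.
have pq n : pos (q n) by rewrite /q -{1}sy; apply: pos_star_mul.
have vbound n : n%:R * nm (v n) ^+ 2 <= 1.
  have -> : n%:R * nm (v n) ^+ 2 = nm (n%:R%:C *: (v n ∙ v n)).
    by rewrite nmZp // -nm_cstar2 sv.
  apply: le_trans h1; apply: pos_le_nm; first by apply: posZ => //; rewrite -{1}sv; apply: pos_star_mul.
  have -> : h - n%:R%:C *: (v n ∙ v n) = (h - S n - q n) + q n + (S n - n%:R%:C *: (v n ∙ v n)) by nc_ring.
  by apply: posD => //; apply: posD.
have e0 : 0 < (r ^+ 2 / t) ^+ 2 by rewrite exprn_gt0 // divr_gt0 // exprn_gt0.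
have [N HN] := inv_small e0.
have vN : nm (v N.+1) < r ^+ 2 / t.
  rewrite -(@ltr_pXn2r _ 2) ?nnegrE ?nm_ge0 ?divr_ge0 ?exprn_ge0 ?(ltW r0) ?(ltW t0) //.
  by apply: le_lt_trans (HN N (leqnn _)); rewrite -[X in _ <= X]mul1r ler_pdivlMr ?ltr0n // mulrC.
(* e = 1 - (1 - a m)^2, so 1 - e is a square and e is positive; e is also a polynomial in h without
   constant term, which gives the last clause. *)
pose m := N.+1; pose e := a m + a m - a m ∙ a m.
have eE z : z - e ∙ z = (z - a m ∙ z) - a m ∙ (z - a m ∙ z) by rewrite /e; nc_ring.
have ah' n x : a n ∙ (h ∙ x) = h ∙ (a n ∙ x) by rewrite !cmulA ah.
have pe : pos e.
  rewrite /e; elim: (m) => [|n IH]; first by rewrite a0 cmul0r addr0 subr0; apply: pos0.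
  have -> : a n.+1 + a n.+1 - a n.+1 ∙ a n.+1 = (a n + a n - a n ∙ a n) + q n +
     (1%:C *: ((y n)^† ∙ y n) - (y n)^† ∙ h ∙ y n).
    rewrite sy -yh -cmulA -/(q n) rmorph1 scale1r qv /v aS.
    rewrite !(cmulBl, cmulBr, cmulDl, cmulDr) -!cmulA !(ah, ah'); nc_ring.
  apply: posD; last exact: pos_gap.
  by apply: posD.
have agap z : z^† ∙ z - z^† ∙ e ∙ z = (z - a m ∙ z)^† ∙ (z - a m ∙ z).
  by rewrite cstarB cstarM sa /e; nc_ring.
exists e; split=> //.
- have [w [sw pw ww _]] := pos_sqrt pe.
  rewrite -ww -{1}sw nm_cstar2; apply: nm_le_gap => // z.
  by rewrite sw ww rmorph1 scale1r agap; apply: pos_star_mul.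
- move=> b bB; rewrite eE; apply: le_lt_trans (a1 _ _) _.
  rewrite -(@ltr_pXn2r _ 2) ?nnegrE ?nm_ge0 ?(ltW r0) // -nm_cstar2r.
  have bt : nm ((b - a m ∙ b) ∙ (b - a m ∙ b)^†) <= t * nm (v m).
    apply: (@le_trans _ _ (t * nm (q m))); last first.
      by rewrite ler_wpM2l ?(ltW t0) // qv; apply: a1.
    rewrite -(nmZp _ (ltW t0)); apply: pos_le_nm; first exact: pos_mul_star.
    pose Z c := c - c ∙ a m - a m ∙ (c - c ∙ a m).
    have -> : (b - a m ∙ b) ∙ (b - a m ∙ b)^† = Z (b ∙ b^†).
      by rewrite cstarB cstarM sa /Z; nc_ring.
    have -> : t%:C *: q m = Z B.
      have -> : B = t%:C *: h by rewrite /h scalerA fmorphV divff // scale1r.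
      clearbody h.
      rewrite qv /v /Z !(cmulBl, cmulBr, cmulDl, cmulDr, cmulZl, cmulZr) -?cmulA !(ah, ah'); nc_ring.
    have -> : Z B - Z (b ∙ b^†) = Z (B - b ∙ b^†) by rewrite /Z; nc_ring.
    have [bs' ->] : exists bs', B = b ∙ b^† + \sum_(c <- bs') c ∙ c^†.
      exists (rem b bs); rewrite /B (perm_big _ (perm_to_rem bB)) big_cons //.
    have ZE c : Z (c ∙ c^†) = (c - a m ∙ c) ∙ (c - a m ∙ c)^†.
      by rewrite cstarB cstarM sa /Z; nc_ring.
    rewrite addrC addKr; have -> : Z (\sum_(c <- bs') c ∙ c^†) = \sum_(c <- bs') Z (c ∙ c^†).
      by apply: (big_morph Z) => [c d|]; rewrite /Z; nc_ring.
    by apply: pos_sum => c _; rewrite ZE; apply: pos_mul_star.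
  apply: le_lt_trans bt _; rewrite mulrC -ltr_pdivlMr //.
- move=> S1 lS SM SB; have Sa := aP S1 lS SM SB; have [S0 SP] := lS.
  rewrite /e -scaleN1r addrC; apply: (SP); first exact: SM.
  by rewrite -[X in X + _]scale1r; apply: (SP).
Qed.

End Positive.

(** * Bounded functionals *)

Section HahnBanach.
Variables (R : realType) (V : lmodType R[i]).
Implicit Types (p q f g : V -> R) (F : set (V -> R)) (x y : V) (t : R).

Definition sublinear p := (forall x y, p (x + y) <= p x + p y) /\
  (forall t x, 0 < t -> p (t%:C *: x) = t * p x).

Lemma sublinear0 p : sublinear p -> p 0 = 0.
Proof.
move=> [_ pZ]; have := pZ 2 0 (ltr0Sn _ _); rewrite scaler0; lra.
Qed.

Lemma sublinearN p x : sublinear p -> - p (- x) <= p x.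
Proof.
move=> sp; have := sp.1 x (- x); rewrite subrr sublinear0 //; lra.
Qed.

(** The stability conditions only ask that sums and multiples be dominated by some member of the
    family. This covers lowering at a vector, lower bounds of chains, majorants of functionals and
    functionals below a weight. *)
Lemma sublinear_inf F (m : V -> R) : F !=set0 ->
  (forall f x, F f -> m x <= f x) ->
  (forall f1 f2 x y, F f1 -> F f2 -> exists2 f, F f & f (x + y) <= f1 x + f2 y) ->
  (forall f t x, F f -> 0 < t -> exists2 f', F f' & f' (t%:C *: x) <= t * f x) ->
  let q x := inf [set f x | f in F] in
  [/\ sublinear q, forall f x, F f -> q x <= f x
    & forall x a, (forall f, F f -> a <= f x) -> a <= q x].
Proof.
move=> [f0 F0] Fm FD FZ q.
have ne x : [set f x | f in F] !=set0 by exists (f0 x); exists f0.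
have lb x : has_lbound [set f x | f in F] by exists (m x) => _ [f Ff <-]; apply: Fm.
have qf f x : F f -> q x <= f x by move=> Ff; apply: ge_inf => //; exists f.
have qg x a : (forall f, F f -> a <= f x) -> a <= q x.
  by move=> h; apply: lb_le_inf => // _ [f Ff <-]; apply: h.
have qZ t x : 0 < t -> q (t%:C *: x) <= t * q x.
  move=> t0; rewrite -ler_pdivrMl //; apply: qg => f Ff; rewrite ler_pdivrMl //.
  by have [f' Ff' h] := FZ f t x Ff t0; apply: le_trans h; apply: qf.
split=> //; split=> [x y|t x t0].
  rewrite -lerBlDr; apply: (qg) => f1 Ff1; rewrite lerBlDl -lerBlDr.
  apply: (qg) => f2 Ff2; rewrite lerBlDr [f2 y + _]addrC.
  by have [f Ff h] := FD f1 f2 x y Ff1 Ff2; apply: le_trans h; apply: qf.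
apply/eqP; rewrite eq_le qZ //=.
have ti : 0 < t^-1 by rewrite invr_gt0.
have := qZ t^-1 (t%:C *: x) ti; rewrite scalerA -rmorphM mulVf ?gt_eqF // scale1r.
by rewrite ler_pdivlMl.
Qed.

(* Hence a minimal sublinear functional is additive. *)
Lemma sublinear_lower p y : sublinear p -> exists q,
  [/\ sublinear q, forall x, q x <= p x & forall x, q x <= p (x + y) - p y].
Proof.
move=> sp; pose F := [set (fun x => p (x + t%:C *: y) - t * p y) | t in [set t : R | 0 <= t]].
have pZ0 t x : 0 <= t -> p (t%:C *: x) = t * p x.
  rewrite le_eqVlt => /orP[/eqP<-|]; last exact: sp.2.
  by rewrite scale0r sublinear0 // mul0r.
have [||||sq qF _] := @sublinear_inf F (fun x => - p (- x)).
- by exists (fun x => p (x + 0%:C *: y) - 0 * p y); exists 0 => /=.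
- move=> _ x [t /= t0 <-]; have := sp.1 (x + t%:C *: y) (- x).
  rewrite addrAC subrr add0r pZ0 //; lra.
- move=> _ _ x z [t /= t0 <-] [s /= s0 <-].
  exists (fun x => p (x + (t + s)%:C *: y) - (t + s) * p y); first by exists (t + s) => //=; apply: addr_ge0.
  have := sp.1 (x + t%:C *: y) (z + s%:C *: y).
  by rewrite rmorphD /= scalerDl addrACA; lra.
- move=> _ s x [t /= t0 <-] s0.
  exists (fun x => p (x + (s * t)%:C *: y) - (s * t) * p y); first by exists (s * t) => //=; apply: mulr_ge0 => //; apply: ltW.
  by rewrite rmorphM /= -scalerA -scalerDr sp.2 //; lra.
eexists; split; first exact: sq.
- by move=> x; have := qF _ x (ex_intro2 _ _ 0 (lexx 0) erefl); rewrite scale0r addr0 mul0r subr0.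
- by move=> x; have := qF _ x (ex_intro2 _ _ 1 ler01 erefl); rewrite scale1r mul1r.
Qed.

(** A minimal sublinear functional is additive by [sublinear_lower]. Lowering p at x0 beforehand
    gives p1 (- x0) <= - p x0, and this passes to every functional below p1, so g x0 = p x0. *)
Theorem hahn_banach p (x0 : V) : sublinear p -> exists g,
  [/\ forall x y, g (x + y) = g x + g y, forall t x, g (t%:C *: x) = t * g x,
      forall x, g x <= p x & g x0 = p x0].
Proof.
move=> sp; have [p1 [sp1 p1p p1x0]] := sublinear_lower x0 sp.
pose T := {q | sublinear q /\ forall x, q x <= p1 x}.
(* The order is reversed, so that Zorn's lemma yields a minimal element. *)
have [||||[q [sq qp]] qmin] := @Zorn T (fun (q q' : T) => `[< forall x, sval q' x <= sval q x >]).
- by move=> q; apply/asboolP => x.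
- move=> q r s /asboolP h1 /asboolP h2; apply/asboolP => x.
  exact: le_trans (h2 x) (h1 x).
- move=> [q hq] [r hr] /asboolP /= h1 /asboolP /= h2.
  have e : q = r by apply: funext => x; apply/eqP; rewrite eq_le h1 h2.
  by move: hq; rewrite e => hq; congr exist; apply: Prop_irrelevance.
- move=> A tot; have [A0|/set0P[[q0 [sq0 q0p]] Aq0]] := eqVneq A set0.
    have h : sublinear p1 /\ forall x, p1 x <= p1 x by split.
    by exists (exist _ p1 h) => s; rewrite A0.
  have mx (q r : T) : A q -> A r -> exists2 s, A s & forall x, sval s x <= sval q x /\ sval s x <= sval r x.
    move=> Aq Ar; case: (tot q r Aq Ar) => /asboolP h.
      by exists r => // x.
    by exists q => // x.
  pose F := [set sval q | q in A].
  have [||||sm mF _] := @sublinear_inf F (fun x => - p1 (- x)).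
  + by exists q0; exists (exist _ q0 (conj sq0 q0p)).
  + move=> _ x [[q [sq qp]] _ <-] /=; have := sublinearN x sq; have := qp (- x); lra.
  + move=> _ _ x y [q1 A1 <-] [q2 A2 <-]; have [s As hs] := mx q1 q2 A1 A2.
    exists (sval s); first by exists s.
    apply: le_trans ((svalP s).1.1 x y) _; apply: lerD; [exact: (hs x).1 | exact: (hs y).2].
  + move=> _ t x [q Aq <-] t0; exists (sval q); first by exists q.
    by rewrite (svalP q).1.2.
  have mp x : inf [set f x | f in F] <= p1 x.
    by apply: le_trans (mF q0 x _) (q0p x); exists (exist _ q0 (conj sq0 q0p)).
  exists (exist _ (fun x => inf [set f x | f in F]) (conj sm mp)) => s As.
  by apply/asboolP => x /=; apply: mF; exists s.
have add x y : q (x + y) = q x + q y.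
  have [r [sr rq ry]] := sublinear_lower y sq.
  have rp z : r z <= p1 z by apply: le_trans (rq z) (qp z).
  have /(congr1 sval)/= e := qmin (exist _ r (conj sr rp)) (introT (asboolP _) rq).
  by apply/eqP; rewrite eq_le sq.1; have := ry x; rewrite -e; lra.
have q0 := sublinear0 sq.
have qN x : q (- x) = - q x by have := add x (- x); rewrite subrr q0; lra.
have qp' x : q x <= p x := le_trans (qp x) (p1p x).
exists q; split=> // [t x|].
  have [t0|t0|->] := ltrgt0P t; first exact: sq.2.
    have nt0 : 0 < - t by rewrite oppr_gt0.
    have := sq.2 _ x nt0; rewrite rmorphN scaleNr qN /=; lra.
  by rewrite scale0r q0 mul0r.
apply/eqP; rewrite eq_le qp' /=; have := p1x0 (- x0); have := qp (- x0).
rewrite qN addNr (sublinear0 sp); lra.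
Qed.

End HahnBanach.

Section BoundedLinear.
Variables (R : realType) (V W : normedModType R[i]).

Definition nmc (k : R[i]) : R := complex.Re `|k|.

Definition bounded_linear (F : V -> W) := linear F /\
  exists2 C : R, 0 <= C & forall x, nm (F x) <= C * nm x.

Lemma bounded_linearE (F : V -> W) : bounded_linear F <-> linear F /\ continuous F.
Proof.
split=> [[lF [C C0 h]]|[lF cF]]; split=> //; pose F' : {linear V -> W} := HB.pack F (GRing.isLinear.Build R[i] V W _ F lF).
  apply: (@bounded_linear_continuous _ _ _ F'); apply/linear_boundedP.
  exists C%:C; split; first by rewrite realE lecR C0.
  move=> r Cr x /=; apply: le_trans (_ : C%:C * `|x| <= _).
    by rewrite !nmE -rmorphM lecR h.
  by rewrite ler_wpM2r // ltW.
have /linear_boundedP[r [rr hr]] := @continuous_linear_bounded _ _ _ 0 F' (cF 0).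
exists (`|complex.Re r| + 1) => [|x]; first by rewrite addr_ge0.
rewrite -lecR rmorphM /= -!nmE; apply: hr.
rewrite -(RRe_real rr) ltcR; have := ler_norm (complex.Re r); lra.
Qed.

Section Consequences.
Variable F : V -> W.
Hypothesis bF : bounded_linear F.
Lemma blP k x y : F (k *: x + y) = k *: F x + F y. Proof. exact: bF.1. Qed.
Lemma blD x y : F (x + y) = F x + F y.
Proof. by rewrite -[x]scale1r blP !scale1r. Qed.
Lemma bl0 : F 0 = 0.
Proof. by apply: (addrI (F 0)); rewrite -blD !addr0. Qed.
Lemma blZ k x : F (k *: x) = k *: F x.
Proof. by rewrite -[k *: x]addr0 blP bl0 addr0. Qed.
Lemma blN x : F (- x) = - F x.
Proof. by rewrite -scaleN1r blZ scaleN1r. Qed.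
Lemma blB x y : F (x - y) = F x - F y.
Proof. by rewrite blD blN. Qed.
Lemma bl_sum (I : Type) (r : seq I) (P : pred I) (u : I -> V) :
  F (\sum_(i <- r | P i) u i) = \sum_(i <- r | P i) F (u i).
Proof. by apply: (big_morph F blD bl0). Qed.
Lemma bl_scvg u l : scvg u l -> scvg (F \o u) (F l).
Proof.
have [_ [C C0 h]] := bF => ul e e0.
have d0 : 0 < e / (C + 1) by rewrite divr_gt0 // ltr_wpDl.
have [N HN] := ul _ d0; exists N => n /HN; rewrite ltr_pdivlMr ?ltr_wpDl // => hn.
rewrite /= -blB; apply: le_lt_trans (h _) _; apply: le_lt_trans hn.
by rewrite mulrC ler_wpM2l ?nm_ge0 // lerDl.
Qed.
End Consequences.

Lemma bl_zero : bounded_linear (fun=> 0 : W).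
Proof.
split; first by move=> k x y; rewrite scaler0 addr0.
by exists 0; [apply: lexx | move=> x; rewrite nm0 mul0r].
Qed.

Lemma bl_comb (k : R[i]) (F G : V -> W) : bounded_linear F -> bounded_linear G ->
  bounded_linear (fun x => k *: F x + G x).
Proof.
move=> bF bG; have [_ [C C0 hC]] := bF; have [_ [D D0 hD]] := bG; split.
  move=> l x y; rewrite (blP bF) (blP bG) !scalerDr addrACA.
  by rewrite !scalerA [k * l]mulrC.
exists (nmc k * C + D) => [|x]; first by rewrite addr_ge0 ?mulr_ge0 // -ler0c /nmc RRe_real ?normr_real.
apply: le_trans (nmD _ _) _; rewrite mulrDl; apply: lerD; last exact: hD.
rewrite nmZ -mulrA ler_wpM2l // -ler0c RRe_real ?normr_real //.
Qed.

End BoundedLinear.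

Lemma bl_comp (R : realType) (U V W : normedModType R[i]) (G : V -> W) (F : U -> V) :
  bounded_linear F -> bounded_linear G -> bounded_linear (fun x => G (F x)).
Proof.
move=> bF bG; have [_ [C C0 hC]] := bF; have [_ [D D0 hD]] := bG; split.
  by move=> l x y; rewrite (blP bF) (blP bG).
exists (D * C) => [|x]; first exact: mulr_ge0.
by apply: le_trans (hD _) _; rewrite -mulrA ler_wpM2l.
Qed.

(** The density principle behind most identities on tensor products below: they are checked on
    elementary tensors, or on another total set adapted to the maps. *)
Lemma bl_eq_total (R : realType) (A : cstarType R) (W : normedModType R[i])
    (S : set A) (F G : A -> W) : bounded_linear F -> bounded_linear G ->
  cspan S = setT -> (forall x, S x -> F x = G x) -> F = G.
Proof.
move=> bF bG tS FG; apply: funext => x.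
have : cspan S x by rewrite tS.
move=> /closure_scvg[u [Su ux]].
apply: (@scvg_uniq _ _ (F \o u)); first exact: bl_scvg.
suff -> : F \o u = G \o u by apply: bl_scvg.
apply: funext => n /=; have [m [k [s [Ss ->]]]] := Su n.
by rewrite !bl_sum //; apply: eq_bigr => i _; rewrite !blZ // FG.
Qed.

Section Functionals.
Variables (R : realType) (A : cstarType R).
Implicit Types (g : A -> R) (f : A -> R[i]) (a b c x y : A).
Local Notation pos := (@pos_cone R A).

Lemma nmcE (k : R[i]) : `|k| = (nmc k)%:C.
Proof. by rewrite /nmc RRe_real ?normr_real. Qed.
Lemma nmc_nm (k : R[i]) : nm (k : R[i]^o) = nmc k. Proof. by []. Qed.
Lemma nmc_ge0 (k : R[i]) : 0 <= nmc k.
Proof. by rewrite -lecR -nmcE normr_ge0. Qed.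
Lemma nmcM (k l : R[i]) : nmc (k * l) = nmc k * nmc l.
Proof. by apply: complexI; rewrite rmorphM /= -!nmcE normrM. Qed.
Lemma nmcD (k l : R[i]) : nmc (k + l) <= nmc k + nmc l.
Proof. exact: (@nmD _ (R[i]^o) k l). Qed.
Lemma nmc_real (t : R) : nmc t%:C = `|t|.
Proof. by rewrite /nmc normc_def /= expr0n /= addr0 sqrtr_sqr. Qed.
Lemma nmcJ (k : R[i]) : nmc (Num.conj k) = nmc k.
Proof. by rewrite /nmc norm_conjC. Qed.
Lemma nmc_sqr (k : R[i]) : k * Num.conj k = (nmc k ^+ 2)%:C.
Proof. by rewrite -normCK nmcE rmorphXn. Qed.

Lemma dualE f : dual f <-> bounded_linear (f : A -> R[i]^o).
Proof. by rewrite bounded_linearE. Qed.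

Lemma complex_split (k : R[i]) : k = (complex.Re k)%:C + 'i%R * (complex.Im k)%:C.
Proof. by rewrite -complexiE -complexE. Qed.

Lemma linear_of_real (V W : lmodType R[i]) (F : V -> W) :
  (forall x y : V, F (x + y) = F x + F y) ->
  (forall (t : R) (x : V), F (t%:C *: x) = t%:C *: F x) ->
  (forall x : V, F ('i%R *: x) = 'i%R *: F x) -> linear F.
Proof.
move=> FD FZ Fi k x y; rewrite FD; congr (_ + _).
by rewrite (complex_split k) !scalerDl FD FZ -!scalerA Fi FZ.
Qed.

Lemma dual_le f : dual f -> exists2 C : R, 0 <= C & forall a, nmc (f a) <= C * nm a.
Proof. by move=> /dualE[]. Qed.

Definition re_part a : A := (2^-1)%:C *: (a + a^†).
Lemma re_partD a b : re_part (a + b) = re_part a + re_part b.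
Proof. by rewrite /re_part cstarD addrACA scalerDr. Qed.
Lemma re_partZ (t : R) a : re_part (t%:C *: a) = t%:C *: re_part a.
Proof. by rewrite /re_part cstarZr; nc_ring_with R A. Qed.
Lemma re_part_sa a : a^† = a -> re_part a = a.
Proof.
by move=> sa; rewrite /re_part sa fmorphV rmorph_nat; nc_ring_with R A.
Qed.
Lemma re_part_le a : nm (re_part a) <= nm a.
Proof.
rewrite nmZp ?invr_ge0 //; have := nmD a a^†; rewrite nm_star; lra.
Qed.
Lemma re_partN a : re_part (- a) = - re_part a.
Proof. by rewrite -scaleN1r -(rmorphN1 (real_complex R)) re_partZ rmorphN1 scaleN1r. Qed.
Lemma re_part_split a : a = re_part a - 'i%R *: re_part ('i%R *: a).
Proof.
rewrite /re_part cstarZ conjCi fmorphV rmorph_nat.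
have -> : 'i%R *: (2^-1 *: ('i%R *: a + - 'i%R *: a^†)) = ('i%R * 'i%R) *: (2^-1 *: (a - a^†)).
  by nc_ring_with R A.
by rewrite -expr2 sqrCi; nc_ring_with R A.
Qed.

(** The real part of i a is minus the imaginary part of a, so f is the hermitian extension of g from
    the self-adjoint elements. *)
Lemma complexify (g : A -> R) (C : R) : 0 <= C ->
  (forall x y, g (x + y) = g x + g y) -> (forall t x, g (t%:C *: x) = t * g x) ->
  (forall x, g x <= C * nm x) ->
  exists2 f, dual f & forall a, a^† = a -> f a = (g a)%:C.
Proof.
move=> C0 gD gZ gC.
have gC' x : `|g x| <= C * nm x.
  rewrite ler_norml gC andbT lerNl -mulN1r -gZ rmorphN1 scaleN1r.
  by rewrite -(nmN x) gC.
have gN x : g (- x) = - g x by rewrite -scaleN1r -(rmorphN1 (real_complex R)) gZ mulN1r.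
pose f a : R[i] := (g (re_part a))%:C - 'i%R * (g (re_part ('i%R *: a)))%:C.
exists f; last first.
  move=> a sa; rewrite /f re_part_sa //; have -> : re_part ('i%R *: a) = 0.
    by rewrite /re_part cstarZ conjCi sa scaleNr subrr scaler0.
  have -> : g 0 = 0 by have := gD 0 0; rewrite addr0; lra.
  by rewrite rmorph0 mulr0 subr0.
apply/dualE; split.
  apply: linear_of_real => [x y|t x|x].
  - by rewrite /f scalerDr !re_partD !gD !rmorphD /=; ring.
  - rewrite /f; have -> : 'i%R *: (t%:C *: x) = t%:C *: ('i%R *: x) by rewrite !scalerA mulrC.
    by rewrite !re_partZ !gZ !rmorphM /= /GRing.scale /=; ring.
  rewrite /f scalerA -expr2 sqrCi scaleN1r re_partN gN rmorphN /= /GRing.scale /= mulrBr.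
  by rewrite mulrA -expr2 sqrCi mulN1r mulrN !opprK addrC.
exists (C + C) => [|a]; first exact: addr_ge0.
rewrite nmc_nm /f mulrDl; apply: le_trans (nmcD _ _) _; apply: lerD.
  rewrite nmc_real; apply: le_trans (gC' _) _.
  by apply: ler_wpM2l => //; apply: re_part_le.
rewrite -mulNr nmcM nmc_real.
have -> : nmc (- 'i%R) = 1 :> R by rewrite /nmc normrN normCi.
rewrite mul1r; apply: le_trans (gC' _) _; apply: ler_wpM2l => //.
apply: le_trans (re_part_le _) _; rewrite nmZ.
by rewrite normCi mul1r.
Qed.

Lemma pos_dist h c : pos h -> pos c -> nm h <= 1 -> nm c <= 1 -> nm (h - c) <= 1.
Proof.
move=> /pos_cposE ph /pos_cposE pc h1 c1; apply: nm_le_mul => // z.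
have [_ H] := cpos_bound ph h1; have [_ K] := cpos_bound pc c1.
have -> : (h - c) ∙ z = (2^-1)%:C *: ((1%:C *: z - 2%:C *: (c ∙ z)) - (1%:C *: z - 2%:C *: (h ∙ z))).
  by rewrite fmorphV rmorph_nat rmorph1; nc_ring.
rewrite nmZp ?invr_ge0 //; apply: le_trans (_ : 2^-1 * (nm z + nm z) <= _); last by lra.
rewrite ler_wpM2l ?invr_ge0 //; apply: le_trans (nmB _ _) _.
by have := H z; have := K z; lra.
Qed.

Lemma nm_sublinear : sublinear (@nm R A).
Proof. by split=> [|t x t0]; [exact: nmD | rewrite nmZp // ltW]. Qed.

(** A norming functional g of w^† w is already positive: it takes the value 1 at a positive h of
    norm 1, and nm (h - k) <= 1 for every positive k of norm 1, so 1 - g k <= 1. This replaces the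
    evaluation at a unit. *)
Lemma norming_state w : exists f, [/\ pos_dual f, forall c, f (c^† ∙ c) <= (nm c ^+ 2)%:C
  & f (w^† ∙ w) = (nm w ^+ 2)%:C].
Proof.
have [g [gD gZ gn gw]] := hahn_banach (w^† ∙ w) nm_sublinear.
have gn' x : g x <= 1 * nm x by rewrite mul1r.
have [f df fg] := complexify ler01 gD gZ gn'.
have fp c : f (c^† ∙ c) = (g (c^† ∙ c))%:C by rewrite fg // pos_sa //; apply: pos_star_mul.
have [w0|w0] := eqVneq w 0.
  exists (fun=> 0); split=> [|c|].
  - split; last by move=> c; apply: lexx.
    by apply/dualE; apply: bl_zero.
  - by rewrite lecR exprn_ge0 ?nm_ge0.
  - by rewrite w0 nm0 expr0n.
have nw : 0 < nm w ^+ 2 by rewrite exprn_gt0 // nm_gt0.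
exists f; split=> [|c|]; [split; [exact: df | move=> c] | | by rewrite fp gw nm_cstar2].
  rewrite fp ler0c; have [->|c0] := eqVneq c 0.
    by rewrite cmul0r -(scale0r (0 : A)) -(rmorph0 (real_complex R)) gZ mul0r.
  have nc : 0 < nm c ^+ 2 by rewrite exprn_gt0 // nm_gt0.
  pose h := (nm w ^- 2)%:C *: (w^† ∙ w); pose k := (nm c ^- 2)%:C *: (c^† ∙ c).
  have nh : nm h = 1 by rewrite nmZp ?invr_ge0 ?(ltW nw) // nm_cstar2 mulVf ?gt_eqF.
  have nk : nm k = 1 by rewrite nmZp ?invr_ge0 ?(ltW nc) // nm_cstar2 mulVf ?gt_eqF.
  have hk : nm (h - k) <= 1.
    by apply: pos_dist; rewrite ?nh ?nk //; apply: posZ; rewrite ?invr_ge0 ?(ltW nw) ?(ltW nc) //; apply: pos_star_mul.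
  have := le_trans (gn (h - k)) hk.
  have -> : g (h - k) = 1 - nm c ^- 2 * g (c^† ∙ c).
    rewrite -scaleN1r -(rmorphN1 (real_complex R)) gD !gZ gw nm_cstar2 mulVf ?gt_eqF //; ring.
  by rewrite lerBlDl lerDr pmulr_rge0 // invr_gt0.
by rewrite fp lecR; apply: le_trans (gn _) _; rewrite nm_cstar2.
Qed.

(** A one-sided Jordan decomposition. Take k below the infimum over positive c, s of C nm (x - c -
    s) - f c, and p = -k. The choice c = 0 makes p positive, s = 0 makes p - f positive; the infimum
    is finite because nm c <= nm (c + s). *)
Lemma dual_majorant f : dual f -> (forall a, f a^† = Num.conj (f a)) ->
  exists2 p, pos_dual p & pos_dual (fun a => p a - f a).
Proof.
move=> df hf; have [C C0 fC] := dual_le df; have bf := iffLR (dualE f) df.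
pose rf a := complex.Re (f a).
have fr c : pos c -> f c = (rf c)%:C.
  by move=> pc; rewrite /rf RRe_real //; apply/CrealP; rewrite -hf pos_sa.
have rfD x y : rf (x + y) = rf x + rf y by rewrite /rf (blD bf) raddfD.
have rfZ t x : rf (t%:C *: x) = t * rf x.
  by rewrite /rf (blZ bf) /GRing.scale /=; case: (f x) => u v /=; ring.
have rfC c : rf c <= C * nm c.
  apply: le_trans (fC c); rewrite /rf; apply: le_trans (ler_norm _) _.
  by rewrite /nmc -lecR RRe_real ?normr_real // normc_ge_Re.
pose F := [set u : A -> R | exists c s, [/\ pos c, pos s & u = fun a => C * nm (a - c - s) - rf c]].
have [||||sq qF _] := @sublinear_inf R A F (fun x => - (C * nm x)).
- by exists (fun a => C * nm (a - 0 - 0) - rf 0), 0, 0; split=> //; apply: pos0.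
- move=> _ x [c [s [pc ps ->]]]; have h1 := rfC c.
  have h2 : nm c <= nm (c + s) by apply: pos_le_nm; rewrite // [c + s]addrC addrK.
  have h3 : nm (c + s) <= nm (x - c - s) + nm x.
    have e : x - c - s = x - (c + s) by rewrite opprD addrA.
    have := nmB x (x - (c + s)); rewrite subKr -e; lra.
  have := ler_wpM2l C0 (le_trans h2 h3); lra.
- move=> _ _ x y [c [s [pc ps ->]]] [c' [s' [pc' ps' ->]]].
  exists (fun a => C * nm (a - (c + c') - (s + s')) - rf (c + c')).
    by exists (c + c'), (s + s'); split=> //; apply: posD.
  have h : nm (x + y - (c + c') - (s + s')) <= nm (x - c - s) + nm (y - c' - s').
    have -> : x + y - (c + c') - (s + s') = (x - c - s) + (y - c' - s') by nc_ring_with R A.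
    exact: nmD.
  have := ler_wpM2l C0 h; rewrite rfD; lra.
- move=> _ t x [c [s [pc ps ->]]] t0.
  exists (fun a => C * nm (a - t%:C *: c - t%:C *: s) - rf (t%:C *: c)).
    by exists (t%:C *: c), (t%:C *: s); split=> //; apply: posZ => //; apply: ltW.
  by rewrite -!scalerBr nmZp ?(ltW t0) // rfZ; lra.
have [k [kD kZ kq _]] := hahn_banach (0 : A) sq.
have kF u x : F u -> k x <= u x by move=> Fu; apply: le_trans (kq x) (qF u x Fu).
have kN x : k (- x) = - k x by rewrite -scaleN1r -(rmorphN1 (real_complex R)) kZ mulN1r.
have rf0 : rf 0 = 0 by have := rfD 0 0; rewrite addr0; lra.
have kn x : k x <= C * nm x.
  have := @kF (fun a => C * nm (a - 0 - 0) - rf 0) x; rewrite !subr0 rf0 subr0; apply.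
  by exists 0, 0; split; rewrite ?rf0 //; apply: pos0.
have [p dp pk] : exists2 p, dual p & forall a, a^† = a -> p a = (- k a)%:C.
  apply: (@complexify (fun a => - k a) C) => // [x y|t x|x]; rewrite ?kD ?kZ; try lra.
  by rewrite -kN -[nm x]nmN.
have pp : pos_dual p.
  split; [exact: dp | move=> a]; rewrite (pk _ (pos_sa (pos_star_mul a))).
  have h : F (fun x => C * nm (x - 0 - a^† ∙ a) - rf 0).
    by exists 0, (a^† ∙ a); split=> //; [apply: pos0 | apply: pos_star_mul].
  by rewrite ler0c oppr_ge0; have := kF _ (a^† ∙ a) h; rewrite subr0 subrr nm0 mulr0 rf0 subr0.
exists p; first exact: pp.
split.
  have := bl_comb (-1) bf (iffLR (dualE p) dp); rewrite dualE; congr bounded_linear.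
  by apply: funext => a; rewrite scaleN1r addrC.
move=> a; have pa := pos_star_mul a.
rewrite (pk _ (pos_sa pa)) fr // -rmorphB ler0c.
have h : F (fun x => C * nm (x - a^† ∙ a - 0) - rf (a^† ∙ a)).
  by exists (a^† ∙ a), 0; split=> //; apply: pos0.
by have := kF _ (a^† ∙ a) h; rewrite subrr subr0 nm0 mulr0 sub0r subr_ge0 lerNr.
Qed.

End Functionals.

(** * Adjointable maps, multipliers and representations by them *)

Section Adjointable.
Variables (R : realType) (T : cstarType R).
Implicit Types (X Y Z : T) (F G : T -> T) (m n : multiplier T).

(** Adjointability for T as a Hilbert module over itself. Linearity and T-linearity follow, and
    these maps are exactly the left parts of multipliers ([multiplier_adjoint], [mLE]). *)
Definition adjoint_pair F G := forall X Y, (F X)^† ∙ Y = X^† ∙ G Y.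

Lemma cstar_separate X Y : (forall Z, Z^† ∙ X = Z^† ∙ Y) -> X = Y.
Proof.
move=> h; apply/eqP; rewrite -subr_eq0; apply/eqP/cstar_mul_eq0.
by rewrite cmulBr h subrr.
Qed.

Lemma adjoint_sym F G : adjoint_pair F G -> adjoint_pair G F.
Proof.
by move=> h X Y; rewrite -[Y in LHS]cstarK -cstarM -h cstarM cstarK.
Qed.

Lemma adjoint_mul F G X Y : adjoint_pair F G -> F (X ∙ Y) = F X ∙ Y.
Proof.
move=> /adjoint_sym h; apply: cstar_separate => Z.
by rewrite -h cmulA h -cmulA.
Qed.

Lemma adjoint_linear F G : adjoint_pair F G -> linear F.
Proof.
move=> /adjoint_sym h k X Y; apply: cstar_separate => Z.
by rewrite -h cmulDr cmulZr !h -cmulZr -cmulDr.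
Qed.

Lemma adjointD F G X Y : adjoint_pair F G -> F (X + Y) = F X + F Y.
Proof. by move=> h; rewrite -[X in LHS]scale1r (adjoint_linear h) scale1r. Qed.
Lemma adjoint0 F G : adjoint_pair F G -> F 0 = 0.
Proof. by move=> h; apply: (addrI (F 0)); rewrite -(adjointD _ _ h) !addr0. Qed.
Lemma adjointZ F G k X : adjoint_pair F G -> F (k *: X) = k *: F X.
Proof. by move=> h; rewrite -[k *: X]addr0 (adjoint_linear h) (adjoint0 h) addr0. Qed.

Lemma multiplier_adjoint m : adjoint_pair (mL m) (mL (mstar m)).
Proof. by move=> X Y; rewrite /= -[Y in LHS]cstarK -cstarM mLR cstarM. Qed.

Lemma mLE F G (h : adjoint_pair F G) : exists m, mL m = F /\ mL (mstar m) = G.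
Proof.
have e X Y : X ∙ F Y = (G X^†)^† ∙ Y by rewrite (adjoint_sym h) cstarK.
exists (Multiplier e); split=> //=; apply: funext => X /=.
by rewrite !cstarK.
Qed.

Lemma multiplier_eq m n : mL m = mL n -> m = n.
Proof.
case: m n => [F F' h] [G G' k] /= e; move: k; rewrite -e => k.
have e' : F' = G'.
  apply: funext => X; apply/(can_inj (@cstarK R T))/cstar_separate => Z.
  by rewrite -!cstarM -h -k.
by move: h; rewrite e' => h; congr Multiplier; apply: Prop_irrelevance.
Qed.

Lemma mRE m X : mR m X = (mL (mstar m) X^†)^†.
Proof. by rewrite /= !cstarK. Qed.

End Adjointable.

Section Actions.
Variables (R : realType) (A T : cstarType R).
Implicit Types (a b h : A) (X Y Z : T).
Local Notation pos := (@pos_cone R _).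

(** A representation of A by adjointable maps of T. It treats left multiplication, the two legs of a
    tensor product, the comultiplication and its amplifications alike. *)
Definition action (pi : A -> T -> T) := [/\ forall k a b Y, pi (k *: a + b) Y = k *: pi a Y + pi b Y,
  forall a b Y, pi (a ∙ b) Y = pi a (pi b Y) & forall a, adjoint_pair (pi a) (pi a^†)].

Variable pi : A -> T -> T.
Hypothesis hpi : action pi.

Lemma actDl a b Y : pi (a + b) Y = pi a Y + pi b Y.
Proof. by have [h _ _] := hpi; rewrite -[a]scale1r h !scale1r. Qed.
Lemma act0l Y : pi 0 Y = 0.
Proof. by apply: (addrI (pi 0 Y)); rewrite -actDl !addr0. Qed.
Lemma actZl k a Y : pi (k *: a) Y = k *: pi a Y.
Proof. by have [h _ _] := hpi; rewrite -[k *: a]addr0 h act0l addr0. Qed.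
Lemma actNl a Y : pi (- a) Y = - pi a Y.
Proof. by rewrite -scaleN1r actZl scaleN1r. Qed.
Lemma actBl a b Y : pi (a - b) Y = pi a Y - pi b Y.
Proof. by rewrite actDl actNl. Qed.
Lemma act_suml (I : Type) (r : seq I) (P : pred I) (u : I -> A) Y :
  pi (\sum_(i <- r | P i) u i) Y = \sum_(i <- r | P i) pi (u i) Y.
Proof. by apply: (big_morph (pi ^~ Y)) => [a b|]; [apply: actDl | apply: act0l]. Qed.
Lemma actM a b Y : pi (a ∙ b) Y = pi a (pi b Y). Proof. by have [_ h _] := hpi. Qed.
Lemma act_adj a X Y : (pi a X)^† ∙ Y = X^† ∙ pi a^† Y. Proof. by have [_ _ h] := hpi; apply: h. Qed.
Lemma act_adjoint a : adjoint_pair (pi a) (pi a^†). Proof. by have [_ _ h] := hpi; apply: h. Qed.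
Definition actDr a X Y := adjointD X Y (act_adjoint a).
Definition actZr a k X := adjointZ k X (act_adjoint a).
Lemma act_mulr a X Y : pi a (X ∙ Y) = pi a X ∙ Y. Proof. exact: adjoint_mul (act_adjoint a). Qed.

(** [pi] transports the root of [sqrt_gap], so the gap is M times the square of Y - pi s Y. *)
Lemma act_gap h (M : R) Y : h^† = h -> nm h < M -> pos (M%:C *: (Y^† ∙ Y) - Y^† ∙ pi h Y).
Proof.
move=> sh hM; have [s [ss hs _]] := sqrt_gap sh hM.
have -> : M%:C *: (Y^† ∙ Y) - Y^† ∙ pi h Y = M%:C *: ((Y - pi s Y)^† ∙ (Y - pi s Y)).
  have e : Y^† ∙ pi (s ∙ s) Y = (pi s Y)^† ∙ pi s Y by rewrite actM act_adj ss.
  have e' : (pi s Y)^† ∙ Y = Y^† ∙ pi s Y by rewrite act_adj ss.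
  rewrite -hs actZl actBl actDl cmulZr cmulBr e cmulDr cstarB cmulBl !cmulBr e'.
  by nc_ring.
apply: posZ; last exact: pos_star_mul.
exact: le_trans (nm_ge0 h) (ltW hM).
Qed.

Lemma act_bound a Y : nm (pi a Y) <= nm a * nm Y.
Proof.
rewrite -(@ler_pXn2r _ 2) ?nnegrE ?mulr_ge0 ?nm_ge0 // exprMn -!nm_cstar2.
apply: (@le_eps _ _ _ (nm (Y^† ∙ Y))) => e e0; rewrite mulrC -mulrDr mulrC -nmZp; last first.
  by rewrite addr_ge0 ?nm_ge0 // ltW.
apply: pos_le_nm; first exact: pos_star_mul.
rewrite act_adj -actM; apply: act_gap; first by rewrite cstarM cstarK.
by rewrite ltrDl.
Qed.

Lemma act_bounded a : bounded_linear (pi a).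
Proof.
split; first exact: adjoint_linear (act_adjoint a).
by exists (nm a) => [|Y]; [exact: nm_ge0 | exact: act_bound].
Qed.

(* Row Cauchy--Schwarz; the gap is
   [sum_j |Y_j - M^-1 pi(x_j)^* s|^2 + M^-2 (M s^* s - s^* pi(h) s)]
   with [s = sum_j pi(x_j) Y_j] and [h = sum_j x_j x_j^*], up to a factor [M]. *)
Lemma row_gap n (x : 'I_n -> A) (Y : 'I_n -> T) (M : R) :
  nm (\sum_i x i ∙ (x i)^†) < M ->
  pos (M%:C *: (\sum_i (Y i)^† ∙ Y i) -
       (\sum_i pi (x i) (Y i))^† ∙ \sum_i pi (x i) (Y i)).
Proof.
move=> hM; set h := \sum_i _ in hM; set s := \sum_i pi _ _.
have M0 : 0 < M := le_lt_trans (nm_ge0 h) hM.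
have MC : M%:C != 0 :> R[i] by rewrite -(rmorph0 (real_complex R)) (inj_eq (@complexI _)) gt_eqF.
have sh : h^† = h by rewrite cstar_sum; apply: eq_bigr => i _; rewrite cstarM cstarK.
pose V i := Y i - M%:C^-1 *: pi (x i)^† s.
have MJ : Num.conj (M%:C^-1) = M%:C^-1 :> R[i] by rewrite -fmorphV conjC_real.
have -> : M%:C *: (\sum_i (Y i)^† ∙ Y i) - s^† ∙ s =
  M%:C *: (\sum_i (V i)^† ∙ V i) + M^-1%:C *: (M%:C *: (s^† ∙ s) - s^† ∙ pi h s); last first.
  apply: posD; apply: posZ; rewrite ?invr_ge0 ?(ltW M0) //.
    by apply: pos_sum => i _; apply: pos_star_mul.
  exact: act_gap.
have -> : \sum_i (V i)^† ∙ V i = \sum_i (Y i)^† ∙ Y i - M%:C^-1 *: (s^† ∙ s)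
    - M%:C^-1 *: (s^† ∙ s) + M%:C^-2 *: (s^† ∙ pi h s).
  have e1 s' : \sum_i (pi (x i)^† s')^† ∙ Y i = s'^† ∙ s.
    by rewrite /s cmul_sumr; apply: eq_bigr => i _; rewrite act_adj cstarK.
  have e2 s' : \sum_i (Y i)^† ∙ pi (x i)^† s' = s^† ∙ s'.
    by rewrite /s cstar_sum cmul_suml; apply: eq_bigr => i _; rewrite act_adj.
  have e3 : \sum_i (pi (x i)^† s)^† ∙ pi (x i)^† s = s^† ∙ pi h s.
    rewrite act_suml cmul_sumr; apply: eq_bigr => i _.
    by rewrite act_adj cstarK actM.
  rewrite -{1}e1 -{1}e2 -e3 !scaler_sumr -!sumrB -big_split /=; apply: eq_bigr => i _.
  rewrite /V cstarB cstarZ MJ expr2 invfM; move: (pi _ _) => p; nc_ring.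
rewrite fmorphV; move: (\sum_i _) => y; move: (pi h s) => p; nc_ring.
Qed.

End Actions.

Lemma left_mul_action (R : realType) (A : cstarType R) : action (@cmul R A).
Proof.
split=> [k a b Y|a b Y|a X Y]; first by rewrite cmulDl cmulZl.
  by rewrite cmulA.
by rewrite cstarM cmulA.
Qed.

(** * Semi-inner products *)

Section Resolvent.
Variables (R : realType) (A : cstarType R).
Implicit Types (a c q r u x z : A).
Local Notation pos := (@pos_cone R A).

(* [u = c (c + d)^-1] is the fixed point of [u |-> (c + (t - c) u) / (t + d)]
   for [t > |c|]. *)
Lemma resolvent c (d : R) : pos c -> 0 < d -> exists u,
  [/\ pos u, u ∙ c = c ∙ u & c ∙ u + d%:C *: u = c].
Proof.
move=> pc d0; pose t := nm c; have t0 : 0 <= t := nm_ge0 c.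
have td : 0 < t + d by rewrite ltr_wpDl.
have tdC : (t + d)%:C != 0 :> R[i] by rewrite -(rmorph0 (real_complex R)) (inj_eq (@complexI _)) gt_eqF.
pose F x := (t + d)^-1%:C *: (c + (t%:C *: x - c ∙ x)).
pose u n := iter n F 0.
have uS n : u n.+1 = F (u n) by [].
have ti : 0 <= (t + d)^-1 by rewrite invr_ge0 ltW.
have [hc _] := cpos_bound (iffLR (pos_cposE c) pc) (lexx t).
have cu n : u n ∙ c = c ∙ u n.
  elim: n => [|n IH]; first by rewrite cmul0l cmul0r.
  rewrite uS /F cmulZl cmulZr; congr (_ *: _).
  have -> : (c + (t%:C *: u n - c ∙ u n)) ∙ c = c ∙ c + (t%:C *: (u n ∙ c) - c ∙ (u n ∙ c)) by nc_ring.
  by rewrite IH; nc_ring.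
have pu n : pos (u n).
  elim: n => [|n IH]; first exact: pos0.
  rewrite uS; apply: posZ => //; apply: posD => //.
  have [k [sk pk kk ck]] := pos_sqrt IH.
  have -> : t%:C *: u n - c ∙ u n = t%:C *: (k^† ∙ k) - k^† ∙ c ∙ k.
    by rewrite sk kk (ck c (cu n)) -cmulA kk.
  by apply: pos_gap; [apply: pos_sa |].
have [|||v uv] := @scvg_geom _ _ u (nm (u 1%N)) (t / (t + d)); last 1 first.
- have pv := pos_scvg pu uv; exists v; split=> //; first exact: scvg_comm uv cu.
  have e : F v = v.
    apply: (scvg_uniq _ (scvg_shift 1 uv)) => e e0.
    have h : scvg (fun n => F (u n)) (F v).
      apply: scvgZ; apply: scvgD; first exact: scvg_cst.
      have h := scvgD (scvgZ t%:C uv) (scvgZ (-1) (scvgMr c uv)).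
      by move=> d' /h[N HN]; exists N => n /HN; rewrite !scaleN1r.
    by have [N HN] := h e e0; exists N => n Nn; rewrite addn1; apply: HN.
  have : (t + d)%:C *: v = c + (t%:C *: v - c ∙ v).
    by rewrite -[in LHS]e /F scalerA fmorphV divff // scale1r.
  rewrite rmorphD /= scalerDl => h.
  have -> : d%:C *: v = t%:C *: v + d%:C *: v - t%:C *: v by rewrite addrC addKr.
  rewrite h; nc_ring.
- by apply/andP; split; [exact: divr_ge0 (ltW td) | rewrite ltr_pdivrMr // mul1r ltrDl].
- exact: nm_ge0.
have u0 : u 0%N = 0 by [].
elim=> [|n IH]; first by rewrite u0 subr0 expr0 mulr1 lexx.
have -> : u n.+2 - u n.+1 = F (u n.+1) - F (u n) by [].
rewrite /F -scalerBr (nmZp _ ti).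
have -> : c + (t%:C *: u n.+1 - c ∙ u n.+1) - (c + (t%:C *: u n - c ∙ u n)) =
  t%:C *: (u n.+1 - u n) - c ∙ (u n.+1 - u n) by nc_ring.
have -> : nm (u 1%N) * (t / (t + d)) ^+ n.+1 = (t + d)^-1 * (t * (nm (u 1%N) * (t / (t + d)) ^+ n)).
  by rewrite exprS; ring.
rewrite ler_wpM2l //.
by apply: le_trans (hc _) _; rewrite ler_wpM2l.
Qed.

(** If q^† q <= c + r with r small, then q u is close to q and satisfies (q u)^† (q u) <= c for u =
    c (c + d)^-1: compression by u sends c + d below c, and compression by 1 - u sends it below d.
    It is the approximation step of [combes]. *)
Lemma pos_regularize c q r (d : R) : 0 < d -> pos c -> r^† = r -> nm r <= d ->
  pos (c + r - q^† ∙ q) -> exists u,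
  [/\ u^† = u, pos (c - (q ∙ u)^† ∙ (q ∙ u)) & nm (q - q ∙ u) ^+ 2 <= d].
Proof.
move=> d0 pc sr rd pz; have [u [pu cu e]] := resolvent pc d0.
have su := pos_sa pu; exists u; split=> //.
  have -> : c - (q ∙ u)^† ∙ (q ∙ u) = d%:C *: u + (d%:C *: (u^† ∙ u) - u^† ∙ r ∙ u)
      + u^† ∙ (c + r - q^† ∙ q) ∙ u.
    rewrite cstarM su -{1}e; have -> : d%:C *: (u ∙ u) = u ∙ c - u ∙ (c ∙ u).
      by rewrite -[in u ∙ c]e; nc_ring.
    by rewrite cu; nc_ring.
  apply: posD; last exact: pos_conj.
  by apply: posD; [apply: posZ => //; apply: ltW | apply: pos_gap].
apply: nm_le_gap => [|x]; first exact: ltW.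
pose y := x - u ∙ x.
have -> : d%:C *: (x^† ∙ x) - x^† ∙ ((q - q ∙ u)^† ∙ (q - q ∙ u)) ∙ x =
   d%:C *: (x^† ∙ u ∙ x) + (d%:C *: (y^† ∙ y) - y^† ∙ r ∙ y) + y^† ∙ (c + r - q^† ∙ q) ∙ y.
  have h : c ∙ y = d%:C *: (u ∙ x).
    by rewrite /y cmulBr -[in c ∙ x]e; nc_ring.
  have -> : y^† ∙ (c + r - q^† ∙ q) ∙ y = y^† ∙ (c ∙ y) + y^† ∙ ((r - q^† ∙ q) ∙ y) by nc_ring.
  by rewrite h /y !(cstarB, cstarM) su; nc_ring.
apply: posD; last exact: pos_conj.
apply: posD; last exact: pos_gap.
by apply: posZ; [apply: ltW | apply: pos_conj].
Qed.

End Resolvent.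

(** Stated for numbers, so that it applies both to semi-inner products and to forms on formal sums,
    which do not live on a vector space. *)
Lemma quadratic_CS (R : realType) (a b : R) (z : R[i]) : 0 <= a -> 0 <= b ->
  (forall l : R[i], 0 <= (a ^+ 2)%:C + Num.conj l * z + l * Num.conj z +
     l * Num.conj l * (b ^+ 2)%:C) -> nmc z <= a * b.
Proof.
move=> a0 b0 h; set c := nmc z; have c0 : 0 <= c := nmc_ge0 _.
have key t : 0 <= a ^+ 2 - 2 * t * c ^+ 2 + t ^+ 2 * c ^+ 2 * b ^+ 2.
  rewrite -ler0c; have := h (- (t%:C * z)); congr (0 <= _).
  have c2 : c%:C ^+ 2 = z * Num.conj z by rewrite nmc_sqr rmorphXn.
  have lJ : Num.conj (- (t%:C * z)) = - (t%:C * Num.conj z) by rewrite rmorphN rmorphM /= conjC_real.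
  rewrite lJ !rmorphD rmorphN /= !(rmorphM, rmorphXn) /= -?expr2 c2 rmorph_nat.
  by move: (Num.conj z) (a%:C) (b%:C) (t%:C) => w a' b' t'; ring.
rewrite -(@ler_pXn2r _ 2) ?nnegrE ?mulr_ge0 // exprMn.
move: (a ^+ 2) (b ^+ 2) (exprn_ge0 2 a0) (exprn_ge0 2 b0) key => {h a0 b0}{}a {}b a0 b0' key.
have [b0|b0] := ltrP 0 b.
  have := key b^-1; rewrite exprVn => h; rewrite -ler_pdivrMr //; move: h.
  have -> : a - 2 * b^-1 * c ^+ 2 + b ^- 2 * c ^+ 2 * b = a - c ^+ 2 / b by (field; rewrite gt_eqF).
  by rewrite subr_ge0.
have {b0} b0 : b = 0 by apply/eqP; rewrite eq_le b0.
rewrite b0 mulr0 leNgt; apply/negP => c2.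
have := key ((a + 1) / (2 * c ^+ 2)); rewrite b0 mulr0 addr0.
have -> : 2 * ((a + 1) / (2 * c ^+ 2)) * c ^+ 2 = a + 1 by field; rewrite -sqrf_eq0 gt_eqF.
lra.
Qed.

Section SemiInner.
Variables (R : realType) (V : lmodType R[i]).

(** A possibly degenerate form with a domain. GNS spaces are handled through it, without quotient or
    completion. *)
Record semi_inner (N : set V) (ip : V -> V -> R[i]) : Prop := SemiInner {
  si_N0 : N 0 ;
  si_NP : forall k x y, N x -> N y -> N (k *: x + y) ;
  si_P : forall k x y z, N x -> N y -> N z -> ip (k *: x + y) z = k * ip x z + ip y z ;
  si_conj : forall x y, N x -> N y -> ip y x = Num.conj (ip x y) ;
  si_ge0 : forall x, N x -> 0 <= ip x x
}.

Variables (N : set V) (ip : V -> V -> R[i]).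
Hypothesis H : semi_inner N ip.
Implicit Types (x y z : V) (k : R[i]).

Definition sn x : R := Num.sqrt (complex.Re (ip x x)).

Lemma siND x y : N x -> N y -> N (x + y).
Proof. by move=> Nx Ny; rewrite -[x]scale1r; apply: (si_NP H). Qed.
Lemma siNZ k x : N x -> N (k *: x).
Proof. by move=> Nx; rewrite -[k *: x]addr0; apply: (si_NP H) => //; exact: si_N0 H. Qed.
Lemma siNB x y : N x -> N y -> N (x - y).
Proof. by move=> Nx Ny; rewrite addrC -scaleN1r; apply: (si_NP H). Qed.
Lemma siN_sum (I : Type) (r : seq I) (P : pred I) (F : I -> V) :
  (forall i, P i -> N (F i)) -> N (\sum_(i <- r | P i) F i).
Proof. by move=> h; elim/big_ind: _ => //; [exact: si_N0 H | exact: siND]. Qed.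

Lemma siD x y z : N x -> N y -> N z -> ip (x + y) z = ip x z + ip y z.
Proof. by move=> Nx Ny Nz; rewrite -{1}[x]scale1r (si_P H) // mul1r. Qed.
Lemma si0l z : N z -> ip 0 z = 0.
Proof.
move=> Nz; have N0 := si_N0 H; apply: (addrI (ip 0 z)).
by rewrite -siD // !addr0.
Qed.
Lemma siZ k x z : N x -> N z -> ip (k *: x) z = k * ip x z.
Proof.
by move=> Nx Nz; rewrite -{1}[k *: x]addr0 (si_P H) ?si0l ?addr0 //; exact: si_N0 H.
Qed.
Lemma siB x y z : N x -> N y -> N z -> ip (x - y) z = ip x z - ip y z.
Proof. by move=> Nx Ny Nz; rewrite addrC -scaleN1r (si_P H) // mulN1r addrC. Qed.
Lemma si_suml (I : Type) (r : seq I) (P : pred I) (F : I -> V) z :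
  (forall i, P i -> N (F i)) -> N z ->
  ip (\sum_(i <- r | P i) F i) z = \sum_(i <- r | P i) ip (F i) z.
Proof.
move=> h Nz; suff [] : N (\sum_(i <- r | P i) F i) /\
  ip (\sum_(i <- r | P i) F i) z = \sum_(i <- r | P i) ip (F i) z by [].
elim/big_rec2: _ => [|i y1 y2 Pi [Ny1 e]]; first by split; [exact: si_N0 H | exact: si0l].
have NF := h i Pi; split; first exact: siND.
by rewrite siD // e.
Qed.
Lemma siDr x y z : N x -> N y -> N z -> ip z (x + y) = ip z x + ip z y.
Proof.
move=> Nx Ny Nz; rewrite (si_conj H (siND Nx Ny) Nz) siD // rmorphD.
by rewrite (si_conj H Nx Nz) (si_conj H Ny Nz).
Qed.
Lemma siZr k x z : N x -> N z -> ip z (k *: x) = Num.conj k * ip z x.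
Proof. by move=> Nx Nz; rewrite (si_conj H (siNZ k Nx) Nz) siZ // rmorphM (si_conj H Nx Nz). Qed.
Lemma si_sumr (I : Type) (r : seq I) (P : pred I) (F : I -> V) z :
  (forall i, P i -> N (F i)) -> N z ->
  ip z (\sum_(i <- r | P i) F i) = \sum_(i <- r | P i) ip z (F i).
Proof.
move=> h Nz; rewrite (si_conj H (siN_sum r h) Nz) si_suml // rmorph_sum.
by apply: eq_bigr => i Pi; rewrite [RHS](si_conj H (h i Pi) Nz).
Qed.

Lemma sn_ge0 x : 0 <= sn x. Proof. exact: sqrtr_ge0. Qed.
Lemma sn2 x : N x -> ip x x = (sn x ^+ 2)%:C.
Proof.
move=> Nx; have h := si_ge0 H Nx.
rewrite /sn sqr_sqrtr ?RRe_real ?ger0_real //.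
by rewrite -ler0c RRe_real ?ger0_real.
Qed.
Lemma sn2E x : N x -> sn x ^+ 2 = complex.Re (ip x x).
Proof. by move=> Nx; rewrite sn2. Qed.

Lemma si_CS x y : N x -> N y -> nmc (ip x y) <= sn x * sn y.
Proof.
move=> Nx Ny; apply: quadratic_CS; rewrite ?sn_ge0 // => l.
have NZ := siNZ l Ny; have Nl : N (x + l *: y) by apply: siND.
have := si_ge0 H Nl; rewrite siD // !siDr // siZr // siZ // siZr // siZ // !sn2 //.
by rewrite (si_conj H Nx Ny) !addrA mulrA [Num.conj l * l]mulrC.
Qed.

Lemma snZ k x : N x -> sn (k *: x) = nmc k * sn x.
Proof.
move=> Nx; apply/eqP; rewrite -(@eqrXn2 _ 2) ?mulr_ge0 ?sn_ge0 ?nmc_ge0 //.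
have NZ := siNZ k Nx.
rewrite exprMn; apply/eqP/complexI; rewrite -(sn2 NZ) [RHS]rmorphM /= -(sn2 Nx).
rewrite siZ // siZr //.
by rewrite mulrA nmc_sqr.
Qed.
Lemma snN x : N x -> sn (- x) = sn x.
Proof. by move=> Nx; rewrite -scaleN1r snZ // /nmc normrN1 mul1r. Qed.
Lemma sn0 : sn 0 = 0.
Proof. by rewrite /sn si0l ?sqrtr0 //; exact: si_N0 H. Qed.

Lemma snD x y : N x -> N y -> sn (x + y) <= sn x + sn y.
Proof.
move=> Nx Ny; have Nxy := siND Nx Ny.
rewrite -(@ler_pXn2r _ 2) ?nnegrE ?addr_ge0 ?sn_ge0 //.
rewrite -lecR -sn2 // siD // !siDr // !sn2 // (si_conj H Nx Ny).
have h : ip x y + Num.conj (ip x y) <= (2 * (sn x * sn y))%:C.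
  rewrite -[Num.conj _]/((ip x y)^*%C) addcJ rmorphM rmorph_nat ler_pM2l ?ltr0n // lecR.
  apply: le_trans (si_CS Nx Ny); rewrite -lecR -nmcE.
  by apply: le_trans (normc_ge_Re _); rewrite lecR ler_norm.
have -> : (sn x ^+ 2)%:C + ip x y + (Num.conj (ip x y) + (sn y ^+ 2)%:C) =
   (sn x ^+ 2)%:C + (ip x y + Num.conj (ip x y)) + (sn y ^+ 2)%:C by ring.
have -> : (sn x + sn y) ^+ 2 = sn x ^+ 2 + 2 * (sn x * sn y) + sn y ^+ 2 by ring.
rewrite [leRHS]rmorphD [X in _ <= X + _]rmorphD lerD2r lerD2l; exact: h.
Qed.

Lemma sn_sum (I : Type) (r : seq I) (F : I -> V) : (forall i, N (F i)) ->
  sn (\sum_(i <- r) F i) <= \sum_(i <- r) sn (F i).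
Proof.
move=> h; elim: r => [|i r IH]; first by rewrite !big_nil sn0.
rewrite !big_cons; apply: le_trans (snD _ _) _ => //; first exact: siN_sum.
by rewrite lerD2l.
Qed.

Lemma snB x y : N x -> N y -> sn (x - y) <= sn x + sn y.
Proof.
move=> Nx Ny; rewrite -(snN Ny); apply: snD => //.
by rewrite -scaleN1r; apply: siNZ.
Qed.

Lemma si_ip0 x y : N x -> N y -> sn x = 0 -> ip x y = 0.
Proof.
move=> Nx Ny x0; apply/eqP; rewrite -normr_eq0 nmcE.
have := si_CS Nx Ny; rewrite x0 mul0r => h.
by have -> : nmc (ip x y) = 0 by apply/eqP; rewrite eq_le h nmc_ge0.
Qed.

(** Only the first [n] members are orthonormal; a total sequence avoids dependent indices when [n]
    varies. *)
Definition on_family n (e : nat -> V) := (forall i, N (e i)) /\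
  forall i j, (i < n)%N -> (j < n)%N -> ip (e i) (e j) = (i == j)%:R.

Definition on_proj n (e : nat -> V) x := \sum_(j < n) ip x (e j) *: e j.

Lemma proj_N n e x : on_family n e -> N (on_proj n e x).
Proof. by move=> [Ne _]; apply: siN_sum => j _; apply: siNZ. Qed.

Lemma on_comb n e (k : nat -> R[i]) i : on_family n e -> (i < n)%N ->
  ip (\sum_(j < n) k j *: e j) (e i) = k i.
Proof.
move=> [Ne on] iN; rewrite si_suml //; last by move=> j _; apply: siNZ.
rewrite (bigD1 (Ordinal iN)) //= siZ // on // eqxx mulr1 big1 ?addr0 // => j ji.
by rewrite siZ // on //; move: ji; rewrite -val_eqE /= => /negbTE ->; rewrite mulr0.
Qed.

Lemma proj_orth n e x i : on_family n e -> N x -> (i < n)%N ->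
  ip (x - on_proj n e x) (e i) = 0.
Proof.
move=> on Nx iN; have [Ne _] := on; rewrite siB //; last exact: proj_N.
by rewrite (on_comb (fun j => ip x (e j))) // subrr.
Qed.

(** Vectors whose remainder has seminorm 0 are skipped, so n may be smaller than m and the v i are
    recovered only up to seminorm 0. *)
Lemma gram_schmidt m (v : nat -> V) : (forall i, N (v i)) -> exists n e,
  on_family n e /\ forall i, (i < m)%N -> sn (v i - on_proj n e (v i)) = 0.
Proof.
move=> Nv; elim: m => [|m [n [e [on h]]]].
  by exists 0%N, v; split=> //; split.
have [Ne oe] := on; pose w := v m - on_proj n e (v m).
have Nw : N w by apply: siNB => //; apply: proj_N.
have [w0|w0] := eqVneq (sn w) 0.
  exists n, e; split=> // i; rewrite ltnS leq_eqVlt => /orP[/eqP -> //|]; exact: h.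
pose f := (sn w)^-1%:C *: w; pose e' i := if i == n then f else e i.
have Nf : N f by apply: siNZ.
have e'n i : (i < n)%N -> e' i = e i by rewrite /e' => /ltn_eqF ->.
have fe i : (i < n)%N -> ip f (e i) = 0 by move=> iN; rewrite siZ // proj_orth // mulr0.
have on' : on_family n.+1 e'.
  split=> [i|i j]; first by rewrite /e'; case: ifP.
  rewrite (ltnS i) (ltnS j) (leq_eqVlt i) (leq_eqVlt j) => /orP[/eqP ->|iN] /orP[/eqP ->|jN].
  - rewrite /e' eqxx siZ ?siZr // sn2 // conjC_real -!rmorphM /=.
    by rewrite (_ : _ * (_ * _) = 1) ?rmorph1 //; field.
  - by rewrite (e'n j jN) gtn_eqF // /e' eqxx fe.
  - by rewrite (e'n i iN) ltn_eqF // /e' eqxx (si_conj H Nf (Ne i)) fe // rmorph0.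
  by rewrite !e'n // oe.
have pE x : on_proj n.+1 e' x = on_proj n e x + ip x f *: f.
  rewrite /on_proj big_ord_recr /=; congr (_ + _); last by rewrite /e' eqxx.
  by apply: eq_bigr => j _; rewrite e'n.
exists n.+1, e'; split=> // i; rewrite ltnS leq_eqVlt => /orP[/eqP ->|iN]; rewrite pE opprD addrA -/w.
  have -> : ip (v m) f = (sn w)%:C.
    have Np := proj_N (v m) on.
    rewrite -[v m](subrK (on_proj n e (v m))) -/w siD // siZr // sn2 // conjC_real.
    have -> : ip (on_proj n e (v m)) f = 0.
      rewrite si_suml //; last by move=> j _; apply: siNZ.
      by apply: big1 => j _; rewrite siZ // (si_conj H Nf (Ne j)) fe // rmorph0 mulr0.
    by rewrite addr0 -rmorphM /= expr2 mulKf.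
  by rewrite /f scalerA -rmorphM mulfV // rmorph1 scale1r subrr sn0.
have Ni : N (v i - on_proj n e (v i)) by apply: siNB => //; apply: proj_N.
have -> : ip (v i) f = 0.
  have Np := proj_N (v i) on.
  rewrite -[v i](subrK (on_proj n e (v i))) siD // si_ip0 ?h // add0r.
  rewrite si_suml //; last by move=> j _; apply: siNZ.
  by apply: big1 => j _; rewrite siZ // (si_conj H Nf (Ne j)) fe // rmorph0 mulr0.
by rewrite scale0r subr0 h.
Qed.

End SemiInner.

(** * Weights *)

Section WeightExtension.
Variables (R : realType) (A : cstarType R) (eta : A -> \bar R).
Hypothesis wt : weight eta.
Implicit Types (a b c p q x y z : A) (t r : R).
Local Notation pos := (@pos_cone R _).

Definition wfin p := pos p /\ (eta p < +oo)%E.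
Definition wval p : R := fine (eta p).

Lemma wfinE p : wfin p -> eta p = (wval p)%:E.
Proof.
move=> [pp fp]; have [ge0 _ _] := wt; rewrite /wval fineK // ge0_fin_numE //; exact: ge0.
Qed.
Lemma wval_ge0 p : pos p -> 0 <= wval p.
Proof. by move=> pp; have [ge0 _ _] := wt; apply: fine_ge0; apply: ge0. Qed.
Lemma wfinD p q : wfin p -> wfin q -> wfin (p + q) /\ wval (p + q) = wval p + wval q.
Proof.
move=> fp fq; have [_ D _] := wt.
have e : eta (p + q) = (wval p + wval q)%:E.
  by rewrite D ?EFinD ?(wfinE fp) ?(wfinE fq) //; [case: fp | case: fq].
split; last by rewrite {1}/wval e.
by split; [apply: posD; [case: fp | case: fq] | rewrite e ltry].
Qed.
Lemma wfinZ t p : 0 <= t -> wfin p -> wfin (t%:C *: p) /\ wval (t%:C *: p) = t * wval p.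
Proof.
move=> t0 fp; have [_ _ Z] := wt.
have e : eta (t%:C *: p) = (t * wval p)%:E.
  by rewrite Z // ?EFinM ?(wfinE fp) //; case: fp.
split; last by rewrite {1}/wval e.
by split; [apply: posZ => //; case: fp | rewrite e ltry].
Qed.
Lemma wfin0 : wfin 0 /\ wval 0 = 0.
Proof.
have [_ _ Z] := wt; have e : eta 0 = 0%E.
  have := Z 0 0 (lexx 0) (@pos0 R A); by rewrite scaler0 mul0e.
by split; [split; [exact: pos0 | rewrite e ltry] | rewrite /wval e].
Qed.
Lemma wfin_le x y : wfin y -> pos x -> pos (y - x) -> wfin x /\ wval x <= wval y.
Proof.
move=> fy px pyx; have [ge0 D _] := wt.
have e : eta y = (eta x + eta (y - x)%R)%E by rewrite -D // [(x + _)%R]addrC subrK.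
have fx : wfin x.
  by split=> //; apply: le_lt_trans (fy.2); rewrite e leeDl //; apply: ge0.
have fyx : wfin (y - x).
  by split=> //; apply: le_lt_trans (fy.2); rewrite e leeDr //; apply: ge0.
split=> //; have [_] := wfinD fx fyx; rewrite [x + _]addrC subrK => ->.
by rewrite lerDl wval_ge0.
Qed.

(* The linear extension of [eta] to the span of its finite positive elements. *)
Definition wdec x (v : R[i]) := exists p1 p2 p3 p4,
  [/\ [/\ wfin p1, wfin p2, wfin p3 & wfin p4], x = (p1 - p2) + 'i%R *: (p3 - p4)
    & v = (wval p1 - wval p2)%:C + 'i%R * (wval p3 - wval p4)%:C].
Definition wdom x := exists v, wdec x v.
Definition wbar x : R[i] := xget 0 (wdec x).

Lemma wdec_uniq x v w : wdec x v -> wdec x w -> v = w.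
Proof.
have main p1 p2 q1 q2 : wfin p1 -> wfin p2 -> wfin q1 -> wfin q2 ->
    p1 - p2 = q1 - q2 -> wval p1 - wval p2 = wval q1 - wval q2.
  move=> f1 f2 g1 g2 e; have h : p1 + q2 = q1 + p2.
    by rewrite -[p1](subrK p2) e addrAC subrK.
  have [_ h1] := wfinD f1 g2; have [_ h2] := wfinD g1 f2.
  by move: h1; rewrite h h2; lra.
move=> [p1 [p2 [p3 [p4 [[f1 f2 f3 f4] -> ->]]]]] [q1 [q2 [q3 [q4 [[g1 g2 g3 g4] e ->]]]]].
have sa p q p' q' : wfin p -> wfin q -> wfin p' -> wfin q' ->
    (p - q + 'i%R *: (p' - q'))^† = p - q - 'i%R *: (p' - q').
  move=> [a _] [b _] [c _] [d _].
  by rewrite cstarD cstarZ conjCi !cstarB !pos_sa // scaleNr.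
have e' := congr1 (@cstar R A) e; rewrite !sa // in e'.
have two (a b a' b' : A) : a + b = a' + b' -> a - b = a' - b' -> a = a' /\ b = b'.
  move=> h1 h2; split.
    have -> : a = 2^-1 *: ((a + b) + (a - b)) by nc_ring_with R A.
    by rewrite h1 h2; nc_ring_with R A.
  have -> : b = 2^-1 *: ((a + b) - (a - b)) by nc_ring_with R A.
  by rewrite h1 h2; nc_ring_with R A.
have [e1 /(scalerI (neq0Ci _)) e2] := two _ _ _ _ e e'.
by rewrite (main p1 p2 q1 q2) // (main p3 p4 q3 q4).
Qed.

Lemma wbarE x v : wdec x v -> wbar x = v.
Proof. by move=> h; apply: wdec_uniq (h); rewrite /wbar; apply: xgetPex; exists v. Qed.
Lemma wdomE x : wdom x -> wdec x (wbar x).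
Proof. by move=> [v h]; rewrite (wbarE h). Qed.

Lemma wdec_pos p : wfin p -> wdec p (wval p)%:C.
Proof.
move=> fp; have [f0 v0] := wfin0; exists p, 0, 0, 0; split=> //.
  by rewrite !subr0 scaler0 addr0.
by rewrite v0 !subr0 rmorph0 mulr0 addr0.
Qed.
Lemma wdecD x y v w : wdec x v -> wdec y w -> wdec (x + y) (v + w).
Proof.
move=> [p1 [p2 [p3 [p4 [[f1 f2 f3 f4] -> ->]]]]] [q1 [q2 [q3 [q4 [[g1 g2 g3 g4] -> ->]]]]].
have [h1 e1] := wfinD f1 g1; have [h2 e2] := wfinD f2 g2.
have [h3 e3] := wfinD f3 g3; have [h4 e4] := wfinD f4 g4.
exists (p1 + q1), (p2 + q2), (p3 + q3), (p4 + q4); split=> //.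
  by nc_ring_with R A.
by rewrite e1 e2 e3 e4 !(rmorphB, rmorphD) /=; ring.
Qed.
Lemma wdecZp t x v : 0 <= t -> wdec x v -> wdec (t%:C *: x) (t%:C * v).
Proof.
move=> t0 [p1 [p2 [p3 [p4 [[f1 f2 f3 f4] -> ->]]]]].
have [h1 e1] := wfinZ t0 f1; have [h2 e2] := wfinZ t0 f2.
have [h3 e3] := wfinZ t0 f3; have [h4 e4] := wfinZ t0 f4.
exists (t%:C *: p1), (t%:C *: p2), (t%:C *: p3), (t%:C *: p4); split=> //.
  by nc_ring_with R A.
by rewrite e1 e2 e3 e4 !(rmorphB, rmorphM) /=; ring.
Qed.
Lemma wdecN x v : wdec x v -> wdec (- x) (- v).
Proof.
move=> [p1 [p2 [p3 [p4 [[f1 f2 f3 f4] -> ->]]]]].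
exists p2, p1, p4, p3; split=> //; first by nc_ring_with R A.
by rewrite !rmorphB /=; ring.
Qed.
Lemma wdec_i x v : wdec x v -> wdec ('i%R *: x) ('i%R * v).
Proof.
move=> [p1 [p2 [p3 [p4 [[f1 f2 f3 f4] -> ->]]]]].
exists p4, p3, p1, p2; split=> //.
  by rewrite scalerDr scalerA -expr2 sqrCi scaleN1r opprB addrC.
by rewrite mulrDr mulrA -expr2 sqrCi mulN1r -rmorphN opprB addrC.
Qed.
Lemma wdecZ k x v : wdec x v -> wdec (k *: x) (k * v).
Proof.
move=> h; have real t : wdec (t%:C *: x) (t%:C * v).
  have [t0|t0] := leP 0 t; first exact: wdecZp.
  have nt : 0 <= - t by rewrite oppr_ge0 ltW.
  by have := wdecN (wdecZp nt h); rewrite !rmorphN scaleNr mulNr !opprK.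
rewrite (complex_split k) scalerDl mulrDl -scalerA -mulrA.
by apply: wdecD => //; apply: wdec_i.
Qed.
Lemma wdec_star x v : wdec x v -> wdec x^† (Num.conj v).
Proof.
move=> [p1 [p2 [p3 [p4 [[f1 f2 f3 f4] -> ->]]]]].
exists p1, p2, p4, p3; split=> //.
  have [a1 _] := f1; have [a2 _] := f2; have [a3 _] := f3; have [a4 _] := f4.
  by rewrite cstarD cstarZ conjCi !cstarB !pos_sa // scaleNr -scalerN opprB.
by rewrite rmorphD rmorphM /= conjCi !conjC_real mulNr -mulrN -rmorphN opprB.
Qed.

Lemma wbarD x y : wdom x -> wdom y -> wbar (x + y) = wbar x + wbar y.
Proof. by move=> /wdomE h /wdomE k; apply: wbarE; apply: wdecD. Qed.
Lemma wdomD x y : wdom x -> wdom y -> wdom (x + y).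
Proof. by move=> /wdomE h /wdomE k; eexists; apply: wdecD h k. Qed.
Lemma wbarZ k x : wdom x -> wbar (k *: x) = k * wbar x.
Proof. by move=> /wdomE h; apply: wbarE; apply: wdecZ. Qed.
Lemma wdomZ k x : wdom x -> wdom (k *: x).
Proof. by move=> /wdomE h; eexists; apply: wdecZ h. Qed.
Lemma wbar_star x : wdom x -> wbar x^† = Num.conj (wbar x).
Proof. by move=> /wdomE h; apply: wbarE; apply: wdec_star. Qed.
Lemma wbar_pos p : wfin p -> wbar p = (wval p)%:C.
Proof. by move=> h; apply: wbarE; apply: wdec_pos. Qed.
Lemma wdom_pos p : wfin p -> wdom p.
Proof. by move=> h; eexists; apply: wdec_pos h. Qed.

End WeightExtension.

Definition positive_map (R : realType) (T A : cstarType R) (S : T -> A) :=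
  [/\ bounded_linear S, forall Z, pos_cone (S (Z^† ∙ Z)) & forall Z, S Z^† = (S Z)^†].

Section WeightForms.
Variables (R : realType) (T A : cstarType R) (eta : A -> \bar R) (S : T -> A).
Hypothesis wt : weight eta.
Hypothesis pS : positive_map S.
Implicit Types (X Y Z W : T).

(** For S = id this is the GNS domain of eta. For S = id ⊗ f it plays the role of the domain of eta
    ⊗ f, and [wip] that of its inner product. *)
Definition wN : set T := [set Z | wfin eta (S (Z^† ∙ Z))].
Definition wip Z W : R[i] := wbar eta (S (W^† ∙ Z)).

Let bS : bounded_linear S. Proof. by case: pS. Qed.

Lemma pmap_pos Z : pos_cone Z -> pos_cone (S Z).
Proof. by move=> [W ->]; have [_ h _] := pS. Qed.

Lemma wN_gap Z W (M : R) : 0 <= M -> wN Z -> pos_cone (M%:C *: (Z^† ∙ Z) - W^† ∙ W) ->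
  wN W /\ wval eta (S (W^† ∙ W)) <= M * wval eta (S (Z^† ∙ Z)).
Proof.
move=> M0 NZ h; have [fM <-] := wfinZ wt M0 NZ.
apply: wfin_le => //; first by apply: pmap_pos; apply: pos_star_mul.
by rewrite -(blZ bS) -(blB bS); apply: pmap_pos.
Qed.

Lemma polarization Z W : W^† ∙ Z = (4^-1)%:C *: ((Z + W)^† ∙ (Z + W) - (Z - W)^† ∙ (Z - W)
   + 'i%R *: ((Z + 'i%R *: W)^† ∙ (Z + 'i%R *: W) - (Z - 'i%R *: W)^† ∙ (Z - 'i%R *: W))).
Proof.
have -> : (Z + 'i%R *: W)^† ∙ (Z + 'i%R *: W) - (Z - 'i%R *: W)^† ∙ (Z - 'i%R *: W) =
    'i%R *: (Z^† ∙ W + Z^† ∙ W - W^† ∙ Z - W^† ∙ Z).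
  by rewrite !(cstarD, cstarN) cstarZ conjCi; nc_ring.
rewrite scalerA -expr2 sqrCi !(cstarD, cstarN) fmorphV rmorph_nat; nc_ring.
Qed.

Lemma wN_comb k Z W : wN Z -> wN W -> wN (k *: Z + W).
Proof.
move=> NZ NW; have M0 : 0 <= nmc k ^+ 2 := exprn_ge0 2 (nmc_ge0 k).
have [f1 _] := wfinZ wt M0 NZ; have [f2 _] := wfinD wt f1 NW.
have [f3 _] := wfinD wt f2 f2.
apply: (wfin_le wt f3 _ _).1; first by apply: pmap_pos; apply: pos_star_mul.
rewrite -!(blZ bS) -!(blD bS) -(blB bS); apply: pmap_pos; exists (k *: Z - W).
rewrite -nmc_sqr !(cstarD, cstarN) cstarZ.
nc_ring.
Qed.

Lemma wN0 : wN 0.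
Proof. by rewrite /wN /= cmul0r (bl0 bS); exact: (wfin0 wt).1. Qed.

Lemma wN_dom Z W : wN Z -> wN W -> wdom eta (S (W^† ∙ Z)).
Proof.
move=> NZ NW; rewrite polarization (blZ bS); apply: wdomZ => //.
have h (k : R[i]) : wdom eta (S ((Z + k *: W)^† ∙ (Z + k *: W))).
  by apply: wdom_pos => //; rewrite addrC; apply: wN_comb.
have h1 := h 1; have h2 := h (-1); have h3 := h 'i%R; have h4 := h (- 'i%R).
rewrite scale1r in h1; rewrite scaleN1r in h2; rewrite scaleNr in h4.
have sub x y : wdom eta x -> wdom eta y -> wdom eta (x - y).
  by move=> hx hy; rewrite -scaleN1r; apply: wdomD => //; apply: wdomZ.
rewrite (blD bS) (blZ bS) !(blB bS); apply: wdomD => //; first exact: sub.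
by apply: wdomZ => //; apply: sub.
Qed.

Lemma wip_semi_inner : semi_inner wN wip.
Proof.
have [_ pp ps] := pS.
split.
- exact: wN0.
- exact: wN_comb.
- move=> k X Y Z NX NY NZ; rewrite /wip cmulDr cmulZr (blP bS).
  rewrite wbarD ?wbarZ //; first exact: wN_dom.
    by apply: wdomZ => //; apply: wN_dom.
  exact: wN_dom.
- move=> X Y NX NY; rewrite /wip -wbar_star //; last exact: wN_dom.
  by rewrite -ps cstarM cstarK.
move=> X NX; rewrite /wip wbar_pos // ler0c.
by apply: wval_ge0 => //; exact: pp.
Qed.

Lemma wsn2 Z : wN Z -> sn wip Z ^+ 2 = wval eta (S (Z^† ∙ Z)).
Proof. by move=> NZ; rewrite (sn2E wip_semi_inner NZ) /wip wbar_pos. Qed.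

End WeightForms.

Section FunctionalForms.
Variables (R : realType) (T : cstarType R) (f : T -> R[i]).
Hypothesis pf : pos_dual f.
Implicit Types (X Y Z W : T).

Let bf : bounded_linear (f : T -> R[i]^o).
Proof. by apply/dualE; case: pf. Qed.

Definition fip Z W : R[i] := f (W^† ∙ Z).

Lemma pos_dual_star Z : f Z^† = Num.conj (f Z).
Proof.
have fr p : pos_cone p -> f p = Num.conj (f p).
  by move=> [b ->]; apply/esym/CrealP/ger0_real; case: pf.
have sa Y : Y^† = Y -> f Y = Num.conj (f Y).
  move=> /cpos_decomp[p [n [/pos_cposE pp /pos_cposE pn -> _ _]]].
  by rewrite (blB bf) rmorphB /= -!fr.
have rsa Y : (re_part Y)^† = re_part Y by rewrite /re_part cstarZr cstarD cstarK addrC.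
rewrite (re_part_split Z); have := rsa Z; have := rsa ('i%R *: Z).
move: (re_part Z) (re_part ('i%R *: Z)) => u v sv su.
have -> : (u - 'i%R *: v)^† = u + 'i%R *: v by rewrite cstarB cstarZ conjCi su sv scaleNr opprK.
rewrite (blD bf) (blB bf) (blZ bf) rmorphB [in RHS]/GRing.scale /= rmorphM /= conjCi.
by rewrite -(sa _ su) -(sa _ sv) mulNr opprK.
Qed.

Lemma fip_semi_inner : semi_inner setT fip.
Proof.
split=> //.
- by move=> k X Y Z _ _ _; rewrite /fip cmulDr cmulZr (blP bf).
- by move=> X Y _ _; rewrite /fip -pos_dual_star cstarM cstarK.
by move=> X _; rewrite /fip; case: pf.
Qed.

Lemma fsn2 Z : (sn fip Z ^+ 2)%:C = f (Z^† ∙ Z).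
Proof. by rewrite -(sn2 fip_semi_inner (I : setT Z)). Qed.

Lemma fpos Z : pos_cone Z -> 0 <= f Z.
Proof. by move=> [b ->]; case: pf. Qed.

End FunctionalForms.

Lemma id_positive (R : realType) (A : cstarType R) : positive_map (@id A).
Proof.
split=> //; last by move=> Z; apply: pos_star_mul.
by split=> //; exists 1 => // x; rewrite mul1r.
Qed.

(** * Lower semicontinuous weights and the bounded functionals below them *)

Section LowerSemicontinuity.
Variables (R : realType) (A : cstarType R) (eta : A -> \bar R).
Hypothesis wt : weight eta.
Hypothesis lsc : forall r : R, closed [set a | pos_cone a /\ (eta a <= r%:E)%E].
Implicit Types (a b c q s x z : A) (d r t : R).
Local Notation pos := (@pos_cone R _).
Local Notation wfin := (wfin eta).
Local Notation wval := (wval eta).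
Local Notation N := (wN eta (@id A)).
Local Notation ip := (wip eta (@id A)).

Let wI := wip_semi_inner wt (@id_positive R A).

Lemma wlsc (u : nat -> A) l r : scvg u l -> (forall n, wfin (u n) /\ wval (u n) <= r) ->
  wfin l /\ wval l <= r.
Proof.
move=> ul h; have [pl el] : pos l /\ (eta l <= r%:E)%E.
  have := closed_scvg (@lsc r) _ ul; apply => n /=; have [fn vn] := h n.
  by split; [case: fn | rewrite (wfinE wt fn) lee_fin].
have fl : wfin l by split=> //; apply: le_lt_trans el (ltry _).
by split=> //; rewrite -lee_fin -(wfinE wt fl).
Qed.

Lemma wN_lsc (u : nat -> A) l r : scvg u l -> (forall n, N (u n) /\ sn ip (u n) <= r) ->
  N l /\ sn ip l <= r.
Proof.
move=> ul h; have r0 : 0 <= r by apply: le_trans (h 0%N).2; apply: sn_ge0.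
have [||fl vl] := @wlsc (fun n => (u n)^† ∙ u n) (l^† ∙ l) (r ^+ 2).
- by apply: scvgM => //; apply: scvg_star.
- move=> n; have [Nn sn_] := h n; split; first exact: Nn.
  by rewrite -(wsn2 wt (@id_positive R A) Nn) ler_pXn2r ?nnegrE ?sn_ge0.
split; first exact: fl.
rewrite -(@ler_pXn2r _ 2) ?nnegrE ?sn_ge0 //.
by rewrite (wsn2 wt (@id_positive R A) fl).
Qed.

(** A form of dominated convergence: otherwise the elements b - c n, which tend to b, would all have
    value at most wval b - d. *)
Lemma wval_small (c : nat -> A) b d : wfin b -> 0 < d -> scvg c 0 ->
  (forall n, pos (c n)) -> (forall n, pos (b - c n)) -> exists n, wval (c n) < d.
Proof.
move=> fb d0 c0 pc pbc; apply: contrapT => /forallNP h.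
have bc : scvg (fun n => b - c n) b.
  by move=> e /c0[n Hn]; exists n => m /Hn; rewrite subr0 addrAC subrr sub0r nmN.
have [_] : wfin b /\ wval b <= wval b - d; last by lra.
apply: wlsc bc _ => n; have [fc _] := wfin_le wt fb (pc n) (pbc n).
have [|fbc _] := wfin_le wt fb (pbc n); first by rewrite opprB addrC subrK.
split=> //; have [_] := wfinD wt fbc fc; rewrite subrK => ->.
by have /negP := h n; rewrite -leNgt; lra.
Qed.

Lemma lsc_gap q d : wfin (q^† ∙ q) -> 0 < d -> exists2 g, 0 < g & forall u,
  wfin ((q ∙ u)^† ∙ (q ∙ u)) -> nm (q - q ∙ u) < g ->
  wval (q^† ∙ q) - d < wval ((q ∙ u)^† ∙ (q ∙ u)).
Proof.
move=> fq d0; apply: contrapT => H.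
have {}H n : exists u, [/\ wfin ((q ∙ u)^† ∙ (q ∙ u)), nm (q - q ∙ u) < n.+1%:R^-1 &
    wval ((q ∙ u)^† ∙ (q ∙ u)) <= wval (q^† ∙ q) - d].
  apply: contrapT => K; apply: H; exists n.+1%:R^-1; first by rewrite invr_gt0 ltr0n.
  move=> u fu nu; rewrite ltNge; apply/negP => v; apply: K; by exists u.
have /choice[u Hu] := H.
have qu : scvg (fun n => q ∙ u n) q.
  apply: (@scvg_squeeze _ _ _ _ (fun n => n.+1%:R^-1)) => [n|r]; last exact: inv_small.
  by rewrite nmC; case: (Hu n) => _ /ltW.
have [_] : wfin (q^† ∙ q) /\ wval (q^† ∙ q) <= wval (q^† ∙ q) - d; last by lra.
apply: (@wlsc (fun n => (q ∙ u n)^† ∙ (q ∙ u n))).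
  by apply: scvgM => //; apply: scvg_star.
by move=> n; case: (Hu n).
Qed.

(** Combes' theorem. The functional is found below the infimum of wval c + n nm (a - c + s): the
    norm keeps it bounded, c puts it below the weight and s makes it positive. The work lies in
    showing that this infimum at z is at least wval z - d. *)
Theorem combes q d : wfin (q^† ∙ q) -> 0 < d -> exists w, [/\ pos_dual w,
  forall x, wfin x -> w x <= (wval x)%:C & (wval (q^† ∙ q) - d)%:C <= w (q^† ∙ q)].
Proof.
move=> fz d0; set z := q^† ∙ q in fz *.
have [g g0 Hg] := lsc_gap fz d0.
have pz : pos z := pos_star_mul q.
have vz : 0 <= wval z := wval_ge0 wt pz.
(* A competitor with value below wval z - d has a remainder r with n nm r <= wval z, so nm r <= rho
   by the choice of n. [pos_regularize] then moves q by at most g / 2, which is less than g as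
   [lsc_gap] requires. *)
pose rho := (g / 2) ^+ 2; have rho0 : 0 < rho by rewrite exprn_gt0 // divr_gt0.
pose n := wval z / rho + 1; have n0 : 0 < n by rewrite ltr_wpDl // divr_ge0 // ltW.
pose F := [set f : A -> R | exists c s, [/\ wfin c, pos s & f = fun a => wval c + n * nm (a - c + s)]].
have [f00 v00] := wfin0 wt.
have [||||sp pF pl] := @sublinear_inf R A F (fun=> 0).
- by exists (fun a => wval 0 + n * nm (a - 0 + 0)), 0, 0; split=> //; apply: pos0.
- move=> _ x [c [s [[pc _] ps ->]]]; have := wval_ge0 wt pc.
  by have := mulr_ge0 (ltW n0) (nm_ge0 (x - c + s)); lra.
- move=> _ _ x y [c [s [fc ps ->]]] [c' [s' [fc' ps' ->]]].
  have [fcc vcc] := wfinD wt fc fc'.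
  exists (fun a => wval (c + c') + n * nm (a - (c + c') + (s + s'))).
    by exists (c + c'), (s + s'); split=> //; apply: posD.
  rewrite vcc; have -> : x + y - (c + c') + (s + s') = (x - c + s) + (y - c' + s') by nc_ring_with R A.
  have := ler_wpM2l (ltW n0) (nmD (x - c + s) (y - c' + s')); lra.
- move=> _ t x [c [s [fc ps ->]]] t0; have [fc' vc'] := wfinZ wt (ltW t0) fc.
  exists (fun a => wval (t%:C *: c) + n * nm (a - t%:C *: c + t%:C *: s)).
    by exists (t%:C *: c), (t%:C *: s); split=> //; apply: posZ => //; apply: ltW.
  by rewrite vc' -scalerBr -scalerDr nmZp ?(ltW t0) //; lra.
have [w [wD wZ wp wz]] := hahn_banach z sp.
have wF f x : F f -> w x <= f x by move=> Ff; apply: le_trans (wp x) (pF f x Ff).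
have wN' x : w (- x) = - w x by rewrite -scaleN1r -(rmorphN1 (real_complex R)) wZ mulN1r.
have F0 : F (fun a => wval 0 + n * nm (a - 0 + 0)).
  by exists 0, 0; split=> //; apply: pos0.
have wn x : w x <= n * nm x.
  by have := wF _ x F0; rewrite v00 add0r subr0 addr0.
have [f df fw] := complexify (ltW n0) wD wZ wn.
exists f; split.
- split; [exact: df | move=> a; rewrite fw ?ler0c ?(pos_sa (pos_star_mul a)) //].
  have h : F (fun x => wval 0 + n * nm (x - 0 + a^† ∙ a)).
    by exists 0, (a^† ∙ a); split=> //; apply: pos_star_mul.
  by have := wF _ (- (a^† ∙ a)) h; rewrite v00 add0r subr0 addNr nm0 mulr0 wN' oppr_le0.
- move=> x fx; rewrite fw ?lecR; last by apply: pos_sa; case: fx.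
  have h : F (fun a => wval x + n * nm (a - x + 0)) by exists x, 0; split=> //; apply: pos0.
  by have := wF _ x h; rewrite subrr addr0 nm0 mulr0 addr0.
rewrite fw ?lecR; last exact: pos_sa.
rewrite wz; apply: pl => _ [c [s [fc ps ->]]].
rewrite leNgt; apply/negP => lt; have pc : pos c by case: fc.
pose r := z - c + s.
have vc := wval_ge0 wt pc.
have rr : nm r <= rho.
  have : n * nm r <= wval z by move: lt; rewrite -/r; lra.
  rewrite mulrC -ler_pdivlMr // => h; apply: le_trans h _.
  by rewrite ler_pdivrMr // /n mulrDr mulr1 mulrC divfK ?gt_eqF // lerDl ltW.
have sr : r^† = r by rewrite cstarD cstarB !pos_sa.
have [|u [su pu nu]] := @pos_regularize _ _ c q r rho rho0 pc sr rr.
  have -> : c + r - q^† ∙ q = s by rewrite /r /z; nc_ring.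
  exact: ps.
have [fu vu] := wfin_le wt fc (pos_star_mul _) pu.
have gu : nm (q - q ∙ u) < g.
  apply: (@le_lt_trans _ _ (g / 2)); last by lra.
  by rewrite -(@ler_pXn2r _ 2) ?nnegrE ?nm_ge0 // divr_ge0 // ltW.
have := Hg u fu gu; have := mulr_ge0 (ltW n0) (nm_ge0 r); move: lt; rewrite -/r; lra.
Qed.

(** ip - w is again a positive form and is at most ip. Its Cauchy-Schwarz inequality turns the
    single estimate at q, taken with d^2, into a uniform estimate over all b. *)
Lemma combes_ip q d : N q -> 0 < d -> exists w, [/\ pos_dual w,
  forall b, N b -> sn (fip w) b <= sn ip b &
  forall b, N b -> nmc (ip q b - w (b^† ∙ q)) <= d * sn ip b].
Proof.
move=> Nq d0; have [w [pw ww wq]] := combes Nq (exprn_gt0 2 d0).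
have ww' b : N b -> w (b^† ∙ b) <= ip b b by move=> Nb; rewrite /wip wbar_pos //; apply: ww.
have wb b : N b -> sn (fip w) b <= sn ip b.
  move=> Nb; rewrite -(@ler_pXn2r _ 2) ?nnegrE ?sn_ge0 // -lecR (fsn2 pw) -(sn2 wI Nb).
  exact: ww'.
exists w; split=> // b Nb.
pose jp x y := ip x y - w (y^† ∙ x).
have fI := fip_semi_inner pw.
have jI : semi_inner N jp.
  split; [exact: si_N0 wI | exact: si_NP wI | | |].
  - move=> k x y z Nx Ny Nz; rewrite /jp (si_P wI) // -[w (z^† ∙ (k *: x + y))]/(fip w _ _) (si_P fI) //.
    by rewrite /fip; ring.
  - move=> x y Nx Ny; rewrite /jp (si_conj wI Nx Ny) rmorphB.
    by rewrite -[w (x^† ∙ y)]/(fip w y x) (si_conj fI (I : setT x) I).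
  by move=> x Nx; rewrite /jp subr_ge0 ww'.
rewrite -/(jp q b); apply: le_trans (si_CS jI Nq Nb) _.
have h : sn jp b <= sn ip b.
  rewrite -(@ler_pXn2r _ 2) ?nnegrE ?sn_ge0 // -lecR -(sn2 jI Nb) -(sn2 wI Nb) /jp.
  by rewrite lerBlDr lerDl; case: pw.
have k : sn jp q <= d.
  rewrite -(@ler_pXn2r _ 2) ?nnegrE ?sn_ge0 ?(ltW d0) // -lecR -(sn2 jI Nq) /jp.
  rewrite /wip wbar_pos //; move: wq; rewrite rmorphB /=; set x := w _; set y := _%:C.
  by rewrite lerBlDr lerBlDl addrC.
by apply: ler_pM => //; apply: sn_ge0.
Qed.

(** A positive u of finite weight lies in N because u^2 <= nm u * u, and such u are dense in the
    positive cone. *)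
Lemma bl_dense_zero (W : normedModType R[i]) (F : A -> W) : bounded_linear F ->
  (pos `<=` closure [set a | pos a /\ (eta a < +oo)%E]) ->
  (forall x, N x -> F x = 0) -> forall x, F x = 0.
Proof.
move=> bF dense F0.
have Fp p : pos p -> F p = 0.
  move=> /dense/closure_scvg[u [uf up]].
  apply: (scvg_uniq (bl_scvg bF up)); suff -> : F \o u = fun=> 0 by exact: scvg_cst.
  apply: funext => n /=; apply: F0; have fu := uf n; have [pu _] := fu.
  have [fM _] := wfinZ wt (nm_ge0 (u n)) fu.
  apply: (wfin_le wt fM _ _).1; first exact: pos_star_mul.
  have [k [sk pk kk _]] := pos_sqrt pu.
  rewrite (pos_sa pu); have -> : (nm (u n))%:C *: u n - u n ∙ u n =
     (nm (u n))%:C *: (k^† ∙ k) - k^† ∙ u n ∙ k.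
    have ku : k ∙ u n = u n ∙ k by rewrite -kk cmulA.
    by rewrite sk kk ku -cmulA kk.
  by apply: pos_gap; [apply: pos_sa |].
have Fs a : a^† = a -> F a = 0.
  move=> /cpos_decomp[p [n [/pos_cposE pp /pos_cposE pn -> _ _]]].
  by rewrite (blB bF) !Fp // subrr.
have rsa (Y : A) : (re_part Y)^† = re_part Y by rewrite /re_part cstarZr cstarD cstarK addrC.
by move=> x; rewrite (re_part_split x) (blB bF) (Fs _ (rsa x)) (blZ bF) (Fs _ (rsa _)) scaler0 subrr.
Qed.

End LowerSemicontinuity.

(** * Minimal tensor products *)

Section ScalarLimits.
Variables (R : realType) (V : normedModType R[i]).

Lemma scvgZ2 (k : nat -> R[i]^o) l (u : nat -> V) v : scvg k l -> scvg u v ->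
  scvg (fun n => (k n : R[i]) *: u n) ((l : R[i]) *: v).
Proof.
move=> kl uv; have h0 : scvg (fun n => ((k n - l) : R[i]) *: (u n - v)) 0.
  move=> e e0; have e1 : 0 < Num.min e 1 by rewrite lt_min e0 ltr01.
  have [N1 h1] := kl _ e1; have [N2 h2] := uv _ e1.
  exists (maxn N1 N2) => n; rewrite geq_max => /andP[/h1 a1 /h2 a2].
  rewrite subr0 nmZ -/(nmc _).
  move: a1 a2; rewrite !lt_min => /andP[_ a1] /andP[a2 _].
  apply: le_lt_trans a2; rewrite -[leRHS]mul1r; apply: ler_wpM2r; first exact: nm_ge0.
  exact: ltW.
have h1 : scvg (fun n => ((k n - l) : R[i]) *: v) 0.
  move=> e e0; have d0 : 0 < e / (nm v + 1) by rewrite divr_gt0 // ltr_wpDl ?nm_ge0.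
  have [N HN] := kl _ d0; exists N => n /HN; rewrite ltr_pdivlMr ?ltr_wpDl ?nm_ge0 // => a1.
  rewrite subr0 nmZ -/(nmc _); apply: le_lt_trans a1.
  by apply: ler_wpM2l; [exact: nmc_ge0 | rewrite lerDl].
have := scvgD (scvgD h0 h1) (scvgZ l uv); rewrite !add0r => H e /H[N HN].
exists N => n /HN; have -> // : ((k n - l) : R[i]) *: (u n - v) + ((k n - l) : R[i]) *: v +
  (l : R[i]) *: u n = (k n : R[i]) *: u n.
by rewrite -scalerDr subrK scalerBl subrK.
Qed.

End ScalarLimits.

Section CodeExtension.
Variables (R : realType) (K : Type) (V : normedModType R[i]) (W : completeNormedModType R[i]).
Variables (e : K -> V) (ph : K -> W) (sc : R[i] -> K -> K) (C : R).
Hypothesis (C0 : 0 <= C).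
Hypothesis (e_sc : forall k p, e (sc k p) = k *: e p).
Hypothesis (ph_sc : forall k p, ph (sc k p) = k *: ph p).
Let ev (x : seq K) := \sum_(p <- x) e p.
Hypothesis dense : forall Z, exists x : nat -> seq K, scvg (fun n => ev (x n)) Z.
Let ps (x : seq K) := \sum_(p <- x) ph p.
Hypothesis hC : forall x, nm (ps x) <= C * nm (ev x).

(** Finite sequences of symbols stand for formal sums. The bound [hC], applied to differences of
    sequences, shows at once that the value depends only on the sum and that it extends by
    continuity. *)
Lemma code_ext : exists2 S : V -> W, bounded_linear S & forall p, S (e p) = ph p.
Proof.
have ev_cat x y : ev (x ++ y) = ev x + ev y by rewrite /ev big_cat.
have ps_cat x y : ps (x ++ y) = ps x + ps y by rewrite /ps big_cat.
pose fscale k (x : seq K) := [seq sc k p | p <- x].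
have ev_scale k x : ev (fscale k x) = k *: ev x.
  by rewrite /ev big_map scaler_sumr; apply: eq_bigr => p _.
have ps_scale k x : ps (fscale k x) = k *: ps x.
  by rewrite /ps big_map scaler_sumr; apply: eq_bigr => p _.
have diff x y : nm (ps x - ps y) <= C * nm (ev x - ev y).
  by have := hC (x ++ fscale (-1) y); rewrite ps_cat ps_scale ev_cat ev_scale !scaleN1r.
have lim (u : nat -> seq K) Z : scvg (fun n => ev (u n)) Z -> exists l, scvg (fun n => ps (u n)) l.
  move=> uZ; apply: scvg_cauchy => eps eps0.
  have d0 : 0 < eps / (2 * (C + 1)) by rewrite divr_gt0 // mulr_gt0 // ltr_wpDl.
  have [N HN] := uZ _ d0; exists N => m n /HN hm /HN hn.
  apply: le_lt_trans (diff _ _) _; have := nm_tri (ev (u m)) Z (ev (u n)).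
  rewrite [nm (Z - _)]nmC; move: hm hn; rewrite !ltr_pdivlMr ?mulr_gt0 ?ltr_wpDl //.
  set a := nm (_ - Z); set b := nm (_ - Z); set c := nm _ => h1 h2 h3.
  have a0 : 0 <= a := nm_ge0 _; have b0 : 0 <= b := nm_ge0 _.
  have : C * c <= C * (a + b) by apply: ler_wpM2l.
  lra.
have uniq (u v : nat -> seq K) Z l m : scvg (fun n => ev (u n)) Z -> scvg (fun n => ev (v n)) Z ->
    scvg (fun n => ps (u n)) l -> scvg (fun n => ps (v n)) m -> l = m.
  move=> uZ vZ ul vm; apply: (scvg_uniq ul) => eps eps0.
  have d0 : 0 < eps / (2 * (C + 1)) / 2 by rewrite !divr_gt0 // mulr_gt0 // ltr_wpDl.
  have [N1 H1] := uZ _ d0; have [N2 H2] := vZ _ d0.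
  have e2 : 0 < eps / 2 by lra.
  have [N3 H3] := vm _ e2.
  exists (maxn N1 (maxn N2 N3)) => n; rewrite !geq_max => /and3P[/H1 h1 /H2 h2 /H3 h3].
  apply: le_lt_trans (nm_tri _ (ps (v n)) _) _.
  have := diff (u n) (v n); have := nm_tri (ev (u n)) Z (ev (v n)).
  rewrite [nm (Z - _)]nmC => h4 h5.
  move: h1 h2; rewrite -mulrA -invfM !ltr_pdivlMr ?mulr_gt0 ?ltr_wpDl // => h1 h2.
  move: h1 h2 h3 h4 h5; set a := nm _; set b := nm _; set c := nm _; set d := nm _; set f := nm _.
  move=> h1 h2 h3 h4 h5; have a0 : 0 <= a := nm_ge0 _; have b0 : 0 <= b := nm_ge0 _.
  have : C * d <= C * (a + b) by apply: ler_wpM2l.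
  lra.
have /choice[x xZ] : forall Z, exists x : nat -> seq K, scvg (fun n => ev (x n)) Z by exact: dense.
have /choice[S HS] : forall Z, exists l, scvg (fun n => ps (x Z n)) l by move=> Z; apply: lim (xZ Z).
have key (u : nat -> seq K) Z l : scvg (fun n => ev (u n)) Z -> scvg (fun n => ps (u n)) l -> S Z = l.
  by move=> h k; apply: (uniq (x Z) u Z).
exists S; last first.
  by move=> p; apply: (key (fun=> [:: p])); rewrite /ev /ps big_seq1; exact: scvg_cst.
split.
  move=> k Y Z; apply: (key (fun n => fscale k (x Y n) ++ x Z n)).
    have := scvgD (scvgZ k (xZ Y)) (xZ Z) => h eps /h[N HN]; exists N => n /HN.
    by rewrite ev_cat ev_scale.
  have := scvgD (scvgZ k (HS Y)) (HS Z) => h eps /h[N HN]; exists N => n /HN.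
  by rewrite ps_cat ps_scale.
exists C => // Z; apply: (@le_eps _ _ _ (C + 1)) => eps eps0.
have [N1 H1] := xZ Z _ eps0; have [N2 H2] := HS Z _ eps0.
have := H1 _ (leq_maxl N1 N2); have := H2 _ (leq_maxr N1 N2); set n := maxn _ _ => h1 h2.
have h3 : nm (ps (x Z n)) <= C * nm (ev (x Z n)) := hC (x Z n).
have h4 : nm (S Z) <= nm (ps (x Z n) - S Z) + nm (ps (x Z n)).
  by have := nm_tri (S Z) (ps (x Z n)) 0; rewrite !subr0 nmC.
have h5 : nm (ev (x Z n)) <= nm (ev (x Z n) - Z) + nm Z.
  by have := nm_tri (ev (x Z n)) Z 0; rewrite !subr0.
have h6 := ler_wpM2l C0 h5; have h7 := ler_wpM2l C0 (ltW h2); lra.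
Qed.

End CodeExtension.

Section Codes.
Variables (R : realType) (A B T : cstarType R) (t : min_tensor A B T).
Implicit Types (a : A) (b : B) (x y u v : seq (A * B)) (Z : T) (k : R[i]).

Lemma tensDl a a' b : t (a + a') b = t a b + t a' b.
Proof. by rewrite -[a]scale1r tensPl !scale1r. Qed.
Lemma tens0l b : t 0 b = 0.
Proof. by apply: (addrI (t 0 b)); rewrite -tensDl !addr0. Qed.
Lemma tensZl k a b : t (k *: a) b = k *: t a b.
Proof. by rewrite -[k *: a]addr0 tensPl tens0l addr0. Qed.
Lemma tensDr a b b' : t a (b + b') = t a b + t a b'.
Proof. by rewrite -[b]scale1r tensPr !scale1r. Qed.
Lemma tens0r a : t a 0 = 0.
Proof. by apply: (addrI (t a 0)); rewrite -tensDr !addr0. Qed.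
Lemma tensZr k a b : t a (k *: b) = k *: t a b.
Proof. by rewrite -[k *: b]addr0 tensPr tens0r addr0. Qed.
Lemma tensBr a b b' : t a (b - b') = t a b - t a b'.
Proof. by rewrite tensDr -scaleN1r tensZr scaleN1r. Qed.
Lemma tens_suml (I : Type) (r : seq I) (P : pred I) (F : I -> A) b :
  t (\sum_(i <- r | P i) F i) b = \sum_(i <- r | P i) t (F i) b.
Proof. by apply: (big_morph (t^~ b)) => [c d|]; [exact: tensDl | exact: tens0l]. Qed.
Lemma tens_sumr (I : Type) (r : seq I) (P : pred I) (F : I -> B) a :
  t a (\sum_(i <- r | P i) F i) = \sum_(i <- r | P i) t a (F i).
Proof. by apply: (big_morph (t a)) => [c d|]; [exact: tensDr | exact: tens0r]. Qed.

Definition ev x : T := \sum_(p <- x) t p.1 p.2.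
Definition fscale k x : seq (A * B) := [seq (k *: p.1, p.2) | p <- x].

Lemma ev_cat x y : ev (x ++ y) = ev x + ev y.
Proof. by rewrite /ev big_cat. Qed.
Lemma ev_scale k x : ev (fscale k x) = k *: ev x.
Proof. by rewrite /ev big_map scaler_sumr; apply: eq_bigr => p _; rewrite tensZl. Qed.

Lemma ev_dense Z : exists x : nat -> seq (A * B), scvg (fun n => ev (x n)) Z.
Proof.
have : cspan [set t a b | a in setT & b in setT] Z by rewrite tens_dense.
move=> /closure_scvg[w [Sw wZ]].
have /choice[x Hx] : forall n, exists x, ev x = w n.
  move=> n; have [m [k [s [hs ->]]]] := Sw n.
  have /choice[p Hp] : forall i, exists p : A * B, t p.1 p.2 = s i.
    by move=> i; have [a _ [b _ <-]] := hs i; exists (a, b).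
  exists [seq (k i *: (p i).1, (p i).2) | i <- index_enum 'I_m].
  by rewrite /ev big_map; apply: eq_bigr => i _; rewrite tensZl Hp.
by exists x; move=> e /wZ[N HN]; exists N => n /HN; rewrite Hx.
Qed.

Lemma tens_ext (W : completeNormedModType R[i]) (ph : A -> B -> W) (C : R) : 0 <= C ->
  (forall k a a' b, ph (k *: a + a') b = k *: ph a b + ph a' b) ->
  (forall x, nm (\sum_(p <- x) ph p.1 p.2) <= C * nm (ev x)) ->
  exists2 S : T -> W, bounded_linear S & forall a b, S (t a b) = ph a b.
Proof.
move=> C0 lp hC.
have ph0 b : ph 0 b = 0.
  by apply: (addrI (ph 0 b)); have := lp 1 0 0 b; rewrite !scale1r !addr0.
have phZ k a b : ph (k *: a) b = k *: ph a b by have := lp k a 0 b; rewrite ph0 !addr0.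
have [||||S bS h] := @code_ext R (A * B)%type T W (fun p => t p.1 p.2) (fun p => ph p.1 p.2)
  (fun k p => (k *: p.1, p.2)) C C0.
- by move=> k p; rewrite tensZl.
- by move=> k p; rewrite phZ.
- exact: ev_dense.
- exact: hC.
by exists S => // a b; rewrite (h (a, b)).
Qed.

End Codes.

Lemma get_spec (T : pointedType) (P : set T) x : P x -> P (get P).
Proof. by move=> h; apply: getPex; exists x. Qed.

Section Flip.
Variables (R : realType) (A B T : cstarType R) (t : min_tensor A B T).

Let swap (C D : Type) (x : seq (C * D)) : seq (D * C) := [seq (p.2, p.1) | p <- x].

Let formal_eval_swap (C D : cstarType R) (f : C -> R[i]) (g : D -> R[i]) x :
  formal_eval f g x = formal_eval g f (swap x).
Proof. by rewrite /formal_eval big_map; apply: eq_bigr => p _; rewrite mulrC. Qed.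

Let formal_mul_swap (C D : cstarType R) (x y : seq (C * D)) :
  swap (formal_mul x y) = formal_mul (swap x) (swap y).
Proof. by rewrite /swap /formal_mul map_allpairs allpairs_mapl allpairs_mapr. Qed.

Let formal_star_swap (C D : cstarType R) (x : seq (C * D)) :
  swap (formal_star x) = formal_star (swap x).
Proof. by rewrite /swap /formal_star -!map_comp. Qed.

Let spatial_swap (C D : cstarType R) (x : seq (C * D)) c :
  spatial_norm_le x c -> spatial_norm_le (swap x) c.
Proof.
have swapK (z : seq (C * D)) : swap (swap z) = z.
  by rewrite /swap -map_comp map_id_in // => -[].
move=> h f g pf pg y /=; have := h g f pg pf (swap y) => /=.
rewrite [X in X <= _ -> _]formal_eval_swap [formal_eval g f (formal_mul _ (swap y))]formal_eval_swap.
have swapK' (z : seq (D * C)) : swap (swap z) = z.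
  by rewrite /swap -map_comp map_id_in // => -[].
by rewrite !(formal_mul_swap, formal_star_swap) swapK'.
Qed.

(** The spatial norm is symmetric in the two factors. Statements about one leg are transferred to
    the other through this flipped tensor product on the same algebra. *)
Lemma flip_tensor : exists t' : min_tensor B A T, forall a b, t' b a = t a b.
Proof.
unshelve eexists (@MinTensor R B A T (fun b a => t a b) _ _ _ _ _ _) => //=.
- by move=> k b b' a; rewrite tensPr.
- by move=> k b a a'; rewrite tensPl.
- by move=> b b' a a'; rewrite tensM.
- by move=> b a; rewrite tens_star.
- rewrite -(tens_dense t); congr cspan; apply/seteqP; split=> z [u _ [v _ <-]].
    by exists v => //; exists u.
  by exists v => //; exists u.
move=> x c c0; have -> : \sum_(p <- x) t p.2 p.1 = \sum_(p <- swap x) t p.1 p.2.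
  by rewrite big_map.
rewrite (tens_norm t _ c0); split; last exact: spatial_swap.
have swapK (z : seq (B * A)) : swap (swap z) = z.
  by rewrite /swap -map_comp map_id_in // => -[].
by move=> /spatial_swap; rewrite swapK.
Qed.

End Flip.

(** * Multipliers acting on one leg or both legs of a tensor product *)

Section GoodMultipliers.
Variables (R : realType).

(* [F] has norm at most [sqrt M], witnessed by a defect operator. *)
Definition has_defect (A : cstarType R) (F : A -> A) := exists (M : R) N, 0 <= M /\
  forall a a', M%:C *: (a^† ∙ a') = (F a)^† ∙ F a' + (N a)^† ∙ N a'.

Definition good (A : cstarType R) (m : multiplier A) :=
  has_defect (mL m) /\ has_defect (mL (mstar m)).

Lemma act_defect (A T : cstarType R) (pi : A -> T -> T) a : action pi -> has_defect (pi a).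
Proof.
move=> hpi; have sh : (a^† ∙ a)^† = a^† ∙ a by rewrite cstarM cstarK.
have M0 : 0 <= nm (a^† ∙ a) + 1 by rewrite addr_ge0 ?nm_ge0.
have [|s [ss hs _]] := @sqrt_gap _ _ (a^† ∙ a) (nm (a^† ∙ a) + 1) sh; first by rewrite ltrDl.
exists (nm (a^† ∙ a) + 1), (fun Y => (Num.sqrt (nm (a^† ∙ a) + 1))%:C *: (Y - pi s Y)).
split=> // X Y; rewrite (act_adj hpi) -(actM hpi) -{2}hs; move: (nm (a^† ∙ a) + 1) M0 => M M0.
rewrite cstarZr cmulZl cmulZr scalerA -rmorphM /= -expr2 sqr_sqrtr //.
have e : (pi s X)^† ∙ Y = X^† ∙ pi s Y by rewrite (act_adj hpi) ss.
have e' : (pi s X)^† ∙ pi s Y = X^† ∙ pi (s ∙ s) Y by rewrite (act_adj hpi) ss (actM hpi).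
rewrite (actZl hpi) (actBl hpi) (actDl hpi) cstarB !(cmulBl, cmulBr) e e'.
by nc_ring.
Qed.

Lemma good_mof (A : cstarType R) (c : A) : good (mof c).
Proof.
split; first exact: (@act_defect A A (@cmul R A) c (left_mul_action A)).
have -> : mL (mstar (mof c)) = cmul c^† by apply: funext => x; rewrite /= cstarM cstarK.
exact: (@act_defect A A (@cmul R A) c^† (left_mul_action A)).
Qed.

Lemma good_mone (A : cstarType R) : good (mone A).
Proof.
have h : has_defect (@id A).
  by exists 1, (fun=> 0); split=> // a a'; rewrite rmorph1 scale1r cmul0r addr0.
split; first exact: h.
by have -> : mL (mstar (mone A)) = id by apply: funext => x; rewrite /= cstarK.
Qed.

Lemma good_mstar (A : cstarType R) (m : multiplier A) : good m -> good (mstar m).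
Proof.
move=> [h1 h2]; split=> //.
by have -> : mL (mstar (mstar m)) = mL m by apply: funext => x; rewrite /= !cstarK.
Qed.

Variables (A B T : cstarType R) (t : min_tensor A B T).

Lemma adjoint_total (F G : T -> T) (S : set T) : bounded_linear F -> bounded_linear G ->
  cspan S = setT -> (forall X Y, S X -> S Y -> (F X)^† ∙ Y = X^† ∙ G Y) -> adjoint_pair F G.
Proof.
move=> bF bG tS h.
have lm c : bounded_linear (cmul c : T -> T) := act_bounded (left_mul_action T) c.
have h1 X Y : S Y -> (F X)^† ∙ Y = X^† ∙ G Y.
  move=> SY; have e : (fun X => Y^† ∙ F X) = (fun X => (G Y)^† ∙ X).
    apply: (bl_eq_total _ (lm _) tS) => [|Z SZ]; first exact: bl_comp bF (lm _).
    by have := congr1 (@cstar R T) (h _ _ SZ SY); rewrite !cstarM !cstarK.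
  by have := congr1 (fun u => (u X)^†) e; rewrite /= !cstarM !cstarK.
move=> X Y; have := @bl_eq_total _ _ _ S (cmul (F X)^†) (fun Y => X^† ∙ G Y).
move=> /(_ (lm _) (bl_comp bG (lm _)) tS) e.
by rewrite -[LHS]/(cmul (F X)^† Y) e // => Z SZ; apply: h1.
Qed.

(** A mere norm bound on F does not bound F ⊗ 1, but the identity of [has_defect] is algebraic and
    amplifies: on formal sums it exhibits M |x|^2 - |(F ⊗ 1) x|^2 as a square. *)
Lemma left_leg (m : multiplier A) : good m -> exists F G, [/\ adjoint_pair F G,
  bounded_linear F, forall a b, F (t a b) = t (mL m a) b
  & forall a b, G (t a b) = t (mL (mstar m) a) b].
Proof.
have main (F G : A -> A) : adjoint_pair F G -> has_defect F ->
    exists2 H : T -> T, bounded_linear H & forall a b, H (t a b) = t (F a) b.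
  move=> ad [M [N [M0 e]]].
  apply: (@tens_ext _ _ _ _ t T (fun a b => t (F a) b) (Num.sqrt M) (sqrtr_ge0 M)) => [k a a' b|x].
    by rewrite (adjoint_linear ad) tensPl.
  rewrite -(@ler_pXn2r _ 2) ?nnegrE ?mulr_ge0 ?sqrtr_ge0 ?nm_ge0 // exprMn sqr_sqrtr //.
  rewrite -!nm_cstar2 -nmZp //; apply: pos_le_nm; first exact: pos_star_mul.
  have -> : M%:C *: ((ev t x)^† ∙ ev t x) = (\sum_(p <- x) t (F p.1) p.2)^† ∙ (\sum_(p <- x) t (F p.1) p.2)
     + (\sum_(p <- x) t (N p.1) p.2)^† ∙ (\sum_(p <- x) t (N p.1) p.2).
    have sq (u : A -> A) : (\sum_(p <- x) t (u p.1) p.2)^† ∙ (\sum_(p <- x) t (u p.1) p.2) =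
      \sum_(p <- x) \sum_(q <- x) t ((u p.1)^† ∙ u q.1) (p.2^† ∙ q.2).
      rewrite cstar_sum cmul_suml; apply: eq_bigr => p _; rewrite cmul_sumr.
      by apply: eq_bigr => q _; rewrite -tens_star -tensM.
    rewrite (sq F) (sq N) -[ev t x]/(\sum_(p <- x) t (id p.1) p.2) (sq id).
    rewrite scaler_sumr -big_split; apply: eq_bigr => p _ /=.
    rewrite scaler_sumr -big_split; apply: eq_bigr => q _ /=.
    by rewrite -tensZl e tensDl.
  by rewrite addrC addKr; apply: pos_star_mul.
move=> [d1 d2]; have ad := multiplier_adjoint m.
have [F bF Fe] := main _ _ ad d1; have [G bG Ge] := main _ _ (adjoint_sym ad) d2.
exists F, G; split=> //; apply: (adjoint_total bF bG (tens_dense t)) => _ _ [a _ [b _ <-]] [a' _ [b' _ <-]].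
by rewrite Fe Ge -!tens_star -!tensM ad.
Qed.

End GoodMultipliers.

Section TensorMultipliers.
Variables (R : realType) (A B T : cstarType R) (t : min_tensor A B T).

Lemma right_leg (n : multiplier B) : good n -> exists F G, [/\ adjoint_pair F G,
  bounded_linear F, forall a b, F (t a b) = t a (mL n b)
  & forall a b, G (t a b) = t a (mL (mstar n) b)].
Proof.
move=> gn; have [t' ht] := flip_tensor t; have [F [G [ad bF Fe Ge]]] := left_leg t' gn.
by exists F, G; split=> // a b; rewrite -!ht.
Qed.

Lemma cmul_total (S : set T) (X Y : T) : cspan S = setT -> (forall Z, S Z -> Z ∙ X = Z ∙ Y) -> X = Y.
Proof.
move=> tS h; apply: cstar_separate => Z.
have rm c : bounded_linear (fun Z : T => Z ∙ c).
  split; first by move=> k U V; rewrite cmulDl cmulZl.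
  by exists (nm c) => [|U]; [exact: nm_ge0 | rewrite mulrC nmM].
by have := bl_eq_total (rm X) (rm Y) tS h => /(congr1 (@^~ Z^†)).
Qed.

Lemma mtens_spec (m : multiplier A) (n : multiplier B) : good m -> good n ->
  [/\ bounded_linear (mL (mtens t m n)),
      forall a b, mL (mtens t m n) (t a b) = t (mL m a) (mL n b) &
      forall a b, mR (mtens t m n) (t a b) = t (mR m a) (mR n b)].
Proof.
move=> gm gn; have [F [G [ad bF Fe Ge]]] := left_leg t gm.
have [F' [G' [ad' bF' Fe' Ge']]] := right_leg gn.
have adc : adjoint_pair (fun Z => F (F' Z)) (fun Z => G' (G Z)).
  by move=> X Y; rewrite ad ad'.
have [p [pL pR]] := mLE adc.
have sp a b : mL p (t a b) = t (mL m a) (mL n b) /\ mR p (t a b) = t (mR m a) (mR n b).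
  rewrite mRE pL pR Fe' Fe -tens_star Ge Ge' -!tens_star; split=> //.
  by rewrite /= !cstarK.
have e : mtens t m n = p.
  have sq := @get_spec _ [set q : multiplier T | forall a b,
    mL q (t a b) = t (mL m a) (mL n b) /\ mR q (t a b) = t (mR m a) (mR n b)] p sp.
  apply: multiplier_eq; apply: funext => Z.
  apply: (cmul_total (tens_dense t)) => _ [a _ [b _ <-]].
  by rewrite !mLR (sq a b).2 (sp a b).2.
rewrite e; split=> [|a b|a b]; [|by case: (sp a b)|by case: (sp a b)].
by rewrite pL; apply: bl_comp.
Qed.

Lemma mtens_mstar m n : good m -> good n ->
  mL (mstar (mtens t m n)) = mL (mtens t (mstar m) (mstar n)).
Proof.
move=> gm gn; have [_ e1 e2] := mtens_spec gm gn.
have [b3 e3 _] := mtens_spec (good_mstar gm) (good_mstar gn).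
have ad := multiplier_adjoint (mtens t m n).
apply: funext => Z; apply: (cmul_total (tens_dense t)) => X [a _ [b _ <-]].
have eX : t a b = (t a^† b^†)^† by rewrite -tens_star !cstarK.
rewrite {1}eX -ad e1.
have lm c : bounded_linear (cmul c : T -> T) := act_bounded (left_mul_action T) c.
have e : cmul (t (mL m a^†) (mL n b^†))^† = (fun Z => t a b ∙ mL (mtens t (mstar m) (mstar n)) Z).
  apply: (bl_eq_total (lm _) (bl_comp b3 (lm _)) (tens_dense t)) => _ [c _ [d _ <-]].
  by rewrite e3 -tens_star -!tensM /= !mstar_subproof.
by have := congr1 (fun F => F Z) e.
Qed.

(** Left multiplication by c ⊗ 1 and, next, by 1 ⊗ c. *)
Definition l1 (c : A) : T -> T := mL (mtens t (mof c) (mone B)).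
Definition l2 (c : B) : T -> T := mL (mtens t (mone A) (mof c)).

Lemma l1E c a b : l1 c (t a b) = t (c ∙ a) b.
Proof. by rewrite /l1; have [_ -> _] := mtens_spec (good_mof c) (good_mone B). Qed.
Lemma l2E c a b : l2 c (t a b) = t a (c ∙ b).
Proof. by rewrite /l2; have [_ -> _] := mtens_spec (good_mone A) (good_mof c). Qed.
Lemma l1_bl c : bounded_linear (l1 c).
Proof. by have [] := mtens_spec (good_mof c) (good_mone B). Qed.
Lemma l2_bl c : bounded_linear (l2 c).
Proof. by have [] := mtens_spec (good_mone A) (good_mof c). Qed.

Lemma mstar_mof (D : cstarType R) (c : D) : mstar (mof c) = mof c^†.
Proof. by apply: multiplier_eq; apply: funext => x; rewrite /= cstarM cstarK. Qed.
Lemma mstar_mone (D : cstarType R) : mstar (mone D) = mone D.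
Proof. by apply: multiplier_eq; apply: funext => x; rewrite /= cstarK. Qed.

Lemma l1_action : action l1.
Proof.
split.
- move=> k a b Z; have e : l1 (k *: a + b) = (fun Z => k *: l1 a Z + l1 b Z).
    apply: (bl_eq_total (l1_bl _) (bl_comb _ (l1_bl _) (l1_bl _)) (tens_dense t)).
    by move=> _ [c _ [d _ <-]]; rewrite !l1E cmulDl cmulZl tensPl.
  by rewrite e.
- move=> a b Z; have e : l1 (a ∙ b) = (fun Z => l1 a (l1 b Z)).
    apply: (bl_eq_total (l1_bl _) (bl_comp (l1_bl _) (l1_bl _)) (tens_dense t)).
    by move=> _ [c _ [d _ <-]]; rewrite !l1E cmulA.
  by rewrite e.
move=> a; have := multiplier_adjoint (mtens t (mof a) (mone B)).
by rewrite (mtens_mstar (good_mof a) (good_mone B)) mstar_mof mstar_mone.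
Qed.
Lemma l2_action : action l2.
Proof.
split.
- move=> k a b Z; have e : l2 (k *: a + b) = (fun Z => k *: l2 a Z + l2 b Z).
    apply: (bl_eq_total (l2_bl _) (bl_comb _ (l2_bl _) (l2_bl _)) (tens_dense t)).
    by move=> _ [c _ [d _ <-]]; rewrite !l2E cmulDl cmulZl tensPr.
  by rewrite e.
- move=> a b Z; have e : l2 (a ∙ b) = (fun Z => l2 a (l2 b Z)).
    apply: (bl_eq_total (l2_bl _) (bl_comp (l2_bl _) (l2_bl _)) (tens_dense t)).
    by move=> _ [c _ [d _ <-]]; rewrite !l2E cmulA.
  by rewrite e.
move=> a; have := multiplier_adjoint (mtens t (mone A) (mof a)).
by rewrite (mtens_mstar (good_mone A) (good_mof a)) mstar_mof mstar_mone.
Qed.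

Lemma l12_comm a b Z : l1 a (l2 b Z) = l2 b (l1 a Z).
Proof.
have e : (fun Z => l1 a (l2 b Z)) = (fun Z => l2 b (l1 a Z)).
  apply: (bl_eq_total (bl_comp (l2_bl _) (l1_bl _)) (bl_comp (l1_bl _) (l2_bl _)) (tens_dense t)).
  by move=> _ [c _ [d _ <-]]; rewrite !(l1E, l2E).
by have := congr1 (fun F => F Z) e.
Qed.

End TensorMultipliers.

Section PositivityCriterion.
Variables (R : realType) (A : cstarType R).
Implicit Types (a b p n : A) (f g : A -> R[i]).
Local Notation pos := (@pos_cone R _).

Lemma pos_dual_sandwich g n : pos_dual g -> pos_dual (fun a => g (n^† ∙ a ∙ n)).
Proof.
move=> pg; have [dg gp] := pg; split; last first.
  move=> a; have := gp (a ∙ n); by rewrite cstarM !cmulA.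
apply/dualE; apply: (@bl_comp _ A A _ (g : A -> R[i]^o) (fun a => n^† ∙ a ∙ n)); last exact/dualE.
split; first by move=> k x y; rewrite cmulDr cmulDl cmulZr cmulZl.
exists (nm n^† * nm n) => [|x]; first by rewrite mulr_ge0 ?nm_ge0.
apply: le_trans (nmM _ _) _; rewrite [leRHS]mulrAC.
by apply: ler_wpM2r; [exact: nm_ge0 | exact: nmM].
Qed.

(** Test on the negative part n: n (p - n) n = - n^3, and a state norming k n, with k^2 = n, shows
    that n^3 and hence n vanishes. *)
Lemma pos_functional a : a^† = a -> (forall g, pos_dual g -> 0 <= g a) -> pos a.
Proof.
move=> /cpos_decomp[p [n [/pos_cposE pp /pos_cposE pn -> pn0 np0]]] h.
have [k [sk pk kk _]] := pos_sqrt pn.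
have sn' := pos_sa pn.
have e3 : n^† ∙ (p - n) ∙ n = - ((k ∙ n)^† ∙ (k ∙ n)).
  by rewrite cmulBr sn' np0 sub0r cmulNl cstarM sk sn' -!cmulA [k ∙ (k ∙ n)]cmulA kk.
have [g [pg _ gn]] := norming_state (k ∙ n).
have bg : bounded_linear (g : A -> R[i]^o) by apply/dualE; case: pg.
have := h _ (pos_dual_sandwich n pg); rewrite e3 (blN bg) gn oppr_ge0 => h0.
have {h0} kn : nm (k ∙ n) = 0.
  by apply/eqP; rewrite -sqrf_eq0 eq_le exprn_ge0 ?nm_ge0 // andbT -lecR.
have kn0 := nm_eq0 kn.
have n0 : n = 0.
  by apply: sa_sq0 => //; rewrite -{1}kk -cmulA kn0 cmul0r.
by rewrite n0 subr0.
Qed.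

(** Polarizing g (c^† a c) gives g (d^† a c) = 0 for all c and d; with c = a^† and d = a a^† and a
    norming state this is nm a ^ 4 = 0. *)
Lemma dual_separate a b : (forall g, pos_dual g -> g a = g b) -> a = b.
Proof.
move=> h; apply/eqP; rewrite -subr_eq0; apply/eqP.
have {}h g : pos_dual g -> g (a - b) = 0.
  move=> pg; have bg : bounded_linear (g : A -> R[i]^o) by apply/dualE; case: pg.
  by rewrite (blB bg) h // subrr.
move: (a - b) h => {b}a h.
have sw c : forall g, pos_dual g -> g (c^† ∙ a ∙ c) = 0.
  by move=> g pg; apply: (h _ (pos_dual_sandwich c pg)).
have pol c d g : pos_dual g -> g (d^† ∙ a ∙ c) = 0.
  move=> pg; have bg : bounded_linear (g : A -> R[i]^o) by apply/dualE; case: pg.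
  have -> : d^† ∙ a ∙ c = (4^-1)%:C *: ((c + d)^† ∙ a ∙ (c + d) - (c - d)^† ∙ a ∙ (c - d)
     + 'i%R *: ((c + 'i%R *: d)^† ∙ a ∙ (c + 'i%R *: d) - (c - 'i%R *: d)^† ∙ a ∙ (c - 'i%R *: d))).
    have -> : (c + 'i%R *: d)^† ∙ a ∙ (c + 'i%R *: d) - (c - 'i%R *: d)^† ∙ a ∙ (c - 'i%R *: d) =
        'i%R *: (c^† ∙ a ∙ d + c^† ∙ a ∙ d - d^† ∙ a ∙ c - d^† ∙ a ∙ c).
      by rewrite !(cstarD, cstarN) cstarZ conjCi; nc_ring.
    rewrite scalerA -expr2 sqrCi !(cstarD, cstarN) fmorphV rmorph_nat; nc_ring.
  by rewrite (blZ bg) (blD bg) (blZ bg) !(blB bg) !sw // !subrr scaler0 addr0 scaler0.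
have [g [pg _ ga]] := norming_state (a ∙ a^†).
have := pol a^† (a ∙ a^†) g pg; rewrite -cmulA ga nm_cstar2r => h0.
have {h0} /eqP : (nm a ^+ 2) ^+ 2 = 0 by apply: complexI; rewrite h0 rmorph0.
by rewrite !sqrf_eq0 => /eqP/nm_eq0.
Qed.

End PositivityCriterion.

(** * Product functionals and slice maps *)

Section ProductFunctionals.
Variables (R : realType) (A B T : cstarType R) (t : min_tensor A B T).
Variables (f : A -> R[i]) (g : B -> R[i]).
Hypothesis (pf : pos_dual f) (pg : pos_dual g).
Implicit Types (u v x y : seq (A * B)).

Let bf : bounded_linear (f : A -> R[i]^o). Proof. by apply/dualE; case: pf. Qed.
Let bg : bounded_linear (g : B -> R[i]^o). Proof. by apply/dualE; case: pg. Qed.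

Definition code_form u v : R[i] := formal_eval f g (formal_mul (formal_star v) u).

Lemma code_formE u v : code_form u v =
  \sum_(q <- v) \sum_(p <- u) f (q.1^† ∙ p.1) * g (q.2^† ∙ p.2).
Proof. by rewrite /code_form /formal_eval big_allpairs_dep big_map. Qed.

Lemma code_form_spatial x y : code_form (formal_mul x y) (formal_mul x y) <=
  (nm (ev t x) ^+ 2)%:C * code_form y y.
Proof.
have h : `|\sum_(p <- x) t p.1 p.2| <= (nm (ev t x))%:C by rewrite nmE.
by have /(tens_norm t _ (nm_ge0 _)) h' := h; apply: h'.
Qed.

(** The spatial bound for the empty sum, whose norm is at most 1, reads 0 <= (f ⊗ g)(y^† y): the
    norm condition already contains the positivity of f ⊗ g. *)
Lemma code_form_ge0 y : 0 <= code_form y y.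
Proof.
have h : `|\sum_(p <- [::] : seq (A * B)) t p.1 p.2| <= 1%:C by rewrite big_nil normr0.
have /(tens_norm t _ ler01)/(_ f g pf pg y) h' := h.
by move: h'; rewrite /= /formal_eval /= big_nil expr1n mul1r.
Qed.

Lemma code_form_conj u v : code_form v u = Num.conj (code_form u v).
Proof.
rewrite !code_formE rmorph_sum exchange_big; apply: eq_bigr => q _.
rewrite rmorph_sum; apply: eq_bigr => p _.
by rewrite rmorphM /= -(pos_dual_star pf) -(pos_dual_star pg) !cstarM !cstarK.
Qed.

Lemma code_form_comb (l : R[i]) u v :
  code_form (u ++ fscale l v) (u ++ fscale l v) =
  code_form u u + Num.conj l * code_form u v + l * code_form v u + l * Num.conj l * code_form v v.
Proof.
have linl u1 u2 w : code_form (u1 ++ fscale l u2) w = code_form u1 w + l * code_form u2 w.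
  rewrite !code_formE mulr_sumr -big_split; apply: eq_bigr => q _ /=.
  rewrite big_cat big_map mulr_sumr; congr (_ + _); apply: eq_bigr => p _ /=.
  by rewrite cmulZr (blZ bf) /GRing.scale /= mulrA.
rewrite linl code_form_conj linl [X in _ + l * X]code_form_conj linl !rmorphD !rmorphM /=.
by rewrite -!code_form_conj; ring.
Qed.

Definition code_norm u : R := Num.sqrt (complex.Re (code_form u u)).
Lemma code_norm_sqr u : (code_norm u ^+ 2)%:C = code_form u u.
Proof.
have h := code_form_ge0 u; rewrite /code_norm sqr_sqrtr ?RRe_real ?ger0_real //.
by rewrite -ler0c RRe_real ?ger0_real.
Qed.

Lemma code_form_CS u v : nmc (code_form u v) <= code_norm u * code_norm v.
Proof.
apply: quadratic_CS; rewrite ?sqrtr_ge0 // => l.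
by rewrite !code_norm_sqr -code_form_conj -code_form_comb code_form_ge0.
Qed.

Lemma approx_seq (D : cstarType R) (bs : seq D) : exists e : nat -> D,
  [/\ forall n, pos_cone (e n), forall n, nm (e n) <= 1 &
      forall b, b \in bs -> scvg (fun n => e n ∙ b ∙ e n) b].
Proof.
have /choice[e He] : forall n : nat, exists e : D, [/\ pos_cone e, nm e <= 1 &
   forall b, b \in bs ++ [seq c^† | c <- bs] -> nm (b - e ∙ b) < n.+1%:R^-1].
  move=> n; have [|e [pe e1 eb _]] := @approx_unit _ _ (bs ++ [seq c^† | c <- bs]) n.+1%:R^-1.
    by rewrite invr_gt0 ltr0n.
  by exists e.
exists e; split=> [n|n|b bb]; try by case: (He n).
apply: (@scvg_squeeze _ _ _ _ (fun n => n.+1%:R^-1 + n.+1%:R^-1)).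
  move=> n; have [pe e1 h] := He n; rewrite nmC.
  have h1 := h b; rewrite mem_cat bb in h1; have {}h1 := ltW (h1 isT).
  have h2 := h b^†; rewrite mem_cat map_f ?orbT // in h2; have {}h2 := ltW (h2 isT).
  apply: le_trans (nm_tri _ (e n ∙ b) _) _; apply: lerD => //.
  have -> : e n ∙ b - e n ∙ b ∙ e n = e n ∙ (b^† - e n ∙ b^†)^†.
    by rewrite cstarB cstarM cstarK (pos_sa pe); nc_ring.
  apply: le_trans (nmM _ _) _; rewrite nm_star; apply: le_trans h2.
  by rewrite -[leRHS]mul1r; apply: ler_wpM2r; [exact: nm_ge0 |].
move=> r r0; have r2 : 0 < r / 2 by lra.
by have [N HN] := inv_small r2; exists N => n /HN; move: (n.+1%:R^-1) => q; lra.
Qed.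

(** Approximate units e n and d n replace the cyclic vectors: (f ⊗ g) of the compressed sum is a
    matrix coefficient at e n ⊗ d n, bounded by Cauchy-Schwarz and the definition of the spatial
    norm. *)
Lemma product_bound (Cf Cg : R) x : 0 <= Cf -> 0 <= Cg ->
  (forall a, f (a^† ∙ a) <= (Cf * nm a ^+ 2)%:C) -> (forall b, g (b^† ∙ b) <= (Cg * nm b ^+ 2)%:C) ->
  nmc (formal_eval f g x) <= Cf * Cg * nm (ev t x).
Proof.
move=> Cf0 Cg0 hf hg.
have [e [pe e1 ex]] := approx_seq [seq p.1 | p <- x].
have [d [pd d1 dx]] := approx_seq [seq p.2 | p <- x].
pose u n : R[i]^o := \sum_(p <- x) f (e n ∙ p.1 ∙ e n) * g (d n ∙ p.2 ∙ d n).
have ux : scvg u (formal_eval f g x : R[i]^o).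
  rewrite /u /formal_eval; elim: (x) ex dx => [|p y IH] ex dx.
    by move=> r r0; exists 0%N => n _; rewrite !big_nil subrr nm0.
  have IH' := IH _ _; have {}IH' : scvg (fun n => (\sum_(p <- y) f (e n ∙ p.1 ∙ e n) * g (d n ∙ p.2 ∙ d n)) : R[i]^o)
     ((\sum_(p <- y) f p.1 * g p.2) : R[i]^o).
    by apply: IH => b bb; [apply: ex | apply: dx]; rewrite inE bb orbT.
  have h1 := bl_scvg bf (ex p.1 (mem_head _ _)); have h2 := bl_scvg bg (dx p.2 (mem_head _ _)).
  have h3 := scvgD (scvgZ2 h1 h2) IH'.
  by move=> r /h3[N HN]; exists N => n /HN; rewrite !big_cons.
rewrite -nmc_nm; apply: (scvg_le ux) => n.
pose Y := [:: (e n, d n)].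
have YY : code_norm Y ^+ 2 <= Cf * Cg.
  rewrite -lecR code_norm_sqr code_formE !big_seq1 /= rmorphM; apply: ler_pM.
  - by case: pf => _; apply.
  - by case: pg => _; apply.
  - apply: le_trans (hf _) _; rewrite lecR -[leRHS]mulr1; apply: ler_wpM2l => //.
    by rewrite exprn_ile1 // nm_ge0.
  apply: le_trans (hg _) _; rewrite lecR -[leRHS]mulr1; apply: ler_wpM2l => //.
  by rewrite exprn_ile1 // nm_ge0.
have -> : u n = code_form (formal_mul x Y) Y.
  rewrite /u code_formE big_seq1 /formal_mul big_allpairs_dep; apply: eq_bigr => p _.
  by rewrite big_seq1 /= !(pos_sa (pe n)) !(pos_sa (pd n)) !cmulA.
apply: le_trans (code_form_CS _ _) _.
have h : code_norm (formal_mul x Y) <= nm (ev t x) * code_norm Y.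
  rewrite -(@ler_pXn2r _ 2) ?nnegrE ?mulr_ge0 ?sqrtr_ge0 ?nm_ge0 // exprMn.
  by rewrite -lecR code_norm_sqr [leRHS]rmorphM /= code_norm_sqr code_form_spatial.
have c0 : 0 <= code_norm Y := sqrtr_ge0 _.
apply: le_trans (ler_wpM2r c0 h) _.
have -> : nm (ev t x) * code_norm Y * code_norm Y = code_norm Y ^+ 2 * nm (ev t x) by ring.
by apply: ler_wpM2r; [exact: nm_ge0 | exact: YY].
Qed.

End ProductFunctionals.

Section Slices.
Variables (R : realType) (A B T : cstarType R) (t : min_tensor A B T).
Implicit Types (a : A) (b : B) (Z : T) (g : B -> R[i]).

Lemma dual_pos_bound (D : cstarType R) (f : D -> R[i]) : pos_dual f ->
  exists2 C : R, 0 <= C & forall a : D, f (a^† ∙ a) <= (C * nm a ^+ 2)%:C.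
Proof.
move=> [df fp]; have [C C0 h] := dual_le df; exists C => // a.
have := h (a^† ∙ a); rewrite nm_cstar2 -lecR -nmcE => /(le_trans _); apply.
by rewrite ger0_norm.
Qed.

(** The norm of the slice y is tested by a state h norming y^† y; moving y^† into the first leg
    gives nm y ^ 2 <= C nm y times the norm of the tensor. *)
Lemma slice_pos_ex g : pos_dual g -> exists2 S : T -> A, bounded_linear S &
  forall a b, S (t a b) = g b *: a.
Proof.
move=> pg; have [C C0 hg] := dual_pos_bound pg.
have bg : bounded_linear (g : B -> R[i]^o) by apply/dualE; case: pg.
apply: (@tens_ext _ _ _ _ t A (fun a b => g b *: a) C C0) => [k a a' b|x].
  by rewrite scalerDr !scalerA mulrC.
set y := \sum_(p <- x) _.
have [h [ph h1 hy]] := norming_state y.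
have bh : bounded_linear (h : A -> R[i]^o) by apply/dualE; case: ph.
have hC a : h (a^† ∙ a) <= (1 * nm a ^+ 2)%:C by rewrite mul1r.
pose x' := [seq (y^† ∙ p.1, p.2) | p <- x].
have := product_bound t ph pg x' ler01 C0 hC hg.
have -> : formal_eval h g x' = h (y^† ∙ y).
  rewrite {2}/y cmul_sumr (bl_sum bh) /formal_eval big_map; apply: eq_bigr => p _.
  by rewrite cmulZr (blZ bh) mulrC.
have -> : ev t x' = l1 t y^† (ev t x).
  by rewrite /ev (bl_sum (l1_bl t _)) big_map; apply: eq_bigr => p _; rewrite l1E.
rewrite hy nmc_real ger0_norm ?exprn_ge0 ?nm_ge0 // mul1r => H.
have := act_bound (l1_action t) y^† (ev t x); rewrite nm_star => H'.
have [->|y0] := eqVneq y 0; first by rewrite nm0 mulr_ge0 ?nm_ge0.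
have ny : 0 < nm y by rewrite nm_gt0.
rewrite -(ler_pM2l ny) -expr2; apply: le_trans H _.
by rewrite mulrCA; apply: ler_wpM2l.
Qed.

Lemma slice_positive g S : pos_dual g -> bounded_linear S ->
  (forall a b, S (t a b) = g b *: a) -> positive_map S.
Proof.
move=> pg bS Se.
have bg : bounded_linear (g : B -> R[i]^o) by apply/dualE; case: pg.
have st Z : S Z^† = (S Z)^†.
  have [x xZ] := ev_dense t Z.
  have h1 := bl_scvg bS (scvg_star xZ); have h2 := scvg_star (bl_scvg bS xZ).
  apply: (scvg_uniq h1) => e /h2[N HN]; exists N => n /HN /=.
  rewrite /ev cstar_sum !(bl_sum bS) cstar_sum.
  have -> // : \sum_(p <- x n) S (t p.1 p.2)^† = \sum_(p <- x n) (S (t p.1 p.2))^†.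
  by apply: eq_bigr => p _; rewrite -tens_star !Se cstarZ (pos_dual_star pg).
split=> // Z.
have [x xZ] := ev_dense t Z.
have h := bl_scvg bS (scvgM (scvg_star xZ) xZ).
apply: (pos_scvg _ h) => n /=; apply: pos_functional.
  by rewrite -st cstarM cstarK.
move=> f pf; have bf : bounded_linear (f : A -> R[i]^o) by apply/dualE; case: pf.
have -> : f (S ((ev t (x n))^† ∙ ev t (x n))) = code_form f g (x n) (x n); last first.
  exact: (code_form_ge0 t pf pg).
rewrite code_formE /ev cstar_sum cmul_suml (bl_sum bS) (bl_sum bf); apply: eq_bigr => q _.
rewrite cmul_sumr (bl_sum bS) (bl_sum bf); apply: eq_bigr => p _.
by rewrite -tens_star -tensM Se (blZ bf) mulrC.
Qed.

Lemma dual_comb (D : cstarType R) (k : R[i]) (f : D -> R[i]) (g : D -> R[i]) : dual f -> dual g ->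
  dual (fun a : D => k * f a + g a).
Proof. by move=> /dualE bf /dualE bg; apply/dualE; apply: (bl_comb k bf bg). Qed.

Lemma dual_conj (D : cstarType R) (f : D -> R[i]) : dual f -> dual (fun a : D => Num.conj (f a^†)).
Proof.
move=> /dualE bf; have [_ [C C0 h]] := bf; apply/dualE; split.
  by move=> k x y; rewrite cstarP (blP bf) rmorphD /= /GRing.scale /= rmorphM /= conjCK.
by exists C => // x; rewrite nmc_nm nmcJ -(nm_star x); apply: h.
Qed.

(** A bounded functional is a combination of two hermitian ones, and by [dual_majorant] each of
    these is a difference of positive functionals. *)
Lemma slice_dual_ex g : dual g -> exists2 S : T -> A, bounded_linear S &
  forall a b, S (t a b) = g b *: a.
Proof.
have herm h : dual h -> (forall b, h b^† = Num.conj (h b)) -> exists2 S : T -> A, bounded_linear S &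
  forall a b, S (t a b) = h b *: a.
  move=> dh hh; have [p pp pph] := dual_majorant dh hh.
  have [S1 b1 e1] := slice_pos_ex pp; have [S2 b2 e2] := slice_pos_ex pph.
  exists (fun Z => -1 *: S2 Z + S1 Z); first exact: bl_comb.
  by move=> a b; rewrite e1 e2 scaleN1r -scaleNr -scalerDl opprB subrK.
move=> dg; pose g' b := Num.conj (g b^†); have dg' : dual g' := dual_conj dg.
have bg : bounded_linear (g : B -> R[i]^o) by apply/dualE.
have [|S1 b1 e1] := herm _ (dual_comb 1 dg dg').
  by move=> b; rewrite /g' rmorphD rmorphM /= rmorph1 !mul1r !conjCK cstarK addrC.
have d2 : dual (fun b => 'i%R * (-1 * g' b + g b) + 0).
  apply: dual_comb; first exact: dual_comb.
  apply/dualE; exact: bl_zero.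
have [|S2 b2 e2] := herm _ d2.
  move=> b; rewrite /g' !addr0 !rmorphM !rmorphD !rmorphM /= conjCi !conjCK rmorphN rmorph1 cstarK; ring.
exists (fun Z => 2^-1 *: (- 'i%R *: S2 Z + S1 Z) + 0).
  by apply: bl_comb; [apply: bl_comb | apply: bl_zero].
move=> a b; rewrite e1 e2 scalerA -scalerDl scalerA addr0; congr (_ *: _).
have -> : - 'i%R * ('i%R * (-1 * g' b + g b) + 0) + (1 * g b + g' b) =
   - ('i%R ^+ 2) * (-1 * g' b + g b) + (1 * g b + g' b) :> R[i] by ring.
by rewrite sqrCi opprK; field.
Qed.

Lemma slice_r_spec g : dual g -> bounded_linear (slice_r t g) /\
  forall a b, slice_r t g (t a b) = g b *: a.
Proof.
move=> dg; have [S bS Se] := slice_dual_ex dg.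
have [lS cS] := iffLR (bounded_linearE S) bS.
have [l c e] := @get_spec _ [set S : T -> A |
    [/\ linear S, continuous S & forall a b, S (t a b) = g b *: a]] S (And3 lS cS Se).
split; last exact: e.
by apply/bounded_linearE; split; [exact: l | exact: c].
Qed.

End Slices.

Section LeftSlices.
Variables (R : realType) (A B T : cstarType R) (t : min_tensor A B T).

Lemma slice_l_spec (f : A -> R[i]) : dual f -> bounded_linear (slice_l t f) /\
  forall a b, slice_l t f (t a b) = f a *: b.
Proof.
move=> df; have [t' ht] := flip_tensor t; have [S bS Se] := slice_dual_ex t' df.
have {}Se a b : S (t a b) = f a *: b by rewrite -ht Se.
have [lS cS] := iffLR (bounded_linearE S) bS.
have [l c e] := @get_spec _ [set S : T -> B |
    [/\ linear S, continuous S & forall a b, S (t a b) = f a *: b]] S (And3 lS cS Se).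
split; last exact: e.
by apply/bounded_linearE; split; [exact: l | exact: c].
Qed.

Lemma slice_r_positive (g : B -> R[i]) : pos_dual g -> positive_map (slice_r t g).
Proof. by move=> pg; have [b e] := slice_r_spec t pg.1; apply: slice_positive pg b e. Qed.

Lemma dual_tens_spec (f : A -> R[i]) (g : B -> R[i]) : dual f -> dual g ->
  [/\ dual (dual_tens t f g), forall a b, dual_tens t f g (t a b) = f a * g b &
      forall Z, dual_tens t f g Z = f (slice_r t g Z)].
Proof.
move=> df dg; have [bS Se] := slice_r_spec t dg.
pose h Z := f (slice_r t g Z).
have dh : dual h by apply/dualE; apply: bl_comp bS _; apply/dualE.
have bf : bounded_linear (f : A -> R[i]^o) by apply/dualE.
have he a b : h (t a b) = f a * g b by rewrite /h Se (blZ bf) mulrC.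
have [d e] := @get_spec _ [set h : T -> R[i]^o | dual h /\ forall a b, h (t a b) = f a * g b] h (conj dh he).
split; [exact: d | exact: e |].
move=> Z; have -> // : dual_tens t f g = h.
apply: (bl_eq_total (F := dual_tens t f g : T -> R[i]^o) (G := h : T -> R[i]^o) _ _ (tens_dense t)).
- by apply/dualE.
- by apply/dualE.
by move=> _ [a _ [b _ <-]]; exact: etrans (e a b) (esym (he a b)).
Qed.

Lemma dual_tensE (f : A -> R[i]) (g : B -> R[i]) Z : dual f -> dual g ->
  f (slice_r t g Z) = g (slice_l t f Z).
Proof.
move=> df dg; have [bS Se] := slice_r_spec t dg; have [bL Le] := slice_l_spec df.
have bf := iffLR (dualE f) df; have bg := iffLR (dualE g) dg.
have e := bl_eq_total (bl_comp bS bf) (bl_comp bL bg) (tens_dense t).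
have := congr1 (fun F => F Z) (e _); apply => _ [a _ [b _ <-]].
by rewrite Se Le (blZ bf) (blZ bg) /GRing.scale /= mulrC.
Qed.

Lemma dual_tens_pos f g : pos_dual f -> pos_dual g -> pos_dual (dual_tens t f g).
Proof.
move=> pf pg; have [d _ e] := dual_tens_spec pf.1 pg.1; split; first exact: d.
move=> Z; rewrite e; apply: (fpos pf); exact: (pmap_pos (slice_r_positive pg) (pos_star_mul _)).
Qed.

End LeftSlices.

Section SliceModule.
Variables (R : realType) (A B T : cstarType R) (t : min_tensor A B T).
Implicit Types (a p : A) (b w : B) (X Y Z : T).

Lemma tens_starM a b Z : (t a b)^† ∙ Z = l1 t a^† (l2 t b^† Z).
Proof.
have e : cmul (t a b)^† = (fun Z => l1 t a^† (l2 t b^† Z)).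
  apply: (bl_eq_total (act_bounded (left_mul_action T) _) (bl_comp (l2_bl t _) (l1_bl t _)) (tens_dense t)).
  by move=> _ [c _ [d _ <-]]; rewrite l2E l1E -tens_star tensM.
by have := congr1 (fun F => F Z) e.
Qed.

Section Right.
Variable (f : B -> R[i]).
Hypothesis df : dual f.
Let S := slice_r t f.

Lemma slice_r_bl : bounded_linear S. Proof. exact: (slice_r_spec t df).1. Qed.
Lemma slice_rE a b : S (t a b) = f b *: a. Proof. exact: (slice_r_spec t df).2. Qed.

Lemma slice_r_l1 a Z : S (l1 t a Z) = a ∙ S Z.
Proof.
have e : (fun Z => S (l1 t a Z)) = (fun Z => a ∙ S Z).
  apply: (bl_eq_total (bl_comp (l1_bl t _) slice_r_bl) _ (tens_dense t)).
    exact: bl_comp slice_r_bl (act_bounded (left_mul_action A) _).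
  by move=> _ [c _ [d _ <-]]; rewrite l1E !slice_rE cmulZr.
by have := congr1 (fun F => F Z) e.
Qed.

Lemma slice_r_starM a b Z : S ((t a b)^† ∙ Z) = a^† ∙ S (l2 t b^† Z).
Proof. by rewrite tens_starM slice_r_l1. Qed.
End Right.

Section Left.
Variable (f : A -> R[i]).
Hypothesis df : dual f.
Let S := slice_l t f.

Lemma slice_l_bl : bounded_linear S. Proof. exact: (slice_l_spec t df).1. Qed.
Lemma slice_lE a b : S (t a b) = f a *: b. Proof. exact: (slice_l_spec t df).2. Qed.

Lemma slice_l_l2 b Z : S (l2 t b Z) = b ∙ S Z.
Proof.
have e : (fun Z => S (l2 t b Z)) = (fun Z => b ∙ S Z).
  apply: (bl_eq_total (bl_comp (l2_bl t _) slice_l_bl) _ (tens_dense t)).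
    exact: bl_comp slice_l_bl (act_bounded (left_mul_action B) _).
  by move=> _ [c _ [d _ <-]]; rewrite l2E !slice_lE cmulZr.
by have := congr1 (fun F => F Z) e.
Qed.

End Left.
End SliceModule.

Lemma ord_neqF n (i j : 'I_n) : i != j -> (i == j :> nat) = false.
Proof. by move/negbTE. Qed.

(** * Density of elementary tensors in the GNS domain of eta ⊗ f *)

Section Density.
Variables (R : realType) (A B T : cstarType R) (t : min_tensor A B T).
Variables (eta : A -> \bar R) (f : B -> R[i]).
Hypothesis wt : weight eta.
Hypothesis lsc : forall r : R, closed [set a | pos_cone a /\ (eta a <= r%:E)%E].
Hypothesis pf : pos_dual f.
Implicit Types (a : A) (b : B) (X Y Z : T).
Local Notation S := (slice_r t f).
Local Notation N := (wN eta (@id A)).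
Local Notation ip := (wip eta (@id A)).
Local Notation NT := (wN eta S).
Local Notation ipT := (wip eta S).

Let bS := slice_r_bl t pf.1.
Let Se a b : S (t a b) = f b *: a. Proof. exact: (slice_rE t pf.1 a b). Qed.
Let pS := slice_r_positive t pf.
Let wI := wip_semi_inner wt (@id_positive R A).
Let tI := wip_semi_inner wt pS.
Let fI := fip_semi_inner pf.

Lemma wip_tens (p p' : A) (w w' : B) : N p -> N p' ->
  NT (t p w) /\ ipT (t p w) (t p' w') = ip p p' * fip f w w'.
Proof.
move=> Np Np'; split; last first.
  rewrite /wip -tens_star -tensM Se (wbarZ wt) 1?mulrC //.
  exact: (wN_dom wt (@id_positive R A)).
rewrite /wN /= -tens_star -tensM Se.
have -> : f (w^† ∙ w) = (sn (fip f) w ^+ 2)%:C by rewrite fsn2.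
by apply: (wfinZ wt _ Np).1; rewrite exprn_ge0 // sn_ge0.
Qed.

Lemma sn_tens (p : A) (w : B) : N p -> sn ipT (t p w) = sn ip p * sn (fip f) w.
Proof.
move=> Np; have [NT1 e] := wip_tens w w Np Np.
apply/eqP; rewrite -(@eqrXn2 _ 2) ?mulr_ge0 ?sn_ge0 //; apply/eqP/complexI.
by rewrite -(sn2 tI NT1) e exprMn (sn2 wI Np) (sn2 fI (I : setT w)) -rmorphM.
Qed.

Lemma slice_null (w : B) X : sn (fip f) w = 0 -> S (l2 t w^† X) = 0.
Proof.
move=> w0; have e : (fun X => S (l2 t w^† X)) = (fun=> 0).
  apply: (bl_eq_total (bl_comp (l2_bl t _) bS) (bl_zero _ _) (tens_dense t)).
  move=> _ [a _ [b _ <-]]; rewrite l2E Se.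
  have -> : f (w^† ∙ b) = Num.conj (fip f w b).
    by rewrite -(si_conj fI (I : setT w) (I : setT b)).
  by rewrite (si_ip0 fI (I : setT w) (I : setT b) w0) rmorph0 scale0r.
by have := congr1 (fun F => F X) e.
Qed.

Section Projection.
Variables (n : nat) (w : nat -> B).
Hypothesis on : on_family setT (fip f) n w.
Let c l Z := S (l2 t (w l)^† Z).
Let P Z := \sum_(l < n) t (c l Z) (w l).

(** Pythagoras with values in A: [P] is the projection of the second leg onto the span of the
    orthonormal w l. *)
Lemma slice_proj Z : S ((Z - P Z)^† ∙ (Z - P Z)) = S (Z^† ∙ Z) - \sum_(l < n) (c l Z)^† ∙ c l Z.
Proof.
set q := \sum_(l < n) (c l Z)^† ∙ c l Z.
have sq : q^† = q by rewrite cstar_sum; apply: eq_bigr => l _; rewrite cstarM cstarK.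
have [_ _ ps] := pS.
have e1 X : S ((P Z)^† ∙ X) = \sum_(l < n) (c l Z)^† ∙ c l X.
  rewrite cstar_sum cmul_suml (bl_sum bS); apply: eq_bigr => l _.
  by rewrite (slice_r_starM t pf.1).
have e2 : S ((P Z)^† ∙ P Z) = q.
  rewrite e1; apply: eq_bigr => l _; congr (_ ∙ _).
  rewrite /c (bl_sum (l2_bl t _)) (bl_sum bS) (bigD1 l) //= l2E Se.
  rewrite -[f _]/(fip f (w l) (w l)) on.2 // eqxx scale1r big1 ?addr0 // => m ml.
  rewrite l2E Se.
  by rewrite -[f _]/(fip f (w m) (w l)) on.2 // (ord_neqF ml) scale0r.
have e3 : S (Z^† ∙ P Z) = q.
  by have := ps ((P Z)^† ∙ Z); rewrite e1 -/q sq cstarM cstarK.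
rewrite cstarB cmulBl !cmulBr !(blB bS) e2 e1 e3 -/q opprB addrA subrK; by [].
Qed.

Lemma proj_tens a b : sn (fip f) (b - on_proj (fip f) n w b) = 0 ->
  exists2 b0, sn (fip f) b0 = 0 & t a b - P (t a b) = t a b0.
Proof.
move=> b0; exists (b - on_proj (fip f) n w b) => //.
rewrite tensBr tens_sumr; congr (_ - _); apply: eq_bigr => l _.
rewrite /c l2E Se.
by rewrite tensZl -tensZr.
Qed.

Lemma proj_additive X Y : P (X + Y) = P X + P Y.
Proof.
rewrite /P -big_split; apply: eq_bigr => l _ /=.
by rewrite /c (blD (l2_bl t _)) (blD bS) tensDl.
Qed.

(** Best approximation: a sum with second legs in the span of the w l is fixed by [P] up to null
    vectors, so Z - P Z arises from Z - ev t x by the complementary projection. *)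
Lemma slice_proj_code (x : seq (A * B)) Z :
  (forall p : A * B, p \in x -> sn (fip f) (p.2 - on_proj (fip f) n w p.2) = 0) ->
  nm (S ((Z - P Z)^† ∙ (Z - P Z))) <= nm (S ((Z - ev t x)^† ∙ (Z - ev t x))).
Proof.
move=> hx; set D := Z - ev t x; have [_ pp ps] := pS.
have null X : S ((ev t x - P (ev t x))^† ∙ X) = 0.
  elim: (x) hx => [|p y IH] hx.
    rewrite /ev big_nil; have -> : P 0 = 0.
      by apply: (addrI (P 0)); rewrite -proj_additive !addr0.
    by rewrite subrr cstar0 cmul0l (bl0 bS).
  have -> : ev t (p :: y) = t p.1 p.2 + ev t y by rewrite /ev big_cons.
  rewrite proj_additive opprD addrACA cstarD cmulDl (blD bS) IH ?addr0; last first.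
    by move=> q qy; apply: hx; rewrite inE qy orbT.
  have [b0 nb0 ->] := @proj_tens p.1 p.2 (hx p (mem_head _ _)).
  by rewrite (slice_r_starM t pf.1) slice_null // cmul0r.
have e : Z - P Z = (D - P D) + (ev t x - P (ev t x)).
  rewrite addrACA -opprD -proj_additive /D subrK; by [].
have -> : S ((Z - P Z)^† ∙ (Z - P Z)) = S ((D - P D)^† ∙ (D - P D)).
  rewrite e; move: null; move: (ev t x - P (ev t x)) (D - P D) => V U null.
  rewrite cstarD cmulDl !cmulDr !(blD bS) !null !addr0.
  by have := ps (V^† ∙ U); rewrite null cstar0 cstarM cstarK => ->; rewrite addr0.
apply: pos_le_nm; first exact: pp.
rewrite slice_proj opprB addrC subrK; apply: pos_sum => l _; exact: pos_star_mul.
Qed.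

End Projection.

(** Norm approximants of Z may have infinite weight. They only supply second legs; projecting Z
    itself onto the span of these legs gives tensors with coefficients in N. The squared errors lie
    below S (Z^† Z) and tend to 0 in norm, so [wval_small] makes their weight small. *)
Lemma tens_dense_r Z (d : R) : NT Z -> 0 < d -> exists n (p : nat -> A) (w : nat -> B),
  [/\ on_family setT (fip f) n w, forall l, N (p l) &
      NT (Z - \sum_(l < n) t (p l) (w l)) /\ sn ipT (Z - \sum_(l < n) t (p l) (w l)) < d].
Proof.
move=> NZ d0; have [_ pp _] := pS; have [x xZ] := ev_dense t Z.
have /choice[w Hw] : forall n, exists w : nat * (nat -> B), on_family setT (fip f) w.1 w.2 /\
    forall p : A * B, p \in x n -> sn (fip f) (p.2 - on_proj (fip f) w.1 w.2 p.2) = 0.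
  move=> n; pose v i := nth 0 [seq p.2 | p <- x n] i.
  have [m [e [on h]]] := gram_schmidt fI (size (x n)) (v := v) (fun=> I).
  exists (m, e); split=> // p px; have hp := map_f snd px; have := h (index p.2 [seq q.2 | q <- x n]).
  by rewrite /v nth_index // -[size (x n)](size_map snd) index_mem; apply.
pose c n l := S (l2 t ((w n).2 l)^† Z).
pose P n := \sum_(l < (w n).1) t (c n l) ((w n).2 l).
have cE n : S ((Z - P n)^† ∙ (Z - P n)) = S (Z^† ∙ Z) - \sum_(l < (w n).1) (c n l)^† ∙ c n l.
  exact: (slice_proj (Hw n).1 Z).
pose D n := Z - ev t (x n).
have D0 : scvg (fun n => S ((D n)^† ∙ D n)) 0.
  have h1 : scvg D 0.
    by move=> e /xZ[N0 HN]; exists N0 => n /HN; rewrite subr0 nmC.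
  have := bl_scvg bS (scvgM (scvg_star h1) h1); by rewrite cmul0r (bl0 bS).
have c0 : scvg (fun n => S ((Z - P n)^† ∙ (Z - P n))) 0.
  move=> e /D0[N0 HN]; exists N0 => n /HN; rewrite !subr0; apply: le_lt_trans.
  by apply: (slice_proj_code (Hw n).1); exact: (Hw n).2.
have cpos n : pos_cone (S (Z^† ∙ Z) - S ((Z - P n)^† ∙ (Z - P n))).
  by rewrite cE opprB addrC subrK; apply: pos_sum => l _; apply: pos_star_mul.
have [n Hn] := wval_small wt lsc NZ (exprn_gt0 2 d0) c0 (fun n => pp _) cpos.
exists (w n).1, (fun l => if (l < (w n).1)%N then c n l else 0), (w n).2.
have -> : \sum_(l < (w n).1) t (if (l < (w n).1)%N then c n l else 0) ((w n).2 l) = P n.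
  by apply: eq_bigr => l _; rewrite ltn_ord.
have NP : NT (Z - P n) by apply: (wfin_le wt NZ (pp _) (cpos n)).1.
split; [exact: (Hw n).1 | | split=> //]; last first.
  rewrite -(@ltr_pXn2r _ 2) ?nnegrE ?sn_ge0 ?(ltW d0) //.
  by rewrite (wsn2 wt pS NP).
move=> l; case: ifP => [ln|_]; last by rewrite /wN /= cmul0r; exact: (wfin0 wt).1.
apply: (wfin_le wt NZ (pos_star_mul _) _).1.
have := pp (Z - P n); rewrite cE => h.
have -> : S (Z^† ∙ Z) - (c n l)^† ∙ c n l = (S (Z^† ∙ Z) - \sum_(l < (w n).1) (c n l)^† ∙ c n l)
    + \sum_(m < (w n).1 | m != Ordinal ln) (c n m)^† ∙ c n m.
  by rewrite [in RHS](bigD1 (Ordinal ln)) //= opprD addrA subrK.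
by apply: posD => //; apply: pos_sum => m _; apply: pos_star_mul.
Qed.

Lemma sn_tens_on_r n (p : nat -> A) (w : nat -> B) : on_family setT (fip f) n w -> (forall l, N (p l)) ->
  sn ipT (\sum_(l < n) t (p l) (w l)) ^+ 2 = \sum_(l < n) sn ip (p l) ^+ 2.
Proof.
move=> on Np; have NT1 l : NT (t (p l) (w l)) by case: (wip_tens (w l) (w l) (Np l) (Np l)).
have NS : NT (\sum_(l < n) t (p l) (w l)) by apply: (siN_sum tI).
apply: complexI; rewrite -(sn2 tI NS) (si_suml tI) // rmorph_sum; apply: eq_bigr => l _.
rewrite (si_sumr tI) // (bigD1 l) //= (wip_tens _ _ (Np l) (Np l)).2 on.2 // eqxx mulr1.
rewrite big1 ?addr0 ?(sn2 wI (Np l)) // => m ml.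
by rewrite (wip_tens _ _ (Np l) (Np m)).2 on.2 // eq_sym (ord_neqF ml) mulr0.
Qed.

Lemma sn_tens_on_l n (p : nat -> A) (w : nat -> B) : on_family N ip n p ->
  sn ipT (\sum_(l < n) t (p l) (w l)) ^+ 2 = \sum_(l < n) sn (fip f) (w l) ^+ 2.
Proof.
move=> [Np on]; have NT1 l : NT (t (p l) (w l)) by case: (wip_tens (w l) (w l) (Np l) (Np l)).
have NS : NT (\sum_(l < n) t (p l) (w l)) by apply: (siN_sum tI).
apply: complexI; rewrite -(sn2 tI NS) (si_suml tI) // rmorph_sum; apply: eq_bigr => l _.
rewrite (si_sumr tI) // (bigD1 l) //= (wip_tens _ _ (Np l) (Np l)).2 on // eqxx mul1r.
rewrite big1 ?addr0 ?(sn2 fI (I : setT (w l))) // => m ml.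
by rewrite (wip_tens _ _ (Np l) (Np m)).2 on // eq_sym (ord_neqF ml) mul0r.
Qed.

(** Orthonormalizing the first legs changes the sum only by null vectors. *)
Lemma tens_dense_l Z (d : R) : NT Z -> 0 < d -> exists n (p : nat -> A) (w : nat -> B),
  [/\ on_family N ip n p &
      NT (Z - \sum_(l < n) t (p l) (w l)) /\ sn ipT (Z - \sum_(l < n) t (p l) (w l)) < d].
Proof.
move=> NZ d0; have [n [p [w [on Np [ND sD]]]]] := tens_dense_r NZ d0.
have [m [e [oe he]]] := gram_schmidt wI n Np; have [Ne _] := oe.
pose w' j := \sum_(l < n) ip (p l) (e j) *: w l.
exists m, e, w'; split=> //.
have NP l := proj_N wI (p l) oe.
have Nr l : N (p l - on_proj ip m e (p l)) by apply: (siNB wI).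
have e1 : Z - \sum_(j < m) t (e j) (w' j) =
   (Z - \sum_(l < n) t (p l) (w l)) + \sum_(l < n) t (p l - on_proj ip m e (p l)) (w l).
  have -> : \sum_(l < n) t (p l - on_proj ip m e (p l)) (w l) =
     \sum_(l < n) t (p l) (w l) - \sum_(l < n) t (on_proj ip m e (p l)) (w l).
    by rewrite -sumrB; apply: eq_bigr => l _; rewrite tensDl -scaleN1r tensZl scaleN1r.
  rewrite addrA subrK; congr (_ - _).
  have -> : \sum_(l < n) t (on_proj ip m e (p l)) (w l) =
    \sum_(l < n) \sum_(j < m) t (e j) (ip (p l) (e j) *: w l).
    apply: eq_bigr => l _; rewrite tens_suml; apply: eq_bigr => j _.
    by rewrite tensZl tensZr.
  by rewrite exchange_big; apply: eq_bigr => j _; rewrite tens_sumr.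
have NT1 l : NT (t (p l - on_proj ip m e (p l)) (w l)) by case: (wip_tens (w l) (w l) (Nr l) (Nr l)).
have NS : NT (\sum_(l < n) t (p l - on_proj ip m e (p l)) (w l)) by apply: (siN_sum tI).
rewrite e1; split; first exact: (siND tI).
apply: le_lt_trans (snD tI ND NS) _; apply: le_lt_trans sD.
rewrite -[leRHS]addr0; apply: lerD => //; apply: le_trans (sn_sum tI _ _) _; first exact: NT1.
rewrite big1 // => l _; rewrite sn_tens // he ?mul0r //.
Qed.

End Density.

Section LinearFunctional.
Variables (R : realType) (V : normedModType R[i]) (f : V -> R[i]).
Hypothesis bf : bounded_linear (f : V -> R[i]^o).
Lemma flD x y : f (x + y) = f x + f y. Proof. exact: (blD bf). Qed.
Lemma flB x y : f (x - y) = f x - f y. Proof. exact: (blB bf). Qed.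
Lemma flZ k x : f (k *: x) = k * f x. Proof. exact: (blZ bf). Qed.
End LinearFunctional.

Lemma scvg_ge0 (R : realType) (u : nat -> R[i]) (l : R[i]) :
  (forall n, 0 <= u n) -> scvg (u : nat -> R[i]^o) (l : R[i]^o) -> 0 <= l.
Proof.
move=> u0 ul; have -> : l = (nmc l)%:C; last by rewrite ler0c nmc_ge0.
apply: (@scvg_uniq _ (R[i]^o) u) => // e /ul[N HN]; exists N => n /HN; apply: le_lt_trans.
have eu : u n = (nmc (u n))%:C by rewrite -nmcE ger0_norm.
rewrite !nmc_nm {1}eu -rmorphB nmc_real.
have sw : nmc (l - u n) = nmc (u n - l) by rewrite /nmc distrC.
rewrite ler_norml; apply/andP; split.
  have := nmcD (u n) (l - u n); rewrite [u n + _]addrC subrK sw; lra.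
have := nmcD (u n - l) l; rewrite subrK; lra.
Qed.

Section ActionMultiplier.
Variables (R : realType) (A B : cstarType R) (pi : A -> B -> B).
Hypothesis hpi : action pi.

Definition act_mult (a : A) : multiplier B :=
  get [set m | mL m = pi a /\ mL (mstar m) = pi a^†].

Lemma act_multE a : mL (act_mult a) = pi a /\ mL (mstar (act_mult a)) = pi a^†.
Proof.
have [m hm] := mLE (act_adjoint hpi a).
exact: (@get_spec _ [set m | mL m = pi a /\ mL (mstar m) = pi a^†] m hm).
Qed.

Lemma act_mult_good a : good (act_mult a).
Proof.
have [e1 e2] := act_multE a; rewrite /good e1 e2.
by split; apply: act_defect.
Qed.
End ActionMultiplier.

Section TensorBound.
Variables (R : realType) (A B T : cstarType R) (t : min_tensor A B T).

Lemma tens_bound a b : nm (t a b) <= nm a * nm b.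
Proof.
rewrite -nm_star; apply: nm_le_mul => [|Z]; first by rewrite mulr_ge0 ?nm_ge0.
rewrite tens_starM -(nm_star a) -(nm_star b) -mulrA.
apply: le_trans (act_bound (l1_action t) _ _) _; apply: ler_wpM2l; first exact: nm_ge0.
exact: act_bound (l2_action t) _ _.
Qed.

Lemma tens_bl_l b : bounded_linear (t^~ b).
Proof.
split; first by move=> k a a'; rewrite tensPl.
by exists (nm b) => [|a]; [exact: nm_ge0 | rewrite mulrC tens_bound].
Qed.
Lemma tens_bl_r a : bounded_linear (t a).
Proof.
split; first by move=> k b b'; rewrite tensPr.
by exists (nm a) => [|b]; [exact: nm_ge0 | exact: tens_bound].
Qed.
End TensorBound.

(** * Tensor products of representations *)

Section TensorAction.
Variables (R : realType) (A1 A2 AA B1 B2 BB : cstarType R).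
Variables (t : min_tensor A1 A2 AA) (s : min_tensor B1 B2 BB).
Variables (pi1 : A1 -> B1 -> B1) (pi2 : A2 -> B2 -> B2).
Hypothesis (h1 : action pi1) (h2 : action pi2).
Implicit Types (x y : seq (A1 * A2)) (u v w : seq (B1 * B2)) (X Y : BB) (Z : AA).

Let O (a : A1) (a' : A2) : BB -> BB := mL (mtens s (act_mult pi1 a) (act_mult pi2 a')).

Let OE a a' b b' : O a a' (s b b') = s (pi1 a b) (pi2 a' b').
Proof.
have [_ e _] := mtens_spec s (act_mult_good h1 a) (act_mult_good h2 a').
by rewrite /O e (act_multE h1 a).1 (act_multE h2 a').1.
Qed.
Let O_bl a a' : bounded_linear (O a a').
Proof. by have [] := mtens_spec s (act_mult_good h1 a) (act_mult_good h2 a'). Qed.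
Let O_eq (F : BB -> BB) a a' : bounded_linear F ->
  (forall b b', F (s b b') = s (pi1 a b) (pi2 a' b')) -> O a a' = F.
Proof.
move=> bF Fe; apply: (bl_eq_total (O_bl _ _) bF (tens_dense s)).
by move=> _ [b _ [b' _ <-]]; rewrite OE Fe.
Qed.
Let O_adj a a' : adjoint_pair (O a a') (O a^† a'^†).
Proof.
apply: (adjoint_total (O_bl _ _) (O_bl _ _) (tens_dense s)) => _ _ [b _ [b' _ <-]] [c _ [c' _ <-]].
by rewrite !OE -!tens_star -!tensM !(act_adj h1, act_adj h2).
Qed.
Let O_mul a a' b b' X : O (a ∙ b) (a' ∙ b') X = O a a' (O b b' X).
Proof.
rewrite (O_eq (F := fun X => O a a' (O b b' X))) //; first exact: bl_comp (O_bl _ _) (O_bl _ _).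
by move=> c c'; rewrite !OE (actM h1) (actM h2).
Qed.

Let opx x X : BB := \sum_(p <- x) O p.1 p.2 X.
Let opc x u : seq (B1 * B2) := [seq (pi1 p.1 q.1, pi2 p.2 q.2) | p <- x, q <- u].

Let opx_bl x : bounded_linear (opx x).
Proof.
rewrite /opx; elim: x => [|p x IH].
  have -> : (fun X => \sum_(p <- [::]) O p.1 p.2 X) = (fun=> 0) by apply: funext => X; rewrite big_nil.
  exact: bl_zero.
have -> : (fun X => \sum_(q <- p :: x) O q.1 q.2 X) = (fun X => 1 *: O p.1 p.2 X + \sum_(q <- x) O q.1 q.2 X).
  by apply: funext => X; rewrite big_cons scale1r.
exact: bl_comb.
Qed.

Let opx_code x u : opx x (ev s u) = ev s (opc x u).
Proof.
rewrite /opx /ev big_allpairs_dep; apply: eq_bigr => p _.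
by rewrite (bl_sum (O_bl _ _)); apply: eq_bigr => q _; rewrite OE.
Qed.

Section VectorState.
Variables (f : B1 -> R[i]) (g : B2 -> R[i]) (xi : seq (B1 * B2)).
Hypothesis (pf : pos_dual f) (pg : pos_dual g).
Local Notation E := (code_form f g).
Let F := dual_tens s f g.

Let F_pos : pos_dual F. Proof. exact: dual_tens_pos. Qed.
Let F_bl : bounded_linear (F : BB -> R[i]^o). Proof. by apply/dualE; case: F_pos. Qed.
Let F_E u v : F ((ev s v)^† ∙ ev s u) = E u v.
Proof.
have [_ Fe _] := dual_tens_spec s pf.1 pg.1.
rewrite code_formE /ev cstar_sum cmul_suml (bl_sum F_bl); apply: eq_bigr => q _.
by rewrite cmul_sumr (bl_sum F_bl); apply: eq_bigr => p _; rewrite -tens_star -tensM /F Fe.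
Qed.

(* The vector functional of [xi] under the (not yet extended) representation. *)
Let Phi : {Phi : AA -> R[i] | bounded_linear (Phi : AA -> R[i]^o) &
  forall a a', Phi (t a a') = F ((ev s xi)^† ∙ O a a' (ev s xi))}.
Proof.
apply: cid2; have main (v : seq (B1 * B2)) : exists2 Phi : AA -> R[i], bounded_linear (Phi : AA -> R[i]^o) &
    forall a a', Phi (t a a') = F ((ev s xi)^† ∙ O a a' (ev s v)).
  have pair (p q : B1 * B2) : exists2 Phi : AA -> R[i], bounded_linear (Phi : AA -> R[i]^o) &
      forall a a', Phi (t a a') = F ((s q.1 q.2)^† ∙ O a a' (s p.1 p.2)).
    have vf (D E : cstarType R) (pi : D -> E -> E) (k : E -> R[i]) c d : action pi -> dual k ->
        dual (fun a => k (d^† ∙ pi a c)).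
      move=> hpi dk; apply/dualE.
      have b1 : bounded_linear (fun a => pi a c).
        split; first by move=> l a b; have [h _ _] := hpi; rewrite h.
        by exists (nm c) => [|a]; [exact: nm_ge0 | rewrite mulrC; exact: act_bound].
      apply: (bl_comp (bl_comp b1 (act_bounded (left_mul_action E) d^†))); exact/dualE.
    have d1 := vf _ _ _ _ p.1 q.1 h1 pf.1; have d2 := vf _ _ _ _ p.2 q.2 h2 pg.1.
    have [d3 e3 _] := dual_tens_spec t d1 d2.
    exists (dual_tens t (fun a => f (q.1^† ∙ pi1 a p.1)) (fun a => g (q.2^† ∙ pi2 a p.2))).
      by apply/dualE.
    move=> a a'; rewrite e3 OE -tens_star -tensM /F.
    by have [_ -> _] := dual_tens_spec s pf.1 pg.1.
  have inner (w : seq (B1 * B2)) : exists2 Phi : AA -> R[i], bounded_linear (Phi : AA -> R[i]^o) &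
      forall a a', Phi (t a a') = F ((ev s w)^† ∙ O a a' (ev s v)).
    elim: w => [|q w [P1 bP1 eP1]].
      exists (fun=> 0); first exact: bl_zero.
      by move=> a a'; rewrite /ev big_nil cstar0 cmul0l (bl0 F_bl).
    have [P2 bP2 eP2] : exists2 Phi : AA -> R[i], bounded_linear (Phi : AA -> R[i]^o) &
        forall a a', Phi (t a a') = F ((s q.1 q.2)^† ∙ O a a' (ev s v)).
      elim: (v) => [|p v' [P2 bP2 eP2]].
        exists (fun=> 0); first exact: bl_zero.
        by move=> a a'; rewrite /ev big_nil (bl0 (O_bl _ _)) cmul0r (bl0 F_bl).
      have [P3 bP3 eP3] := pair p q.
      exists (fun Z => 1 * P3 Z + P2 Z); first exact: (bl_comb 1 bP3 bP2).
      move=> a a'; rewrite eP3 eP2 mul1r -(blD F_bl) -cmulDr -(blD (O_bl _ _)).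
      by rewrite [in RHS]/ev big_cons.
    exists (fun Z => 1 * P2 Z + P1 Z); first exact: (bl_comb 1 bP2 bP1).
    move=> a a'; rewrite eP1 eP2 mul1r -(blD F_bl) -cmulDl -cstarD.
    by rewrite [in RHS]/ev big_cons.
  exact: inner.
exact: main.
Qed.

(** The vector functional of xi extends to a positive functional P on AA whose mass is c. Evaluating
    at the root of M - x^† x then gives P (x^† x) <= M c for all M above the squared norm of x. *)
Lemma vector_state_bound x : E (opc x xi) (opc x xi) <= (nm (ev t x) ^+ 2)%:C * E xi xi.
Proof.
have [P bP eP] := Phi; set c := F ((ev s xi)^† ∙ ev s xi).
have PC y : P (ev t y) = F ((ev s xi)^† ∙ opx y (ev s xi)).
  rewrite /ev (bl_sum bP) /opx cmul_sumr (bl_sum F_bl); apply: eq_bigr => p _.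
  exact: eP.
have opx_star y X Y : (opx y X)^† ∙ Y = X^† ∙ opx (formal_star y) Y.
  rewrite /opx cstar_sum cmul_suml cmul_sumr big_map; apply: eq_bigr => p _.
  exact: O_adj.
have ev_star y : (ev t y)^† = ev t (formal_star y).
  by rewrite /ev cstar_sum big_map; apply: eq_bigr => p _; rewrite tens_star.
have ev_mul y z : ev t y ∙ ev t z = ev t (formal_mul y z).
  rewrite /ev cmul_suml big_allpairs_dep; apply: eq_bigr => p _.
  by rewrite cmul_sumr; apply: eq_bigr => q _; rewrite tensM.
have opx_mul y z X : opx y (opx z X) = opx (formal_mul y z) X.
  rewrite /opx big_allpairs_dep; apply: eq_bigr => p _.
  by rewrite (bl_sum (O_bl _ _)); apply: eq_bigr => q _; rewrite O_mul.
have PM y z : P ((ev t y)^† ∙ ev t z) = F ((opx y (ev s xi))^† ∙ opx z (ev s xi)).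
  by rewrite ev_star ev_mul PC -opx_mul opx_star.
(* This is the squared length of (1 - Z) xi, whose nonnegativity passes from formal sums to all of
   AA. At Z = S, multiplied by M, it is M c - P (x^† x). *)
pose def Z := c - P Z - Num.conj (P Z) + P (Z^† ∙ Z).
have P_pos : pos_dual P.
  split; first exact/dualE.
  move=> Z; have [y yZ] := ev_dense t Z.
  apply: (scvg_ge0 _ (bl_scvg bP (scvgM (scvg_star yZ) yZ))) => n /=.
  by rewrite PM; case: F_pos.
have def_ge0 Z : 0 <= def Z.
  have [y yZ] := ev_dense t Z.
  have h k : 0 <= def (ev t (y k)).
    have -> : def (ev t (y k)) = F ((ev s xi - opx (y k) (ev s xi))^† ∙ (ev s xi - opx (y k) (ev s xi))).
      rewrite /def PM PC -(pos_dual_star F_pos) cstarM cstarK.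
      by rewrite cstarB cmulBl !cmulBr !(blB F_bl) -/c; ring.
    by case: F_pos.
  have h1' := bl_scvg bP yZ; have h2' := bl_scvg bP (scvgM (scvg_star yZ) yZ).
  have h4 : scvg (fun k => Num.conj (P (ev t (y k))) : R[i]^o) (Num.conj (P Z) : R[i]^o).
    by move=> r /h1'[N HN]; exists N => k /HN; rewrite !nmc_nm /= -rmorphB nmcJ.
  apply: (scvg_ge0 h).
  have := scvgD (scvgD (scvgD (scvg_cst (c : R[i]^o)) (scvgZ (-1) h1')) (scvgZ (-1) h4)) h2'.
  by move=> H r /H[N HN]; exists N => k /HN; rewrite /= !scaleN1r.
have Phh : P ((ev t x)^† ∙ ev t x) = E (opc x xi) (opc x xi).
  by rewrite PM !opx_code F_E.
have key M : nm (ev t x) ^+ 2 < M -> E (opc x xi) (opc x xi) <= M%:C * E xi xi.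
  move=> hM; have [||S [sS eS _]] := @sqrt_gap _ _ ((ev t x)^† ∙ ev t x) M.
  - by rewrite cstarM cstarK.
  - by rewrite nm_cstar2.
  have M0 : 0 <= M by apply: le_trans (ltW hM); rewrite exprn_ge0 // nm_ge0.
  have := def_ge0 S; rewrite /def -(pos_dual_star P_pos) sS => d0.
  have : 0 <= M%:C * (c - P S - P S + P (S ∙ S)) by rewrite mulr_ge0 // ler0c.
  move=> d1; rewrite -Phh -eS (flZ bP) (flB bP) (flD bP) -F_E -/c -subr_ge0.
  by move: d1; congr (_ <= _); ring.
rewrite -!(code_norm_sqr s pf pg) -rmorphM lecR.
apply: (@le_eps _ _ _ (code_norm f g xi ^+ 2)) => r r0.
have := key (nm (ev t x) ^+ 2 + r); rewrite ltrDl => /(_ r0).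
rewrite -!(code_norm_sqr s pf pg) -rmorphM lecR => h; apply: le_trans h _.
by rewrite mulrDl [r * _]mulrC.
Qed.

End VectorState.

Let opx_bound x X : nm (opx x X) <= nm (ev t x) * nm X.
Proof.
have code u : nm (opx x (ev s u)) <= nm (ev t x) * nm (ev s u).
  rewrite opx_code -lecR -nmE; set c := nm (ev t x) * nm (ev s u).
  have c0 : 0 <= c by rewrite mulr_ge0 ?nm_ge0.
  rewrite /ev; apply/(tens_norm s _ c0) => f g pf pg y /=.
  have -> : formal_mul (opc x u) y = opc x (formal_mul u y).
    rewrite /opc; elim: (x) => [|p x' IH] //=; rewrite -IH /formal_mul allpairs_cat; congr cat.
    rewrite allpairs_mapl map_allpairs; apply: eq_allpairs => q r /=.
    by rewrite (act_mulr h1) (act_mulr h2).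
  have h := vector_state_bound (formal_mul u y) pf pg x.
  have -> : (c ^+ 2)%:C = (nm (ev t x) ^+ 2)%:C * (nm (ev s u) ^+ 2)%:C by rewrite -rmorphM -exprMn.
  apply: le_trans h _; rewrite -mulrA.
  apply: ler_wpM2l; first by rewrite ler0c exprn_ge0 // nm_ge0.
  exact: code_form_spatial.
have [y yX] := ev_dense s X.
have := bl_scvg (opx_bl x) yX => hx; apply: (@le_eps _ _ _ (nm (ev t x) + 1)) => r r0.
have [N1 H1] := hx _ r0; have [N2 H2] := yX _ r0.
have := H1 _ (leq_maxl N1 N2); have := H2 _ (leq_maxr N1 N2); set n := maxn _ _ => k2 k1.
have := code (y n); have := nm_tri (opx x X) (opx x (ev s (y n))) 0; rewrite !subr0 nmC => k3 k4.
have := nm_tri (ev s (y n)) X 0; rewrite !subr0 => k5.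
have k6 : nm (ev t x) * nm (ev s (y n)) <= nm (ev t x) * (r + nm X).
  by apply: ler_wpM2l; [exact: nm_ge0 | lra].
have : nm (opx x (ev s (y n)) - opx x X) < r by [].
lra.
Qed.

(** Contractivity of pi1 ⊗ pi2 for the minimal norms. It furnishes the witness selected by
    [hom_tens]. *)
Lemma tens_action : exists2 Pi : AA -> BB -> BB, action Pi &
  forall a a' b b', Pi (t a a') (s b b') = s (pi1 a b) (pi2 a' b').
Proof.
have ex X : exists2 S : AA -> BB, bounded_linear S & forall a a', S (t a a') = O a a' X.
  apply: (@tens_ext _ _ _ _ t BB (fun a a' => O a a' X) (nm X) (nm_ge0 X)) => [k a b a'|x].
    rewrite (O_eq (F := fun X => k *: O a a' X + O b a' X)) //; first exact: bl_comb.
    by move=> c c'; rewrite !OE; have [-> _ _] := h1; rewrite tensPl.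
  by rewrite mulrC; exact: opx_bound.
have /choice[P HP] : forall X, exists S : AA -> BB, bounded_linear S /\ forall a a', S (t a a') = O a a' X.
  by move=> X; have [S bS eS] := ex X; exists S.
have bP X : bounded_linear (P X) := (HP X).1.
have eP X a a' : P X (t a a') = O a a' X := (HP X).2 a a'.
have Pb Z X : nm (P X Z) <= nm Z * nm X.
  have [y yZ] := ev_dense t Z; have h1' := bl_scvg (bP X) yZ.
  apply: (@le_eps _ _ _ (nm X + 1)) => r r0.
  have [N1 H1] := h1' _ r0; have [N2 H2] := yZ _ r0.
  have := H1 _ (leq_maxl N1 N2); have := H2 _ (leq_maxr N1 N2); set n := maxn _ _ => k2 k1.
  have k4 : nm (P X (ev t (y n))) <= nm (ev t (y n)) * nm X.
    rewrite {1}/ev (bl_sum (bP X)); under eq_bigr do rewrite eP; exact: opx_bound.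
  have := nm_tri (P X Z) (P X (ev t (y n))) 0; rewrite !subr0 nmC => k3.
  have := nm_tri (ev t (y n)) Z 0; rewrite !subr0 => k5.
  have k6 : nm (ev t (y n)) * nm X <= (r + nm Z) * nm X.
    by apply: ler_wpM2r; [exact: nm_ge0 | lra].
  have : nm (P X (ev t (y n)) - P X Z) < r by [].
  lra.
have adj Z X Y : (P X Z)^† ∙ Y = X^† ∙ P Y Z^†.
  have e : (fun Z => Y^† ∙ P X Z) = (fun Z => (P Y Z^†)^† ∙ X).
    apply: (bl_eq_total (bl_comp (bP X) (act_bounded (left_mul_action BB) _)) _ (tens_dense t)).
      split; first by move=> k U V; rewrite cstarP (blP (bP Y)) cstarP conjCK cmulDl cmulZl.
      exists (nm Y * nm X) => [|U]; first by rewrite mulr_ge0 ?nm_ge0.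
      apply: le_trans (nmM _ _) _; rewrite nm_star.
      apply: le_trans (ler_wpM2r (nm_ge0 X) (Pb _ _)) _.
      by rewrite nm_star (_ : nm U * nm Y * nm X = nm Y * nm X * nm U) //; ring.
    move=> _ [a _ [a' _ <-]]; rewrite eP -tens_star eP.
    by have := O_adj a^† a'^† Y X; rewrite !cstarK.
  by have := congr1 (fun F => (F Z)^†) e; rewrite /= !cstarM !cstarK.
have bX Z : bounded_linear (fun X => P X Z).
  split; last by exists (nm Z) => [|X]; [exact: nm_ge0 | exact: Pb].
  apply: (@adjoint_linear _ _ _ (fun X => P X Z^†)) => X Y; exact: adj.
exists (fun Z X => P X Z); last by move=> a a' b b'; rewrite eP OE.
split; [by move=> k Z W X; rewrite (blP (bP X)) | | by move=> Z X Y; exact: adj].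
have step (a : A1) (a' : A2) Z X : P X (Z ∙ t a a') = P (O a a' X) Z.
  have rm : bounded_linear (fun Z => Z ∙ t a a').
    split; first by move=> k U V; rewrite cmulDl cmulZl.
    by exists (nm (t a a')) => [|U]; [exact: nm_ge0 | rewrite mulrC nmM].
  have e := bl_eq_total (bl_comp rm (bP X)) (bP (O a a' X)) (tens_dense t).
  have := congr1 (fun F => F Z) (e _); apply => _ [b _ [b' _ <-]].
  by rewrite -tensM !eP O_mul.
move=> Z W X; have e := bl_eq_total (bl_comp (act_bounded (left_mul_action AA) Z) (bP X))
  (bl_comp (bP X) (bX Z)) (tens_dense t).
have := congr1 (fun F => F W) (e _); apply => _ [a _ [a' _ <-]].
by rewrite step eP.
Qed.

End TensorAction.

(** * The comultiplication *)

Section ClosedSpan.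
Variables (R : realType).

Lemma cspan_scvg (A : cstarType R) (S : set A) u l : (forall n, cspan S (u n)) -> scvg u l -> cspan S l.
Proof. by move=> Su ul; apply: (@closed_scvg _ _ (cspan S) u l (@closed_closure _ _) Su ul). Qed.

Lemma cspan_sub (A : cstarType R) (S : set A) x : S x -> cspan S x.
Proof.
move=> Sx; apply: subset_closure; exists 1%N, (fun=> 1), (fun=> x); split=> //.
by rewrite big_ord1 scale1r.
Qed.

Lemma lin_span_P (A : cstarType R) (S : set A) k x y : lin_span S x -> lin_span S y -> lin_span S (k *: x + y).
Proof.
move=> [n [l [s [Ss ->]]]] [m [l' [s' [Ss' ->]]]].
exists (n + m)%N, (fun i : 'I_(n + m) => match fintype.split i with inl j => k * l j | inr j => l' j end),
  (fun i : 'I_(n + m) => match fintype.split i with inl j => s j | inr j => s' j end); split.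
  by move=> i; case: (fintype.split i).
rewrite big_split_ord scaler_sumr /=; congr (_ + _); apply: eq_bigr => i _.
  by rewrite -[lshift m i]/(unsplit (inl i)) unsplitK scalerA.
by rewrite -[rshift n i]/(unsplit (inr i)) unsplitK.
Qed.

Lemma cspan_P (A : cstarType R) (S : set A) k x y : cspan S x -> cspan S y -> cspan S (k *: x + y).
Proof.
move=> /closure_scvg[u [Su ux]] /closure_scvg[v [Sv vy]].
apply: (@cspan_scvg _ _ (fun n => k *: u n + v n)).
  by move=> n; apply: subset_closure; apply: lin_span_P.
by apply: scvgD => //; apply: scvgZ.
Qed.

Lemma cspan0 (A : cstarType R) (S : set A) : cspan S 0.
Proof.
apply: subset_closure; exists 0%N, (fun=> 0), (fun=> 0); split; first by case.
by rewrite big_ord0.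
Qed.

Lemma cspan_sum (A : cstarType R) (S : set A) (I : Type) (r : seq I) (P : pred I) (F : I -> A) :
  (forall i, P i -> cspan S (F i)) -> cspan S (\sum_(i <- r | P i) F i).
Proof.
move=> h; elim/big_ind: _ => //; first exact: cspan0.
by move=> x y Sx Sy; rewrite -[x]scale1r; apply: cspan_P.
Qed.

Lemma cspanZ (A : cstarType R) (S : set A) k x : cspan S x -> cspan S (k *: x).
Proof. by move=> Sx; rewrite -[k *: x]addr0; apply: cspan_P => //; apply: cspan0. Qed.

Lemma cspan_image (A B : cstarType R) (S : set A) (S' : set B) (F : A -> B) : bounded_linear F ->
  (forall x, S x -> cspan S' (F x)) -> forall x, cspan S x -> cspan S' (F x).
Proof.
move=> bF h x /closure_scvg[u [Su ux]]; apply: cspan_scvg (bl_scvg bF ux) => n /=.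
have [m [k [s [Ss ->]]]] := Su n; rewrite (bl_sum bF); apply: cspan_sum => i _.
by rewrite (blZ bF); apply: cspanZ; apply: h.
Qed.

Lemma cspan_top (A : cstarType R) (S S' : set A) : cspan S = setT ->
  (forall x, S x -> cspan S' x) -> cspan S' = setT.
Proof.
move=> tS h; apply/seteqP; split=> // x _.
have bi : bounded_linear (@id A) by have [] := @id_positive R A.
by apply: (cspan_image bi h); rewrite tS.
Qed.

Lemma tens_total2 (A B T : cstarType R) (t : min_tensor A B T) (S1 : set A) (S2 : set B) :
  cspan S1 = setT -> cspan S2 = setT -> cspan [set t a b | a in S1 & b in S2] = setT.
Proof.
move=> h1 h2; apply: cspan_top (tens_dense t) _ => _ [a _ [b _ <-]].
apply: (@cspan_image B T S2 _ (t a) (tens_bl_r t a)); last by rewrite h2.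
move=> b' Sb'; apply: (@cspan_image A T S1 _ (t^~ b') (tens_bl_l t b')); last by rewrite h1.
by move=> a' Sa'; apply: cspan_sub; exists a' => //; exists b'.
Qed.

Lemma product_total (A : cstarType R) : cspan [set a ∙ b | a in setT & b in setT] = (setT : set A).
Proof.
apply/seteqP; split=> // x _; have /choice[e He] : forall n : nat, exists e : A, nm (x - e ∙ x) < n.+1%:R^-1.
  move=> n; have [|e [_ _ h _]] := @approx_unit _ _ [:: x] n.+1%:R^-1; first by rewrite invr_gt0.
  by exists e; apply: h; rewrite mem_head.
apply: (@cspan_scvg _ _ (fun n => e n ∙ x)).
  by move=> n; apply: cspan_sub; exists (e n) => //; exists x.
apply: (@scvg_squeeze _ _ _ _ (fun n => n.+1%:R^-1)) => [n|r]; last exact: inv_small.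
by rewrite nmC ltW.
Qed.

End ClosedSpan.

(** * Nondegenerate homomorphisms and their extension to multipliers *)

Section NondegenerateHoms.
Variables (R : realType).

Lemma nondeg_action (A B : cstarType R) (F : A -> multiplier B) :
  nondeg_hom F -> action (fun a => mL (F a)).
Proof.
move=> [lF mF sF _]; split=> [k a b Y|a b Y|a]; first exact: lF.
  by rewrite mF.
by rewrite sF; apply: multiplier_adjoint.
Qed.

Lemma nondeg_good (A B : cstarType R) (F : A -> multiplier B) a : nondeg_hom F -> good (F a).
Proof.
move=> hF; have actF := nondeg_action hF; split; first exact: (act_defect a actF).
by have [_ _ sF _] := hF; rewrite -sF; exact: (act_defect a^† actF).
Qed.

Lemma mof_nondeg (A : cstarType R) : nondeg_hom (@mof R A).
Proof.
split.
- by move=> k a b c; rewrite /= cmulDl cmulZl.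
- by move=> a b; apply: multiplier_eq; apply: funext => x; rewrite /= cmulA.
- by move=> a; rewrite mstar_mof.
exact: product_total.
Qed.

Lemma hom_tens_spec (A A' AA B B' BB : cstarType R) (s : min_tensor A A' AA)
    (t : min_tensor B B' BB) (F : A -> multiplier B) (F' : A' -> multiplier B') :
  nondeg_hom F -> nondeg_hom F' ->
  nondeg_hom (hom_tens s t F F') /\ forall a a' b b',
    mL (hom_tens s t F F' (s a a')) (t b b') = t (mL (F a) b) (mL (F' a') b').
Proof.
move=> hF hF'; have aF := nondeg_action hF; have aF' := nondeg_action hF'.
have [P aP eP] := tens_action s t aF aF'.
have mt a a' : mL (mtens t (F a) (F' a')) = P (s a a').
  have [b1 e1 _] := mtens_spec t (nondeg_good a hF) (nondeg_good a' hF').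
  apply: (bl_eq_total b1 (act_bounded aP _) (tens_dense t)) => _ [b _ [b' _ <-]].
  by rewrite e1 eP.
pose H Z := act_mult P Z; have HE Z := act_multE aP Z.
have HnD : nondeg_hom H.
  split.
  - by move=> k X Y Z; rewrite !(HE _).1; have [-> _ _] := aP.
  - by move=> X Y; apply: multiplier_eq; apply: funext => Z; rewrite /= !(HE _).1 (actM aP).
  - by move=> X; apply: multiplier_eq; rewrite (HE _).1 (HE X).2.
  have [_ _ _ n1] := hF; have [_ _ _ n2] := hF'.
  apply: cspan_top (tens_total2 t n1 n2) _ => _ [_ [a _ [b _ <-]] [_ [a' _ [b' _ <-]] <-]].
  apply: cspan_sub; exists (s a a') => //; exists (t b b') => //.
  by rewrite (HE _).1 eP.
have Hm a a' : H (s a a') = mtens t (F a) (F' a').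
  by apply: multiplier_eq; rewrite (HE _).1 mt.
have [g1 g2] := @get_spec _ [set H : AA -> multiplier BB |
    nondeg_hom H /\ forall a a', H (s a a') = mtens t (F a) (F' a')] H (conj HnD Hm).
split; first exact: g1.
by move=> a a' b b'; rewrite [hom_tens _ _ _ _ _]g2 mt eP.
Qed.

(** The extension sends F a b to F (m a) b on a total set. As in [left_leg], the defect of m, pushed
    through F, shows that this is well defined and bounded. *)
Lemma mult_ext_spec (A B : cstarType R) (F : A -> multiplier B) (m : multiplier A) :
  nondeg_hom F -> good m -> forall a, mmul (mult_ext F m) (F a) = F (mL m a) /\
                                      mmul (F a) (mult_ext F m) = F (mR m a).
Proof.
move=> hF gm; have aF := nondeg_action hF; have [_ _ sF nF] := hF.
have dense Z : exists x : nat -> seq (A * B), scvg (fun n => \sum_(p <- x n) mL (F p.1) p.2) Z.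
  have : cspan [set mL (F a) b | a in setT & b in setT] Z by rewrite nF.
  move=> /closure_scvg[w [Sw wZ]].
  have /choice[x Hx] : forall n, exists x : seq (A * B), \sum_(p <- x) mL (F p.1) p.2 = w n.
    move=> n; have [k [l [v [hv ->]]]] := Sw n.
    have /choice[p Hp] : forall i, exists p : A * B, mL (F p.1) p.2 = v i.
      by move=> i; have [a _ [b _ <-]] := hv i; exists (a, b).
    exists [seq (l i *: (p i).1, (p i).2) | i <- index_enum 'I_k].
    by rewrite big_map; apply: eq_bigr => i _ /=; rewrite (actZl aF) Hp.
  by exists x; move=> e /wZ[N HN]; exists N => n /HN; rewrite Hx.
have main (n : multiplier A) : has_defect (mL n) -> exists2 S : B -> B, bounded_linear S &
    forall p : A * B, S (mL (F p.1) p.2) = mL (F (mL n p.1)) p.2.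
  move=> [M [N [M0 e]]]; have ad := multiplier_adjoint n.
  apply: (@code_ext R (A * B)%type B B (fun p => mL (F p.1) p.2) (fun p => mL (F (mL n p.1)) p.2)
    (fun k p => (k *: p.1, p.2)) (Num.sqrt M)) => //.
  - by move=> k p /=; rewrite (actZl aF).
  - by move=> k p /=; rewrite (adjointZ _ _ ad) (actZl aF).
  move=> x; rewrite -(@ler_pXn2r _ 2) ?nnegrE ?mulr_ge0 ?sqrtr_ge0 ?nm_ge0 // exprMn sqr_sqrtr //.
  rewrite -!nm_cstar2 -nmZp //; apply: pos_le_nm; first exact: pos_star_mul.
  have sq (u : A -> A) : (\sum_(p <- x) mL (F (u p.1)) p.2)^† ∙ (\sum_(p <- x) mL (F (u p.1)) p.2) =
    \sum_(p <- x) \sum_(q <- x) p.2^† ∙ mL (F ((u p.1)^† ∙ u q.1)) q.2.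
    rewrite cstar_sum cmul_suml; apply: eq_bigr => p _; rewrite cmul_sumr.
    by apply: eq_bigr => q _; rewrite (act_adj aF) -(actM aF).
  rewrite (sq (mL n)) (sq id) scaler_sumr -sumrB.
  have -> : \sum_(p <- x) (M%:C *: (\sum_(q <- x) p.2^† ∙ mL (F ((id p.1)^† ∙ id q.1)) q.2) -
      \sum_(q <- x) p.2^† ∙ mL (F ((mL n p.1)^† ∙ mL n q.1)) q.2) =
    \sum_(p <- x) \sum_(q <- x) p.2^† ∙ mL (F ((N p.1)^† ∙ N q.1)) q.2.
    apply: eq_bigr => p _; rewrite scaler_sumr -sumrB; apply: eq_bigr => q _.
    rewrite -cmulZr -(actZl aF) e (actDl aF) cmulDr addrC addKr; by [].
  by rewrite -(sq N); apply: pos_star_mul.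
have [d1 d2] := gm.
have [P bP eP] := main _ d1; have [Q bQ eQ] := main _ d2.
have ad := multiplier_adjoint m.
have adPQ : adjoint_pair P Q.
  apply: (adjoint_total bP bQ nF) => _ _ [a _ [b _ <-]] [a' _ [b' _ <-]].
  rewrite (eP (a, b)) (eQ (a', b')) /=.
  by rewrite !(act_adj aF) -!(actM aF) ad.
have [p [pL _]] := mLE adPQ.
have sp a : mmul p (F a) = F (mL m a) /\ mmul (F a) p = F (mR m a).
  split; apply: multiplier_eq; apply: funext => X /=.
    by rewrite pL (eP (a, X)).
  have bF c : bounded_linear (mL (F c)) := act_bounded aF c.
  have e : (fun X => mL (F a) (P X)) = mL (F (mR m a)).
    apply: (bl_eq_total (bl_comp bP (bF _)) (bF _) nF) => _ [c _ [d _ <-]].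
    by rewrite (eP (c, d)) /= -!(actM aF) mLR.
  by rewrite pL; have := congr1 (fun H => H X) e.
exact: (@get_spec _ [set p | forall a, mmul p (F a) = F (mL m a) /\ mmul (F a) p = F (mR m a)] p sp).
Qed.

End NondegenerateHoms.

Section RightMultiplication.
Variables (R : realType) (A B T : cstarType R) (t : min_tensor A B T).
Implicit Types (Z W : T).

Lemma dual_mull (E : cstarType R) (f : E -> R[i]) d : dual f -> dual (fun x : E => f (d ∙ x)).
Proof. by move=> /dualE bf; apply/dualE; apply: (bl_comp (act_bounded (left_mul_action E) d) bf). Qed.
Lemma mulr_bl (E : cstarType R) (c : E) : bounded_linear (fun x : E => x ∙ c).
Proof.
split; first by move=> k U V; rewrite cmulDl cmulZl.
by exists (nm c) => [|U]; [exact: nm_ge0 | rewrite mulrC nmM].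
Qed.
Lemma dual_mulr (E : cstarType R) (f : E -> R[i]) c : dual f -> dual (fun x : E => f (x ∙ c)).
Proof. by move=> /dualE bf; apply/dualE; apply: (bl_comp (mulr_bl c) bf). Qed.

(** Right multiplication by c ⊗ 1 and, next, by 1 ⊗ c, transported from the left by the
    involution. *)
Definition r1 (c : A) Z : T := (l1 t c^† Z^†)^†.
Definition r2 (c : B) Z : T := (l2 t c^† Z^†)^†.

Lemma star_conj_bl (E E' : cstarType R) (F : E -> E') : bounded_linear F ->
  bounded_linear (fun Z : E => (F Z^†)^†).
Proof.
move=> bF; split; first by move=> k X Y; rewrite cstarP (blP bF) cstarP conjCK.
have [_ [C C0 h]] := bF; exists C => // x; rewrite nm_star -(nm_star x); exact: h.
Qed.
Lemma r1_bl c : bounded_linear (r1 c). Proof. exact: star_conj_bl (l1_bl t _). Qed.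
Lemma r2_bl c : bounded_linear (r2 c). Proof. exact: star_conj_bl (l2_bl t _). Qed.
Lemma r1E c a b : r1 c (t a b) = t (a ∙ c) b.
Proof. by rewrite /r1 -tens_star l1E -tens_star cstarM !cstarK. Qed.
Lemma r2E c a b : r2 c (t a b) = t a (b ∙ c).
Proof. by rewrite /r2 -tens_star l2E -tens_star cstarM !cstarK. Qed.
Lemma r1_mul c Z W : r1 c Z ∙ W = Z ∙ l1 t c W.
Proof. by rewrite /r1 (act_adj (l1_action t)) !cstarK. Qed.
Lemma r2_mul c Z W : r2 c Z ∙ W = Z ∙ l2 t c W.
Proof. by rewrite /r2 (act_adj (l2_action t)) !cstarK. Qed.

Lemma slice_r_r1 (f : B -> R[i]) c Z : dual f -> slice_r t f (r1 c Z) = slice_r t f Z ∙ c.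
Proof.
move=> df; have bS := slice_r_bl t df.
have e := bl_eq_total (bl_comp (r1_bl c) bS) (bl_comp bS (mulr_bl c)) (tens_dense t).
have := congr1 (fun F => F Z) (e _); apply => _ [a _ [b _ <-]].
by rewrite r1E !(slice_rE t df) cmulZl.
Qed.
Lemma slice_r_r2 (f : B -> R[i]) c Z : dual f ->
  slice_r t f (r2 c Z) = slice_r t (fun x => f (x ∙ c)) Z.
Proof.
move=> df; have bS := slice_r_bl t df; have df' := dual_mulr c df.
have e := bl_eq_total (bl_comp (r2_bl c) bS) (slice_r_bl t df') (tens_dense t).
have := congr1 (fun F => F Z) (e _); apply => _ [a _ [b _ <-]].
by rewrite r2E (slice_rE t df) (slice_rE t df').
Qed.
Lemma slice_r_l2 (f : B -> R[i]) d Z : dual f ->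
  slice_r t f (l2 t d Z) = slice_r t (fun x => f (d ∙ x)) Z.
Proof.
move=> df; have bS := slice_r_bl t df; have df' := dual_mull d df.
have e := bl_eq_total (bl_comp (l2_bl t d) bS) (slice_r_bl t df') (tens_dense t).
have := congr1 (fun F => F Z) (e _); apply => _ [a _ [b _ <-]].
by rewrite l2E (slice_rE t df) (slice_rE t df').
Qed.
Lemma slice_l_r2 (f : A -> R[i]) c Z : dual f -> slice_l t f (r2 c Z) = slice_l t f Z ∙ c.
Proof.
move=> df; have bS := slice_l_bl t df.
have e := bl_eq_total (bl_comp (r2_bl c) bS) (bl_comp bS (mulr_bl c)) (tens_dense t).
have := congr1 (fun F => F Z) (e _); apply => _ [a _ [b _ <-]].
by rewrite r2E !(slice_lE t df) cmulZl.
Qed.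
Lemma slice_l_r1 (f : A -> R[i]) c Z : dual f ->
  slice_l t f (r1 c Z) = slice_l t (fun x => f (x ∙ c)) Z.
Proof.
move=> df; have bS := slice_l_bl t df; have df' := dual_mulr c df.
have e := bl_eq_total (bl_comp (r1_bl c) bS) (slice_l_bl t df') (tens_dense t).
have := congr1 (fun F => F Z) (e _); apply => _ [a _ [b _ <-]].
by rewrite r1E (slice_lE t df) (slice_lE t df').
Qed.
Lemma slice_l_l1 (f : A -> R[i]) d Z : dual f ->
  slice_l t f (l1 t d Z) = slice_l t (fun x => f (d ∙ x)) Z.
Proof.
move=> df; have bS := slice_l_bl t df; have df' := dual_mull d df.
have e := bl_eq_total (bl_comp (l1_bl t d) bS) (slice_l_bl t df') (tens_dense t).
have := congr1 (fun F => F Z) (e _); apply => _ [a _ [b _ <-]].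
by rewrite l1E (slice_lE t df) (slice_lE t df').
Qed.

Lemma cmul_separate (E : cstarType R) (X Y : E) : (forall W : E, X ∙ W = Y ∙ W) -> X = Y.
Proof.
move=> h; apply/(can_inj (@cstarK R E))/cstar_separate => V.
by rewrite -!cstarM h.
Qed.

Lemma mof_inj (E : cstarType R) : injective (@mof R E).
Proof.
move=> x y /(congr1 (@mL R E)) e; apply: cmul_separate => W.
by have := congr1 (fun F => F W) e.
Qed.

End RightMultiplication.

(** Two factorizations agree at m because u (m b) = (u m) b for u in A: both values are limits of f
    (u m) along an approximate unit u. *)
Lemma dual_ext_spec (R : realType) (A : cstarType R) (f g : A -> R[i]) (b : A) (m : multiplier A) :
  dual g -> (forall a, f a = g (a ∙ b)) -> dual_ext f m = g (mL m b).
Proof.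
move=> dg fg; have h : [set z : R[i] | exists g b,
    [/\ dual g, forall a, f a = g (a ∙ b) & z = g (mL m b)]] (g (mL m b)) by exists g, b.
have [g' [b' [dg' fg' e]]] := @xgetPex _ 0 _ (ex_intro _ _ h).
rewrite /dual_ext e; apply/eqP; rewrite -subr_eq0 -normr_eq0 nmcE.
have [C C0 hC] := dual_le dg; have [C' C'0 hC'] := dual_le dg'.
have bg := iffLR (dualE g) dg; have bg' := iffLR (dualE g') dg'.
suff -> : nmc (g' (mL m b') - g (mL m b)) = 0 by [].
apply/eqP; rewrite eq_le nmc_ge0 andbT; apply: (@le_eps _ _ _ (C + C')) => r r0; rewrite add0r.
have [u [_ _ hu _]] := approx_unit [:: mL m b; mL m b'] r0.
have ub := hu (mL m b) (mem_head _ _); have ub' := hu (mL m b') _.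
have {}ub' : nm (mL m b' - u ∙ mL m b') < r by apply: ub'; rewrite !inE eqxx orbT.
have -> : g' (mL m b') - g (mL m b) = g' (mL m b' - u ∙ mL m b') - g (mL m b - u ∙ mL m b).
  rewrite (flB bg) (flB bg') !mLR -fg -fg'; ring.
apply: le_trans (@nmB _ (R[i]^o) _ _) _; rewrite !nmc_nm.
have h1 := hC (mL m b - u ∙ mL m b); have h2 := hC' (mL m b' - u ∙ mL m b').
have h3 := ler_wpM2l C0 (ltW ub); have h4 := ler_wpM2l C'0 (ltW ub'); lra.
Qed.

Section Interface.
Variables (R : realType) (G : cstar_bialgebra R).
Local Notation A := (C0 G).
Local Notation T := (C0_2 G).
Local Notation T3 := (C0_3 G).
Local Notation t := (tens2 G).
Local Notation t21 := (tens21 G).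
Local Notation t12 := (tens12 G).
Implicit Types (a b c d q u v w x y : A) (Z W X Y : T).

Definition D a : T -> T := mL (Delta a).

Lemma D_action : action D. Proof. exact: nondeg_action (Delta_hom G). Qed.

(** Delta(a)(1 ⊗ b) and, next, Delta(a)(b ⊗ 1), as elements of T by the cancellation laws. Slices of
    Delta are computed on them, which keeps functionals on A rather than on its multipliers. *)
Definition Zr a b : T := get [set z | forall W, z ∙ W = D a (l2 t b W)].
Definition Zl a b : T := get [set z | forall W, z ∙ W = D a (l1 t b W)].

Lemma ZrE a b W : Zr a b ∙ W = D a (l2 t b W).
Proof.
have [z hz] := Delta_cancel_r_sub a b.
have h V : z ∙ V = D a (l2 t b V) by have := congr1 (fun m => mL m V) hz.
exact: (@get_spec _ [set z | forall W, z ∙ W = D a (l2 t b W)] z h W).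
Qed.
Lemma ZlE a b W : Zl a b ∙ W = D a (l1 t b W).
Proof.
have [z hz] := Delta_cancel_l_sub a b.
have h V : z ∙ V = D a (l1 t b V) by have := congr1 (fun m => mL m V) hz.
exact: (@get_spec _ [set z | forall W, z ∙ W = D a (l1 t b W)] z h W).
Qed.

Lemma Zr_total : cspan [set Zr a b | a in setT & b in setT] = setT.
Proof.
apply: cspan_top (Delta_cancel_r G) _ => z [a [b hz]]; apply: cspan_sub.
exists a => //; exists b => //; apply: cmul_separate => W; rewrite ZrE.
by have := congr1 (fun m => mL m W) hz.
Qed.

Lemma D_tens_r a c b : D a (t c b) = r1 t c (Zr a b).
Proof.
apply: cmul_separate => W; rewrite r1_mul ZrE -(act_mulr D_action); congr (D a _).
have e : cmul (t c b) = (fun W => l2 t b (l1 t c W)).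
  apply: (bl_eq_total (act_bounded (left_mul_action T) _) (bl_comp (l1_bl t _) (l2_bl t _)) (tens_dense t)).
  by move=> _ [x _ [y _ <-]]; rewrite l1E l2E tensM.
by have := congr1 (fun F => F W) e.
Qed.
Lemma D_tens_l a c b : D a (t c b) = r2 t b (Zl a c).
Proof.
apply: cmul_separate => W; rewrite r2_mul ZlE -(act_mulr D_action); congr (D a _).
have e : cmul (t c b) = (fun W => l1 t c (l2 t b W)).
  apply: (bl_eq_total (act_bounded (left_mul_action T) _) (bl_comp (l2_bl t _) (l1_bl t _)) (tens_dense t)).
  by move=> _ [x _ [y _ <-]]; rewrite l2E l1E tensM.
by have := congr1 (fun F => F W) e.
Qed.

(** Whatever factorization of g is selected, the resulting multiplier sends c to the slice by g of
    Delta(a)(c ⊗ 1). Hence it agrees with the explicit witness. *)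
Lemma R_mapE f g b a : dual f -> (forall x, g x = f (x ∙ b)) -> R_map g a = slice_r t f (Zr a b).
Proof.
move=> df gf; have dg : dual g.
  by have -> : g = (fun x => f (x ∙ b)) by [apply: funext]; apply: dual_mulr.
pose S := [set p : multiplier A | exists g' b', [/\ dual g', forall x, g x = g' (x ∙ b')
  & forall c, mL p c = slice_r t g' (mL (Delta a) (t c b'))]].
have SE p : S p -> forall c, mL p c = slice_r t g (Zl a c).
  move=> [g' [b' [dg' hg e]]] c; rewrite e -/(D a) D_tens_l slice_r_r2 //.
  by congr (slice_r t _ _); apply: funext.
have S0 : S (mof (slice_r t f (Zr a b))).
  by exists f, b; split=> // c; rewrite -/(D a) D_tens_r slice_r_r1.
have e : mslice_r t g (Delta a) = mof (slice_r t f (Zr a b)).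
  apply: multiplier_eq; apply: funext => c.
  by rewrite (SE _ (get_spec S0)) (SE _ S0).
have h := @get_spec A [set b : A | mof b = mslice_r t g (Delta a)] _ (esym e).
by apply: mof_inj; rewrite -e.
Qed.

Lemma L_mapE f g b a : dual f -> (forall x, g x = f (x ∙ b)) -> L_map g a = slice_l t f (Zl a b).
Proof.
move=> df gf; have dg : dual g.
  by have -> : g = (fun x => f (x ∙ b)) by [apply: funext]; apply: dual_mulr.
pose S := [set p : multiplier A | exists g' b', [/\ dual g', forall x, g x = g' (x ∙ b')
  & forall c, mL p c = slice_l t g' (mL (Delta a) (t b' c))]].
have SE p : S p -> forall c, mL p c = slice_l t g (Zr a c).
  move=> [g' [b' [dg' hg e]]] c; rewrite e -/(D a) D_tens_r slice_l_r1 //.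
  by congr (slice_l t _ _); apply: funext.
have S0 : S (mof (slice_l t f (Zl a b))).
  by exists f, b; split=> // c; rewrite -/(D a) D_tens_l slice_l_r2.
have e : mslice_l t g (Delta a) = mof (slice_l t f (Zl a b)).
  apply: multiplier_eq; apply: funext => c.
  by rewrite (SE _ (get_spec S0)) (SE _ S0).
have h := @get_spec A [set b : A | mof b = mslice_l t g (Delta a)] _ (esym e).
by apply: mof_inj; rewrite -e.
Qed.

Lemma ZrP k a a' b : Zr (k *: a + a') b = k *: Zr a b + Zr a' b.
Proof. by apply: cmul_separate => W; rewrite cmulDl cmulZl !ZrE; have [-> _ _] := D_action. Qed.
Lemma ZlP k a a' b : Zl (k *: a + a') b = k *: Zl a b + Zl a' b.
Proof. by apply: cmul_separate => W; rewrite cmulDl cmulZl !ZlE; have [-> _ _] := D_action. Qed.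
Lemma ZrPr k a b b' : Zr a (k *: b + b') = k *: Zr a b + Zr a b'.
Proof.
apply: cmul_separate => W; rewrite cmulDl cmulZl !ZrE; have [-> _ _] := l2_action t.
by rewrite (actDr D_action) (actZr D_action).
Qed.
Lemma ZlPr k a b b' : Zl a (k *: b + b') = k *: Zl a b + Zl a b'.
Proof.
apply: cmul_separate => W; rewrite cmulDl cmulZl !ZlE; have [-> _ _] := l1_action t.
by rewrite (actDr D_action) (actZr D_action).
Qed.
Lemma Zr_bound a b : nm (Zr a b) <= nm a * nm b.
Proof.
apply: nm_le_mul => [|W]; first by rewrite mulr_ge0 ?nm_ge0.
rewrite ZrE -mulrA; apply: le_trans (act_bound D_action _ _) _.
by apply: ler_wpM2l; [exact: nm_ge0 | exact: (act_bound (l2_action t))].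
Qed.
Lemma Zl_bound a b : nm (Zl a b) <= nm a * nm b.
Proof.
apply: nm_le_mul => [|W]; first by rewrite mulr_ge0 ?nm_ge0.
rewrite ZlE -mulrA; apply: le_trans (act_bound D_action _ _) _.
by apply: ler_wpM2l; [exact: nm_ge0 | exact: (act_bound (l1_action t))].
Qed.
Lemma Zr_bl b : bounded_linear (Zr^~ b).
Proof.
split; first by move=> k a a'; rewrite ZrP.
by exists (nm b) => [|a]; [exact: nm_ge0 | rewrite mulrC Zr_bound].
Qed.
Lemma Zr_blr a : bounded_linear (Zr a).
Proof.
split; first by move=> k b b'; rewrite ZrPr.
by exists (nm a) => [|b]; [exact: nm_ge0 | exact: Zr_bound].
Qed.
Lemma Zl_bl b : bounded_linear (Zl^~ b).
Proof.
split; first by move=> k a a'; rewrite ZlP.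
by exists (nm b) => [|a]; [exact: nm_ge0 | rewrite mulrC Zl_bound].
Qed.
Lemma Zl_blr a : bounded_linear (Zl a).
Proof.
split; first by move=> k b b'; rewrite ZlPr.
by exists (nm a) => [|b]; [exact: nm_ge0 | exact: Zl_bound].
Qed.

Lemma Zr_D a a' b : D a (Zr a' b) = Zr (a ∙ a') b.
Proof. by apply: cmul_separate => W; rewrite -(act_mulr D_action) !ZrE (actM D_action). Qed.
Lemma Zl_D a a' b : D a (Zl a' b) = Zl (a ∙ a') b.
Proof. by apply: cmul_separate => W; rewrite -(act_mulr D_action) !ZlE (actM D_action). Qed.
Lemma Zr_r2 a b c : Zr a (b ∙ c) = r2 t c (Zr a b).
Proof. by apply: cmul_separate => W; rewrite r2_mul !ZrE (actM (l2_action t)). Qed.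
Lemma Zl_r1 a b c : Zl a (b ∙ c) = r1 t c (Zl a b).
Proof. by apply: cmul_separate => W; rewrite r1_mul !ZlE (actM (l1_action t)). Qed.

Lemma Zr_starM a b X : (Zr a b)^† ∙ X = l2 t b^† (D a^† X).
Proof.
apply: cstar_separate => Z; rewrite cmulA -cstarM ZrE (act_adj D_action).
by rewrite (act_adj (l2_action t)).
Qed.

Lemma Zr_sandwich_star a c d : (l2 t d^† (Zr a c))^† = l2 t c^† (Zr a^† d).
Proof.
apply: cmul_separate => W; apply: cstar_separate => X.
rewrite cmulA -cstarM -(act_mulr (l2_action t)) ZrE.
rewrite -(act_mulr (l2_action t)) ZrE.
by rewrite (act_adj (l2_action t)) cstarK (act_adj D_action) (act_adj (l2_action t)).
Qed.

Section Coassociativity.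
Variables (mu f h : A -> R[i]).
Hypothesis (dmu : dual mu) (df : dual f) (dh : dual h).

Lemma dual_tens_assoc (Z : T3) :
  dual_tens t21 (dual_tens t mu f) h Z = dual_tens t12 mu (dual_tens t f h) Z.
Proof.
have [d1 e1 _] := dual_tens_spec t dmu df; have [d2 e2 _] := dual_tens_spec t df dh.
have [d3 e3 _] := dual_tens_spec t21 d1 dh; have [d4 e4 _] := dual_tens_spec t12 dmu d2.
have e := @bl_eq_total _ T3 (R[i]^o) [set t21 x c | x in [set t a b | a in setT & b in setT] & c in setT]
  (dual_tens t21 (dual_tens t mu f) h) (dual_tens t12 mu (dual_tens t f h)) (iffLR (dualE _) d3) (iffLR (dualE _) d4).
have cT : cspan (setT : set A) = setT.
  by apply/seteqP; split=> // x _; apply: cspan_sub.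
have := congr1 (fun F => F Z) (e (tens_total2 t21 (tens_dense t) cT) _); apply.
move=> _ [_ [a _ [b _ <-]] [c _ <-]].
by rewrite e3 e1 tens_assoc e4 e2 mulrA.
Qed.

End Coassociativity.
End Interface.

Lemma act_bounded_l (R : realType) (A T : cstarType R) (pi : A -> T -> T) Y :
  action pi -> bounded_linear (pi^~ Y).
Proof.
move=> hpi; split; first by move=> k a b; have [-> _ _] := hpi.
by exists (nm Y) => [|a]; [exact: nm_ge0 | rewrite mulrC; exact: act_bound].
Qed.

Section Coassociativity.
Variables (R : realType) (G : cstar_bialgebra R).
Local Notation A := (C0 G).
Local Notation T := (C0_2 G).
Local Notation T3 := (C0_3 G).
Local Notation t := (tens2 G).
Local Notation t21 := (tens21 G).
Local Notation t12 := (tens12 G).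
Implicit Types (a b c q s u w x y : A) (Z V : T) (X : T3).

Let H1 := hom_tens t t21 (@Delta R G) (@mof R A).
Let H2 := hom_tens t t12 (@mof R A) (@Delta R G).
Let S1 := hom_tens_spec t t21 (Delta_hom G) (@mof_nondeg R A).
Let S2 := hom_tens_spec t t12 (@mof_nondeg R A) (Delta_hom G).
Let P1 Z X := mL (H1 Z) X.
Let P2 Z X := mL (H2 Z) X.
Let a1 : action P1 := nondeg_action S1.1.
Let a2 : action P2 := nondeg_action S2.1.
Let P1E a c V s : P1 (t a c) (t21 V s) = t21 (D a V) (c ∙ s). Proof. exact: S1.2. Qed.
Let P2E a c s V : P2 (t a c) (t12 s V) = t12 (a ∙ s) (D c V). Proof. exact: S2.2. Qed.

Let p b := mult_ext H1 (Delta b).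
Let p1 b Z X : mL (p b) (P1 Z X) = P1 (D b Z) X.
Proof.
have [e _] := mult_ext_spec S1.1 (nondeg_good b (Delta_hom G)) Z.
by have := congr1 (fun m => mL m X) e.
Qed.
Let p2 b Z X : mL (p b) (P2 Z X) = P2 (D b Z) X.
Proof.
have [e _] := mult_ext_spec S2.1 (nondeg_good b (Delta_hom G)) Z.
rewrite /p /H1 Delta_coassoc; by have := congr1 (fun m => mL m X) e.
Qed.

Let P1_r1 x Z V s : P1 (r1 t x Z) (t21 V s) = P1 Z (t21 (D x V) s).
Proof.
have e := bl_eq_total (bl_comp (r1_bl t x) (act_bounded_l (t21 V s) a1))
  (act_bounded_l (t21 (D x V) s) a1) (tens_dense t).
have := congr1 (fun F => F Z) (e _); apply => _ [a _ [c _ <-]].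
by rewrite r1E !P1E (actM (@D_action _ G)).
Qed.
Let P2_r2 x Z s V : P2 (r2 t x Z) (t12 s V) = P2 Z (t12 s (D x V)).
Proof.
have e := bl_eq_total (bl_comp (r2_bl t x) (act_bounded_l (t12 s V) a2))
  (act_bounded_l (t12 s (D x V)) a2) (tens_dense t).
have := congr1 (fun F => F Z) (e _); apply => _ [a _ [c _ <-]].
by rewrite r2E !P2E (actM (@D_action _ G)).
Qed.

Let nD : cspan [set D a V | a in setT & V in setT] = (setT : set T).
Proof. by have [_ _ _ h] := Delta_hom G. Qed.

Let p_left b V u s : mL (p b) (t21 V (u ∙ s)) = P1 (Zr b u) (t21 V s).
Proof.
apply: cstar_separate => X; rewrite mLR.
have lm (c : T3) : bounded_linear (cmul c : T3 -> T3) := act_bounded (left_mul_action T3) c.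
have e := bl_eq_total (bl_comp (tens_bl_l t21 (u ∙ s)) (lm (mR (p b) X^†)))
  (bl_comp (bl_comp (tens_bl_l t21 s) (act_bounded a1 (Zr b u))) (lm X^†)) nD.
have := congr1 (fun F => F V) (e _); apply => _ [x _ [W _ <-]].
by rewrite -mLR -P1E p1 D_tens_r P1_r1.
Qed.
Let p_right b V x s : mL (p b) (t12 (x ∙ s) V) = P2 (Zl b x) (t12 s V).
Proof.
apply: cstar_separate => X; rewrite mLR.
have lm (c : T3) : bounded_linear (cmul c : T3 -> T3) := act_bounded (left_mul_action T3) c.
have e := bl_eq_total (bl_comp (tens_bl_r t12 (x ∙ s)) (lm (mR (p b) X^†)))
  (bl_comp (bl_comp (tens_bl_r t12 s) (act_bounded a2 (Zl b x))) (lm X^†)) nD.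
have := congr1 (fun F => F V) (e _); apply => _ [c _ [W _ <-]].
by rewrite -mLR -P2E p2 D_tens_l P2_r2.
Qed.

Section Slices.
Variables (mu f h : A -> R[i]).
Hypothesis (dmu : dual mu) (df : dual f) (dh : dual h).

Let sl1 Z V s : slice_r t21 h (P1 Z (t21 V s)) = D (slice_r t h (r2 t s Z)) V.
Proof.
have b1 := slice_r_bl t21 dh; have b2 := slice_r_bl t dh.
have e := bl_eq_total (bl_comp (act_bounded_l (t21 V s) a1) b1)
  (bl_comp (bl_comp (r2_bl t s) b2) (act_bounded_l V (@D_action _ G))) (tens_dense t).
have := congr1 (fun F => F Z) (e _); apply => _ [a _ [c _ <-]].
by rewrite P1E r2E (slice_rE t21 dh) (slice_rE t dh) (actZl (@D_action _ G)).
Qed.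
Let sl2 Z V s : slice_l t12 mu (P2 Z (t12 s V)) = D (slice_l t mu (r1 t s Z)) V.
Proof.
have b1 := slice_l_bl t12 dmu; have b2 := slice_l_bl t dmu.
have e := bl_eq_total (bl_comp (act_bounded_l (t12 s V) a2) b1)
  (bl_comp (bl_comp (r1_bl t s) b2) (act_bounded_l V (@D_action _ G))) (tens_dense t).
have := congr1 (fun F => F Z) (e _); apply => _ [a _ [c _ <-]].
by rewrite P2E r1E (slice_lE t12 dmu) (slice_lE t dmu) (actZl (@D_action _ G)).
Qed.

(** Both sides evaluate mu ⊗ f ⊗ h at the twice iterated comultiplication of y times q ⊗ w ⊗ g, once
    for each bracketing. *)
Lemma coassoc y q w g :
  dual_tens t mu f (D (slice_r t h (Zr y g)) (t q w)) =
  dual_tens t f h (D (slice_l t mu (Zl y q)) (t w g)).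
Proof.
have [d1 _ _] := dual_tens_spec t dmu df; have [d2 _ _] := dual_tens_spec t df dh.
(* [p_right] and [p_left] consume one factor of the first, respectively the third, leg, so these
   legs are products here; such products are total. *)
have base x s u s' : dual_tens t mu f (D (slice_r t h (Zr y (u ∙ s'))) (t (x ∙ s) w)) =
    dual_tens t f h (D (slice_l t mu (Zl y (x ∙ s))) (t w (u ∙ s'))).
  have := dual_tens_assoc dmu df dh (mL (p y) (t21 (t (x ∙ s) w) (u ∙ s'))).
  have [_ _ ->] := dual_tens_spec t21 d1 dh; rewrite p_left sl1 -Zr_r2 => ->.
  have [_ _ ->] := dual_tens_spec t12 dmu d2; rewrite dual_tensE //.
  by rewrite -p_left tens_assoc p_right sl2 -Zl_r1.
have bD V : bounded_linear (fun a : A => D a V) := act_bounded_l V (@D_action _ G).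
have bDa (a : A) : bounded_linear (D a) := act_bounded (@D_action _ G) a.
have b1 := iffLR (dualE _) d1; have b2 := iffLR (dualE _) d2.
have stepq x s : dual_tens t mu f (D (slice_r t h (Zr y g)) (t (x ∙ s) w)) =
    dual_tens t f h (D (slice_l t mu (Zl y (x ∙ s))) (t w g)).
  have e := bl_eq_total
    (bl_comp (bl_comp (bl_comp (Zr_blr y) (slice_r_bl t dh)) (bD (t (x ∙ s) w))) b1)
    (bl_comp (bl_comp (tens_bl_r t w) (bDa (slice_l t mu (Zl y (x ∙ s))))) b2) (product_total A).
  have := congr1 (fun F => F g) (e _); apply => _ [u _ [s' _ <-]]; exact: base.
have e := bl_eq_total
  (bl_comp (bl_comp (tens_bl_l t w) (bDa (slice_r t h (Zr y g)))) b1)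
  (bl_comp (bl_comp (bl_comp (Zl_blr y) (slice_l_bl t dmu)) (bD (t w g))) b2) (product_total A).
have := congr1 (fun F => F q) (e _); apply => _ [u _ [s' _ <-]]; exact: stepq.
Qed.

End Slices.
End Coassociativity.

Section SliceNorms.
Variables (R : realType) (A B T : cstarType R) (t : min_tensor A B T).

Lemma l2_approx (Z : T) (bs : seq B) : exists e : nat -> B,
  [/\ forall n, pos_cone (e n), forall n, nm (e n) <= 1, scvg (fun n => l2 t (e n) Z) Z &
      forall b, b \in bs -> scvg (fun n => b ∙ e n) b].
Proof.
have /choice[e He] : forall n : nat, exists e : B, [/\ pos_cone e, nm e <= 1,
   nm (l2 t e Z - Z) <= n.+1%:R^-1 + n.+1%:R^-1 + n.+1%:R^-1 &
   forall b, b \in bs -> nm (b ∙ e - b) <= n.+1%:R^-1].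
  move=> n; have r0 : 0 < n.+1%:R^-1 :> R by rewrite invr_gt0.
  move: (n.+1%:R^-1) r0 => r r0.
  have [x xZ] := ev_dense t Z; have [N /(_ N (leqnn _))] := xZ _ r0.
  move: (x N) => {N xZ}x hx; pose M := \sum_(q <- x) nm q.1.
  have M0 : 0 <= M by apply: sumr_ge0 => q _; exact: nm_ge0.
  pose rho := r / (M + 1); have M1 : 0 < M + 1 by rewrite ltr_wpDl.
  have rho0 : 0 < rho by rewrite divr_gt0.
  have rhoM : M * rho <= r.
    by rewrite mulrCA -[leRHS]mulr1 ler_pM2l // ler_pdivrMr // mul1r lerDl.
  have rhor : rho <= r by rewrite ler_pdivrMr // ler_peMr ?(ltW r0) // lerDr.
  have [e [pe e1 h _]] := approx_unit ([seq q.2 | q <- x] ++ [seq b^† | b <- bs]) rho0.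
  exists e; split=> //; last first.
    move=> b bb; rewrite nmC -nm_star cstarB cstarM (pos_sa pe); apply: le_trans rhor; apply/ltW/h.
    by rewrite mem_cat map_f ?orbT.
  have h1 : nm (l2 t e (ev t x) - ev t x) <= r.
    rewrite /ev (bl_sum (l2_bl t _)) -sumrB; apply: le_trans (nm_sum _ _ _) _.
    apply: le_trans rhoM; rewrite /M mulr_suml big_seq [leRHS]big_seq; apply: ler_sum => q qx.
    rewrite l2E -tensBr; apply: le_trans (tens_bound _ _ _) _.
    apply: ler_wpM2l; first exact: nm_ge0.
    by rewrite nmC; apply/ltW/h; rewrite mem_cat map_f.
  have h2 : nm (l2 t e Z - l2 t e (ev t x)) <= r.
    rewrite -(blB (l2_bl t e)); apply: le_trans (act_bound (l2_action t) _ _) _.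
    rewrite -[leRHS]mul1r; apply: ler_pM; rewrite ?nm_ge0 //.
    by rewrite nmC; apply: ltW.
  have h3 := nm_tri (l2 t e Z) (l2 t e (ev t x)) Z; have h4 := nm_tri (l2 t e (ev t x)) (ev t x) Z.
  lra.
exists e; split=> [n|n||b bb]; try by case: (He n).
  apply: (@scvg_squeeze _ _ _ _ (fun n => n.+1%:R^-1 + n.+1%:R^-1 + n.+1%:R^-1)).
    by move=> n; case: (He n).
  move=> r r0; have r3 : 0 < r / 3 by rewrite divr_gt0.
  by have [N HN] := inv_small r3; exists N => n /HN; move: (n.+1%:R^-1) => q; lra.
apply: (@scvg_squeeze _ _ _ _ (fun n => n.+1%:R^-1)) => [n|r]; last exact: inv_small.
by case: (He n) => _ _ _; apply.
Qed.

Variables (eta : A -> \bar R) (f : B -> R[i]).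
Hypothesis wt : weight eta.
Hypothesis lsc : forall r : R, closed [set a | pos_cone a /\ (eta a <= r%:E)%E].
Hypothesis pf : pos_dual f.
Implicit Types (p : A) (d : B) (Y : T).
Local Notation S := (slice_r t f).
Local Notation N := (wN eta (@id A)).
Local Notation ip := (wip eta (@id A)).
Local Notation NT := (wN eta S).
Local Notation ipT := (wip eta S).

Let wI := wip_semi_inner wt (@id_positive R A).
Let pS := slice_r_positive t pf.
Let fI := fip_semi_inner pf.

Lemma slice_adjoint p d Y : ipT Y (t p d) = ip (S (l2 t d^† Y)) p.
Proof. by rewrite /wip (slice_r_starM t pf.1). Qed.

(** Bessel's inequality for the single vector d, normalized; a null d is handled by [slice_null]. *)
Lemma sn_slice d Y : NT Y -> N (S (l2 t d^† Y)) /\ sn ip (S (l2 t d^† Y)) <= sn (fip f) d * sn ipT Y.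
Proof.
move=> NY; have [d0|d0] := eqVneq (sn (fip f) d) 0.
  rewrite (slice_null t pf Y d0) d0 mul0r (sn0 wI); split=> //; exact: (si_N0 wI).
pose w := (sn (fip f) d)^-1%:C *: d.
have fw : fip f w w = 1.
  rewrite (siZ fI) // (siZr fI) // (sn2 fI) // conjC_real -!rmorphM /=.
  by rewrite (_ : _ * (_ * _) = 1) ?rmorph1 //; field.
have on : on_family setT (fip f) 1 (fun=> w).
  by split=> // i j; rewrite !ltnS !leqn0 => /eqP -> /eqP ->.
have := slice_proj t pf on Y; rewrite big_ord1; set c := S (l2 t w^† Y) => e.
have [_ pp _] := pS; have pc := pp (Y - t c w).
rewrite e big_ord1 in pc.
have [fc vc] := wfin_le wt NY (pos_star_mul c) pc.
have ew : S (l2 t d^† Y) = (sn (fip f) d)%:C *: c.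
  have -> : d^† = (sn (fip f) d)%:C *: w^†.
    by rewrite /w cstarZr scalerA -rmorphM mulfV // rmorph1 scale1r.
  by rewrite (actZl (l2_action t)) (blZ (slice_r_bl t pf.1)).
have Nc : N c := fc.
rewrite ew; split; first exact: (siNZ wI).
rewrite (snZ wI) // nmc_real ger0_norm ?sn_ge0 //; apply: ler_wpM2l; first exact: sn_ge0.
rewrite -(@ler_pXn2r _ 2) ?nnegrE ?sn_ge0 //.
by rewrite (wsn2 wt (@id_positive R A) Nc) (wsn2 wt pS NY).
Qed.

End SliceNorms.

Section FlipSlices.
Variables (R : realType) (A B T : cstarType R) (t : min_tensor A B T) (t' : min_tensor B A T).
Hypothesis ht : forall a b, t' b a = t a b.

Lemma flip_slice f : dual f -> slice_l t f = slice_r t' f.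
Proof.
move=> df; apply: (bl_eq_total (slice_l_bl t df) (slice_r_bl t' df) (tens_dense t)).
by move=> _ [a _ [b _ <-]]; rewrite (slice_lE t df) -ht (slice_rE t' df).
Qed.

Lemma flip_l1 a : l1 t a = l2 t' a.
Proof.
apply: (bl_eq_total (l1_bl t a) (l2_bl t' a) (tens_dense t)).
by move=> _ [c _ [b _ <-]]; rewrite l1E -!ht l2E.
Qed.
End FlipSlices.

(** * Invariance of the Haar weights *)

Lemma sesqui_polarization (R : realType) (V A : cstarType R) (B : V -> V -> A) :
  (forall k x y z, B (k *: x + y) z = k *: B x z + B y z) ->
  (forall k x y z, B z (k *: x + y) = Num.conj k *: B z x + B z y) -> forall x y,
  B x y = (4^-1)%:C *: (B (x + y) (x + y) - B (x - y) (x - y)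
    + 'i%R *: (B (x + 'i%R *: y) (x + 'i%R *: y) - B (x - 'i%R *: y) (x - 'i%R *: y))).
Proof.
move=> Bl Br x y.
have e (k k' : R[i]) : Num.conj k = k' -> B (x + k *: y) (x + k *: y) =
    (k * k') *: B y y + k *: B y x + k' *: B x y + B x x.
  by move=> <-; rewrite addrC Bl !Br scalerDr scalerA !addrA.
have -> : x + y = x + 1 *: y by rewrite scale1r.
have -> : x - y = x + (-1) *: y by rewrite scaleN1r.
have -> : x - 'i%R *: y = x + (- 'i%R) *: y by rewrite scaleNr.
have i2 : 'i%R * 'i%R = -1 :> R[i] by rewrite -expr2 sqrCi.
rewrite !(e _ _ erefl) !rmorphN /= rmorph1 conjCi opprK !mulrNN !mulr1 !mulrN !mulNr i2 opprK.
move: (B y y) (B y x) (B x y) (B x x) => p q r s.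
have -> : 'i%R *: (1 *: p + 'i%R *: q + - 'i%R *: r + s - (1 *: p + - 'i%R *: q + 'i%R *: r + s)) =
   ('i%R * 'i%R) *: (q + q - r - r) by nc_ring_with R A.
by rewrite i2 fmorphV rmorph_nat; nc_ring_with R A.
Qed.

(** * Invariant weights make a ⊗ c |-> Delta(a)(1 ⊗ c) isometric *)

Section OneSidedInvariance.
Variables (R : realType) (A T : cstarType R) (t : min_tensor A A T).
Variables (D : A -> T -> T) (Z : A -> A -> T) (eta : A -> \bar R).
Hypothesis aD : action D.
Hypothesis ZE : forall a c W, Z a c ∙ W = D a (l2 t c W).
Hypothesis wt : weight eta.
Hypothesis inv : forall f c x, pos_dual f -> wfin eta x ->
  eta (slice_r t f (l2 t c^† (Z x c))) = ((complex.Re (f (c^† ∙ c)))%:E * eta x)%E.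
Implicit Types (a b c d x : A) (W X : T).

Let al2 := l2_action t.

Lemma oZ_starM a c X : (Z a c)^† ∙ X = l2 t c^† (D a^† X).
Proof.
apply: cstar_separate => W; rewrite cmulA -cstarM ZE (act_adj aD).
by rewrite (act_adj al2).
Qed.
Lemma oZ_D a a' c : D a (Z a' c) = Z (a ∙ a') c.
Proof. by apply: cmul_separate => W; rewrite -(act_mulr aD) !ZE (actM aD). Qed.
Lemma oZP k a a' b : Z (k *: a + a') b = k *: Z a b + Z a' b.
Proof. by apply: cmul_separate => W; rewrite cmulDl cmulZl !ZE; have [-> _ _] := aD. Qed.
Lemma oZPr k a b b' : Z a (k *: b + b') = k *: Z a b + Z a b'.
Proof.
apply: cmul_separate => W; rewrite cmulDl cmulZl !ZE; have [-> _ _] := al2.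
by rewrite (actDr aD) (actZr aD).
Qed.

Variable f : A -> R[i].
Hypothesis pf : pos_dual f.
Local Notation S := (slice_r t f).
Local Notation N := (wN eta (@id A)).
Local Notation ip := (wip eta (@id A)).
Local Notation NT := (wN eta S).
Local Notation ipT := (wip eta S).
Let pS := slice_r_positive t pf.
Let bS := slice_r_bl t pf.1.
Let fI := fip_semi_inner pf.
Let wI := wip_semi_inner wt (@id_positive R A).
Let tI := wip_semi_inner wt pS.

Let Q x c d := S (l2 t d^† (Z x c)).

Let fre c : f (c^† ∙ c) = (complex.Re (f (c^† ∙ c)))%:C.
Proof. by rewrite RRe_real // ger0_real //; case: pf. Qed.

Lemma inv_fin c x : wfin eta x -> wfin eta (Q x c c) /\
  wval eta (Q x c c) = complex.Re (f (c^† ∙ c)) * wval eta x.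
Proof.
move=> fx; have e : eta (Q x c c) = (complex.Re (f (c^† ∙ c)) * wval eta x)%:E.
  by rewrite /Q inv // (wfinE wt fx) EFinM.
have [k [sk pk kk _]] := pos_sqrt fx.1.
split; last by rewrite {1}/wval e.
split; last by rewrite e ltry.
have -> : Q x c c = S ((Z k c)^† ∙ Z k c) by rewrite oZ_starM oZ_D sk kk.
by have [_ h _] := pS.
Qed.

Let Q_lin c d k x y : Q (k *: x + y) c d = k *: Q x c d + Q y c d.
Proof. by rewrite /Q oZP (blP (l2_bl t _)) (blP bS). Qed.
Let Q_D c d x y : Q (x + y) c d = Q x c d + Q y c d.
Proof. by have := Q_lin c d 1 x y; rewrite !scale1r. Qed.
Let Q_0 c d : Q 0 c d = 0.
Proof. by apply: (addrI (Q 0 c d)); rewrite -Q_D !addr0. Qed.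
Let Q_Z c d k x : Q (k *: x) c d = k *: Q x c d.
Proof. by have := Q_lin c d k x 0; rewrite Q_0 !addr0. Qed.
Let Q_B c d x y : Q (x - y) c d = Q x c d - Q y c d.
Proof. by rewrite Q_D -scaleN1r Q_Z scaleN1r. Qed.

Let inv_dec c x v : wdec eta x v -> wdec eta (Q x c c) (f (c^† ∙ c) * v).
Proof.
move=> [p1 [p2 [p3 [p4 [[f1 f2 f3 f4] -> ->]]]]].
have [h1 e1] := inv_fin c f1; have [h2 e2] := inv_fin c f2.
have [h3 e3] := inv_fin c f3; have [h4 e4] := inv_fin c f4.
exists (Q p1 c c), (Q p2 c c), (Q p3 c c), (Q p4 c c); split=> //.
  by rewrite Q_D Q_Z !Q_B.
by rewrite e1 e2 e3 e4 fre !rmorphB !rmorphM /=; ring.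
Qed.

Lemma inv_bar c d x : wdom eta x ->
  wdom eta (Q x c d) /\ wbar eta (Q x c d) = f (d^† ∙ c) * wbar eta x.
Proof.
move=> /(wdomE wt); move: (wbar eta x) => v dx.
have e : Q x c d = (4^-1)%:C *: (Q x (c + d) (c + d) - Q x (c - d) (c - d)
    + 'i%R *: (Q x (c + 'i%R *: d) (c + 'i%R *: d) - Q x (c - 'i%R *: d) (c - 'i%R *: d))).
  apply: (@sesqui_polarization _ A A (Q x)) => k u u' z.
    by rewrite /Q oZPr (blP (l2_bl t _)) (blP bS).
  by rewrite /Q cstarP; have [-> _ _] := al2; rewrite (blP bS).
have bf : bounded_linear (f : A -> R[i]^o) by apply/dualE; case: pf.
have e' : f (d^† ∙ c) = (4^-1)%:C * (f ((c + d)^† ∙ (c + d)) - f ((c - d)^† ∙ (c - d))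
    + 'i%R * (f ((c + 'i%R *: d)^† ∙ (c + 'i%R *: d)) - f ((c - 'i%R *: d)^† ∙ (c - 'i%R *: d)))).
  by rewrite {1}(polarization c d) (flZ bf) (flD bf) (flZ bf) !(flB bf).
have h u := inv_dec u dx.
suff dec : wdec eta (Q x c d) (f (d^† ∙ c) * v) by split; [exists (f (d^† ∙ c) * v) | apply: wbarE].
rewrite e e'; move: (h (c + d)) (h (c - d)) (h (c + 'i%R *: d)) (h (c - 'i%R *: d)).
move: (f _) (f _) (f _) (f _) => k4 k3 k2 k1 h1 h2 h3 h4.
have dB p q w w' : wdec eta p w -> wdec eta q w' -> wdec eta (p - q) (w - w').
  by move=> h5 h6; apply: wdecD => //; apply: wdecN.
have -> : (4^-1)%:C * (k1 - k2 + 'i%R * (k3 - k4)) * v =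
  (4^-1)%:C * (k1 * v - k2 * v + 'i%R * (k3 * v - k4 * v)) by ring.
apply: wdecZ => //; apply: wdecD => //; first exact: dB.
by apply: wdecZ => //; apply: dB.
Qed.

Lemma oZ_N a c : N a -> NT (Z a c).
Proof.
move=> Na; rewrite /wN /= oZ_starM oZ_D; exact: (inv_fin c Na).1.
Qed.

(** The isometry property of the multiplicative unitary at the level of forms. With [D] and [Z]
    abstract it serves psi with [Zr], and phi with [Zl] through the flipped tensor product. *)
Lemma oZ_ip a b c d : N a -> N b -> ipT (Z a c) (Z b d) = ip a b * f (d^† ∙ c).
Proof.
move=> Na Nb; rewrite /wip oZ_starM oZ_D.
have [_ ->] := inv_bar c d (wN_dom wt (@id_positive R A) Na Nb).
by rewrite mulrC.
Qed.

Lemma oZ_sn a c : N a -> sn ipT (Z a c) = sn ip a * sn (fip f) c.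
Proof.
move=> Na; have NZ := oZ_N c Na.
apply/eqP; rewrite -(@eqrXn2 _ 2) ?mulr_ge0 ?sn_ge0 //; apply/eqP/complexI.
rewrite -(sn2 tI NZ) oZ_ip // exprMn (sn2 wI Na).
by rewrite -[f _]/(fip f c c) (sn2 fI (I : setT c)) -rmorphM.
Qed.

End OneSidedInvariance.

Section HaarData.
Variables (R : realType) (G : lcqg R).
Local Notation A := (C0 G).
Local Notation T := (C0_2 G).
Local Notation t := (tens2 G).
Local Notation psi := (@haar_r R G).
Local Notation phi := (@haar_l R G).

Lemma psi_weight : weight psi. Proof. by have [[[]]] := haar_rP G. Qed.
Lemma phi_weight : weight phi. Proof. by have [[[]]] := haar_lP G. Qed.
Lemma psi_lsc (r : R) : closed [set a | pos_cone a /\ (psi a <= r%:E)%E].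
Proof. by have [[[_ _ _ h] _] _ _] := haar_rP G; apply: h. Qed.
Lemma phi_lsc (r : R) : closed [set a | pos_cone a /\ (phi a <= r%:E)%E].
Proof. by have [[[_ _ _ h] _] _ _] := haar_lP G; apply: h. Qed.
Lemma psi_dense : @pos_cone R A `<=` closure [set a | pos_cone a /\ (psi a < +oo)%E].
Proof. by have [[[_ _ h _] _] _ _] := haar_rP G. Qed.
Lemma phi_dense : @pos_cone R A `<=` closure [set a | pos_cone a /\ (phi a < +oo)%E].
Proof. by have [[[_ _ h _] _] _ _] := haar_lP G. Qed.
Lemma psi_faithful : faithful_weight psi. Proof. by have [] := haar_rP G. Qed.
Lemma phi_faithful : faithful_weight phi. Proof. by have [] := haar_lP G. Qed.

Lemma psi_inv f (c x : A) : pos_dual f -> wfin psi x ->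
  psi (slice_r t f (l2 t c^† (Zr x c))) = ((complex.Re (f (c^† ∙ c)))%:E * psi x)%E.
Proof.
move=> pf [px fx]; have [_ _ h] := haar_rP G.
have df' := dual_mull c^† pf.1.
rewrite (slice_r_l2 t _ _ pf.1) -(R_mapE (g := fun y => f (c^† ∙ y ∙ c)) x df'); last first.
  by move=> y; rewrite cmulA.
rewrite (h _ _ (pos_dual_sandwich c pf) px fx).
have e y : f (c^† ∙ y ∙ c) = f (c^† ∙ (y ∙ c)) by rewrite cmulA.
by rewrite (dual_ext_spec (mone A) df' e).
Qed.

(** In the flipped tensor product left slices are right slices, so left invariance takes the form of
    [psi_inv]. *)
Lemma phi_inv (t' : min_tensor A A T) (ht : forall a b, t' b a = t a b) f (c x : A) :
  pos_dual f -> wfin phi x ->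
  phi (slice_r t' f (l2 t' c^† (Zl x c))) = ((complex.Re (f (c^† ∙ c)))%:E * phi x)%E.
Proof.
move=> pf [px fx]; have [_ _ h] := haar_lP G.
have df' := dual_mull c^† pf.1.
rewrite -(flip_slice ht pf.1) -(flip_l1 ht) (slice_l_l1 t _ _ pf.1).
rewrite -(L_mapE (g := fun y => f (c^† ∙ y ∙ c)) x df'); last first.
  by move=> y; rewrite cmulA.
rewrite (h _ _ (pos_dual_sandwich c pf) px fx).
have e y : f (c^† ∙ y ∙ c) = f (c^† ∙ (y ∙ c)) by rewrite cmulA.
by rewrite (dual_ext_spec (mone A) df' e).
Qed.

End HaarData.

Section SliceNormBound.
Variables (R : realType) (A B T : cstarType R) (t : min_tensor A B T).
Variables (eta : A -> \bar R) (f : B -> R[i]) (C : R).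
Hypothesis wt : weight eta.
Hypothesis lsc : forall r : R, closed [set a | pos_cone a /\ (eta a <= r%:E)%E].
Hypothesis pf : pos_dual f.
Hypothesis C0 : 0 <= C.
Hypothesis fC : forall x, f (x^† ∙ x) <= (C * nm x ^+ 2)%:C.

Lemma fsn_bound w : sn (fip f) w <= Num.sqrt C * nm w.
Proof.
rewrite -(@ler_pXn2r _ 2) ?nnegrE ?sn_ge0 ?mulr_ge0 ?sqrtr_ge0 ?nm_ge0 //.
by rewrite exprMn (sqr_sqrtr C0) -lecR (fsn2 pf).
Qed.

Lemma sn_slice_le Y : wN eta (slice_r t f) Y -> wN eta id (slice_r t f Y) /\
  sn (wip eta id) (slice_r t f Y) <= Num.sqrt C * sn (wip eta (slice_r t f)) Y.
Proof.
move=> NY; have [e [pe e1 eY _]] := l2_approx t Y [::].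
apply: (wN_lsc wt lsc (bl_scvg (slice_r_bl t pf.1) eY)) => n /=.
have [h1 h2] := sn_slice wt pf (e n) NY; rewrite (pos_sa (pe n)) in h1 h2; split=> //.
apply: le_trans h2 _; apply: ler_wpM2r; first exact: sn_ge0.
apply: le_trans (fsn_bound _) _; rewrite -[leRHS]mulr1.
by apply: ler_wpM2l => //; exact: sqrtr_ge0.
Qed.
End SliceNormBound.

(** * Functionals whose right slices lie in the GNS domain *)

Section Represent.
Variables (R : realType) (G : lcqg R).
Local Notation A := (C0 G).
Local Notation T := (C0_2 G).
Local Notation t := (tens2 G).
Local Notation psi := (@haar_r R G).
Local Notation phi := (@haar_l R G).
Local Notation N := (wN psi (@id A)).
Local Notation ip := (wip psi (@id A)).
Local Notation Sr f := (slice_r t f).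
Local Notation Sl f := (slice_l t f).
Local Notation NT f := (wN psi (slice_r t f)).
Local Notation ipT f := (wip psi (slice_r t f)).

Lemma rZ_N (f : A -> R[i]) a c : pos_dual f -> N a -> NT f (Zr a c).
Proof. move=> pf; exact: (oZ_N (@D_action _ G) (@ZrE _ G) (psi_weight G) (@psi_inv R G) pf). Qed.
Lemma rZ_ip (f : A -> R[i]) a b c d : pos_dual f -> N a -> N b ->
  ipT f (Zr a c) (Zr b d) = ip a b * f (d^† ∙ c).
Proof.
move=> pf; exact: (oZ_ip (@D_action _ G) (@ZrE _ G) (psi_weight G) (@psi_inv R G) pf).
Qed.
Lemma rZ_sn (f : A -> R[i]) a c : pos_dual f -> N a ->
  sn (ipT f) (Zr a c) = sn ip a * sn (fip f) c.
Proof.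
move=> pf; exact: (oZ_sn (@D_action _ G) (@ZrE _ G) (psi_weight G) (@psi_inv R G) pf).
Qed.

Lemma N_slice (f : A -> R[i]) b d : pos_dual f -> N b -> N (Sr f (Zr b d)).
Proof.
move=> pf Nb; have [C C0 h] := dual_pos_bound pf.
by have [] := sn_slice_le (psi_weight G) (@psi_lsc R G) pf C0 h (rZ_N d pf Nb).
Qed.
Lemma N_slice2 (f : A -> R[i]) b c d : pos_dual f -> N b -> N (Sr f (l2 t c^† (Zr b d))).
Proof. by move=> pf Nb; have [] := sn_slice (psi_weight G) pf c (rZ_N d pf Nb). Qed.

Lemma star_l2 c (Z : T) : (l2 t c Z)^† = r2 t c^† Z^†.
Proof. by rewrite /r2 !cstarK. Qed.
Lemma r12_comm q c (Z : T) : r1 t q (r2 t c Z) = r2 t c (r1 t q Z).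
Proof. by rewrite /r1 /r2 !cstarK l12_comm. Qed.
Lemma r1_Zr_star (q b d : A) : r1 t q (Zr b d)^† = l2 t d^† (Zl b^† q).
Proof.
by apply: cmul_separate => X; rewrite r1_mul Zr_starM -(act_mulr (l2_action t)) ZlE.
Qed.

(* [Q] is the right slice of [Delta b] by the adjoint functional of [h],
   which is characterized here without extending functionals to multipliers. *)
Definition represents (h : A -> R[i]) (Q b : A) := [/\ dual h, N Q &
  forall w, pos_dual w -> forall q, h (Sl w (Zl b^† q)) = w (Q^† ∙ q)].

Lemma slice_r_star (f : A -> R[i]) (Z : T) : pos_dual f -> (Sr f Z)^† = Sr f Z^†.
Proof. by move=> pf; have [_ _ ->] := slice_r_positive t pf. Qed.

Lemma rep_l (f : A -> R[i]) d b : pos_dual f -> N b ->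
  represents (fun x => f (d^† ∙ x)) (Sr f (Zr b d)) b.
Proof.
move=> pf Nb; split; [exact: dual_mull pf.1 | exact: N_slice |] => w pw q.
rewrite -(slice_l_l2 t pw.1) -(dual_tensE t _ pw.1 pf.1) -r1_Zr_star (slice_r_r1 t _ _ pf.1).
by rewrite slice_r_star.
Qed.

Lemma rep_lr (f : A -> R[i]) c d b : pos_dual f -> N b ->
  represents (fun x => f (d^† ∙ x ∙ c)) (Sr f (l2 t c^† (Zr b d))) b.
Proof.
move=> pf Nb; split; [exact: (dual_mull d^† (dual_mulr c pf.1))| exact: N_slice2 |] => w pw q.
rewrite -(slice_l_l2 t pw.1) -(slice_l_r2 t _ _ pw.1) -(dual_tensE t _ pw.1 pf.1).
rewrite -r1_Zr_star slice_r_star // star_l2 cstarK -(slice_r_r1 t _ _ pf.1).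
by rewrite r12_comm.
Qed.

Section Composite.
Variables (om f : A -> R[i]) (g g' w : A).
Hypothesis (po : pos_dual om) (pf : pos_dual f).

(** The functional of x on the left is the convolution of f (g^† . w) with om (g'^† . K). By
    coassociativity its adjoint slices b in two steps, which is what the right-hand side
    displays. *)
Lemma comp_eq K w0 q (b : A) : pos_dual w0 ->
  om (g'^† ∙ Sl f (l1 t g^† (Zl (Sl w0 (Zl b^† q)) w)) ∙ K) =
  w0 ((Sr f (l2 t w^† (Zr (Sr om (l2 t K^† (Zr b g'))) g)))^† ∙ q).
Proof.
move=> p0; set b' := Sr om _; set X := Sl w0 _.
have df := dual_mull g^† pf.1; have dom := dual_mull g'^† po.1.
have [_ _ e1] := dual_tens_spec t df dom.
have [_ _ e2] := dual_tens_spec t p0.1 df.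
have := coassoc p0.1 df dom b^† q w K.
rewrite -/X e1 (dual_tensE t _ df dom) (D_tens_l X) (slice_l_r2 t _ _ df) -(slice_l_l1 t _ _ pf.1).
rewrite cmulA => <-.
rewrite e2 D_tens_r (slice_r_r1 t _ _ df) -(slice_r_l2 t g^† _ pf.1) -(slice_r_l2 t g'^† _ po.1).
by rewrite slice_r_star // Zr_sandwich_star /b' slice_r_star // Zr_sandwich_star.
Qed.

Lemma comp_eq1 w0 q (b : A) : pos_dual w0 ->
  om (g'^† ∙ Sl f (l1 t g^† (Zl (Sl w0 (Zl b^† q)) w))) =
  w0 ((Sr f (l2 t w^† (Zr (Sr om (Zr b g')) g)))^† ∙ q).
Proof.
move=> p0; set Y := Sl f _.
(* An approximate unit in the place of K removes this factor from [comp_eq]; it has to work for Zr b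
   g' and for g'^† Y at once. *)
have [e [pe _ eZ /(_ _ (mem_head _ _)) eY]] := l2_approx t (Zr b g') [:: g'^† ∙ Y].
have bo := iffLR (dualE om) po.1; have b0 := iffLR (dualE w0) p0.1.
have h1 := bl_scvg bo eY.
have h2 := bl_scvg (slice_r_bl t po.1) eZ.
have h3 := bl_scvg (slice_r_bl t pf.1) (bl_scvg (l2_bl t w^†) (bl_scvg (Zr_bl g) h2)).
have h4 := bl_scvg b0 (scvgMl q (scvg_star h3)).
apply: (scvg_uniq (V := R[i]^o) _ h4) => r r0; have [n hn] := h1 r r0; exists n => m /hn /=.
by rewrite /Y comp_eq // (pos_sa (pe m)).
Qed.

Let bF : bounded_linear (fun x => Sl f (l1 t g^† (Zl x w))).
Proof. exact: bl_comp (bl_comp (Zl_bl w) (l1_bl t _)) (slice_l_bl t pf.1). Qed.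

Lemma rep_comp K b : N b ->
  represents (fun x => om (g'^† ∙ Sl f (l1 t g^† (Zl x w)) ∙ K))
    (Sr f (l2 t w^† (Zr (Sr om (l2 t K^† (Zr b g'))) g))) b.
Proof.
move=> Nb; split.
- have d2 := iffLR (dualE _) (dual_mull g'^† (dual_mulr K po.1)).
  by apply/dualE; exact: bl_comp bF d2.
- by apply: N_slice2 => //; apply: N_slice2.
by move=> w0 p0 q; apply: comp_eq.
Qed.

Lemma rep_comp1 b : N b ->
  represents (fun x => om (g'^† ∙ Sl f (l1 t g^† (Zl x w))))
    (Sr f (l2 t w^† (Zr (Sr om (Zr b g')) g))) b.
Proof.
move=> Nb; split.
- have d2 := iffLR (dualE _) (dual_mull g'^† po.1).
  by apply/dualE; exact: bl_comp bF d2.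
- by apply: N_slice2 => //; apply: N_slice.
by move=> w0 p0 q; apply: comp_eq1.
Qed.

End Composite.
End Represent.

(** * The elements e_b(q) *)

Section HarmonicSequences.
Variables (R : realType) (V : completeNormedModType R[i]).
Implicit Types (u : nat -> V) (C : R).

Lemma inv_small_mul C (e : R) : 0 <= C -> 0 < e ->
  exists N, forall n, (N <= n)%N -> n.+1%:R^-1 * C < e.
Proof.
move=> C0 e0; have C1 : 0 < C + 1 by lra.
have [N hN] := inv_small (divr_gt0 e0 C1); exists N => n /hN.
have : 0 < n.+1%:R^-1 :> R by rewrite invr_gt0 ltr0n.
move: (n.+1%:R^-1) => q q0; rewrite ltr_pdivlMr // mulrDr mulr1; move: (q * C) => k h.
by apply: le_lt_trans h; rewrite lerDl ltW.
Qed.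

Lemma scvg_inv (W : normedModType R[i]) (u : nat -> W) l C : 0 <= C -> (forall n, nm (u n - l) <= n.+1%:R^-1 * C) -> scvg u l.
Proof. move=> C0 h; apply: scvg_squeeze h _ => e; exact: inv_small_mul. Qed.

Lemma cauchy_inv u C : 0 <= C ->
  (forall m n, nm (u m - u n) <= (m.+1%:R^-1 + n.+1%:R^-1) * C) -> exists l, scvg u l.
Proof.
move=> C0 h; apply: scvg_cauchy => e e0.
have [N hN] := inv_small_mul C0 (divr_gt0 e0 (ltr0n R 2)); exists N => m n /hN hm /hN hn.
apply: le_lt_trans (h m n) _; rewrite mulrDl.
by rewrite [ltRHS](splitr e); apply: ltrD.
Qed.
End HarmonicSequences.

Lemma sqr_le_mul (R : realType) (x y : R) : 0 <= x -> x ^+ 2 <= x * y -> x <= y \/ x = 0.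
Proof.
move=> x0; have [->|xn h] := eqVneq x 0; first by right.
by left; rewrite expr2 ler_pM2l // in h; rewrite lt_neqAle eq_sym xn.
Qed.

Section WeightIdeal.
Variables (R : realType) (A T : cstarType R) (eta : A -> \bar R) (S : T -> A).
Hypothesis wt : weight eta.
Hypothesis pS : positive_map S.

Lemma wN_mull (z b : T) : wN eta S z -> wN eta S (b ∙ z).
Proof.
move=> Nz; by have [] := wN_gap wt pS (sqr_ge0 (nm b)) Nz (pos_gap_mul b z).
Qed.

Lemma wN_action (B : cstarType R) (pi : B -> T -> T) (b : B) z : action pi ->
  wN eta S z -> wN eta S (pi b z).
Proof.
move=> hp Nz; have M0 : 0 <= nm (b^† ∙ b) + 1 by have := nm_ge0 (b^† ∙ b); lra.
have [] // := wN_gap (Z := z) (W := pi b z) wt pS M0 Nz _.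
rewrite (act_adj hp) -(actM hp); apply: (act_gap hp); last by lra.
by rewrite cstarM cstarK.
Qed.
End WeightIdeal.

Section DominatedFunctional.
Variables (R : realType) (A B T : cstarType R) (t : min_tensor A B T).
Variables (eta : A -> \bar R) (f : B -> R[i]) (om : A -> R[i]) (F : T -> R[i]).
Hypothesis wt : weight eta.
Hypothesis pf : pos_dual f.
Hypothesis po : pos_dual om.
Hypothesis pF : pos_dual F.
Hypothesis FE : forall Z, F Z = om (slice_r t f Z).
Hypothesis dom : forall x, wN eta id x -> sn (fip om) x <= sn (wip eta id) x.

(** om <= eta implies om ⊗ f <= eta ⊗ f: write the slice of Z^† Z as s^2 and apply the domination to
    s. *)
Lemma dom_slice Z : wN eta (slice_r t f) Z -> sn (fip F) Z <= sn (wip eta (slice_r t f)) Z.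
Proof.
move=> NZ; have pS := slice_r_positive t pf.
rewrite -(@ler_pXn2r _ 2) ?nnegrE ?sn_ge0 // -lecR (fsn2 pF) FE (wsn2 wt pS NZ).
have [s [ss ps sX _]] := pos_sqrt NZ.1.
have Ns : wN eta id s by rewrite /wN /= ss sX.
rewrite -sX -{1}ss -(fsn2 po) lecR.
have := wsn2 wt (@id_positive R A) Ns; rewrite ss => <-.
by rewrite ler_pXn2r ?nnegrE ?sn_ge0 //; apply: dom.
Qed.
End DominatedFunctional.

Section DualElement.
Variables (R : realType) (G : lcqg R).
Local Notation A := (C0 G).
Local Notation T := (C0_2 G).
Local Notation t := (tens2 G).
Local Notation psi := (@haar_r R G).
Local Notation phi := (@haar_l R G).
Local Notation N := (wN psi (@id A)).
Local Notation ip := (wip psi (@id A)).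
Local Notation Sr f := (slice_r t f).
Local Notation Sl f := (slice_l t f).
Local Notation NT f := (wN psi (slice_r t f)).
Local Notation ipT f := (wip psi (slice_r t f)).
Let wI := wip_semi_inner (psi_weight G) (@id_positive R A).

Lemma sn_Q (f : A -> R[i]) b w : pos_dual f -> (forall c, f (c^† ∙ c) <= (nm c ^+ 2)%:C) -> N b ->
  sn ip (Sr f (Zr b w)) <= sn ip b * nm w.
Proof.
move=> pf f1 Nb; have h c : f (c^† ∙ c) <= (1 * nm c ^+ 2)%:C by rewrite mul1r.
have [_ h1] := sn_slice_le (psi_weight G) (@psi_lsc R G) pf ler01 h (rZ_N w pf Nb).
apply: le_trans h1 _; rewrite sqrtr1 mul1r rZ_sn //; apply: ler_wpM2l; first exact: sn_ge0.
by have := fsn_bound pf ler01 h w; rewrite sqrtr1 mul1r.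
Qed.

Lemma rep_separate b (u v : A) : N b ->
  (forall h Q, represents h Q b -> h u = h v) -> u = v.
Proof.
move=> Nb h; have [f [pf _ fw]] := norming_state (u - v).
have bf := iffLR (dualE f) pf.1.
have := h _ _ (rep_l (u - v) pf Nb) => e.
move: fw; rewrite cmulBr (flB bf) e subrr => /esym/complexI/eqP.
by rewrite expf_eq0 /= => /eqP/nm_eq0/eqP; rewrite subr_eq0 => /eqP.
Qed.

(** Slice Delta(b^†)(q ⊗ 1) by functionals om n below psi that approximate psi at q with error 1 /
    (n + 1). Every represented functional then sees a convergent sequence, with error proportional
    to the seminorm of its representative. *)
Lemma ef_ex b q : N b -> N q -> exists e, exists om : nat -> A -> R[i],
  [/\ forall n, pos_dual (om n), forall n x, N x -> sn (fip (om n)) x <= sn ip x,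
      scvg (fun n => Sl (om n) (Zl b^† q)) e &
      forall h Q, represents h Q b -> h e = ip q Q].
Proof.
move=> Nb Nq.
have inv0 n : 0 < n.+1%:R^-1 :> R by rewrite invr_gt0 ltr0n.
have [om hom] := choice (fun n => combes_ip (psi_weight G) (@psi_lsc R G) Nq (inv0 n)).
pose u n := Sl (om n) (Zl b^† q).
have hu h Q n : represents h Q b -> nmc (ip q Q - h (u n)) <= n.+1%:R^-1 * sn ip Q.
  by move=> [_ NQ hQ]; have [po _ h2] := hom n; rewrite /u hQ //; apply: h2.
have [e he] : exists e, scvg u e.
  (* The difference w is tested by f (w^† .) for a state f norming w^† w; its representative has
     seminorm at most sn ip b * nm w, so one factor nm w cancels. *)
  apply: (cauchy_inv (sn_ge0 ip b)) => m n; set w := u m - u n.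
  have [f [pf f1 fw]] := norming_state w; have bf := iffLR (dualE f) pf.1.
  have r := rep_l w pf Nb; have hm := hu _ _ m r; have hn := hu _ _ n r.
  have sQ := sn_Q w pf f1 Nb; set Q := Sr f (Zr b w) in r hm hn sQ.
  have : nm w ^+ 2 <= nm w * ((m.+1%:R^-1 + n.+1%:R^-1) * sn ip b).
    have -> : nm w ^+ 2 = nmc (f (w^† ∙ w)) by rewrite fw nmc_real ger0_norm // sqr_ge0.
    have -> : f (w^† ∙ w) = (ip q Q - f (w^† ∙ u n)) + - (ip q Q - f (w^† ∙ u m)).
      by rewrite {2}/w cmulBr (flB bf); ring.
    apply: le_trans (nmcD _ _) _; rewrite -[nmc (- _)]nmc_nm nmN nmc_nm.
    have := inv0 m; have := inv0 n; move: (m.+1%:R^-1) (n.+1%:R^-1) hm hn => i j hm hn j0 i0.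
    apply: le_trans (lerD hn hm) _.
    have -> : nm w * ((i + j) * sn ip b) = j * (sn ip b * nm w) + i * (sn ip b * nm w) by ring.
    by apply: lerD; apply: ler_wpM2l sQ; apply: ltW.
  case/(sqr_le_mul (nm_ge0 w)) => // ->; apply: mulr_ge0; last exact: sn_ge0.
  by apply: addr_ge0; apply: ltW.
exists e, om; split=> //; first by move=> n; have [] := hom n.
  by move=> n x Nx; have [_ h _] := hom n; apply: h.
move=> h Q r; have bh := let: And3 d _ _ := r in iffLR (dualE h) d.
apply: (scvg_uniq (V := R[i]^o) (bl_scvg bh he)).
apply: (scvg_inv (W := R[i]^o) (sn_ge0 ip Q)) => n /=; rewrite nmC nmc_nm; exact: hu.
Qed.

(** Formally (psi ⊗ id)(Delta(b^†)(q ⊗ 1)). For b and q in N a solution exists by [ef_ex] and is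
    unique by [rep_separate]. *)
Definition ef b q : A := xget 0 [set e : A | forall h Q, represents h Q b -> h e = ip q Q].

Lemma efE b q h Q : N b -> N q -> represents h Q b -> h (ef b q) = ip q Q.
Proof.
move=> Nb Nq; have [e [om [_ _ _ he]]] := ef_ex Nb Nq.
have := xgetPex (0 : A) (ex_intro (fun e => forall h Q, represents h Q b -> h e = ip q Q) e he).
by move=> /= H; apply: H.
Qed.

Lemma ef_approx b q : N b -> N q -> exists om : nat -> A -> R[i],
  [/\ forall n, pos_dual (om n), forall n x, N x -> sn (fip (om n)) x <= sn ip x &
      scvg (fun n => Sl (om n) (Zl b^† q)) (ef b q)].
Proof.
move=> Nb Nq; have [e [om [h1 h2 h3 he]]] := ef_ex Nb Nq; exists om; split=> //.
suff -> : ef b q = e by [].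
by apply: (rep_separate Nb) => h Q r; rewrite (he _ _ r) (efE Nb Nq r).
Qed.

Section FixedBase.
Variable b : A.
Hypothesis Nb : N b.

Lemma efP k q q' : N q -> N q' -> ef b (k *: q + q') = k *: ef b q + ef b q'.
Proof.
move=> Nq Nq'; apply: (rep_separate Nb) => h Q r.
have bh := let: And3 d _ _ := r in iffLR (dualE h) d; have NQ := let: And3 _ d _ := r in d.
rewrite (flD bh) (flZ bh) !(efE _ _ r) //; last exact: (si_NP wI).
exact: (si_P wI).
Qed.
Lemma efD q q' : N q -> N q' -> ef b (q + q') = ef b q + ef b q'.
Proof. by move=> Nq Nq'; have := efP 1 Nq Nq'; rewrite !scale1r. Qed.
Lemma ef0 : ef b 0 = 0.
Proof.
by apply: (addrI (ef b 0)); rewrite -efD ?addr0 //; apply: (si_N0 wI).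
Qed.
Lemma efZ k q : N q -> ef b (k *: q) = k *: ef b q.
Proof. by move=> Nq; have := efP k Nq (si_N0 wI); rewrite ef0 !addr0. Qed.
Lemma efB q q' : N q -> N q' -> ef b (q - q') = ef b q - ef b q'.
Proof.
by move=> Nq Nq'; rewrite addrC -scaleN1r efP // scaleN1r addrC.
Qed.
Lemma ef_sum (I : Type) (r : seq I) (F : I -> A) : (forall i, N (F i)) ->
  ef b (\sum_(i <- r) F i) = \sum_(i <- r) ef b (F i).
Proof.
move=> NF; elim: r => [|i r IH]; first by rewrite !big_nil ef0.
by rewrite !big_cons efD ?IH //; apply: (siN_sum wI).
Qed.

Lemma ef_bound q : N q -> nm (ef b q) <= sn ip b * sn ip q.
Proof.
move=> Nq; set e := ef b q; have [f [pf f1 fe]] := norming_state e.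
have r := rep_l e pf Nb; have sQ := sn_Q e pf f1 Nb.
have NQ := let: And3 _ d _ := r in d.
have : nm e ^+ 2 <= nm e * (sn ip b * sn ip q).
  have -> : nm e ^+ 2 = nmc (f (e^† ∙ e)) by rewrite fe nmc_real ger0_norm // sqr_ge0.
  rewrite {2}/e (efE Nb Nq r); apply: le_trans (si_CS wI Nq NQ) _.
  have := sn_ge0 ip q; move: sQ; move: (sn ip _) (sn ip b) (sn ip q) (nm e) => x y z v h z0.
  have -> : v * (y * z) = z * (y * v) by ring.
  exact: ler_wpM2l.
case/(sqr_le_mul (nm_ge0 e)) => // ->.
by apply: mulr_ge0; exact: sn_ge0.
Qed.

(** Bessel again: the elements (e_b(v j))^† z are the coefficients of Delta(b)(1 ⊗ z) along the
    orthonormal v j, and this vector has norm sn ip b times that of z. The bound is independent of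
    n. *)
Lemma ef_row n (v : nat -> A) : on_family N ip n v ->
  nm (\sum_(j < n) ef b (v j) ∙ (ef b (v j))^†) <= sn ip b ^+ 2.
Proof.
move=> on; pose e j := ef b (v j); set X := \sum_(j < n) _.
have pX : pos_cone X by apply: pos_sum => j _; apply: pos_mul_star.
have [s [ss _ sX _]] := pos_sqrt pX.
suff h : nm s ^+ 2 <= sn ip b ^+ 2 by apply: le_trans h; rewrite -sX -{1}ss nm_cstar2.
apply: nm_le_gap => [|z]; first exact: sqr_ge0.
rewrite ss sX; apply: pos_functional => [|g pg].
  rewrite cstarB cstarZ !cstarM !cstarK (pos_sa pX) cmulA.
  by congr (_ *: _ - _); apply/CrealP/ger0_real; rewrite ler0c sqr_ge0.
have bg := iffLR (dualE g) pg.1; have gI := fip_semi_inner pg.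
pose W := \sum_(j < n) t (v j) ((e j)^† ∙ z).
have sW := sn_tens_on_l t (psi_weight G) pg (fun l => (e l)^† ∙ z) on.
have NW : NT g W.
  have tI := wip_semi_inner (psi_weight G) (slice_r_positive t pg).
  apply: (siN_sum tI) => j _.
  by case: (wip_tens t (psi_weight G) pg ((e j)^† ∙ z) z (on.1 j) (on.1 j)).
have tI := wip_semi_inner (psi_weight G) (slice_r_positive t pg).
have NZ := rZ_N z pg Nb.
have Nt (j : 'I_n) : NT g (t (v j) ((e j)^† ∙ z)).
  by case: (wip_tens t (psi_weight G) pg ((e j)^† ∙ z) z (on.1 j) (on.1 j)).
have gX : g (z^† ∙ X ∙ z) = ipT g W (Zr b z).
  rewrite (si_suml tI _ (fun j _ => Nt j) NZ).
  rewrite cmul_sumr cmul_suml (bl_sum bg); apply: eq_bigr => j _.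
  rewrite (si_conj tI NZ (Nt j)) (slice_adjoint t psi pg).
  have r := rep_lr ((e j)^† ∙ z) z pg Nb; have NQ := let: And3 _ d _ := r in d.
  rewrite -(si_conj wI NQ (on.1 j)) -(efE Nb (on.1 j) r).
  by rewrite !cmulA.
have gX2 : g (z^† ∙ X ∙ z) = (sn (ipT g) W ^+ 2)%:C.
  rewrite sW cmul_sumr cmul_suml (bl_sum bg) raddf_sum /=; apply: eq_bigr => j _.
  by rewrite (fsn2 pg) cstarM cstarK !cmulA.
rewrite (flB bg) (flZ bg) gX2 -(fsn2 pg) -rmorphM -rmorphB ler0c subr_ge0.
have : sn (ipT g) W ^+ 2 <= sn (ipT g) W * (sn ip b * sn (fip g) z).
  have -> : sn (ipT g) W ^+ 2 = nmc (g (z^† ∙ X ∙ z)).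
    by rewrite gX2 nmc_real ger0_norm // sqr_ge0.
  by rewrite gX; apply: le_trans (si_CS tI NW NZ) _; rewrite rZ_sn.
have K0 : 0 <= sn ip b * sn (fip g) z by apply: mulr_ge0; exact: sn_ge0.
rewrite -exprMn; case/(sqr_le_mul (sn_ge0 _ W)) => [h|->].
  by rewrite ler_pXn2r ?nnegrE ?sn_ge0.
by rewrite expr0n /= sqr_ge0.
Qed.
End FixedBase.
End DualElement.

Section WeakConvergence.
Variables (R : realType) (A B T : cstarType R) (t : min_tensor A B T).
Variables (eta : A -> \bar R) (f : B -> R[i]).
Hypothesis wt : weight eta.
Hypothesis lsc : forall r : R, closed [set a | pos_cone a /\ (eta a <= r%:E)%E].
Hypothesis pf : pos_dual f.
Local Notation NT := (wN eta (slice_r t f)).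
Local Notation ipT := (wip eta (slice_r t f)).
Let tI := wip_semi_inner wt (slice_r_positive t pf).

(** For bounded sequences weak convergence may be tested on elementary tensors, by their density. *)
Lemma weak_zero (U : nat -> T) (M : R) Z : (forall n, NT (U n)) -> (forall n, sn ipT (U n) <= M) ->
  (forall p g, wN eta id p -> scvg (fun n => ipT (U n) (t p g) : R[i]^o) 0) -> NT Z ->
  scvg (fun n => ipT (U n) Z : R[i]^o) 0.
Proof.
move=> NU UM hU NZ e e0.
have M0 : 0 <= M by apply: le_trans (UM 0%N); exact: sn_ge0.
have M1 : 0 < M + 1 by apply: ltr_wpDl.
have e2 : 0 < e / 2 / (M + 1) by rewrite !divr_gt0.
have [m [p [w [_ Np [NS sS]]]]] := tens_dense_r wt lsc pf NZ e2.
set S := \sum_(l < m) _ in NS sS.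
have Nt (l : 'I_m) : NT (t (p l) (w l)).
  by case: (wip_tens t wt pf (w l) (w l) (Np l) (Np l)).
have NS' : NT S by apply: (siN_sum tI) => l _.
have cS : scvg (fun n => ipT (U n) S : R[i]^o) 0.
  have h (r : seq 'I_m) : scvg (fun n => \sum_(l <- r) ipT (U n) (t (p l) (w l)) : R[i]^o) 0.
    elim: r => [|l r IH].
      by under eq_fun do rewrite big_nil; apply: scvg_cst.
    under eq_fun do rewrite big_cons.
    by have := scvgD (hU (p l) (w l) (Np l)) IH; rewrite addr0.
  have -> : (fun n => ipT (U n) S) = (fun n => \sum_(l < m) ipT (U n) (t (p l) (w l))).
    by apply: funext => n; rewrite (si_sumr tI _ (fun j _ => Nt j) (NU n)).
  exact: h.
have e2' : 0 < e / 2 by rewrite divr_gt0.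
have [n0 hn] := cS _ e2'; exists n0 => n /hn.
rewrite !subr0 !nmc_nm => h1.
have -> : ipT (U n) Z = ipT (U n) (Z - S) + ipT (U n) S.
  by rewrite -(siDr tI) ?subrK.
apply: le_lt_trans (nmcD _ _) _; rewrite [ltRHS]splitr; apply: ler_ltD h1.
apply: le_trans (si_CS tI (NU n) NS) _.
have : sn ipT (U n) * sn ipT (Z - S) <= (M + 1) * (e / 2 / (M + 1)).
  apply: ler_pM; rewrite ?sn_ge0 //; last exact: ltW.
  by apply: le_trans (UM n) _; rewrite lerDl.
by rewrite [X in _ <= X -> _]mulrC divfK // gt_eqF.
Qed.

End WeakConvergence.

Section RowBound.
Variables (R : realType) (A T : cstarType R) (eta : A -> \bar R) (S : T -> A).
Hypothesis wt : weight eta.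
Hypothesis pS : positive_map S.
Lemma wN_row n (Y : 'I_n -> T) (X : T) (M : R) : 0 <= M -> (forall j, wN eta S (Y j)) ->
  pos_cone (M%:C *: (\sum_j (Y j)^† ∙ Y j) - X^† ∙ X) ->
  wN eta S X /\ sn (wip eta S) X ^+ 2 <= M * \sum_j sn (wip eta S) (Y j) ^+ 2.
Proof.
move=> M0 NY pX; have [bS _ _] := pS.
have h (r : seq 'I_n) : wfin eta (S (\sum_(j <- r) (Y j)^† ∙ Y j)) /\
    wval eta (S (\sum_(j <- r) (Y j)^† ∙ Y j)) = \sum_(j <- r) sn (wip eta S) (Y j) ^+ 2.
  elim: r => [|j r [IH1 IH2]]; first by rewrite !big_nil (bl0 bS); exact: wfin0.
  rewrite !big_cons (blD bS); have [h1 ->] := wfinD wt (NY j) IH1; split=> //.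
  by rewrite IH2 (wsn2 wt pS (NY j)).
have [h1 h2] := h (index_enum _); have [h3 h4] := wfinZ wt M0 h1.
have h7 : pos_cone (M%:C *: S (\sum_j (Y j)^† ∙ Y j) - S (X^† ∙ X)).
  by rewrite -(blZ bS) -(blB bS); apply: (pmap_pos pS).
have [_ pSX _] := pS; have [h8 h9] := wfin_le wt h3 (pSX X) h7.
by split=> //; rewrite (wsn2 wt pS) // -h2 -h4.
Qed.
End RowBound.

Lemma faithful_sn0 (R : realType) (A : cstarType R) (eta : A -> \bar R) v :
  weight eta -> faithful_weight eta ->
  wN eta id v -> sn (wip eta id) v = 0 -> v = 0.
Proof.
move=> wt ft Nv s0; apply: cstar_mul_eq0; apply: ft; first exact: pos_star_mul.
have := wsn2 wt (@id_positive R A) Nv; rewrite s0 expr0n /= => e.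
by rewrite (wfinE wt Nv) -e.
Qed.

(** * The elements e_y(p) as vectors of the GNS space of phi *)

Section LeftWeight.
Variables (R : realType) (G : lcqg R) (t' : min_tensor (C0 G) (C0 G) (C0_2 G)).
Local Notation A := (C0 G).
Local Notation T := (C0_2 G).
Local Notation t := (tens2 G).
Hypothesis ht : forall a b, t' b a = t a b.
Local Notation psi := (@haar_r R G).
Local Notation phi := (@haar_l R G).
Local Notation N := (wN psi (@id A)).
Local Notation ip := (wip psi (@id A)).
Local Notation Sr f := (slice_r t f).
Local Notation Sl f := (slice_l t f).
Local Notation NT f := (wN psi (slice_r t f)).
Local Notation ipT f := (wip psi (slice_r t f)).
Local Notation Nf := (wN phi (@id A)).
Local Notation ipf := (wip phi (@id A)).
Local Notation NTf f := (wN phi (slice_r t' f)).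
Local Notation ipTf f := (wip phi (slice_r t' f)).
Let wI := wip_semi_inner (psi_weight G) (@id_positive R A).
Let fI := wip_semi_inner (phi_weight G) (@id_positive R A).

Let lZE a c W : Zl a c ∙ W = D a (l2 t' c W).
Proof. by rewrite ZlE (flip_l1 ht). Qed.
Lemma lZ_N (f : A -> R[i]) a c : pos_dual f -> Nf a -> NTf f (Zl a c).
Proof. move=> pf; exact: (oZ_N (@D_action _ G) lZE (phi_weight G) (phi_inv ht) pf). Qed.
Lemma lZ_ip (f : A -> R[i]) a b c d : pos_dual f -> Nf a -> Nf b ->
  ipTf f (Zl a c) (Zl b d) = ipf a b * f (d^† ∙ c).
Proof. move=> pf; exact: (oZ_ip (@D_action _ G) lZE (phi_weight G) (phi_inv ht) pf). Qed.
Lemma lZ_sn (f : A -> R[i]) a c : pos_dual f -> Nf a ->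
  sn (ipTf f) (Zl a c) = sn ipf a * sn (fip f) c.
Proof. move=> pf; exact: (oZ_sn (@D_action _ G) lZE (phi_weight G) (phi_inv ht) pf). Qed.

(** e is a limit of left slices of Delta(k)^† Delta(h)(p ⊗ 1). For om' below phi, om' (e^† e) is the
    pairing of Delta(h)(p ⊗ 1) with Delta(k)(1 ⊗ e) under om ⊗ om'. Left invariance bounds the first
    vector, right invariance the second, and one factor sn (fip om') e cancels. *)
Lemma ef_phi k h p : N k -> Nf h -> N p -> Nf (ef (h^† ∙ k) p) /\
  sn ipf (ef (h^† ∙ k) p) <= sn ip k * sn ipf h * sn ip p.
Proof.
move=> Nk Nh Np; have Ny : N (h^† ∙ k) := wN_mull (psi_weight G) (@id_positive R A) h^† Nk.
have [om [po dom cv]] := ef_approx Ny Np.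
apply: (wN_lsc (phi_weight G) (@phi_lsc R G) cv) => n.
set K := sn ip k * _ * _; set e := Sl (om n) _.
have K0 : 0 <= K by rewrite !mulr_ge0 ?sn_ge0.
have eE : e = slice_r t' (om n) (D k^† (Zl h p)).
  by rewrite /e cstarM cstarK -Zl_D (flip_slice ht (po n).1).
have NZl := lZ_N p (po n) Nh.
have NY := wN_action (phi_weight G) (slice_r_positive t' (po n)) k^† (@D_action _ G) NZl.
have [C C0 hC] := dual_pos_bound (po n).
have Ne : Nf e.
  by rewrite eE; have [] := sn_slice_le (phi_weight G) (@phi_lsc R G) (po n) C0 hC NY.
split=> //.
have key om' : pos_dual om' -> (forall x, Nf x -> sn (fip om') x <= sn ipf x) ->
    sn (fip om') e <= K.
  move=> p' dom'; pose F := dual_tens t (om n) om'.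
  have pF := dual_tens_pos t (po n) p'; have [_ _ FE] := dual_tens_spec t (po n).1 p'.1.
  have FE1 Z : F Z = om' (Sl (om n) Z) by rewrite /F FE; exact: dual_tensE (po n).1 p'.1.
  have FE2 Z : F Z = om' (slice_r t' (om n) Z) by rewrite FE1 (flip_slice ht (po n).1).
  have h1 := dom_slice (psi_weight G) p' (po n) pF FE (dom n) (rZ_N e p' Nk).
  have h2 := dom_slice (phi_weight G) (po n) p' pF FE2 dom' NZl.
  rewrite rZ_sn // in h1; rewrite lZ_sn // in h2.
  have le2 : sn (fip om') e ^+ 2 <= sn (fip om') e * K.
    have -> : sn (fip om') e ^+ 2 = nmc (F ((Zr k e)^† ∙ Zl h p)).
      rewrite Zr_starM FE1 (slice_l_l2 t (po n).1) (flip_slice ht (po n).1) -eE.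
      by rewrite -(fsn2 p') nmc_real ger0_norm // sqr_ge0.
    have := si_CS (fip_semi_inner pF) (x := Zl h p) (y := Zr k e) I I.
    move=> /le_trans; apply.
    have h3 := le_trans h2 (ler_wpM2l (sn_ge0 ipf h) (dom n p Np)).
    have -> : sn (fip om') e * K = (sn ipf h * sn ip p) * (sn ip k * sn (fip om') e).
      by rewrite /K; ring.
    by apply: ler_pM; rewrite ?sn_ge0.
  by case/(sqr_le_mul (sn_ge0 _ e)): le2 => // ->.
rewrite -(@ler_pXn2r _ 2) ?nnegrE ?sn_ge0 //.
apply: (@le_eps _ _ _ (sn ipf e)) => d d0.
have [om' [p' dom' hh]] := combes_ip (phi_weight G) (@phi_lsc R G) Ne d0.
have := hh e Ne; have := key om' p' dom'.
rewrite (sn2 fI Ne) -(fsn2 p') -rmorphB nmc_real.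
have := sn_ge0 (fip om') e; move: (sn (fip om') e) (sn ipf e) => s u s0 sK.
rewrite ler_norml => /andP[_ le3].
have : s ^+ 2 <= K ^+ 2 by rewrite ler_pXn2r ?nnegrE.
move: (s ^+ 2) (u ^+ 2) (K ^+ 2) le3 => x y z h1 h2.
rewrite mulrC; lra.
Qed.

(** Transfers convergence of kap n to Z0 for psi ⊗ f into weak convergence of U n to V for phi ⊗ f.
    The link [hB] is a family of tests by functionals om, each of which is a pairing with one vector
    B on the psi side. *)
Lemma weak_limit (f : A -> R[i]) (U : nat -> T) (kap : nat -> T) V Z0 M Z : pos_dual f ->
  (forall n, NTf f (U n)) -> (forall n, sn (ipTf f) (U n) <= M) -> NTf f V ->
  (forall n, NT f (kap n)) -> NT f Z0 ->
  (forall e, 0 < e -> exists n0, forall n, (n0 <= n)%N -> sn (ipT f) (kap n - Z0) < e) ->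
  (forall om g g', pos_dual om -> Nf g' -> exists B, [/\ NT f B,
     forall n, om (g'^† ∙ Sl f (l1 t g^† (U n))) = ipT f (kap n) B &
     om (g'^† ∙ Sl f (l1 t g^† V)) = ipT f Z0 B]) ->
  NTf f Z -> scvg (fun n => ipTf f (U n) Z : R[i]^o) (ipTf f V Z : R[i]^o).
Proof.
move=> pf NU UM NV Nk NZ0 hk hB NZ.
have tI := wip_semi_inner (psi_weight G) (slice_r_positive t pf).
have tf := wip_semi_inner (phi_weight G) (slice_r_positive t' pf).
have NUV n : NTf f (U n - V) by apply: (siNB tf).
pose M' := M + sn (ipTf f) V.
have UVM n : sn (ipTf f) (U n - V) <= M'.
  by apply: le_trans (snB tf (NU n) NV) _; rewrite lerD2r.
suff h : scvg (fun n => ipTf f (U n - V) Z : R[i]^o) 0.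
  move=> e /h [n0 hn]; exists n0 => n /hn; rewrite subr0.
  by rewrite (siB tf).
apply: (weak_zero (phi_weight G) (@phi_lsc R G) pf NUV UVM) => // g' g Ng'.
have M0 : 0 <= sn (fip f) g * M'.
  by apply: mulr_ge0; [exact: sn_ge0 | apply: le_trans (UVM 0%N); exact: sn_ge0].
move=> e e0; have e2 : 0 < e / 2 by rewrite divr_gt0.
have [d d0 hd] : exists2 d, 0 < d & d * (sn (fip f) g * M') <= e / 2.
  exists (e / 2 / (sn (fip f) g * M' + 1)); first by rewrite divr_gt0 // ltr_wpDl.
  rewrite mulrAC ler_pdivrMr ?ltr_wpDl //; apply: ler_wpM2l; first exact: ltW.
  by rewrite lerDl.
(* om replaces phi in the pairing with g', with an error d that is uniform over n because the U n -
   V are bounded. *)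
have [om [po _ hom]] := combes_ip (phi_weight G) (@phi_lsc R G) Ng' d0.
have [B [NB B1 B2]] := hB om g g' po Ng'.
have bo := iffLR (dualE om) po.1.
have sB1 : 0 < sn (ipT f) B + 1 by rewrite ltr_wpDl ?sn_ge0.
have [n0 hn] := hk _ (divr_gt0 e2 sB1); exists n0 => n /hn hn'.
rewrite subr0 nmc_nm (slice_adjoint t' phi pf).
set X := slice_r t' f _.
have [NX sX] := sn_slice (phi_weight G) pf g (NUV n); rewrite -/X in NX sX.
have omX : om (g'^† ∙ X) = ipT f (kap n - Z0) B.
  rewrite (siB tI) // -B1 -B2 -(flB bo) -cmulBr -(blB (slice_l_bl t pf.1)) -(blB (l1_bl t _)).
  by rewrite /X (flip_slice ht pf.1) (flip_l1 ht).
have -> : ipf X g' = Num.conj (ipf g' X - om (X^† ∙ g')) + om (g'^† ∙ X).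
  rewrite rmorphB /= -(si_conj fI Ng' NX) -(pos_dual_star po) cstarM cstarK.
  by rewrite subrK.
apply: le_lt_trans (nmcD _ _) _; rewrite nmcJ [ltRHS]splitr; apply: ler_ltD.
  apply: le_trans (hom X NX) _; apply: le_trans hd; apply: ler_wpM2l; first exact: ltW.
  by apply: le_trans sX _; apply: ler_wpM2l; [exact: sn_ge0 | exact: UVM].
rewrite omX; apply: le_lt_trans (si_CS tI _ NB) _; first exact: (siNB tI).
apply: le_lt_trans (_ : _ <= sn (ipT f) (kap n - Z0) * (sn (ipT f) B + 1)) _.
  by apply: ler_wpM2l; [exact: sn_ge0 | rewrite lerDl].
by rewrite -ltr_pdivlMr.
Qed.
End LeftWeight.

Section DualElementSlices.
Variables (R : realType) (G : lcqg R) (t' : min_tensor (C0 G) (C0 G) (C0_2 G)).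
Local Notation A := (C0 G).
Local Notation T := (C0_2 G).
Local Notation t := (tens2 G).
Hypothesis ht : forall a b, t' b a = t a b.
Local Notation psi := (@haar_r R G).
Local Notation phi := (@haar_l R G).
Local Notation N := (wN psi (@id A)).
Local Notation ip := (wip psi (@id A)).
Local Notation Sr f := (slice_r t f).
Local Notation Sl f := (slice_l t f).
Local Notation NT f := (wN psi (slice_r t f)).
Local Notation ipT f := (wip psi (slice_r t f)).
Local Notation Nf := (wN phi (@id A)).
Local Notation ipf := (wip phi (@id A)).
Local Notation NTf f := (wN phi (slice_r t' f)).
Local Notation ipTf f := (wip phi (slice_r t' f)).
Let wI := wip_semi_inner (psi_weight G) (@id_positive R A).
Let fI := wip_semi_inner (phi_weight G) (@id_positive R A).

Lemma l1_r2 g K (Z : T) : l1 t g (r2 t K Z) = r2 t K (l1 t g Z).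
Proof.
by apply: cmul_separate => W; rewrite -(act_mulr (l1_action t)) !r2_mul (act_mulr (l1_action t)).
Qed.

Lemma wN_tens (f : A -> R[i]) p w : pos_dual f -> N p -> NT f (t p w).
Proof. by move=> pf Np; case: (wip_tens t (psi_weight G) pf w w Np Np). Qed.
Lemma wN_tens' (f : A -> R[i]) p w : pos_dual f -> Nf p -> NTf f (t' p w).
Proof. by move=> pf Np; case: (wip_tens t' (phi_weight G) pf w w Np Np). Qed.

Lemma ip_slice (f : A -> R[i]) p w Y : pos_dual f -> N p -> NT f Y ->
  ip p (Sr f (l2 t w^† Y)) = ipT f (t p w) Y.
Proof.
move=> pf Np NY; have tI := wip_semi_inner (psi_weight G) (slice_r_positive t pf).
have [NS _] := sn_slice (psi_weight G) pf w NY.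
by rewrite (si_conj wI NS Np) -(slice_adjoint t psi pf) -(si_conj tI NY (wN_tens w pf Np)).
Qed.

Lemma sn_Zl_on (f : A -> R[i]) n (e w : nat -> A) : pos_dual f ->
  on_family setT (fip f) n w -> (forall l, Nf (e l)) ->
  NTf f (\sum_(l < n) Zl (e l) (w l)) /\
  sn (ipTf f) (\sum_(l < n) Zl (e l) (w l)) ^+ 2 = \sum_(l < n) sn ipf (e l) ^+ 2.
Proof.
move=> pf on Ne; have tf := wip_semi_inner (phi_weight G) (slice_r_positive t' pf).
have Nt (l : 'I_n) : NTf f (Zl (e l) (w l)) by apply: (lZ_N ht).
have NS : NTf f (\sum_(l < n) Zl (e l) (w l)) by apply: (siN_sum tf) => l _.
split=> //; apply: complexI; rewrite -(sn2 tf NS) (si_suml tf _ (fun j _ => Nt j) NS) rmorph_sum.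
apply: eq_bigr => l _ /=; rewrite (si_sumr tf _ (fun j _ => Nt j) (Nt l)) (bigD1 l) //= big1 ?addr0.
  rewrite (lZ_ip ht) // -[f _]/(fip f (w l) (w l)) on.2 // eqxx mulr1.
  by rewrite (sn2 fI (Ne l)).
move=> j jl; rewrite (lZ_ip ht) // -[f _]/(fip f (w l) (w j)) on.2 //.
by rewrite ord_neqF ?mulr0 // eq_sym.
Qed.

Section Tests.
Variables (om f : A -> R[i]) (g g' : A).
Hypothesis (po : pos_dual om) (pf : pos_dual f).
Let bo := iffLR (dualE om) po.1.

(** The test required by [weak_limit]: each functional of e_y(p l) occurring here is represented by
    [rep_comp1], and its representative is a slice of one vector common to all l. *)
Lemma Zl_test y (I : eqType) (r : seq I) (p w : I -> A) : N y -> (forall l, l \in r -> N (p l)) ->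
  om (g'^† ∙ Sl f (l1 t g^† (\sum_(l <- r) Zl (ef y (p l)) (w l)))) =
  ipT f (\sum_(l <- r) t (p l) (w l)) (Zr (Sr om (Zr y g')) g).
Proof.
move=> Ny Np; have tI := wip_semi_inner (psi_weight G) (slice_r_positive t pf).
have NB : NT f (Zr (Sr om (Zr y g')) g) by apply: rZ_N => //; apply: N_slice.
rewrite !big_seq (si_suml tI) // => [|l lr]; last by apply: wN_tens => //; apply: Np.
rewrite (bl_sum (l1_bl t _)) (bl_sum (slice_l_bl t pf.1)) cmul_sumr (bl_sum bo).
apply: eq_bigr => l lr.
by rewrite (efE Ny (Np l lr) (rep_comp1 g g' (w l) po pf Ny)) ip_slice //; apply: Np.
Qed.

(** The analogue of [Zl_test] for the vectors Delta(e_b(p l))(w l ⊗ K), where the leg K is absorbed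
    into the functional. *)
Lemma D_test b K (I : eqType) (r : seq I) (p w : I -> A) : N b -> (forall l, l \in r -> N (p l)) ->
  om (g'^† ∙ Sl f (l1 t g^† (\sum_(l <- r) D (ef b (p l)) (t' K (w l))))) =
  ipT f (\sum_(l <- r) t (p l) (w l)) (Zr (Sr om (l2 t K^† (Zr b g'))) g).
Proof.
move=> Nb Np; have tI := wip_semi_inner (psi_weight G) (slice_r_positive t pf).
have NB : NT f (Zr (Sr om (l2 t K^† (Zr b g'))) g) by apply: rZ_N => //; apply: N_slice2.
rewrite !big_seq (si_suml tI) // => [|l lr]; last by apply: wN_tens => //; apply: Np.
rewrite (bl_sum (l1_bl t _)) (bl_sum (slice_l_bl t pf.1)) cmul_sumr (bl_sum bo).
apply: eq_bigr => l lr.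
have -> : g'^† ∙ Sl f (l1 t g^† (D (ef b (p l)) (t' K (w l)))) =
    g'^† ∙ Sl f (l1 t g^† (Zl (ef b (p l)) (w l))) ∙ K.
  rewrite ht D_tens_l -cmulA -(slice_l_r2 t _ _ pf.1); congr (_ ∙ Sl f _).
  exact: l1_r2.
by rewrite (efE Nb (Np l lr) (rep_comp g g' (w l) po pf K Nb)) ip_slice //; apply: Np.
Qed.
End Tests.

(** Formally, if sum p_l ⊗ w_l tends to Delta(x)(1 ⊗ xi), then sum Delta(e_y(p_l))(w_l ⊗ 1) tends to
    xi ⊗ e_y(x). The first lemma on tests identifies this weak limit; orthonormal second legs and
    [ef_phi] bound the sums. *)
Lemma ef_slice (f : A -> R[i]) x xi d z k h : pos_dual f -> N x -> N k -> Nf h -> Nf z ->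
  ipf (ef (h^† ∙ k) (Sr f (l2 t d^† (Zr x xi)))) z =
  ipTf f (t' (ef (h^† ∙ k) x) xi) (Zl z d).
Proof.
move=> pf Nx Nk Nh Nz; set y := h^† ∙ k.
have bf := iffLR (dualE f) pf.1; have bS := slice_r_bl t pf.1.
have Ny : N y := wN_mull (psi_weight G) (@id_positive R A) h^† Nk.
pose C := sn ip k * sn ipf h; have C0 : 0 <= C by rewrite mulr_ge0 ?sn_ge0.
have tI := wip_semi_inner (psi_weight G) (slice_r_positive t pf).
have tf := wip_semi_inner (phi_weight G) (slice_r_positive t' pf).
have NZ := rZ_N xi pf Nx.
have inv0 n : 0 < n.+1%:R^-1 :> R by rewrite invr_gt0 ltr0n.
have [mm hm] := choice (fun n => tens_dense_r (psi_weight G) (@psi_lsc R G) pf NZ (inv0 n)).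
have [p hp] := choice hm; have [w hw] := choice hp.
pose kap n := \sum_(l < mm n) t (p n l) (w n l).
pose U n := \sum_(l < mm n) Zl (ef y (p n l)) (w n l).
have Np n l : N (p n l) by have [_ h1 _] := hw n; apply: h1.
have Nk' n : NT f (kap n) by apply: (siN_sum tI) => l _; apply: wN_tens.
have sk n : sn (ipT f) (kap n - Zr x xi) < n.+1%:R^-1.
  have [_ _ [h1 h2]] := hw n; apply: le_lt_trans h2; rewrite -(snN tI h1) opprB //.
have Ne n l : Nf (ef y (p n l)) by have [] := ef_phi ht Nk Nh (Np n l).
pose M := C * (1 + sn (ipT f) (Zr x xi)).
have inv1 n : n.+1%:R^-1 <= 1 :> R by rewrite invf_le1 ?ltr0n // ler1n.
have sU n : NTf f (U n) /\ sn (ipTf f) (U n) <= M.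
  have [on _ _] := hw n; have [h1 h2] := sn_Zl_on pf on (Ne n); split=> //.
  have M0 : 0 <= M by rewrite mulr_ge0 // addr_ge0 ?sn_ge0.
  rewrite -(@ler_pXn2r _ 2) ?nnegrE ?sn_ge0 // h2.
  apply: (@le_trans _ _ ((C * sn (ipT f) (kap n)) ^+ 2)).
    rewrite exprMn (sn_tens_on_r t (psi_weight G) pf on (Np n)) mulr_sumr.
    apply: ler_sum => l _; rewrite -exprMn ler_pXn2r ?nnegrE ?mulr_ge0 ?sn_ge0 //.
    by have [] := ef_phi ht Nk Nh (Np n l).
  rewrite ler_pXn2r ?nnegrE //; last by rewrite mulr_ge0 ?sn_ge0.
  apply: ler_wpM2l => //.
  rewrite -[kap n](subrK (Zr x xi)); apply: le_trans (snD tI (siNB tI (Nk' n) NZ) NZ) _.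
  by rewrite lerD2r; apply: le_trans (ltW (sk n)) _.
have [Nex sex] := ef_phi ht Nk Nh Nx; rewrite -/y in Nex sex.
have NV := wN_tens' xi pf Nex; have Nzd := lZ_N ht d pf Nz.
have sk' e : 0 < e -> exists n0, forall n, (n0 <= n)%N -> sn (ipT f) (kap n - Zr x xi) < e.
  by move=> /inv_small [n0 hn]; exists n0 => n /hn; apply: lt_trans.
have cv1 : scvg (fun n => ipTf f (U n) (Zl z d) : R[i]^o)
    (ipTf f (t' (ef y x) xi) (Zl z d) : R[i]^o).
  apply: (weak_limit ht pf (fun n => (sU n).1) (fun n => (sU n).2) NV Nk' NZ sk' _ Nzd).
  move=> om g g' po _; exists (Zr (Sr om (Zr y g')) g); split.
  - by apply: rZ_N => //; apply: N_slice.
  - move=> n; apply: (@Zl_test om f g g' po pf y _ (index_enum _) (fun l : 'I_(mm n) => p n l)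
      (fun l => w n l) Ny) => l _; exact: Np.
  rewrite ht l1E (slice_lE t pf.1) cmulZr (flZ (iffLR (dualE om) po.1)).
  by rewrite (efE Ny Nx (rep_l g' po Ny)) rZ_ip 1?mulrC //; apply: N_slice.
apply: (scvg_uniq (V := R[i]^o) _ cv1).
(* Left invariance turns the pairing with Delta(z)(d ⊗ 1) into the scalars f (d^† w_l), that is,
   into a right slice of kap n inside e_y. *)
have e2 n : ipTf f (U n) (Zl z d) = ipf (ef y (Sr f (l2 t d^† (kap n)))) z.
  have -> : Sr f (l2 t d^† (kap n)) = \sum_(l < mm n) f (d^† ∙ w n l) *: p n l.
    rewrite (bl_sum (l2_bl t _)) (bl_sum bS); apply: eq_bigr => l _.
    by rewrite l2E (slice_rE t pf.1).
  rewrite (ef_sum Ny) => [|l]; last by apply: (siNZ wI).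
  have Nl (l : 'I_(mm n)) : Nf (ef y (f (d^† ∙ w n l) *: p n l)).
    by rewrite (efZ Ny) //; apply: (siNZ fI).
  rewrite (si_suml fI _ (fun j _ => Nl j) Nz).
  rewrite (si_suml tf _ _ Nzd) => [|l _]; last exact: (lZ_N ht).
  apply: eq_bigr => l _; rewrite (lZ_ip ht) // (efZ Ny) // (siZ fI) 1?mulrC //.
pose K := C * sn (fip f) d * sn ipf z.
have K0 : 0 <= K by rewrite !mulr_ge0 ?sn_ge0.
apply: (scvg_inv K0) => n; rewrite nmc_nm e2.
have NQ Y : NT f Y -> N (Sr f (l2 t d^† Y)).
  by move=> NY; have [] := sn_slice (psi_weight G) pf d NY.
have NeQ Y : NT f Y -> Nf (ef y (Sr f (l2 t d^† Y))).
  by move=> NY; have [] := ef_phi ht Nk Nh (NQ Y NY).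
rewrite -(siB fI (NeQ _ (Nk' n)) (NeQ _ NZ) Nz) -(efB Ny (NQ _ (Nk' n)) (NQ _ NZ)).
rewrite -(blB bS) -(blB (l2_bl t _)).
have NkZ := siNB tI (Nk' n) NZ.
apply: le_trans (si_CS fI (NeQ _ NkZ) Nz) _.
have [_ h1] := ef_phi ht Nk Nh (NQ _ NkZ); have [_ h2] := sn_slice (psi_weight G) pf d NkZ.
have -> : n.+1%:R^-1 * K = C * (sn (fip f) d * n.+1%:R^-1) * sn ipf z by rewrite /K; ring.
apply: ler_wpM2r; first exact: sn_ge0.
apply: le_trans h1 _; apply: ler_wpM2l => //; apply: le_trans h2 _.
by apply: ler_wpM2l; [exact: sn_ge0 | apply: ltW].
Qed.

(** Row bounds require orthonormal first legs. Faithfulness of psi upgrades Gram-Schmidt to exact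
    equality, and the quantification over F lets one orthonormalization serve several sums built
    from the same code. *)
Lemma code_on (x : seq (A * A)) : (forall q, q \in x -> N q.1) -> exists n, exists v w : nat -> A,
  on_family N ip n v /\ forall (W : normedModType R[i]) (F : A -> A -> W),
    (forall k p p' w, N p -> N p' -> F (k *: p + p') w = k *: F p w + F p' w) ->
    (forall k p w w', N p -> F p (k *: w + w') = k *: F p w + F p w') ->
    \sum_(q <- x) F q.1 q.2 = \sum_(j < n) F (v j) (w j).
Proof.
move=> Nx; pose u i := (nth (0, 0) x i).1.
have Nu i : N (u i).
  rewrite /u; case: (ltnP i (size x)) => hi; first by apply: Nx; apply: mem_nth.
  by rewrite nth_default //; apply: (si_N0 wI).
have [n [v [on hv]]] := gram_schmidt wI (size x) Nu.
exists n, v, (fun j => \sum_(q <- x) ip q.1 (v j) *: q.2); split=> // W F Fl Fr.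
have F0l w : F 0 w = 0.
  have := Fl 1 0 0 w (si_N0 wI) (si_N0 wI); rewrite !scale1r addr0 => e.
  by apply: (addrI (F 0 w)); rewrite addr0.
have F0r p : N p -> F p 0 = 0.
  move=> Np; have := Fr 1 p 0 0 Np; rewrite !scale1r addr0 => e.
  by apply: (addrI (F p 0)); rewrite addr0.
have xE q : q \in x -> q.1 = \sum_(j < n) ip q.1 (v j) *: v j.
  move=> qx; have := hv (index q x); rewrite index_mem => /(_ qx).
  rewrite /u nth_index // => s0; have NP := siNB wI (Nx q qx) (proj_N wI q.1 on).
  by have /eqP := faithful_sn0 (psi_weight G) (@psi_faithful R G) NP s0; rewrite subr_eq0 => /eqP.
have sl (r : seq 'I_n) (c : 'I_n -> R[i]) w :
    F (\sum_(j <- r) c j *: v j) w = \sum_(j <- r) c j *: F (v j) w.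
  elim: r => [|j r IH]; first by rewrite !big_nil.
  rewrite !big_cons Fl ?IH //; first exact: on.1.
  by apply: (siN_sum wI) => i _; apply: (siNZ wI); exact: on.1.
have sr (r : seq (A * A)) (c : A * A -> R[i]) p : N p ->
    F p (\sum_(q <- r) c q *: q.2) = \sum_(q <- r) c q *: F p q.2.
  move=> Np; elim: r => [|j r IH]; first by rewrite !big_nil F0r.
  by rewrite !big_cons Fr ?IH.
have -> : \sum_(q <- x) F q.1 q.2 = \sum_(q <- x) \sum_(j < n) ip q.1 (v j) *: F (v j) q.2.
  rewrite [LHS]big_seq [RHS]big_seq; apply: eq_bigr => q qx.
  by rewrite {1}(xE q qx) sl.
by rewrite exchange_big; apply: eq_bigr => j _; rewrite sr //; exact: on.1.
Qed.
End DualElementSlices.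

Lemma nm_row (R : realType) (A : cstarType R) n (E : 'I_n -> A) (z : A) (M : R) : 0 <= M ->
  pos_cone (M%:C *: (\sum_j (E j)^† ∙ E j) - z^† ∙ z) -> nm z ^+ 2 <= M * \sum_j nm (E j) ^+ 2.
Proof.
move=> M0 h; rewrite -nm_cstar2; apply: le_trans (pos_le_nm (pos_star_mul z) h) _.
rewrite nmZp //; apply: ler_wpM2l => //; apply: le_trans (nm_sum _ _ _) _.
by apply: ler_sum => j _; rewrite nm_cstar2.
Qed.

(** M >= 1 allows M in place of its square root, which keeps all constants rational expressions. *)
Lemma sqr_bound (R : realType) (s M C r : R) : 0 <= s -> 1 <= M -> 0 <= C -> 0 <= r ->
  s ^+ 2 <= M * (C ^+ 2 * r ^+ 2) -> s <= M * C * r.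
Proof.
move=> s0 M1 C0 r0 h; have M0 : 0 <= M by apply: le_trans M1.
rewrite -(@ler_pXn2r _ 2) ?nnegrE ?mulr_ge0 //; apply: le_trans h _.
rewrite !exprMn -mulrA; apply: ler_wpM2r; first by rewrite mulr_ge0 ?sqr_ge0.
by rewrite expr2 ler_peMr.
Qed.

(** * Vanishing of e_b(a) implies vanishing of e_a(b) *)

Section Core.
Variables (R : realType) (G : lcqg R) (t' : min_tensor (C0 G) (C0 G) (C0_2 G)).
Local Notation A := (C0 G).
Local Notation T := (C0_2 G).
Local Notation t := (tens2 G).
Hypothesis ht : forall a b, t' b a = t a b.
Local Notation psi := (@haar_r R G).
Local Notation phi := (@haar_l R G).
Local Notation N := (wN psi (@id A)).
Local Notation ip := (wip psi (@id A)).
Local Notation Sr f := (slice_r t f).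
Local Notation Sl f := (slice_l t f).
Local Notation NT f := (wN psi (slice_r t f)).
Local Notation ipT f := (wip psi (slice_r t f)).
Local Notation Nf := (wN phi (@id A)).
Local Notation ipf := (wip phi (@id A)).
Local Notation NTf f := (wN phi (slice_r t' f)).
Local Notation ipTf f := (wip phi (slice_r t' f)).
Let wI := wip_semi_inner (psi_weight G) (@id_positive R A).
Let fI := wip_semi_inner (phi_weight G) (@id_positive R A).

Lemma code_dense (f : A -> R[i]) Z (d : R) : pos_dual f -> NT f Z -> 0 < d ->
  exists s : seq (A * A), (forall q, q \in s -> N q.1) /\ sn (ipT f) (ev t s - Z) < d.
Proof.
move=> pf NZ d0; have [n [p [w [on [h1 h2]]]]] := tens_dense_l (psi_weight G) (@psi_lsc R G) pf NZ d0.
exists [seq (p (val l), w (val l)) | l <- index_enum 'I_n]; split.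
  by move=> q /mapP[l _ ->]; exact: on.1.
have tI := wip_semi_inner (psi_weight G) (slice_r_positive t pf).
have -> : ev t [seq (p (val l), w (val l)) | l <- index_enum 'I_n] - Z =
    - (Z - \sum_(l < n) t (p l) (w l)) by rewrite opprB /ev big_map.
by rewrite (snN tI h1).
Qed.

Variable eps : A -> R[i].
Hypothesis deps : dual eps.
Hypothesis epsM : forall a b, eps (a ∙ b) = eps a * eps b.
Hypothesis eps_rep : forall b, N b -> represents eps b b.
Hypothesis eps_slice : forall a c, Sl eps (Zr a c) = a ∙ c.

Section Product.
Variables (a b x k h : A) (f : A -> R[i]).
Hypothesis (Na : N a) (Nb : N b) (Nx : N x) (Nk : N k) (Nh : Nf h) (pf : pos_dual f).
Hypothesis ba0 : ef b a = 0.
Variables (c d : A).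
Let y := h^† ∙ k.
Let Ny : N y := wN_mull (psi_weight G) (@id_positive R A) h^† Nk.
Let K := ef y x.
Let NK : Nf K. Proof. by have [] := ef_phi ht Nk Nh Nx. Qed.
Let tI := wip_semi_inner (psi_weight G) (slice_r_positive t pf).
Let tf := wip_semi_inner (phi_weight G) (slice_r_positive t' pf).
Let gI := fip_semi_inner pf.
Let Q w := Sr f (l2 t d^† (Zr x w)).
Let E w := ef y (Q w).
Let bS := slice_r_bl t pf.1.

Let NQ w : N (Q w). Proof. exact: N_slice2. Qed.
Let sQ w : sn ip (Q w) <= sn (fip f) d * sn ip x * sn (fip f) w.
Proof.
have [_ h1] := sn_slice (psi_weight G) pf d (rZ_N w pf Nx).
by rewrite rZ_sn // mulrA in h1.
Qed.
Let EP l w w' : E (l *: w + w') = l *: E w + E w'.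
Proof.
by rewrite /E /Q ZrPr (blP (l2_bl t _)) (blP bS) (efP Ny) //; exact: NQ.
Qed.
Let C1 := sn ip k * sn ipf h * (sn (fip f) d * sn ip x).
Let C2 := sn ip y * (sn (fip f) d * sn ip x).
(** The summand 1 gives the strict bound asked for by [row_gap] as well as M >= 1 for
    [sqr_bound]. *)
Let M := sn ip b ^+ 2 + 1.
Let M1 : 1 <= M. Proof. by rewrite lerDr sqr_ge0. Qed.
Let M0 : 0 <= M. Proof. exact: le_trans M1. Qed.
Let C10 : 0 <= C1. Proof. by rewrite !mulr_ge0 ?sn_ge0. Qed.
Let C20 : 0 <= C2. Proof. by rewrite !mulr_ge0 ?sn_ge0. Qed.

Let NE w : Nf (E w). Proof. by have [] := ef_phi ht Nk Nh (NQ w). Qed.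
Let sE w : sn ipf (E w) <= C1 * sn (fip f) w.
Proof.
have [_ h1] := ef_phi ht Nk Nh (NQ w); apply: le_trans h1 _.
by rewrite /C1 -[leRHS]mulrA; apply: ler_wpM2l; [rewrite mulr_ge0 ?sn_ge0 | exact: sQ].
Qed.
Let nE w : nm (E w) <= C2 * sn (fip f) w.
Proof.
apply: le_trans (ef_bound Ny (NQ w)) _.
by rewrite /C2 -mulrA; apply: ler_wpM2l; [exact: sn_ge0 | exact: sQ].
Qed.

Let zc (s : seq (A * A)) := \sum_(q <- s) ef b q.1 ∙ E q.2.
Let Uc (s : seq (A * A)) : T := \sum_(q <- s) D (ef b q.1) (t' K q.2).
Let good_code (s : seq (A * A)) := forall q, q \in s -> N q.1.

Let NTev s : good_code s -> NT f (ev t s).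
Proof.
by move=> gs; rewrite /ev big_seq; apply: (siN_sum tI) => q /gs; apply: wN_tens.
Qed.

(** After passing to orthonormal first legs, [ef_row] and the row inequality bound all three
    quantities by the seminorm of [ev t s] alone. Applied to differences of codes, this yields
    Cauchy estimates. *)
Let code_bounds s : good_code s ->
  [/\ nm (zc s) <= M * C2 * sn (ipT f) (ev t s),
      Nf (zc s) /\ sn ipf (zc s) <= M * C1 * sn (ipT f) (ev t s) &
      NTf f (Uc s) /\ sn (ipTf f) (Uc s) <= M * sn ipf K * sn (ipT f) (ev t s)].
Proof.
move=> gs; have [n [v [w [on hF]]]] := code_on gs.
have -> : zc s = \sum_(j < n) ef b (v j) ∙ E (w j).
  apply: (hF A (fun p w => ef b p ∙ E w)) => [l p p' w0 Np Np'|l p w0 w1 Np].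
    by rewrite (efP Nb) // cmulDl cmulZl.
  by rewrite EP cmulDr cmulZr.
have -> : Uc s = \sum_(j < n) D (ef b (v j)) (t' K (w j)).
  apply: (hF T (fun p w => D (ef b p) (t' K w))) => [l p p' w0 Np Np'|l p w0 w1 Np].
    by rewrite (efP Nb) //; have [-> _ _] := @D_action _ G.
  by rewrite tensPr (actDr (@D_action _ G)) (actZr (@D_action _ G)).
have -> : ev t s = \sum_(j < n) t (v j) (w j).
  by apply: (hF T t) => *; [exact: tensPl | exact: tensPr].
have e2 := sn_tens_on_l t (psi_weight G) pf w on.
set r := sn _ _ in e2 *; have r0 : 0 <= r by exact: sn_ge0.
have row : nm (\sum_(j < n) ef b (v j) ∙ (ef b (v j))^†) < M.
  by apply: le_lt_trans (ef_row Nb on) _; rewrite ltrDl.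
have rowA := row_gap (left_mul_action A) (fun j : 'I_n => E (w j)) row.
have rowD := row_gap (@D_action _ G) (fun j : 'I_n => t' K (w j)) row.
have sumle (g : A -> R) C : 0 <= C -> (forall w, 0 <= g w) -> (forall w, g w <= C * sn (fip f) w) ->
    M * \sum_(j < n) g (w j) ^+ 2 <= M * (C ^+ 2 * r ^+ 2).
  move=> C0 g0 gC; apply: ler_wpM2l => //; rewrite e2 mulr_sumr; apply: ler_sum => j _.
  by rewrite -exprMn ler_pXn2r ?nnegrE ?mulr_ge0 ?sn_ge0.
split.
- apply: (sqr_bound (nm_ge0 _) M1 C20 r0); apply: le_trans (nm_row M0 rowA) _.
  by apply: (sumle (fun w => nm (E w))) => // w0; exact: nm_ge0.
- have [h1 h2] := wN_row (phi_weight G) (@id_positive R A) M0 (fun j => NE (w j)) rowA.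
  split=> //; apply: (sqr_bound (sn_ge0 _ _) M1 C10 r0); apply: le_trans h2 _.
  by apply: (sumle (fun w => sn ipf (E w))) => // w0; exact: sn_ge0.
have NtK (j : 'I_n) : NTf f (t' K (w j)) by apply: wN_tens'.
have [h1 h2] := wN_row (phi_weight G) (slice_r_positive t' pf) M0 NtK rowD.
split=> //; apply: (sqr_bound (sn_ge0 _ _) M1 (sn_ge0 ipf K) r0); apply: le_trans h2 _.
apply: (sumle (fun w => sn (ipTf f) (t' K w))); [exact: sn_ge0 | move=> ?; exact: sn_ge0 |].
by move=> w0; rewrite (sn_tens t' (phi_weight G) pf).
Qed.

Let zc_cat s s' : zc (s ++ s') = zc s + zc s'. Proof. by rewrite /zc big_cat. Qed.
Let zcN s : good_code s -> zc (fscale (-1) s) = - zc s.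
Proof.
move=> gs; rewrite /zc /fscale big_map -sumrN !big_seq; apply: eq_bigr => q /gs Nq /=.
by rewrite (efZ Nb) // scaleN1r cmulNl.
Qed.
Let good_sub s s' : good_code s -> good_code s' -> good_code (s ++ fscale (-1) s').
Proof.
move=> gs gs' q; rewrite mem_cat => /orP[/gs //|/mapP[q' /gs' Nq' ->]].
exact: (siNZ wI).
Qed.

(** In each summand e_b(p) is moved to the right-hand vector, [ef_slice] is applied there, and
    e_b(p) returns as Delta(e_b(p)). The pairing of [zc s] becomes one of [Uc s], which can be
    tested weakly. *)
Let zc_ip s z' : good_code s -> Nf z' -> ipf (zc s) z' = ipTf f (Uc s) (Zl z' d).
Proof.
move=> gs Nz; have NZl := lZ_N ht d pf Nz.
have NtK w : NTf f (t' K w) by apply: wN_tens'.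
have NU q : NTf f (D (ef b q) (t' K q)).
  by apply: (wN_action (phi_weight G) (slice_r_positive t' pf)) => //; exact: D_action.
rewrite /zc /Uc (si_suml fI) // => [|q _]; last exact: (wN_mull (phi_weight G) (@id_positive R A)).
rewrite (si_suml tf) // => [|q _]; last first.
  by apply: (wN_action (phi_weight G) (slice_r_positive t' pf)) => //; exact: D_action.
apply: eq_bigr => q _.
have -> : ipf (ef b q.1 ∙ E q.2) z' = ipf (E q.2) ((ef b q.1)^† ∙ z').
  by rewrite /wip cstarM cstarK !cmulA.
rewrite /E /Q (ef_slice ht q.2 d pf Nx Nk Nh) -/y -/K; last first.
  exact: (wN_mull (phi_weight G) (@id_positive R A)).
by rewrite -Zl_D /wip (act_adj (@D_action _ G)) cstarK.
Qed.

(** The counit represents psi-pairings with b and with y, so its multiplicativity turns the products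
    in [zc s] into products of two pairings, hence into a single pairing on the tensor product. *)
Let eps_zc s : good_code s -> eps (zc s) = ipT f (ev t s) (t b (ef x y ∙ d)).
Proof.
move=> gs; have Ntb := wN_tens (ef x y ∙ d) pf Nb; have be := iffLR (dualE eps) deps.
rewrite /zc /ev big_seq [in RHS]big_seq (bl_sum be) (si_suml tI) //; last first.
  by move=> q /gs Nq; apply: wN_tens.
apply: eq_bigr => q /gs Nq /=; rewrite epsM (efE Nb Nq (eps_rep Nb)) (efE Ny (NQ _) (eps_rep Ny)).
rewrite (wip_tens t (psi_weight G) pf _ _ Nq Nb).2; congr (_ * _).
rewrite (si_conj wI Ny (NQ _)) -(efE Nx Ny (rep_lr d q.2 pf Nx)).
rewrite -(pos_dual_star pf) /fip !cstarM !cstarK !cmulA //.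
Qed.

(* The sums [zc (xs n)] converge in norm, and they converge weakly to 0 in the GNS
   space of [phi]; so the limit is 0, and its image under [eps] is the conjugate of the
   left-hand side. *)
Lemma core_form : f (c^† ∙ ef a b ∙ (ef x y ∙ d)) = 0.
Proof.
pose m0 := ef x y ∙ d; pose Z0 := Zr a c; have NZ0 := rZ_N c pf Na.
have be := iffLR (dualE eps) deps.
have Ntb : NT f (t b m0) := wN_tens m0 pf Nb.
have inv0 n : 0 < n.+1%:R^-1 :> R by rewrite invr_gt0 ltr0n.
have [xs hxs] := choice (fun n => code_dense pf NZ0 (inv0 n)).
have gx n : good_code (xs n) := (hxs n).1.
have sx n : sn (ipT f) (ev t (xs n) - Z0) < n.+1%:R^-1 := (hxs n).2.
have Nxs n := NTev (gx n).
have NxZ n := siNB tI (Nxs n) NZ0.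
have sub m n : zc (xs m) - zc (xs n) = zc (xs m ++ fscale (-1) (xs n)) /\
    sn (ipT f) (ev t (xs m ++ fscale (-1) (xs n))) <= m.+1%:R^-1 + n.+1%:R^-1.
  rewrite zc_cat (zcN (gx n)); split=> //.
  have -> : ev t (xs m ++ fscale (-1) (xs n)) = (ev t (xs m) - Z0) - (ev t (xs n) - Z0).
    by rewrite ev_cat ev_scale scaleN1r opprB addrA subrK.
  by apply: le_trans (snB tI (NxZ m) (NxZ n)) _; apply: lerD; apply: ltW.
(* The codes converge to Delta(a)(1 ⊗ c) for psi ⊗ f, and the bounds on differences make [zc (xs n)]
   Cauchy in norm. *)
have [zl hz] : exists zl, scvg (fun n => zc (xs n)) zl.
  apply: (@cauchy_inv _ _ _ (M * C2)); first exact: mulr_ge0.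
  move=> m n; have [-> h1] := sub m n; have [h2 _ _] := code_bounds (good_sub (gx m) (gx n)).
  by apply: le_trans h2 _; rewrite mulrC; apply: ler_wpM2r => //; apply: mulr_ge0.
have Nz n : Nf (zc (xs n)) by have [_ [h1 _] _] := code_bounds (gx n).
pose C3 := M * C1 * 2; have C30 : 0 <= C3 by apply: mulr_ge0; [exact: mulr_ge0 | exact: ler0n].
have close n : Nf (zl - zc (xs n)) /\ sn ipf (zl - zc (xs n)) <= n.+1%:R^-1 * C3.
  have hz' : scvg (fun m => zc (xs (m + n)%N) - zc (xs n)) (zl - zc (xs n)).
    by apply: scvgD (scvg_shift n hz) (scvg_cst _).
  apply: (wN_lsc (phi_weight G) (@phi_lsc R G) hz') => m.
  have [-> h1] := sub (m + n)%N n; have [_ [h2 h3] _] := code_bounds (good_sub (gx (m + n)%N) (gx n)).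
  split=> //; apply: le_trans h3 _.
  have -> : n.+1%:R^-1 * C3 = M * C1 * (n.+1%:R^-1 + n.+1%:R^-1) by rewrite /C3; ring.
  apply: ler_wpM2l; first exact: mulr_ge0.
  apply: le_trans h1 _; rewrite lerD2r lef_pV2 ?posrE ?ltr0n // ler_nat ltnS.
  exact: leq_addl.
have Nzl : Nf zl.
  by have := siND fI (close 0%N).1 (Nz 0%N); rewrite subrK.
have cv1 z' : Nf z' -> scvg (fun n => ipf (zc (xs n)) z' : R[i]^o) (ipf zl z' : R[i]^o).
  move=> Nz'; have K0 : 0 <= C3 * sn ipf z' by rewrite mulr_ge0 ?sn_ge0.
  apply: (scvg_inv K0) => n; rewrite nmC nmc_nm -(siB fI Nzl (Nz n) Nz').
  have [h1 h2] := close n; apply: le_trans (si_CS fI h1 Nz') _.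
  by rewrite mulrA; apply: ler_wpM2r => //; exact: sn_ge0.
have sx' e : 0 < e -> exists n0, forall n, (n0 <= n)%N -> sn (ipT f) (ev t (xs n) - Z0) < e.
  by move=> /inv_small [n0 hn]; exists n0 => n /hn; apply: lt_trans.
pose M3 := M * sn ipf K * (1 + sn (ipT f) Z0).
have NU n : NTf f (Uc (xs n)) by have [_ _ []] := code_bounds (gx n).
have sU n : sn (ipTf f) (Uc (xs n)) <= M3.
  have [_ _ [_ h1]] := code_bounds (gx n); apply: le_trans h1 _.
  apply: ler_wpM2l; first by rewrite mulr_ge0 ?sn_ge0.
  rewrite -[ev t _](subrK Z0); apply: le_trans (snD tI (NxZ n) NZ0) _.
  rewrite lerD2r; apply: le_trans (ltW (sx n)) _.
  by rewrite invf_le1 ?ltr0n // ler1n.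
have cv2 z' : Nf z' -> scvg (fun n => ipf (zc (xs n)) z' : R[i]^o) (0 : R[i]^o).
  move=> Nz'; have NZl := lZ_N ht d pf Nz'.
  have -> : (fun n => ipf (zc (xs n)) z') = (fun n => ipTf f (Uc (xs n)) (Zl z' d)).
    by apply: funext => n; apply: zc_ip.
  rewrite -(si0l tf NZl).
  (* The weak limit to identify is V = 0: the limiting psi-pairing is a functional of e_b(a), which
     vanishes by [ba0]. *)
  apply: (weak_limit ht pf NU sU (si_N0 tf) Nxs NZ0 sx' _ NZl) => om g g' po _.
  exists (Zr (Sr om (l2 t K^† (Zr b g'))) g); split.
  - by apply: rZ_N => //; apply: N_slice2.
  - by move=> n; apply: (D_test ht g g' po pf K snd Nb); exact: gx.
  rewrite (bl0 (l1_bl t _)) (bl0 (slice_l_bl t pf.1)) cmul0r (bl0 (iffLR (dualE om) po.1)).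
  by rewrite rZ_ip //; [rewrite -(efE Nb Na (rep_lr K g' po Nb)) ba0 cmul0r cmul0l
    (bl0 (iffLR (dualE om) po.1)) mul0r | apply: N_slice2].
have zl0 : zl = 0.
  apply: (faithful_sn0 (phi_weight G) (@phi_faithful R G) Nzl).
  have := scvg_uniq (cv1 _ Nzl) (cv2 _ Nzl); rewrite (sn2 fI Nzl) => /complexI/eqP.
  by rewrite expf_eq0 /= => /eqP.
have cv3 := bl_scvg be hz; rewrite zl0 (bl0 be) in cv3.
have cv4 : scvg ((eps : A -> R[i]^o) \o (fun n => zc (xs n))) (ipT f Z0 (t b m0) : R[i]^o).
  apply: (scvg_inv (sn_ge0 (ipT f) (t b m0))) => n /=.
  rewrite nmc_nm (eps_zc (gx n)) -(siB tI (Nxs n) NZ0 Ntb).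
  apply: le_trans (si_CS tI (NxZ n) Ntb) _; apply: ler_wpM2r; first exact: sn_ge0.
  exact: ltW.
have := scvg_uniq cv4 cv3.
rewrite (slice_adjoint t psi pf) (si_conj wI Nb (N_slice2 m0 c pf Na)).
rewrite -(efE Na Nb (rep_lr m0 c pf Na)) => /(congr1 Num.conj).
by rewrite conjCK rmorph0.
Qed.
End Product.

(** [core_form] gives e_a(b) e_x(h^† k) = 0 for all x, h, k. To cancel the second factor, put u =
    e_a(b)^† d: the slices of Delta(x)(1 ⊗ u) by a state norming u^† u vanish for all x, and the
    counit then recovers nm u = 0 from them. *)
Lemma dual_element_sym a b : N a -> N b -> ef b a = 0 -> ef a b = 0.
Proof.
move=> Na Nb ba0.
have prod0 x k h : N x -> N k -> Nf h -> ef a b ∙ ef x (h^† ∙ k) = 0.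
  move=> Nx Nk Nh; apply: cmul_separate => d; rewrite cmul0l -cmulA.
  set V := _ ∙ (_ ∙ d); have [f [pf _ fV]] := norming_state V.
  have := core_form Na Nb Nx Nk Nh pf ba0 V d.
  rewrite -cmulA fV => /complexI/eqP; rewrite expf_eq0 /= => /eqP; exact: nm_eq0.
suff h d : (ef a b)^† ∙ d = 0.
  by apply: cstar_mul_eq0; exact: h.
set u := _ ∙ d; have [f [pf _ fu]] := norming_state u.
have bf := iffLR (dualE f) pf.1; have bS := slice_r_bl t pf.1.
have r0 x : N x -> Sr f (Zr x u) = 0.
  move=> Nx; set r := Sr f _; have Nr : N r by apply: N_slice.
  have h0r h : Nf h -> h ∙ r = 0.
    move=> Nh; have Nhr := wN_mull (psi_weight G) (@id_positive R A) h Nr.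
    apply: (faithful_sn0 (psi_weight G) (@psi_faithful R G) Nhr).
    have Nhh := wN_mull (phi_weight G) (@id_positive R A) h^† Nh.
    have Ny := wN_mull (psi_weight G) (@id_positive R A) (h^† ∙ h)^† Nr.
    (* With y = h^† h r, where r is the slice itself, f (u^† e_x(y)) is the psi-square of h r; its
       vanishing gives h r = 0. *)
    have := efE Nx Ny (rep_l u pf Nx).
    rewrite /u cstarM cstarK -cmulA (prod0 x r (h^† ∙ h) Nx Nr Nhh) cmul0r (bl0 bf) -/r.
    rewrite cstarM cstarK; have -> : ip (h^† ∙ h ∙ r) r = ip (h ∙ r) (h ∙ r).
      by rewrite /wip cstarM !cmulA.
    rewrite (sn2 wI Nhr) => /esym/complexI/eqP; rewrite expf_eq0 /= => /eqP; exact.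
  by apply: cstar_mul_eq0; exact: (bl_dense_zero (phi_weight G) (mulr_bl r) (@phi_dense R G) h0r r^†).
have rx x : Sr f (Zr x u) = 0.
  exact: (bl_dense_zero (psi_weight G) (bl_comp (Zr_bl u) bS) (@psi_dense R G) r0).
(* At x = u^† the counit of the slice is f (u^† u) = nm u ^ 2. *)
have := rx u^†; move=> /(congr1 eps).
rewrite (dual_tensE t _ deps pf.1) eps_slice (bl0 (iffLR (dualE eps) deps)) fu.
by move=> /complexI/eqP; rewrite expf_eq0 /= => /eqP; exact: nm_eq0.
Qed.
End Core.

(** * The counit *)

Lemma double_eq0 (R : realType) (V : normedModType R[i]) (a : V) : a + a = 0 -> a = 0.
Proof.
move/eqP; have -> : a + a = 2%:R *: a by rewrite scaler_nat mulr2n.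
by rewrite scaler_eq0 pnatr_eq0 /= => /eqP.
Qed.

(* [get] returns its default when no candidate exists, so that a fixed point of a choice
   function is a genuine solution except at two exceptional points; linearity then covers
   the exceptional points. *)
Lemma linear_get (R : realType) (A : cstarType R) (Q : A -> set (multiplier A)) (F : A -> A) :
  (forall a b, F (a + b) = F a + F b) ->
  (forall a, get [set b : A | mof b = get (Q a)] = a) ->
  (forall a, Q a (mof a) -> F a = 0) -> forall a, F a = 0.
Proof.
move=> FD getE QF; have F0 : F 0 = 0 by apply: (addrI (F 0)); rewrite -FD !addr0.
have bad a : F a <> 0 -> a = point \/ mof a = point.
  move=> Fa; have [e|na] := pselect (a = point); [by left|right].
  have h : mof a = get (Q a).
    have [[b hb]|no] := pselect (exists b, [set b : A | mof b = get (Q a)] b).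
      by have := getPex (ex_intro _ b hb); rewrite getE.
    by exfalso; apply: na; rewrite -[LHS]getE; apply: getPN => b hb; apply: no; exists b.
  have [[m hm]|no] := pselect (exists m, Q a m).
    by exfalso; apply/Fa/QF; rewrite h; exact: getPex (ex_intro _ m hm).
  by rewrite h; apply: getPN => m hm; apply: no; exists m.
move=> a; have [//|Fa] := pselect (F a = 0).
have F2 : F (a + a) <> 0 by rewrite FD => /double_eq0.
have F3 : F (a + (a + a)) <> 0.
  rewrite !FD => /eqP; have -> : F a + (F a + F a) = 3%:R *: F a by rewrite scaler_nat !mulrS mulr0n addr0.
  by rewrite scaler_eq0 pnatr_eq0 /= => /eqP.
have a0 : a <> 0 by move=> e; apply: Fa; rewrite e.
have e12 : a <> a + a by move=> e; apply: a0; apply: (addrI a); rewrite addr0 -e.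
have e23 : a + a <> a + (a + a) by move=> /addrI.
have e13 : a <> a + (a + a).
  by move=> e; apply: a0; apply: double_eq0; apply: (addrI a); rewrite addr0 -e.
have mi := @mof_inj R A.
case: (bad _ Fa) => h1; case: (bad _ F2) => h2; case: (bad _ F3) => h3.
all: exfalso; first [by apply: e12; rewrite h2 | by apply: e12; apply: mi; rewrite h2
  | by apply: e23; rewrite h3 | by apply: e23; apply: mi; rewrite h3
  | by apply: e13; rewrite h3 | by apply: e13; apply: mi; rewrite h3].
Qed.

Section Counit.
Variables (R : realType) (G : cstar_bialgebra R).
Local Notation A := (C0 G).
Local Notation T := (C0_2 G).
Local Notation t := (tens2 G).
Variable eps : A -> R[i].
Hypothesis deps : dual eps.
Let be := iffLR (dualE eps) deps.

Lemma counit_slice_l : (forall a : A, L_map eps a = a) ->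
  forall a c, slice_l t eps (Zr a c) = a ∙ c.
Proof.
move=> h a c; have bS := slice_l_bl t deps.
apply/eqP; rewrite -subr_eq0; apply/eqP.
apply: (linear_get (Q := fun a => [set p | exists f' b, [/\ dual f', forall a, eps a = f' (a ∙ b)
  & forall c, mL p c = slice_l t f' (mL (Delta a) (t b c))]])
  (F := fun a => slice_l t eps (Zr a c) - a ∙ c)) => [u v|u|u [f' [b [df' fb hm]]]].
- by rewrite (blD (Zr_bl c)) (blD bS) cmulDl opprD addrACA.
- exact: h.
have := hm c => /= ->; rewrite -[mL (Delta u)]/(D u) D_tens_r (slice_l_r1 t _ _ df').
by have -> : (fun x => f' (x ∙ b)) = eps by [apply: funext => x; rewrite fb]; rewrite subrr.
Qed.

Lemma counit_slice_r : (forall a : A, R_map eps a = a) ->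
  forall a c, slice_r t eps (Zl a c) = a ∙ c.
Proof.
move=> h a c; have bS := slice_r_bl t deps.
apply/eqP; rewrite -subr_eq0; apply/eqP.
apply: (linear_get (Q := fun a => [set p | exists f' b, [/\ dual f', forall a, eps a = f' (a ∙ b)
  & forall c, mL p c = slice_r t f' (mL (Delta a) (t c b))]])
  (F := fun a => slice_r t eps (Zl a c) - a ∙ c)) => [u v|u|u [f' [b [df' fb hm]]]].
- by rewrite (blD (Zl_bl c)) (blD bS) cmulDl opprD addrACA.
- exact: h.
have := hm c => /= ->; rewrite -[mL (Delta u)]/(D u) D_tens_l (slice_r_r2 t _ _ df').
by have -> : (fun x => f' (x ∙ b)) = eps by [apply: funext => x; rewrite fb]; rewrite subrr.
Qed.

Hypothesis epsS : forall a c, slice_l t eps (Zr a c) = a ∙ c.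
Local Notation S := (slice_l t eps).
Let bS := slice_l_bl t deps.
Variable w0 : A.
Hypothesis w0n : w0 <> 0.

Let scale_inj (k l : R[i]) : k *: w0 = l *: w0 -> k = l.
Proof.
move/eqP; rewrite -subr_eq0 -scalerBl scaler_eq0 subr_eq0 => /orP[/eqP //|/eqP].
by move=> e; case: w0n.
Qed.

(** Slicing the first leg by the counit undoes the comultiplication, as seen on the total set of
    elements Delta(b)(1 ⊗ c). *)
Let S_D a W : S (D a W) = a ∙ S W.
Proof.
have bD := act_bounded (@D_action _ G) a; have bA := act_bounded (left_mul_action A) a.
have := bl_eq_total (bl_comp bD bS) (bl_comp bS bA) (Zr_total G).
move=> e; have {}e := congr1 (fun F => F W) (e _); apply: e => _ [b _ [c _ <-]].
by rewrite Zr_D !epsS cmulA.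
Qed.

Let S_M X W : S (X ∙ W) = S X ∙ S W.
Proof.
have := bl_eq_total (bl_comp (mulr_bl W) bS) (bl_comp bS (mulr_bl (S W))) (Zr_total G).
move=> e; have {}e := congr1 (fun F => F X) (e _); apply: e => _ [b _ [c _ <-]].
by rewrite ZrE S_D (slice_l_l2 t deps) epsS cmulA.
Qed.

Let SE a b : S (t a b) = eps a *: b. Proof. exact: slice_lE. Qed.

(** [S] is multiplicative by [S_M]; on a ⊗ w0^† and b ⊗ w0 this compares eps (a b) with eps a * eps
    b as coefficients of the nonzero element w0^† w0. *)
Lemma counit_mul a b : eps (a ∙ b) = eps a * eps b.
Proof.
have w2 : w0^† ∙ w0 <> 0 by move/cstar_mul_eq0.
have := S_M (t a w0^†) (t b w0); rewrite -tensM !SE cmulZl cmulZr scalerA.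
move/eqP; rewrite -subr_eq0 -scalerBl scaler_eq0 subr_eq0 => /orP[/eqP //|/eqP].
by move=> e; case: w2.
Qed.

Let S_star W : S W^† = (S W)^†.
Proof.
have bS' := star_conj_bl bS.
have := bl_eq_total bS' bS (Zr_total G).
move=> e; rewrite -[LHS]cstarK; congr (_^†).
have {}e := congr1 (fun F => F W) (e _); apply: e => _ [a _ [c _ <-]].
rewrite epsS -[RHS]cstarK; congr (_^†); apply: cmul_separate => v.
have sep x y : (forall X : T, x ∙ S X = y ∙ S X) -> x = y.
  move=> h; apply: cmul_separate => u; apply: cmul_separate => u'.
  by rewrite -!cmulA -(epsS u) h.
congr (_ ∙ _); apply: sep => X.
by rewrite -S_M Zr_starM (slice_l_l2 t deps) S_D cstarM cmulA.
Qed.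

Lemma counit_star a : eps a^† = Num.conj (eps a).
Proof.
have := S_star (t a w0^†); rewrite -tens_star cstarK !SE cstarZ cstarK.
exact: scale_inj.
Qed.

Lemma counit_pos : pos_dual eps.
Proof.
split=> // a; rewrite counit_mul counit_star mulrC nmc_sqr ler0c; exact: sqr_ge0.
Qed.

(** Powers: nmc (eps a) ^ n = nmc (eps (a^n)) <= C * nm a ^ n for all n, which excludes nmc (eps a)
    > nm a. *)
Lemma counit_contractive a : nmc (eps a) <= nm a.
Proof.
rewrite leNgt; apply/negP => lt; have [C C0 hC] := dual_le deps.
set r := nmc (eps a) in lt *; have r0 : 0 < r by apply: le_lt_trans lt; exact: nm_ge0.
pose p n := iter n (cmul a) a.
have pn n : nm (p n) <= nm a ^+ n.+1.
  elim: n => [|n IH]; first by rewrite expr1.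
  rewrite exprS; apply: le_trans (nmM a (p n)) _.
  by apply: ler_wpM2l => //; exact: nm_ge0.
have ep n : nmc (eps (p n)) = r ^+ n.+1.
  elim: n => [|n IH]; first by rewrite expr1.
  by rewrite exprS -IH -nmcM -counit_mul.
have q1 : 0 <= nm a / r < 1 by rewrite divr_ge0 ?nm_ge0 ?(ltW r0) //= ltr_pdivrMr // mul1r.
have [n0 hn] := geom_small q1 C0 ltr01.
have := hn n0.+1 (leqnSn _); rewrite expr_div_n mulrA ltr_pdivrMr ?exprn_gt0 // mul1r -ep ltNge.
move/negP; apply; apply: le_trans (hC _) _; apply: ler_wpM2l => //; exact: pn.
Qed.

Lemma counit_slice_R (f : A -> R[i]) a c : dual f -> eps (slice_r t f (Zr a c)) = f (a ∙ c).
Proof. by move=> df; rewrite (dual_tensE t _ deps df) epsS. Qed.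

Lemma counit_nonzero : exists a, eps a <> 0.
Proof.
have [//|no] := pselect (exists a, eps a <> 0).
have e0 a : eps a = 0.
  by have [//|n] := pselect (eps a = 0); exfalso; apply: no; exists a.
case: w0n; apply: cmul_separate => c; rewrite cmul0l -epsS.
have h := bl_eq_total bS (@bl_zero _ T A) (tens_dense t).
have {}h := congr1 (fun F => F (Zr w0 c)) (h _); apply: h => _ [a _ [b _ <-]].
by rewrite SE e0 scale0r.
Qed.
End Counit.

Lemma counit_represents (R : realType) (G : lcqg R) (eps : C0 G -> R[i]) : dual eps ->
  (forall a c, slice_r (tens2 G) eps (Zl a c) = a ∙ c) ->
  forall b, wN (@haar_r R G) id b -> represents eps b b.
Proof.
move=> deps epsS b Nb; split=> // w pw q.
by rewrite -(dual_tensE _ _ pw.1 deps) epsS.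
Qed.

Lemma lcqg_nonzero (R : realType) (G : lcqg R) : exists a : C0 G, a <> 0.
Proof.
have [//|no] := pselect (exists a : C0 G, a <> 0).
have [[[_ [a pa /eqP na] _ _] _] _ _] := haar_rP G; case: na.
have -> : a = 0 by have [//|n] := pselect (a = 0); exfalso; apply: no; exists a.
by have [h h'] := wfin0 (psi_weight G); rewrite (wfinE (psi_weight G) h) h'.
Qed.

(** * Expectations onto algebras of matrices *)

Lemma conj_real (R : realType) (s : R) : Num.conj s%:C = s%:C.
Proof. by apply/CrealP; rewrite realE -[0]/(0%:C) !lecR; exact: le_total. Qed.

Section MatrixUnits.
Variables (R : realType) (A : cstarType R) (n : nat).
Implicit Types (a b c u v : A) (i j k l : 'I_n) (x : 'M[A]_n).

Definition emx i j a : 'M[A]_n := \matrix_(k, l) (if (k == i) && (l == j) then a else 0).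

Lemma emxE i j a : emx i j a i j = a.
Proof. by rewrite mxE !eqxx. Qed.

Lemma emx_mull k i b x p q : mat_mul (emx k i b) x p q = if p == k then b ∙ x i q else 0.
Proof.
rewrite mxE (bigD1 i) //= big1 ?addr0 => [|s si].
  by rewrite mxE eqxx andbT; case: eqP => // _; rewrite cmul0l.
by rewrite mxE (negbTE si) andbF cmul0l.
Qed.

Lemma emx_mulr j l c x p q : mat_mul x (emx j l c) p q = if q == l then x p j ∙ c else 0.
Proof.
rewrite mxE (bigD1 j) //= big1 ?addr0 => [|s si].
  by rewrite mxE eqxx /=; case: eqP => // _; rewrite cmul0r.
by rewrite mxE (negbTE si) cmul0r.
Qed.

Lemma emx_sandwich k i j l b c x :
  mat_mul (mat_mul (emx k i b) x) (emx j l c) = emx k l (b ∙ x i j ∙ c).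
Proof.
apply/matrixP => p q; rewrite emx_mulr emx_mull mxE.
by case: eqP; case: eqP => //= _ _; rewrite cmul0l.
Qed.

Lemma emx_mul i j l a b : mat_mul (emx i j a) (emx j l b) = emx i l (a ∙ b).
Proof.
apply/matrixP => p q; rewrite emx_mull !mxE eqxx /=.
by case: eqP; case: eqP => //= _ _; rewrite cmul0r.
Qed.

Lemma emx_star i j a : mat_star (emx i j a) = emx j i a^†.
Proof.
by apply/matrixP => p q; rewrite !mxE andbC; case: ifP => // _; rewrite cstar0.
Qed.

Lemma emxP i j (k : R[i]) a b : emx i j (k *: a + b) = mat_scale k (emx i j a) + emx i j b.
Proof.
apply/matrixP => p q; rewrite !mxE; case: ifP => // _; by rewrite scaler0 addr0.
Qed.

Lemma mat_pos_diag x i : mat_pos_cone x -> pos_cone (x i i).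
Proof.
by move=> [y ->]; rewrite mxE; apply: pos_sum => k _; rewrite mxE; exact: pos_star_mul.
Qed.

Lemma emx_pos i a : pos_cone a -> mat_pos_cone (emx i i a).
Proof. by move=> [b ->]; exists (emx i i b); rewrite emx_star emx_mul. Qed.

Let unit_ball : set ('I_n -> A) := [set b | `|\sum_i (b i)^† ∙ b i| <= 1].

Let ballE (b : 'I_n -> A) : unit_ball b <-> nm (\sum_i (b i)^† ∙ b i) <= 1.
Proof. by rewrite /unit_ball /= nmE -lecR. Qed.

Let ball_coord (b : 'I_n -> A) i : unit_ball b -> nm (b i) <= 1.
Proof.
move/ballE => h; rewrite -(@ler_pXn2r _ 2) ?nnegrE ?nm_ge0 // expr1n -nm_cstar2.
apply: le_trans h; apply: pos_le_nm; first exact: pos_star_mul.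
rewrite (bigD1 i) //= addrAC subrr add0r; apply: pos_sum => k _; exact: pos_star_mul.
Qed.

Let pairing x (b c : 'I_n -> A) := \sum_i \sum_j (b i)^† ∙ x i j ∙ c j.

Let pairing_le x (b c : 'I_n -> A) : unit_ball b -> unit_ball c ->
  nm (pairing x b c) <= \sum_i \sum_j nm (x i j).
Proof.
move=> hb hc; apply: le_trans (nm_sum _ _ _) _; apply: ler_sum => i _.
apply: le_trans (nm_sum _ _ _) _; apply: ler_sum => j _.
apply: le_trans (nmM _ _) _; rewrite -[leRHS]mulr1; apply: ler_pM; rewrite ?nm_ge0 ?ball_coord //.
apply: le_trans (nmM _ _) _; rewrite -[leRHS]mul1r nm_star.
by apply: ler_wpM2r; rewrite ?nm_ge0 ?ball_coord.
Qed.

Let mat_norm_ge x (b c : 'I_n -> A) : unit_ball b -> unit_ball c -> nm (pairing x b c) <= mat_norm x.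
Proof.
move=> hb hc; apply: ub_le_sup; last by exists b => //; exists c.
exists (\sum_i \sum_j nm (x i j)) => _ [b' hb' [c' hc' <-]]; exact: pairing_le.
Qed.

Let single i u : 'I_n -> A := fun k => if k == i then u else 0.
Let single_ball i u : nm u <= 1 -> unit_ball (single i u).
Proof.
move=> h; apply/ballE; rewrite (bigD1 i) //= big1 ?addr0 => [|k ki].
  by rewrite /single eqxx nm_cstar2 exprn_ile1 ?nm_ge0.
by rewrite /single (negbTE ki) cmul0r.
Qed.
Let single_pairing x i j u v : pairing x (single i u) (single j v) = u^† ∙ x i j ∙ v.
Proof.
rewrite /pairing (bigD1 i) //= (bigD1 j) //= /single !eqxx big1 ?addr0 => [|k kj].
  rewrite big1 ?addr0 // => k ki; rewrite big1 // => l _.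
  by rewrite (negbTE ki) cstar0 !cmul0l.
by rewrite (negbTE kj) cmul0r.
Qed.

Lemma mat_norm_entry x i j : nm (x i j) <= mat_norm x.
Proof.
set y := x i j; have [y0|yn] := eqVneq (nm y) 0.
  rewrite y0; apply: le_trans (nm_ge0 (pairing x (single i 0) (single j 0))) _.
  by apply: mat_norm_ge; apply: single_ball; rewrite nm0.
have yp : 0 < nm y by rewrite lt_neqAle eq_sym yn nm_ge0.
(* Vectors at which the (i, j) entry attains its norm: u^† y v is (y y^†)^2 divided by nm y ^ 3, of
   norm nm y. *)
pose u := ((nm y ^+ 2)^-1)%:C *: (y ∙ y^†); pose v := ((nm y)^-1)%:C *: y^†.
have nu : nm u <= 1.
  by rewrite nmZp ?invr_ge0 ?sqr_ge0 // nm_cstar2r mulVf // expf_neq0.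
have nv : nm v <= 1 by rewrite nmZp ?invr_ge0 ?nm_ge0 // nm_star mulVf.
have := mat_norm_ge x (single_ball i nu) (single_ball j nv).
rewrite single_pairing -/y; apply: le_trans.
have -> : u^† ∙ y ∙ v = ((nm y ^+ 2)^-1 * (nm y)^-1)%:C *: ((y ∙ y^†)^† ∙ (y ∙ y^†)).
  rewrite /u /v cstarZ conj_real cmulZl cmulZl cmulZr scalerA -rmorphM /= !cmulA //.
rewrite nmZp; last by rewrite mulr_ge0 ?invr_ge0 ?sqr_ge0 ?nm_ge0.
rewrite nm_cstar2 nm_cstar2r le_eqVlt; apply/orP; left; apply/eqP.
by field.
Qed.

Lemma mat_norm_emx i j a : mat_norm (emx i j a) <= nm a.
Proof.
apply: ge_sup.
  have h0 : unit_ball (single i 0) by apply: single_ball; rewrite nm0.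
  by eexists; exists (single i 0) => //; exists (single i 0).
move=> _ [b hb [c hc <-]]; rewrite -/(nm _).
rewrite (bigD1 i) //= (bigD1 j) //= emxE [X in _ + X + _]big1 ?addr0 => [|k kj]; last first.
  by rewrite mxE (negbTE kj) andbF cmul0r cmul0l.
rewrite big1 ?addr0 => [|k ki]; last first.
  by rewrite big1 // => l _; rewrite mxE (negbTE ki) cmul0r cmul0l.
apply: le_trans (nmM _ _) _; rewrite -[leRHS]mulr1; apply: ler_pM; rewrite ?nm_ge0 ?ball_coord //.
apply: le_trans (nmM _ _) _; rewrite -[leRHS]mul1r nm_star.
by apply: ler_wpM2r; rewrite ?nm_ge0 ?ball_coord.
Qed.
End MatrixUnits.

(** * The entries of a conditional expectation on matrices *)

Section Corners.
Variables (R : realType) (A : cstarType R) (n : nat).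
Variables (B : set 'M[A]_n) (P : 'M[A]_n -> 'M[A]_n).
Hypothesis ce : cond_expectation B P.
Definition corner i j : set A := [set a | B (emx i j a)].
Definition cexp i j a : A := P (emx i j a) i j.
Hypothesis B_entry : forall x i j, B x -> corner i j (x i j).
Hypothesis B_star : forall i j a, corner i j a -> corner j i a^†.
Hypothesis B_unit : forall i (bs : seq A) (r : R), 0 < r -> exists e,
  [/\ corner i i e, nm e <= 1 & forall b, b \in bs -> nm (b - e ∙ b) < r].

Lemma cexp_le i j a : nm (cexp i j a) <= nm a.
Proof.
apply: le_trans (mat_norm_entry _ i j) _; apply: le_trans (ce_contractive ce _) _.
exact: mat_norm_emx.
Qed.

Lemma cexp_bl i j : bounded_linear (cexp i j).
Proof.
split; last by exists 1 => // a; rewrite mul1r cexp_le.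
by move=> k a b; rewrite /cexp emxP (ce_add ce) (ce_scale ce) !mxE.
Qed.

Lemma cexp_in i j a : corner i j (cexp i j a).
Proof. by apply: B_entry; exact: ce_range ce _. Qed.

Lemma cexp_id i j a : corner i j a -> cexp i j a = a.
Proof. by move=> h; rewrite /cexp (ce_id ce) // emxE. Qed.

Lemma cexp_bimod k i j l b c (x : 'M[A]_n) : corner k i b -> corner j l c ->
  cexp k l (b ∙ x i j ∙ c) = b ∙ P x i j ∙ c.
Proof.
by move=> hb hc; rewrite /cexp -emx_sandwich (ce_bimod ce _ hb hc) emx_sandwich emxE.
Qed.

Lemma left_units i (bs : seq A) : exists e : nat -> A, (forall m, corner i i (e m)) /\
  forall b, b \in bs -> scvg (fun m => e m ∙ b) b.
Proof.
have inv0 m : 0 < m.+1%:R^-1 :> R by rewrite invr_gt0 ltr0n.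
have [e he] := choice (fun m => B_unit i bs (inv0 m)).
exists e; split=> [m|b hb]; first by have [] := he m.
apply: (scvg_inv (C := 1)) => // m; rewrite mulr1 nmC; have [_ _ h] := he m.
by apply: ltW; apply: h.
Qed.

Lemma right_units i (bs : seq A) : exists e : nat -> A, (forall m, corner i i (e m)) /\
  forall b, b \in bs -> scvg (fun m => b ∙ e m) b.
Proof.
have [e [h1 h2]] := left_units i [seq b^† | b <- bs].
exists (fun m => (e m)^†); split=> [m|b hb]; first exact: B_star.
have /h2/scvg_star : b^† \in [seq b^† | b <- bs] by apply: map_f.
rewrite cstarK => h r r0; have [n0 hn] := h r r0; exists n0 => m /hn.
by rewrite cstarM cstarK.
Qed.

(** The bimodule property multiplies on both sides at once; an approximate unit of the (j, j) corner
    supplies the right factor. *)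
Lemma cexp_l k i j b a : corner k i b -> cexp k j (b ∙ a) = b ∙ cexp i j a.
Proof.
move=> hb; have [e [he hc]] := right_units j [:: b ∙ a; b ∙ cexp i j a].
have c1 := bl_scvg (cexp_bl k j) (hc _ (mem_head _ _)).
have c2 := hc (b ∙ cexp i j a) (mem_last _ [:: _]).
apply: (scvg_uniq c1) => r /c2 [n0 hn]; exists n0 => m /hn /=.
by have := cexp_bimod (emx i j a) hb (he m); rewrite emxE => ->.
Qed.

Lemma cexp_r i j l c a : corner j l c -> cexp i l (a ∙ c) = cexp i j a ∙ c.
Proof.
move=> hb; have [e [he hc]] := left_units i [:: a ∙ c; cexp i j a ∙ c].
have c1 := bl_scvg (cexp_bl i l) (hc _ (mem_head _ _)).
have c2 := hc (cexp i j a ∙ c) (mem_last _ [:: _]).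
apply: (scvg_uniq c1) => r /c2 [n0 hn]; exists n0 => m /hn /=.
by have := cexp_bimod (emx i j a) (he m) hb; rewrite emxE !cmulA => ->.
Qed.

(** P acts entrywise: sandwiching by approximate units of the diagonal corners i and j isolates the
    (i, j) entry before and after P. *)
Lemma cexp_entry (x : 'M[A]_n) i j : P x i j = cexp i j (x i j).
Proof.
have [e [he hc]] := left_units i [:: x i j; P x i j].
have [e' [he' hc']] := right_units j [:: x i j; P x i j].
have c1 := hc _ (mem_head _ _); have c2 := hc (P x i j) (mem_last _ [:: _]).
apply/esym; apply: (scvg_uniq (bl_scvg (cexp_bl i j) c1)) => r /c2 [n0 hn]; exists n0 => m /hn /=.
suff -> : cexp i j (e m ∙ x i j) = e m ∙ P x i j by [].
have c3 := bl_scvg (cexp_bl i j) (bl_scvg (act_bounded (left_mul_action A) (e m)) (hc' _ (mem_head _ _))).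
have c4 := bl_scvg (act_bounded (left_mul_action A) (e m)) (hc' (P x i j) (mem_last _ [:: _])).
apply: (scvg_uniq c3) => s /c4 [m0 hm]; exists m0 => q /hm /=.
by rewrite !cmulA cexp_bimod.
Qed.

Lemma cexp_pos j a : pos_cone a -> pos_cone (cexp j j a).
Proof. by move=> pa; apply: mat_pos_diag; apply: (ce_pos ce); apply: emx_pos. Qed.

(** Polarization writes both sides through squares, where [cexp_pos] gives self-adjoint values. *)
Lemma cexp_star j (Z W : A) : (cexp j j (W^† ∙ Z))^† = cexp j j (Z^† ∙ W).
Proof.
have bP := cexp_bl j j; have sa c : (cexp j j (c^† ∙ c))^† = cexp j j (c^† ∙ c).
  by apply: pos_sa; apply: cexp_pos; exact: pos_star_mul.
have e1 : (W + Z)^† ∙ (W + Z) = (Z + W)^† ∙ (Z + W) by rewrite addrC.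
have e2 : (W - Z)^† ∙ (W - Z) = (Z - W)^† ∙ (Z - W).
  by rewrite -opprB cstarN cmulNl cmulNr opprK.
have ei (u v : A) : (u + 'i%R *: v)^† ∙ (u + 'i%R *: v) = (v - 'i%R *: u)^† ∙ (v - 'i%R *: u).
  have -> : v - 'i%R *: u = (- 'i%R) *: (u + 'i%R *: v).
    by rewrite scalerDr scalerA mulNr -expr2 sqrCi opprK scale1r scaleNr addrC.
  rewrite cstarZ cmulZl cmulZr scalerA rmorphN /= conjCi opprK mulrN -expr2 sqrCi opprK.
  by rewrite scale1r.
rewrite (polarization Z W) (polarization W Z) e1 e2 (ei W Z) -(ei Z W).
rewrite !(blZ bP, blB bP, blD bP) cstarZ; congr (_ *: _).
  exact: conj_real.
move: (sa (Z + W)) (sa (Z - W)) (sa (Z + 'i%R *: W)) (sa (Z - 'i%R *: W)).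
move: (cexp j j _) (cexp j j _) (cexp j j _) (cexp j j _) => s1 s2 s3 s4 h1 h2 h3 h4.
rewrite cstarD cstarB cstarZ cstarB h1 h2 h3 h4 conjCi scaleNr; congr (_ + _).
by rewrite -scalerN opprB.
Qed.

(** A Kadison-Schwarz inequality across corners. By the module property the gap is exactly the image
    under E_jj of the square of a - E_ij a. *)
Lemma cexp_kadison i j a : pos_cone (cexp j j (a^† ∙ a) - (cexp i j a)^† ∙ cexp i j a).
Proof.
set p := cexp i j a; have bP := cexp_bl j j.
have hp : corner i j p by exact: cexp_in.
have hp' : corner j i p^† := B_star hp.
have e1 : cexp j j (p^† ∙ a) = p^† ∙ p by rewrite (cexp_l j a hp').
have e2 : cexp j j (a^† ∙ p) = p^† ∙ p.
  by rewrite -cexp_star e1 cstarM cstarK.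
have e3 : cexp j j (p^† ∙ p) = p^† ∙ p by rewrite (cexp_l j p hp') cexp_id.
have <- : cexp j j ((a - p)^† ∙ (a - p)) = cexp j j (a^† ∙ a) - p^† ∙ p.
  rewrite cstarB cmulBl !cmulBr !(blB bP) e1 e2 e3; nc_ring_with R A.
by apply: cexp_pos; exact: pos_star_mul.
Qed.

Section InvariantWeight.
Variable eta : A -> \bar R.
Hypothesis wt : weight eta.
Hypothesis eta_cexp : forall j a, wfin eta a -> eta (cexp j j a) = eta a.
Local Notation N := (wN eta (@id A)).
Local Notation ip := (wip eta (@id A)).

Lemma cexp_wfin j a : wfin eta a -> wfin eta (cexp j j a) /\ wval eta (cexp j j a) = wval eta a.
Proof.
move=> fa; have e := eta_cexp j fa; split; last by rewrite /wval e.
by split; [exact: cexp_pos fa.1 | rewrite e fa.2].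
Qed.

Lemma cexp_wbar j x : wdom eta x -> wbar eta (cexp j j x) = wbar eta x.
Proof.
move=> /(wdomE wt); move: (wbar eta x) => v [p1 [p2 [p3 [p4 [[f1 f2 f3 f4] -> ->]]]]].
have bP := cexp_bl j j.
have [g1 e1] := cexp_wfin j f1; have [g2 e2] := cexp_wfin j f2.
have [g3 e3] := cexp_wfin j f3; have [g4 e4] := cexp_wfin j f4.
apply: (wbarE wt); exists (cexp j j p1), (cexp j j p2), (cexp j j p3), (cexp j j p4).
by split=> //; [rewrite (blD bP) (blZ bP) !(blB bP) | rewrite e1 e2 e3 e4].
Qed.

Lemma cexp_N i j a : N a -> N (cexp i j a).
Proof.
move=> Na; have [f1 _] := cexp_wfin j Na.
by have [] := wfin_le wt f1 (pos_star_mul _) (cexp_kadison i j a).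
Qed.

(** b^† E_ij a = E_jj (b^† a) and eta is E_jj-invariant, so E_ij acts as the orthogonal projection
    onto its corner. *)
Lemma cexp_ip i j a b : N a -> N b -> corner i j b -> ip (cexp i j a) b = ip a b.
Proof.
move=> Na Nb hb; rewrite /wip -(cexp_l j a (B_star hb)) cexp_wbar //.
exact: (wN_dom wt (@id_positive R A)).
Qed.
End InvariantWeight.
End Corners.

Section ClosedSpanAlgebra.
Variables (R : realType) (A : cstarType R).
Implicit Types (S Y : set A).

Lemma cspan_mul S : (forall x y, S x -> S y -> cspan S (x ∙ y)) ->
  forall x y, cspan S x -> cspan S y -> cspan S (x ∙ y).
Proof.
move=> h x y cx; apply: (cspan_image (act_bounded (left_mul_action A) x)) => u Su.
by apply: (cspan_image (mulr_bl u)) cx => v Sv; apply: h.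
Qed.

Lemma cspan_star S S' : (forall x, S x -> cspan S' x^†) -> forall x, cspan S x -> cspan S' x^†.
Proof.
move=> h x /closure_scvg[u [uS ux]]; apply: (cspan_scvg _ (scvg_star ux)) => n.
have [m [k [s [hs ->]]]] := uS n; rewrite cstar_sum; apply: cspan_sum => i _.
by rewrite cstarZ; apply: cspanZ; apply: h.
Qed.

(** Elements of A are close to sums of products y w, and [approx_unit] for the finitely many y lies
    in S because it is built from the y y^†. *)
Lemma total_units S Y : lin_subspace S -> (forall x y, S x -> S y -> S (x ∙ y)) ->
  (forall y, Y y -> S (y ∙ y^†)) -> cspan [set y ∙ w | y in Y & w in setT] = setT ->
  forall (bs : seq A) (r : R), 0 < r -> exists e,
    [/\ S e, nm e <= 1 & forall b, b \in bs -> nm (b - e ∙ b) < r].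
Proof.
move=> lS mS YS tot.
have single a (r : R) : 0 < r -> exists e, [/\ S e, nm e <= 1 & nm (a - e ∙ a) < r].
  move=> r0; have r3 : 0 < r / 3 by rewrite divr_gt0.
  have ha : cspan [set y ∙ w | y in Y & w in setT] a by rewrite tot.
  have [a' [n [k [s [hs a'E]]]] aa'] := iffLR (closureP _ a) ha _ r3.
  have {}hs i : exists y w, Y y /\ s i = y ∙ w.
    by have [y Yy [w _ <-]] := hs i; exists y, w.
  have [y hy] := choice hs.
  have [w hw] := choice hy.
  pose K := \sum_(i < n) nm (k i *: w i); have K0 : 0 <= K by apply: sumr_ge0 => i _; exact: nm_ge0.
  have K1 : 0 < K + 1 by rewrite ltr_wpDl.
  have [e [pe e1 ey eS]] := approx_unit [seq y i | i <- index_enum 'I_n] (divr_gt0 r3 K1).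
  exists e; split=> //.
    apply: eS => //; rewrite big_map; have [S0 SP] := lS.
    elim: (index_enum _) => [|i l IH]; first by rewrite big_nil.
    rewrite big_cons -[_ ∙ _]scale1r; apply: SP IH; apply: YS; exact: (hw i).1.
  have aE : a' - e ∙ a' = \sum_(i < n) (y i - e ∙ y i) ∙ (k i *: w i).
    rewrite a'E cmul_sumr -sumrB; apply: eq_bigr => i _.
    by rewrite (hw i).2 cmulBl !cmulZr !cmulA.
  have le1 : nm (a' - e ∙ a') <= r / 3.
    rewrite aE; apply: le_trans (nm_sum _ _ _) _.
    apply: (@le_trans _ _ (\sum_(i < n) r / 3 / (K + 1) * nm (k i *: w i))).
      apply: ler_sum => i _; apply: le_trans (nmM _ _) _; apply: ler_wpM2r; first exact: nm_ge0.
      by apply: ltW; apply: ey; apply: map_f; exact: mem_index_enum.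
    rewrite -mulr_sumr -/K mulrAC ler_pdivrMr //; apply: ler_wpM2l; first exact: ltW.
    by rewrite lerDl.
  have -> : a - e ∙ a = ((a - a') + (a' - e ∙ a')) + e ∙ (a' - a).
    by nc_ring_with R A.
  apply: le_lt_trans (nmD _ _) _.
  have le2 : nm (e ∙ (a' - a)) <= nm (a - a').
    apply: le_trans (nmM _ _) _; rewrite nmC -[leRHS]mul1r; apply: ler_wpM2r => //; exact: nm_ge0.
  have := nmD (a - a') (a' - e ∙ a').
  move: (nm _) (nm _) (nm _) (nm _) aa' le1 le2 => p q u v; lra.
(* One approximation of [h] handles the whole family, as [h] dominates each [b b^*]. *)
move=> bs r r0; pose h := \sum_(b <- bs) b ∙ b^†.
have r2 : 0 < r ^+ 2 / 2 by rewrite divr_gt0 // exprn_gt0.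
have [e [Se e1 eh]] := single h _ r2; exists e; split=> // b hb.
rewrite -(@ltr_pXn2r _ 2) ?nnegrE ?nm_ge0 ?ltW // -nm_cstar2r.
have sumE : \sum_(b <- bs) (b - e ∙ b) ∙ (b - e ∙ b)^† = (h - e ∙ h) - (h - e ∙ h) ∙ e^†.
  rewrite /h cmul_sumr -sumrB cmul_suml -sumrB; apply: eq_bigr => c _.
  by rewrite cstarB cstarM; nc_ring_with R A.
apply: (@le_lt_trans _ _ (nm ((h - e ∙ h) - (h - e ∙ h) ∙ e^†))).
  rewrite -sumE; apply: pos_le_nm; first exact: pos_mul_star.
  rewrite (big_rem b) //= addrAC subrr add0r; apply: pos_sum => c _; exact: pos_mul_star.
apply: le_lt_trans (nmB _ _) _.
have : nm ((h - e ∙ h) ∙ e^†) <= nm (h - e ∙ h).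
  apply: le_trans (nmM _ _) _; rewrite nm_star -[leRHS]mulr1; apply: ler_wpM2l => //; exact: nm_ge0.
move: (nm _) (nm _) eh => p q; lra.
Qed.
End ClosedSpanAlgebra.

Lemma ord2_cases (i : 'I_2) : i = ord0 \/ i = ord_max.
Proof. by case: i => [[|[|k]] hk] //; [left | right]; apply: val_inj. Qed.

(** * Corners and units of the linking algebra of a TRO *)

Section LinkingAlgebra.
Variables (R : realType) (A : cstarType R) (X : set A).
Hypothesis tX : tro X.
Hypothesis nX : tro_nondegenerate X.
Local Notation B := (linking_algebra X).
Local Notation X00 := (cspan (set_mul X (set_star X))).
Local Notation X11 := (cspan (set_mul (set_star X) X)).

Let X0 : X 0. Proof. by have [_ [h _] _] := tX. Qed.
Let S0 : set_star X 0. Proof. by exists 0; rewrite ?cstar0. Qed.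

Lemma corner00 a : corner B ord0 ord0 a <-> X00 a.
Proof.
rewrite /corner /linking_algebra /= !mxE /=; split=> [[] //|h]; split=> //; exact: cspan0.
Qed.
Lemma corner01 a : corner B ord0 ord_max a <-> X a.
Proof.
rewrite /corner /linking_algebra /= !mxE /=; split=> [[] //|h]; split=> //; exact: cspan0.
Qed.
Lemma corner10 a : corner B ord_max ord0 a <-> set_star X a.
Proof.
rewrite /corner /linking_algebra /= !mxE /=; split=> [[] //|h]; split=> //; exact: cspan0.
Qed.
Lemma corner11 a : corner B ord_max ord_max a <-> X11 a.
Proof.
rewrite /corner /linking_algebra /= !mxE /=; split=> [[] //|h]; split=> //; exact: cspan0.
Qed.

Lemma linking_entry (x : 'M[A]_2) i j : B x -> corner B i j (x i j).
Proof.
move=> [h1 h2 h3 h4]; case: (ord2_cases i) => ->; case: (ord2_cases j) => ->.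
- exact/corner00.
- exact/corner01.
- exact/corner10.
exact/corner11.
Qed.

Lemma linking_star i j a : corner B i j a -> corner B j i a^†.
Proof.
case: (ord2_cases i) => ->; case: (ord2_cases j) => ->.
- move=> /corner00 h; apply/corner00; apply: cspan_star h => _ [x Xx [_ [y Xy <-] <-]].
  by apply: cspan_sub; exists y => //; exists x^†; [exists x | rewrite cstarM cstarK].
- by move=> /corner01 h; apply/corner10; exists a.
- by move=> /corner10 [x Xx <-]; apply/corner01; rewrite cstarK.
move=> /corner11 h; apply/corner11; apply: cspan_star h => _ [_ [x Xx <-] [y Xy <-]].
by apply: cspan_sub; exists y^†; [exists y | exists x => //; rewrite cstarM cstarK].
Qed.

(** Nondegeneracy says that X A and, after taking adjoints, X^† A are total in A, as [total_units]
    requires for the two diagonal corners. *)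
Lemma linking_units i (bs : seq A) (r : R) : 0 < r -> exists e,
  [/\ corner B i i e, nm e <= 1 & forall b, b \in bs -> nm (b - e ∙ b) < r].
Proof.
move=> r0; have [_ _ XX] := tX; have [n1 n2] := nX.
have lc (S : set A) : lin_subspace (cspan S).
  by split; [exact: cspan0 | move=> k x y; exact: cspan_P].
case: (ord2_cases i) => ->.
  have [||||e [h1 h2 h3]] := @total_units _ _ X00 X _ _ _ _ bs r r0; last first.
  - by exists e; split=> //; apply/corner00.
  - apply: cspan_top n1 _ => _ [_ [x Xx [y _ <-]] [z _ <-]]; apply: cspan_sub.
    by exists x => //; exists (y ∙ z); rewrite ?cmulA.
  - by move=> y Xy; apply: cspan_sub; exists y => //; exists y^† => //; exists y.
  - apply: cspan_mul => _ _ [x Xx [_ [y Xy <-] <-]] [z Xz [_ [w Xw <-] <-]].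
    apply: cspan_sub; exists (x ∙ y^† ∙ z); first exact: XX.
    by exists w^†; [exists w | rewrite !cmulA].
  - exact: lc.
have [||||e [h1 h2 h3]] := @total_units _ _ X11 (set_star X) _ _ _ _ bs r r0; last first.
- by exists e; split=> //; apply/corner11.
- apply/seteqP; split=> // a _; rewrite -[a]cstarK.
  have : cspan (set_mul (set_mul setT (set_star setT)) X) a^† by rewrite n2.
  apply: cspan_star => _ [_ [x _ [_ [y _ <-] <-]] [z Xz <-]]; apply: cspan_sub.
  by exists z^†; [exists z | exists (y ∙ x^†) => //; rewrite !cstarM cstarK].
- by move=> _ [x Xx <-]; apply: cspan_sub; exists x^†; [exists x | exists x; rewrite ?cstarK].
- apply: cspan_mul => _ _ [_ [x Xx <-] [y Xy <-]] [_ [z Xz <-] [w Xw <-]].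
  apply: cspan_sub; exists x^†; first by exists x.
  by exists (y ∙ z^† ∙ w); [exact: XX | rewrite !cmulA].
exact: lc.
Qed.
End LinkingAlgebra.

(** * Invariant expectations *)

Section InvariantExpectation.
Variables (R : realType) (G : lcqg R) (X : set (C0 G)) (P : 'M[C0 G]_2 -> 'M[C0 G]_2).
Local Notation A := (C0 G).
Local Notation T := (C0_2 G).
Local Notation t := (tens2 G).
Local Notation psi := (@haar_r R G).
Local Notation phi := (@haar_l R G).
Local Notation Sr f := (slice_r t f).
Local Notation N := (wN psi (@id A)).
Local Notation ip := (wip psi (@id A)).
Local Notation B := (linking_algebra X).
Hypothesis tX : tro X.
Hypothesis nX : tro_nondegenerate X.
Hypothesis rX : right_invariant B.
Hypothesis ce : cond_expectation B P.
Hypothesis eP : forall x, mat_pos_cone x -> (weight2 psi x < +oo)%E ->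
  weight2 psi (P x) = weight2 psi x.
Variable eps : A -> R[i].
Hypothesis deps : dual eps.
Hypothesis epsL : forall a : A, L_map eps a = a.
Hypothesis epsR : forall a : A, R_map eps a = a.
Local Notation E := (cexp P).
Let wI := wip_semi_inner (psi_weight G) (@id_positive R A).
Let be := iffLR (dualE eps) deps.
Let bE i j : bounded_linear (E i j) := cexp_bl ce i j.
Let Bent := linking_entry tX.
Let Bst := @linking_star _ _ _ tX.
Let Bun := linking_units tX nX.
Let epsS := counit_slice_l deps epsL.

Lemma weight2_emx (eta : A -> \bar R) j a : weight eta -> weight2 eta (emx j j a) = eta a.
Proof.
move=> wt; have [h0 h0'] := wfin0 wt; have e0 : eta 0 = 0%E by rewrite (wfinE wt h0) h0'.
by rewrite /weight2 !mxE; case: (ord2_cases j) => ->; rewrite /= e0 ?adde0 ?add0e.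
Qed.

Lemma psi_cexp j a : wfin psi a -> psi (E j j a) = psi a.
Proof.
move=> [pa fa]; have h := eP (emx_pos j pa).
rewrite (weight2_emx _ _ (psi_weight G)) in h; rewrite -(h fa) -(weight2_emx j _ (psi_weight G)).
congr (weight2 psi _); apply/matrixP => k l; rewrite (cexp_entry ce Bst Bun) !mxE.
by case: ifP => [/andP[/eqP -> /eqP ->] //|_]; rewrite (bl0 (bE k l)).
Qed.

Lemma corner_slice (f : A -> R[i]) i j a d : dual f -> corner B i j a ->
  corner B i j (Sr f (Zr a d)).
Proof.
move=> df ha; have := Bent i j (rX (dual_mulr d df) ha).
by rewrite !mxE !eqxx (R_mapE (b := d) _ df).
Qed.

Let w0_ex := lcqg_nonzero G.

(* [a - E a] is orthogonal to the corner, and so are its slices by [dual_element_sym]. *)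
Lemma cexp_slice (f : A -> R[i]) i j a d : pos_dual f ->
  E i j (Sr f (Zr a d)) = Sr f (Zr (E i j a) d).
Proof.
move=> pf; have [w0 w0n] := w0_ex; have bS := slice_r_bl t pf.1.
have [t' ht] := flip_tensor t.
have bF : bounded_linear (fun a => (-1) *: Sr f (Zr (E i j a) d) + E i j (Sr f (Zr a d))).
  apply: bl_comb; first exact: bl_comp (bE i j) (bl_comp (Zr_bl d) bS).
  exact: bl_comp (bl_comp (Zr_bl d) bS) (bE i j).
apply/eqP; rewrite -subr_eq0 addrC -scaleN1r; apply/eqP.
apply: (bl_dense_zero (psi_weight G) bF (@psi_dense R G)) => {}a Na.
have NE u : N u -> N (E i j u) by move=> Nu; exact: (cexp_N ce Bent Bst Bun (psi_weight G) psi_cexp).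
have Eip u b : N u -> N b -> corner B i j b -> ip (E i j u) b = ip u b.
  exact: (cexp_ip ce Bst Bun (psi_weight G) psi_cexp).
set p := E i j a; have Np : N p by exact: NE.
have Nal : N (a - p) by apply: (siNB wI).
have ef0 b : N b -> corner B i j b -> ef b (a - p) = 0.
  move=> Nb hb; set e := ef b _; have [g [pg _ ge]] := norming_state e.
  have r := rep_l e pg Nb; have NQ := let: And3 _ q _ := r in q.
  have := efE Nb Nal r; rewrite -/e ge (siB wI) // (Eip a _ Na NQ (corner_slice e pg.1 hb)).
  by rewrite subrr => /complexI/eqP; rewrite expf_eq0 /= => /eqP; exact: nm_eq0.
set Y := Sr f (Zr (a - p) d).
have rY := rep_l d pf Nal; have NY : N Y := let: And3 _ q _ := rY in q.
have q0 : E i j Y = 0.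
  set q := E i j Y; have Nq : N q by exact: NE.
  have hq : corner B i j q by exact: (cexp_in ce Bent).
  have sym := dual_element_sym ht deps (counit_mul deps epsS w0n)
    (counit_represents deps (counit_slice_r deps epsR)) epsS Nal Nq (ef0 q Nq hq).
  apply: (faithful_sn0 (psi_weight G) (@psi_faithful R G) Nq).
  have := sn2 wI Nq; rewrite {1}/q (Eip Y q NY Nq hq) (si_conj wI Nq NY).
  rewrite -(efE Nal Nq rY) sym cmul0r (bl0 (iffLR (dualE f) pf.1)) rmorph0.
  by move=> /complexI/esym/eqP; rewrite expf_eq0 /= => /eqP.
have -> : Sr f (Zr a d) = Sr f (Zr p d) + Y.
  by rewrite /Y -(blD bS) -(blD (Zr_bl d)) addrC subrK.
rewrite (blD (bE i j)) q0 addr0 (cexp_id ce) ?scaleN1r ?addNr //.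
by apply: corner_slice pf.1 _; exact: (cexp_in ce Bent).
Qed.

Definition cfun i j : A -> R[i] := fun a => eps (E i j a).

Lemma cfun_dual i j : dual (cfun i j).
Proof. by apply/dualE; exact: bl_comp (bE i j) be. Qed.

(** After pairing with a positive f, the slice by eps o E_ij becomes eps of E_ij applied to a right
    slice. [cexp_slice] interchanges the two, and the counit then reads off f (E_ij a ∙ d). *)
Lemma slice_cfun i j a d : slice_l t (cfun i j) (Zr a d) = E i j a ∙ d.
Proof.
apply: dual_separate => f pf; have dc := cfun_dual i j.
rewrite -(dual_tensE t _ dc pf.1) /cfun cexp_slice //.
by rewrite (counit_slice_R deps epsS) //; exact: pf.1.
Qed.

Lemma corner_counit i j : (exists2 a, corner B i j a & eps a <> 0) ->
  exists2 b, corner B i j b & eps b = 1.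
Proof.
move=> [a ha /eqP na]; exists ((eps a)^-1 *: a); last by rewrite (flZ be) mulVf.
by rewrite -(cexp_id ce ha) -(blZ (bE i j)); exact: (cexp_in ce Bent).
Qed.

(** The corner contains approximate units of A, so a multiplicative functional vanishing on it would
    vanish everywhere. *)
Lemma diag_counit j : exists2 b, corner B j j b & eps b = 1.
Proof.
apply: corner_counit; have [w0 w0n] := w0_ex; have [a ea] := counit_nonzero deps epsS w0n.
have [e [he hc]] := left_units Bun j [:: a]; have cv := bl_scvg be (hc _ (mem_head _ _)).
have [//|no] := pselect (exists2 a, corner B j j a & eps a <> 0).
exfalso; apply: ea; apply: (scvg_uniq cv) => r r0; exists 0%N => m _ /=.
rewrite (counit_mul deps epsS w0n); have [->|n] := pselect (eps (e m) = 0).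
  by rewrite mul0r subrr nm0.
by exfalso; apply: no; exists (e m).
Qed.

(** If eps vanished on X, it would vanish on the total set X A^† A. The resulting v shows later that
    the idempotent functional is nonzero. *)
Lemma tro_counit : exists2 v, X v & eps v = 1.
Proof.
suff [v /corner01 hv ev] : exists2 v, corner B ord0 ord_max v & eps v = 1.
  by exists v => //; exact: (hv tX).
apply: corner_counit; have [w0 w0n] := w0_ex; have [a ea] := counit_nonzero deps epsS w0n.
have [[x Xx ex]|no] := pselect (exists2 a, X a & eps a <> 0).
  by exists x => //; exact/corner01.
exfalso; apply: ea; have h := bl_eq_total be (@bl_zero _ A R[i]^o) nX.1.
have {}h := congr1 (fun F => F a) (h _); apply: h => _ [_ [x Xx [y _ <-]] [z _ <-]].
rewrite !(counit_mul deps epsS w0n); have [->|n] := pselect (eps x = 0); first by rewrite !mul0r.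
by exfalso; apply: no; exists x.
Qed.

(** An explicit Cohen factorization of the functional through right multiplication by b, which makes
    its strict extension and its slices of Delta computable. *)
Lemma cfun_factor i j b : corner B j j b -> eps b = 1 -> forall x, cfun i j x = cfun i j (x ∙ b).
Proof.
move=> hb eb x; have [w0 w0n] := w0_ex.
by rewrite /cfun (cexp_r ce Bun i x hb) (counit_mul deps epsS w0n) eb mulr1.
Qed.

Lemma L_map_cfun i j a : L_map (cfun i j) a = E i j a.
Proof.
have [b hb eb] := diag_counit j; have dc := cfun_dual i j.
have fac := cfun_factor i hb eb; rewrite (L_mapE a dc fac).
apply: cmul_separate => d; rewrite -(slice_l_r2 t _ _ dc) -D_tens_l D_tens_r (slice_l_r1 t _ _ dc).
have -> : (fun x => cfun i j (x ∙ b)) = cfun i j by apply: funext => x; rewrite -fac.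
exact: slice_cfun.
Qed.

(** Slicing Delta(a) in the first leg yields E_ij a, and slicing once more applies E_ij twice, so
    idempotence of the functional is that of E_ij. *)
Lemma cfun_conv i j : Defs.conv (cfun i j) (cfun i j) = cfun i j.
Proof.
have [b hb eb] := diag_counit j; have dc := cfun_dual i j; have fac := cfun_factor i hb eb.
have facE : (fun x => cfun i j (x ∙ b)) = cfun i j by apply: funext => x; rewrite -fac.
have [d1 d2 d3] := dual_tens_spec t dc dc; have bd := iffLR (dualE _) d1.
have fac2 Z : dual_tens t (cfun i j) (cfun i j) Z = dual_tens t (cfun i j) (cfun i j) (Z ∙ t b b).
  have := bl_eq_total bd (bl_comp (mulr_bl (t b b)) bd) (tens_dense t).
  move=> e; have {}e := congr1 (fun F => F Z) (e _); apply: e => _ [u _ [v _ <-]].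
  by rewrite -tensM !d2 -!fac.
apply: funext => a; rewrite /Defs.conv (dual_ext_spec _ d1 fac2) -[mL (Delta a)]/(D a) D_tens_r d3.
rewrite (dual_tensE t _ dc dc) (slice_l_r1 t _ _ dc) facE slice_cfun -fac.
by rewrite /cfun (cexp_id ce) //; exact: (cexp_in ce Bent).
Qed.

Lemma cfun_contractive i j : contractive_functional (cfun i j).
Proof.
move=> a; have [w0 w0n] := w0_ex; rewrite nmcE nmE lecR /cfun.
by apply: le_trans (counit_contractive deps epsS w0n _) _; exact: (cexp_le ce).
Qed.

(** The functional eps o E_jj is positive and its strict extension takes the value eps b = 1 at the
    unit. Left invariance therefore preserves phi exactly. *)
Lemma phi_cexp j a : wfin phi a -> phi (E j j a) = phi a.
Proof.
move=> [pa fa]; have [_ _ h] := haar_lP G; have [b hb eb] := diag_counit j.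
have [w0 w0n] := w0_ex; have pe := counit_pos deps epsS w0n.
have pc : pos_dual (cfun j j).
  split; first exact: cfun_dual.
  by move=> c; apply: (fpos pe); apply: (cexp_pos ce); exact: pos_star_mul.
rewrite -L_map_cfun (h _ _ pc pa fa) (dual_ext_spec _ pc.1 (cfun_factor j hb eb)) /=.
by rewrite /cfun (cexp_id ce) // eb mul1e.
Qed.
End InvariantExpectation.

Theorem theorem4p1 (R : realType) (G : lcqg R) (X : set (C0 G)) :
  coamenable G ->
  tro X ->
  tro_nondegenerate X ->
  right_invariant (linking_algebra X) ->
  expected (weight2 (@haar_r R G)) (linking_algebra X) ->
  (exists omega : C0 G -> R[i],
     [/\ idempotent_functional omega,
         contractive_functional omega
       & X = range (L_map omega)]) /\
  expected (weight2 (@haar_l R G)) (linking_algebra X).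
Proof.
move=> [eps deps he] tX nX rX [P ce eP].
have epsL a := (he a).1; have epsR a := (he a).2.
have Bent := linking_entry tX.
have LE i j a := L_map_cfun tX nX rX ce eP deps epsL epsR i j a.
split.
  exists (cfun P eps ord0 ord_max); split.
  - split; first exact: (cfun_dual ce deps).
      have [v Xv ev] := tro_counit tX nX ce deps epsL.
      move=> /(congr1 (fun F => F v)); rewrite /cfun (cexp_id ce); last exact/(corner01 tX).
      by rewrite ev => /eqP; rewrite oner_eq0.
    exact: (cfun_conv tX nX rX ce eP deps epsL epsR).
  - exact: (cfun_contractive ce deps epsL).
  apply/seteqP; split=> [x Xx|_ [a _ <-]].
    by exists x => //; rewrite LE (cexp_id ce) //; apply/(corner01 tX).
  by rewrite LE; apply/(corner01 tX); exact: (cexp_in ce Bent).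
(* The same P serves for phi: it acts entrywise and its diagonal entries preserve phi on elements of
   finite weight. *)
exists P => // x px.
rewrite /weight2 => fx; have [p0 p1] := (mat_pos_diag ord0 px, mat_pos_diag ord_max px).
have [ge _ _] := phi_weight G.
have f0 : (haar_l (x ord0 ord0) < +oo)%E.
  by apply: le_lt_trans fx; rewrite leeDl // ge.
have f1 : (haar_l (x ord_max ord_max) < +oo)%E.
  by apply: le_lt_trans fx; rewrite leeDr // ge.
have Bst := @linking_star _ _ _ tX; have Bun := linking_units tX nX.
rewrite !(cexp_entry ce Bst Bun).
by rewrite !(phi_cexp tX nX rX ce eP deps epsL epsR).
Qed.
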